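(* Let $\mathcal{O}=\mathcal{O}_{\mathbb{C}^n,0}$. Let $J\subset\mathcal{O}$ be a Cohen-Macaulay ideal of codimension $p$, let $(E,\varphi)$, $$0\to E_p\xrightarrow{\varphi_p}E_{p-1}\to\cdots\xrightarrow{\varphi_1}E_0\to\mathcal{O}/J\to 0,$$ be a free resolution of $\mathcal{O}/J$ of length $p$ with $\operatorname{rank}E_0=1$, let $I=J(f_1,\dots,f_p)$ be a complete intersection ideal of codimension $p$ contained in $J$, let $(K,\psi)$ be the Koszul complex of $f=(f_1,\dots,f_p)$, and let $a:(K,\psi)\to(E,\varphi)$ be a morphism of complexes extending the natural surjection $\pi:\mathcal{O}/I\to\mathcal{O}/J$. Let $e:=e_p\wedge\cdots\wedge e_1$ be the induced frame of $K_p$. Suppose that $X_1,\dots,X_p$ are (germs at $0\in\mathbb{C}^n$ of) currents, where $X_k$ has bidegree $(0,k-1)$, such that $$f_1X_1=1,\qquad f_jX_k=0\ \text{ for } 1\le j<k\le p,\qquad f_kX_k=\bar\partial X_{k-1}\ \text{ for } 2\le k\le p.$$ Then $$\operatorname{ann}\bigl(a_p(e)\,\bar\partial X_p\bigr)=J .$$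
   Context: $\mathcal{O}=\mathcal{O}_{\mathbb{C}^n,0}$ is the ring of germs of holomorphic functions at $0\in\mathbb{C}^n$, and $J(f_1,\dots,f_p)$ denotes the ideal of $\mathcal{O}$ generated by $f_1,\dots,f_p$. An ideal $J$ is a Cohen-Macaulay ideal of codimension $p$ if it has codimension $p$ and $\mathcal{O}/J$ has a free resolution of length $p$ (by free $\mathcal{O}$-modules of finite rank). A complete intersection ideal of codimension $p$ is an ideal of codimension $p$ that can be generated by exactly $p$ elements; $I=J(f_1,\dots,f_p)$ is such an ideal with generators $f_1,\dots,f_p$. Koszul complex: $K_1\cong\mathcal{O}^p$ is free with frame $e_1,\dots,e_p$, $K_k=\bigwedge^kK_1$, and $\psi_k:K_k\to K_{k-1}$ is contraction with $f_1e_1^*+\cdots+f_pe_p^*$; it is a free resolution of $\mathcal{O}/I$. A morphism of complexes $a:(K,\psi)\to(E,\varphi)$ consists of $\mathcal{O}$-linear maps $a_k:K_k\to E_k$ with $\varphi_ka_k=a_{k-1}\psi_k$; it extends $\pi$ if the map induced on cokernels of $\psi_1$ and $\varphi_1$ is $\pi:\mathcal{O}/I\to\mathcal{O}/J$. Since $a_p(e)\in E_p$ is, in a frame of $E_p$, a tuple of germs of holomorphic functions, $a_p(e)\bar\partial X_p$ is an $E_p$-valued current (a tuple of $(0,p)$-currents). For a (vector-valued) germ of current $T$ at $0$, $\operatorname{ann}T=\{g\in\mathcal{O}: gT=0\}$. *)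

(* Defs.v *)
From HB Require Import structures.
From mathcomp Require Import all_boot all_order all_algebra ring_quotient.
From mathcomp Require Import all_classical all_reals all_analysis complex.
Import numFieldNormedType.Exports.
Import GRing.Theory Num.Theory.

Set Implicit Arguments.
Unset Strict Implicit.
Unset Printing Implicit Defensive.

Local Open Scope classical_set_scope.
Local Open Scope ring_scope.
Local Open Scope complex_scope.

(* R[i] carries no topology in the library; it receives the one that every
   numFieldType gets through _^o. *)
HB.instance Definition _ (R : realType) := NormedModule.copy R[i] (R[i])^o.

(** * Germs at 0 of holomorphic functions *)

(* The ring of germs is the quotient of the ring of functions on C^n that are
   holomorphic near 0 (complex differentiable at each point of a neighborhood
   of 0) by the ideal of functions vanishing near 0; values far from 0 are
   irrelevant. *)
Section HolomorphicGerms.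
Context (R : realType) (n : nat).
Local Notation F := ('rV[R[i]]_n -> R[i]).

Definition holo0 : {pred F} :=
  fun f => `[< \forall z \near (0 : 'rV[R[i]]_n), differentiable f z >].

Lemma holo0_subring : subring_closed holo0.
Proof.
split=> [|f g|f g]; rewrite unfold_in.
- by apply/asboolP; near=> z; exact: (@differentiable_cst _ _ _ (1 : R[i])).
- move=> /asboolP hf /asboolP hg; apply/asboolP; near=> z.
  by apply: differentiableB; near: z.
- move=> /asboolP hf /asboolP hg; apply/asboolP; near=> z.
  by apply: differentiableM; near: z.
Unshelve. all: by end_near. Qed.

HB.instance Definition _ := GRing.isSubringClosed.Build F holo0 holo0_subring.

Record holo_fun := HoloFun { holo_val :> F ; _ : holo_val \in holo0 }.
HB.instance Definition _ := [isSub for holo_val].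
HB.instance Definition _ := [Choice of holo_fun by <:].
HB.instance Definition _ := [SubChoice_isSubComNzRing of holo_fun by <:].

Definition vanish0 : {pred holo_fun} :=
  fun f => `[< \forall z \near (0 : 'rV[R[i]]_n), f z = 0 >].

Lemma vanish0_ideal : idealr_closed vanish0.
Proof.
split=> [||a f g].
- by rewrite unfold_in; apply/asboolP; near=> z.
- rewrite unfold_in; apply/negP => /asboolP /nbhs_singleton /eqP.
  by rewrite (oner_eq0 R[i]).
- rewrite unfold_in => /asboolP f0 /asboolP g0.
  rewrite unfold_in; apply/asboolP; near=> z.
  have fz0 : f z = 0 by near: z.
  have gz0 : g z = 0 by near: z.
  rewrite -[LHS]/(a z * f z + g z).
  by rewrite fz0 gz0 mulr0 addr0.
Unshelve. all: by end_near. Qed.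

HB.instance Definition _ := isIdealr.Build holo_fun vanish0 vanish0_ideal.

Definition hgerm := {ideal_quot vanish0}.

Definition germ_rep (g : hgerm) : 'rV[R[i]]_n -> R[i] := holo_val (repr g).

End HolomorphicGerms.

(** * Ideals, codimension, free resolutions *)

Section Ideals.
Context (A : comNzRingType).

Definition ideal_gen (p : nat) (f : 'I_p -> A) : {pred A} :=
  fun x => `[< exists c : 'I_p -> A, x = \sum_i c i * f i >].

(* There is a chain c 0 < c 1 < ... < c h = P of prime ideals. *)
Definition height_ge (P : prime_idealr A) (h : nat) : Prop :=
  exists c : nat -> prime_idealr A,
    (forall k, (k < h)%N ->
       {subset c k <= c k.+1} /\ exists2 x, x \in c k.+1 & x \notin c k)
    /\ c h =i P.

(* The codimension (height) of an ideal is the minimum of the heights of the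
   prime ideals containing it; the unit ideal has no finite codimension. *)
Definition has_codim (J : {pred A}) (p : nat) : Prop :=
  (forall P : prime_idealr A, {subset J <= P} -> height_ge P p) /\
  (exists P : prime_idealr A, {subset J <= P} /\ ~ height_ge P p.+1).

(* A resolution 0 -> E_p -> ... -> E_0 -> A/J -> 0 by free modules
   E_k = A^(r k), with E_k = 0 for k > p; phi k is the map E_(k+1) -> E_k and
   eps the A-linear augmentation E_0 -> A/J. *)
Record free_resolution (J : idealr A) (p : nat) (r : nat -> nat)
    (phi : forall k, {linear 'rV[A]_(r k.+1) -> 'rV[A]_(r k)})
    (eps : 'rV[A]_(r 0%N) -> {ideal_quot J}) : Prop := FreeResolution {
  resolution_length : forall k, (p < k)%N -> r k = 0%N;
  augmentation_linear : forall (c : A) x y,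
    eps (c *: x + y) = \pi_({ideal_quot J})%qT c * eps x + eps y;
  augmentation_surj : forall q, exists x, eps x = q;
  resolution_exact0 : forall x, eps x = 0 <-> exists y, phi 0%N y = x;
  resolution_exact : forall k x, phi k x = 0 <-> exists y, phi k.+1 y = x
}.

Definition cohen_macaulay (J : idealr A) (p : nat) : Prop :=
  has_codim J p /\ exists r phi eps, @free_resolution J p r phi eps.

End Ideals.

(** * Exterior algebra and Koszul complex *)

(* An element of an exterior algebra with frame e_0, ..., e_(p-1) is encoded by
   its coefficients in the basis e_I := e_(i_1) /\ ... /\ e_(i_k), where
   I = {i_1 < ... < i_k}; then e_j /\ e_I = (-1)^(ext_sign j I) e_(j |: I) for
   j \notin I. *)
Definition ext_sign (p : nat) (j : 'I_p) (I : {set 'I_p}) : nat :=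
  #|[pred i in I | (i < j)%N]|.

Section Koszul.
Context (A : comNzRingType) (p : nat).

Definition wedge_left (j : 'I_p) (w : {set 'I_p} -> A) : {set 'I_p} -> A :=
  fun I => if j \in I then (-1) ^+ ext_sign j I * w (I :\ j) else 0.

(* K_k, the k-th exterior power of A^p *)
Definition koszul (k : nat) : lmodType A :=
  {ffun {I : {set 'I_p} | #|I| == k} -> A^o}.

Definition koszul_coef (k : nat) (x : koszul k) (I : {set 'I_p}) : A :=
  if insub I is Some I' then (x : {ffun _ -> A^o}) I' else 0.

(* The contraction K_(k+1) -> K_k with \sum_j f_j e_j^*. *)
Definition koszul_diff (f : 'I_p -> A) (k : nat) (x : koszul k.+1) : koszul k :=
  [ffun J : {I : {set 'I_p} | #|I| == k} =>
     \sum_(j | j \notin val J)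
       (-1) ^+ ext_sign j (val J) * f j * koszul_coef x (j |: val J)].

(* e_(p-1) /\ ... /\ e_0: factors in decreasing order *)
Definition koszul_frame : koszul p :=
  [ffun I : {I : {set 'I_p} | #|I| == p} =>
     foldl (fun w j => wedge_left j w) (fun I0 => (I0 == finset.set0)%:R) (enum 'I_p)
       (val I)].

(* A morphism of complexes from the Koszul complex of f to (E, phi) that
   induces the natural map A/J(f) -> A/J on the cokernels. *)
Record koszul_morphism (f : 'I_p -> A) (J : idealr A) (r : nat -> nat)
    (phi : forall k, {linear 'rV[A]_(r k.+1) -> 'rV[A]_(r k)})
    (eps : 'rV[A]_(r 0%N) -> {ideal_quot J})
    (a : forall k, {linear koszul k -> 'rV[A]_(r k)}) : Prop :=
  KoszulMorphism {
    morphism_comm : forall k x, phi k (a k.+1 x) = a k (koszul_diff f x);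
    morphism_extends : forall x : koszul 0,
      eps (a 0%N x) = \pi_({ideal_quot J})%qT (koszul_coef x finset.set0)
  }.

End Koszul.

(** * Test functions, distributions and (0,q)-currents near 0 *)

Section Currents.
Context (R : realType) (n : nat).
Local Notation Cn := 'rV[R[i]]_n.

(* (j, false) is the real direction x_j and (j, true) the direction y_j, where
   z_j = x_j + i y_j. *)
Definition real_dir (d : 'I_n * bool) : Cn :=
  (if d.2 then 'i else 1) *: delta_mx 0 d.1.

Definition along (phi : Cn -> R[i]) (z : Cn) (d : 'I_n * bool) : R -> R[i] :=
  fun t => phi (z + t%:C *: real_dir d).

Definition has_partial (d : 'I_n * bool) (phi : Cn -> R[i]) (z : Cn) : Prop :=
  derivable (fun t => complex.Re (along phi z d t)) 0 1 /\
  derivable (fun t => complex.Im (along phi z d t)) 0 1.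

Definition partial (d : 'I_n * bool) (phi : Cn -> R[i]) : Cn -> R[i] :=
  fun z => derive1 (fun t => complex.Re (along phi z d t)) 0 +i*
           derive1 (fun t => complex.Im (along phi z d t)) 0.

Definition partials (s : seq ('I_n * bool)) (phi : Cn -> R[i]) : Cn -> R[i] :=
  foldr partial phi s.

Definition smooth (phi : Cn -> R[i]) : Prop :=
  forall s, continuous (partials s phi) /\
            forall d z, has_partial d (partials s phi) z.

Definition supported_in (K : set Cn) (phi : Cn -> R[i]) : Prop :=
  forall z, ~ K z -> phi z = 0.

Definition test_fun (U : set Cn) (phi : Cn -> R[i]) : Prop :=
  smooth phi /\ exists K, [/\ compact K, K `<=` U & supported_in K phi].

(* Only the values of a functional on test functions are meaningful. *)
Definition functional := (Cn -> R[i]) -> R[i].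

Definition distribution_on (U : set Cn) (u : functional) : Prop :=
  (forall (c : R[i]) phi psi, test_fun U phi -> test_fun U psi ->
     u (fun z => c * phi z + psi z) = c * u phi + u psi) /\
  (forall K, compact K -> K `<=` U ->
     exists (N : nat) (M : R), forall phi (B : R),
       smooth phi -> supported_in K phi ->
       (forall s z, (size s <= N)%N -> `|partials s phi z| <= B%:C) ->
       `|u phi| <= (M * B)%:C).

(* The Lebesgue integral over C^n = R^(2n) of a test function, as an iterated
   integral over the 2n real coordinates. *)
Definition integral1 (g : R -> R[i]) : R[i] :=
  (\int[lebesgue_measure]_t complex.Re (g t)) +i*
  (\int[lebesgue_measure]_t complex.Im (g t)).

Fixpoint iterated_integral (s : seq ('I_n * bool)) (phi : Cn -> R[i]) (z : Cn)
    : R[i] :=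
  if s is d :: s' then integral1 (along (iterated_integral s' phi) z d)
  else phi z.

Definition integralCn (phi : Cn -> R[i]) : R[i] :=
  iterated_integral (enum {: 'I_n * bool}) phi 0.

(* A current T = \sum_I T_I dzbar_I, given by its coefficients T_I, which are
   distributions; dzbar_I is the exterior product in increasing order. *)
Definition current := {set 'I_n} -> functional.

Definition eq_current_germ (T S : current) : Prop :=
  exists U : set Cn, open_nbhs (0 : Cn) U /\
    forall I phi, test_fun U phi -> T I phi = S I phi.

(* T represents the germ at 0 of a current of bidegree (0, q). *)
Definition current_germ (q : nat) (T : current) : Prop :=
  exists U : set Cn, [/\ open_nbhs (0 : Cn) U,
    forall I : {set 'I_n}, #|I| = q -> distribution_on U (T I) &
    forall (I : {set 'I_n}) phi, #|I| <> q -> test_fun U phi -> T I phi = 0].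

Definition zero_current : current := fun _ _ => 0.

(* The constant function 1 as a (0,0)-current. *)
Definition one_current : current :=
  fun I phi => if I == finset.set0 then integralCn phi else 0.

(* Multiplication by a holomorphic germ; up to eq_current_germ it does not
   depend on the chosen representative. *)
Definition mul_current (g : hgerm R n) (T : current) : current :=
  fun I phi => T I (fun z => germ_rep g z * phi z).

(* d/dzbar_j = (d/dx_j + i d/dy_j) / 2 *)
Definition dzbar (j : 'I_n) (phi : Cn -> R[i]) : Cn -> R[i] :=
  fun z => (partial (j, false) phi z + 'i * partial (j, true) phi z) / 2.

(* dbar T = \sum_(j, I) (dT_I / dzbar_j) dzbar_j /\ dzbar_I, with distributional
   derivatives (du / dzbar_j)(phi) = - u (dphi / dzbar_j). *)
Definition dbar (T : current) : current :=
  fun I phi => \sum_(j in I) (-1) ^+ ext_sign j I * - T (I :\ j) (dzbar j phi).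

(* The annihilator of the germ of a tuple of currents. *)
Definition ann (m : nat) (T : 'I_m -> current) : set (hgerm R n) :=
  [set g | forall l, eq_current_germ (mul_current g (T l)) zero_current].

End Currents.

Arguments zero_current {R n}.
Arguments one_current {R n}.

(* Main.v *)
(* For g in O write b = g a, let E_k := e_k /\ ... /\ e_1 and V_k := b_k(E_k) X_k, an
   E_k-valued current. The equations for X say that phi_k V_k = dbar V_(k-1) and
   phi_1 V_1 = b_0(1). If g annihilates a_p(e) dbar X_p, then V_p is dbar-closed. By Dolbeault's
   lemma the V_k can be changed, from k = p downwards, into dbar-closed currents with the same
   images phi_k V_k. The new V_1 is holomorphic by Weyl's lemma, so that b_0(1) lies in the
   image of phi_1 and g in J. Conversely, for g in J the morphism b is null-homotopic, hence
   g a_p(e) = s(psi_p e) for a linear s; this lies in I E_p, and I annihilates dbar X_p.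

   Dolbeault's lemma is proved one variable at a time, by transposing the convolution with a
   cut-off of the Cauchy kernel; splitting that kernel into a singular part with small support
   and a smooth part gives Weyl's lemma. Complex differentiable functions are smooth because,
   by Goursat's bisection argument, they are dbar-closed as distributions. *)

From HB Require Import structures.
From mathcomp Require Import all_boot all_order all_algebra ring_quotient.
From mathcomp Require Import all_classical all_reals all_analysis complex ring lra.
Require Import Defs.
Import Order.TTheory GRing.Theory Num.Theory numFieldNormedType.Exports.
Import ComplexField.Normc.

Set Implicit Arguments.
Unset Strict Implicit.
Unset Printing Implicit Defensive.

Local Open Scope classical_set_scope.
Local Open Scope ring_scope.
Local Open Scope complex_scope.

Local Notation Re := complex.Re.
Local Notation Im := complex.Im.

(** * Integrals of complex functions of a real variable *)

Section ComplexLine.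
Context (R : realType).
Local Notation C := R[i].
Implicit Types (F G : R -> C) (t a b : R) (c : C).

(** The product of a germ and a current is tested by $(gT)(\varphi)=T(g\varphi)$, and a germ is only
    assumed complex differentiable; until such functions are known to be smooth, $g\varphi$ is not a
    test function and $\mathcal O$ does not act on currents. Hence the length of the analytic part,
    and hence Weyl's lemma for distributions precedes every regularity statement about holomorphic
    functions. Singular integrals never occur: the kernel $\bar\zeta^2/\zeta$ is continuous, and the
    derivatives that would turn it into the Cauchy kernel are put on the test function. The price,
    two more derivatives in the seminorm estimates, is harmless for distributions. The constant of
    the reproducing formula is $2\pi$, but only its being nonzero is ever shown. Cubes replace balls
    because the constructions act on one complex variable at a time. The solution operators lose
    part of the cube, so identities between currents hold near 0 only, and the module laws up to
    currents that vanish near 0. *)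

Lemma normc_norm (x : C) : `|x| = (normc x)%:C.
Proof. by case: x. Qed.

Lemma normc_ge0 (x : C) : 0 <= normc x.
Proof. by case: x => a b; rewrite /= sqrtr_ge0. Qed.

Lemma normcB (x y : C) : normc (x - y) = normc (y - x).
Proof. by rewrite -normcN opprB. Qed.

Lemma le_normcB (x y : C) : normc (x - y) <= normc x + normc y.
Proof. by rewrite (le_trans (le_normcD _ _))// normcN. Qed.

Lemma le_normc_sub (y x z : C) : normc (x - z) <= normc (x - y) + normc (y - z).
Proof. by rewrite (le_trans _ (le_normcD _ _))// addrA subrK. Qed.

Lemma Re_le_normc (x : C) : `|Re x| <= normc x.
Proof.
case: x => a b /=; rewrite -sqrtr_sqr ler_sqrt ?addr_ge0 ?sqr_ge0//.
by rewrite lerDl sqr_ge0.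
Qed.

Lemma Im_le_normc (x : C) : `|Im x| <= normc x.
Proof.
case: x => a b /=; rewrite -sqrtr_sqr ler_sqrt ?addr_ge0 ?sqr_ge0//.
by rewrite lerDr sqr_ge0.
Qed.

Lemma normc_le_ReIm (x : C) : normc x <= `|Re x| + `|Im x|.
Proof.
case: x => a b /=; rewrite -[leRHS]ger0_norm ?addr_ge0//.
rewrite -sqrtr_sqr ler_wsqrtr// sqrrD !real_normK ?num_real//.
by rewrite lerD2r lerDl mulrn_wge0// mulr_ge0.
Qed.

Lemma normc_real (x : R) : normc x%:C = `|x|.
Proof. by rewrite /= expr0n addr0 sqrtr_sqr. Qed.

Lemma normcX (x : C) n : normc (x ^+ n) = normc x ^+ n.
Proof. by elim: n => [|n ih]; rewrite ?expr0 ?normc1// !exprS normcM ih. Qed.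

Lemma normci : normc ('i : C) = 1.
Proof. by rewrite /= expr0n add0r expr1n sqrtr1. Qed.

Lemma ReD (x y : C) : Re (x + y) = Re x + Re y. Proof. by case: x y => ? ? []. Qed.

Lemma ImD (x y : C) : Im (x + y) = Im x + Im y. Proof. by case: x y => ? ? []. Qed.

Lemma ReN (x : C) : Re (- x) = - Re x. Proof. by case: x. Qed.

Lemma ImN (x : C) : Im (- x) = - Im x. Proof. by case: x. Qed.

Lemma ReM (x y : C) : Re (x * y) = Re x * Re y - Im x * Im y.
Proof. by case: x y => ? ? []. Qed.

Lemma ImM (x y : C) : Im (x * y) = Re x * Im y + Im x * Re y.
Proof. by case: x y => ? ? []. Qed.

Lemma ReV (x : C) : Re x^-1 = Re x / (Re x * Re x + Im x * Im x).
Proof. by case: x => a b; rewrite -!expr2. Qed.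

Lemma ImV (x : C) : Im x^-1 = - (Im x / (Re x * Re x + Im x * Im x)).
Proof. by case: x => a b; rewrite -!expr2. Qed.

Lemma eqC (x y : C) : Re x = Re y -> Im x = Im y -> x = y.
Proof. by case: x y => ? ? [? ?] /= -> ->. Qed.

(** Norms and radii in [R[i]] are complex numbers, but a positive one has zero imaginary part, so
    real radii suffice. *)
Lemma ccvgP T (F : set_system T) {FF : Filter F} (f : T -> C) (l : C) :
  f @ F --> l <-> forall e : R, 0 < e -> \forall x \near F, normc (l - f x) < e.
Proof.
split=> [/cvgrPdist_lt h e e0|h].
  have /h : 0 < e%:C by rewrite ltcR.
  by apply: filterS => x; rewrite normc_norm ltcR.
apply/cvgrPdist_lt => e; case: e => e e'; rewrite ltcE/= => /andP[/eqP -> e0].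
by apply: filterS (h _ e0) => x; rewrite normc_norm -ltcR.
Qed.

Lemma ccvgReIm T (F : set_system T) {FF : Filter F} (f : T -> C) (l : C) :
  f @ F --> l <->
  (fun x => Re (f x)) @ F --> Re l /\ (fun x => Im (f x)) @ F --> Im l.
Proof.
split=> [/ccvgP h|[/cvgrPdist_lt h1 /cvgrPdist_lt h2]].
  split; apply/cvgrPdist_lt => e e0; apply: filterS (h _ e0) => x; apply: le_lt_trans.
    by rewrite -ReN -ReD Re_le_normc.
  by rewrite -ImN -ImD Im_le_normc.
apply/ccvgP => e e0; have e2 : 0 < e / 2 by rewrite divr_gt0.
near=> x; rewrite (le_lt_trans (normc_le_ReIm _))// [ltRHS]splitr.
rewrite ReD ReN ImD ImN ltrD//; near: x; [exact: h1|exact: h2].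
Unshelve. all: by end_near. Qed.

Lemma is_derive_ext (f g : R -> R) t (a b : R) : is_derive t 1 f a ->
  f =1 g -> a = b -> is_derive t 1 g b.
Proof. by move=> + /funext <- <-. Qed.

(* [cderiv] and [ccont] are inductive so that unification never unfolds them. *)
Variant cderiv F t c : Prop := CDeriv of
  is_derive t 1 (fun s => Re (F s)) (Re c) & is_derive t 1 (fun s => Im (F s)) (Im c).

Variant ccont (T : topologicalType) (f : T -> C) : Prop := CCont of continuous f.

Lemma ccontE (T : topologicalType) (f : T -> C) : ccont f -> continuous f.
Proof. by case. Qed.

Lemma cderiv_uniq F t c d : cderiv F t c -> cderiv F t d -> c = d.
Proof.
by move=> [[_ h1] [_ h2]] [[_ h3] [_ h4]]; apply: eqC; rewrite -?h1 -?h2.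
Qed.

Lemma cderiv_near F G t c : (\near t, F t = G t) -> cderiv F t c -> cderiv G t c.
Proof.
move=> FG [h1 h2]; split.
  by apply: near_eq_is_derive h1; apply: filterS FG => s ->.
by apply: near_eq_is_derive h2; apply: filterS FG => s ->.
Qed.

Lemma cderiv_cst c t : cderiv (fun=> c) t 0.
Proof. by split; exact: is_derive_cst. Qed.

Lemma cderivD F G t c d : cderiv F t c -> cderiv G t d ->
  cderiv (fun s => F s + G s) t (c + d).
Proof.
move=> [h1 h2] [h3 h4]; split.
  have -> : (fun s => Re (F s + G s)) = (fun s => Re (F s)) + (fun s => Re (G s)).
    by apply/funext => s; rewrite ReD.
  by rewrite ReD; apply: is_deriveD.
have -> : (fun s => Im (F s + G s)) = (fun s => Im (F s)) + (fun s => Im (G s)).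
  by apply/funext => s; rewrite ImD.
by rewrite ImD; apply: is_deriveD.
Qed.

Lemma cderivN F t c : cderiv F t c -> cderiv (fun s => - F s) t (- c).
Proof.
move=> [h1 h2]; split.
  have -> : (fun s => Re (- F s)) = - (fun s => Re (F s)).
    by apply/funext => s; rewrite ReN.
  by rewrite ReN; apply: is_deriveN.
have -> : (fun s => Im (- F s)) = - (fun s => Im (F s)).
  by apply/funext => s; rewrite ImN.
by rewrite ImN; apply: is_deriveN.
Qed.

Lemma cderivB F G t c d : cderiv F t c -> cderiv G t d ->
  cderiv (fun s => F s - G s) t (c - d).
Proof. by move=> h1 h2; apply: cderivD h1 _; exact: cderivN. Qed.

Lemma cderivM F G t c d : cderiv F t c -> cderiv G t d ->
  cderiv (fun s => F s * G s) t (c * G t + F t * d).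
Proof.
move=> [h1 h2] [h3 h4]; split.
  apply: is_derive_ext (is_deriveB (is_deriveM h1 h3) (is_deriveM h2 h4)) _ _.
    by move=> s; rewrite ReM.
  by rewrite ReD !ReM /GRing.scale /=; ring.
apply: is_derive_ext (is_deriveD (is_deriveM h1 h4) (is_deriveM h2 h3)) _ _.
  by move=> s; rewrite ImM.
by rewrite ImD !ImM /GRing.scale /=; ring.
Qed.

Lemma cderivZ k F t c : cderiv F t c -> cderiv (fun s => k * F s) t (k * c).
Proof. by move=> h; have := cderivM (cderiv_cst k t) h; rewrite mul0r add0r. Qed.

Lemma cderiv_real (g : R -> R) t (d : R) : is_derive t 1 g d ->
  cderiv (fun s => (g s)%:C) t d%:C.
Proof. by move=> h; split => //=; exact: is_derive_cst. Qed.

Lemma cderiv_comp F (g : R -> R) t (d : R) c : is_derive t 1 g d ->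
  cderiv F (g t) c -> cderiv (fun s => F (g s)) t (d%:C * c).
Proof.
move=> hg [h1 h2]; split.
  by rewrite ReM/= mul0r subr0 mulrC; apply: (is_derive1_comp h1).
by rewrite ImM/= mul0r addr0 mulrC; apply: (is_derive1_comp h2).
Qed.

Lemma cderiv_shift F a t c : cderiv F (a + t) c -> cderiv (fun s => F (a + s)) t c.
Proof.
move=> h; have := @cderiv_comp F (fun s => a + s) t 1 c _ h; rewrite mul1r; apply.
have -> : (fun s => a + s) = cst a + id by [].
by apply: is_derive_eq; rewrite add0r.
Qed.

Lemma cderiv_opp F a t c : cderiv F (a - t) c -> cderiv (fun s => F (a - s)) t (- c).
Proof.
move=> h; have := @cderiv_comp F (fun s => a - s) t (- 1) c _ h.
rewrite rmorphN mulN1r; apply.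
have -> : (fun s => a - s) = cst a - id by [].
by apply: is_derive_eq; rewrite add0r.
Qed.

Lemma cderivV F t c : F t != 0 -> cderiv F t c ->
  cderiv (fun s => (F s)^-1) t (- c / F t ^+ 2).
Proof.
move=> Ft0 [h1 h2].
(* $1/F=\bar F/N$ with $N=|F|^2$ real, so that only the real quotient rule is needed. *)
pose N := (fun s => Re (F s)) * (fun s => Re (F s)) + (fun s => Im (F s)) * (fun s => Im (F s)).
have Nt0 : N t != 0.
  rewrite /N /= !fctE -!expr2; apply: contra Ft0; rewrite paddr_eq0 ?sqr_ge0// !sqrf_eq0.
  by move=> /andP[/eqP h /eqP h']; apply/eqP/eqC.
have dN : is_derive t 1 N (2 * (Re (F t) * Re c + Im (F t) * Im c)).
  apply: is_derive_ext (is_deriveD (is_deriveM h1 h1) (is_deriveM h2 h2)) _ _ => //.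
  by rewrite /GRing.scale /=; ring.
have dV := is_deriveV Nt0 dN.
have NE : (N t)%:C = F t * (Re (F t) -i* Im (F t)).
  by rewrite /N /= !fctE; case: (F t) => x y /=; simpc; congr (_ +i* _); ring.
have Ec : - c / F t ^+ 2 = - c * (Re (F t) -i* Im (F t)) ^+ 2 / (N t ^+ 2)%:C.
  rewrite rmorphXn /= NE; field; rewrite Ft0 andbT.
  by apply: contraNneq Nt0 => h; move: NE; rewrite h mulr0 => -[->].
have NtE : N t = Re (F t) * Re (F t) + Im (F t) * Im (F t) by [].
rewrite {}Ec -fmorphV; split.
  apply: is_derive_ext (is_deriveM h1 dV) _ _; first by move=> s; rewrite ReV.
  rewrite NtE in Nt0; rewrite /GRing.scale /= !ReM !ImM /= ReN ImN NtE.
  by field.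
apply: is_derive_ext (is_deriveN (is_deriveM h2 dV)) _ _; first by move=> s; rewrite ImV.
rewrite NtE in Nt0; rewrite /GRing.scale /= !ImM !ReM /= ReN ImN NtE.
by field.
Qed.

Lemma real_mvt_bound (f f' : R -> R) (a b M : R) : a <= b ->
  (forall t, a <= t <= b -> is_derive t 1 f (f' t)) ->
  (forall t, a <= t <= b -> `|f' t| <= M) -> `|f b - f a| <= M * (b - a).
Proof.
move=> ab df bf.
have [||x] := @MVT_segment R f f' a b ab.
- by move=> x; rewrite in_itv/= => /andP[xa xb]; apply: df; rewrite !ltW.
- apply: derivable_within_continuous => x; rewrite in_itv/= => h.
  by have [] := df _ h.
rewrite in_itv/= => xab ->.
by rewrite normrM (ger0_norm (_ : 0 <= b - a)) ?subr_ge0// ler_wpM2r ?subr_ge0 ?bf.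
Qed.

(** The mean value theorem fails for complex values and is applied to the two components; adding
    them costs the factor 2 that recurs in [cint_bound]. *)
Lemma cderiv_bound F F' a b (M : R) : a <= b ->
  (forall t, a <= t <= b -> cderiv F t (F' t)) ->
  (forall t, a <= t <= b -> normc (F' t) <= M) ->
  normc (F b - F a) <= 2 * M * (b - a).
Proof.
move=> ab dF bF; rewrite (le_trans (normc_le_ReIm _))// ReD ReN ImD ImN.
rewrite -mulrA mulr_natl mulr2n lerD//.
- apply: (@real_mvt_bound (fun t => Re (F t)) (fun t => Re (F' t))) => // t abt.
    by have [] := dF t abt.
  exact: le_trans (Re_le_normc _) (bF _ abt).
- apply: (@real_mvt_bound (fun t => Im (F t)) (fun t => Im (F' t))) => // t abt.
    by have [] := dF t abt.
  exact: le_trans (Im_le_normc _) (bF _ abt).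
Qed.

Lemma cderiv0_cst F : (forall t, cderiv F t 0) -> forall a b, F a = F b.
Proof.
move=> dF; have h a b : a <= b -> F a = F b.
  move=> ab; have := @cderiv_bound F (fun=> 0) a b 0 ab (fun t _ => dF t).
  rewrite normc0 mulr0 mul0r => /(_ (fun _ _ => lexx _)) => h.
  apply/esym/eqP; rewrite -subr_eq0; apply/eqP/eq0_normc/eqP.
  by rewrite eq_le h normc_ge0.
by move=> a b; case: (leP a b) => [/h//|/ltW /h].
Qed.

(** The integral from a fixed base point is a primitive only to the right of that point. Subtracting
    its value at 0 makes the choice of a negative base point irrelevant, so the base point may move
    with [x]. *)
Lemma real_primitive (f : R -> R) : continuous f ->
  exists G : R -> R, forall t, is_derive t 1 G (f t).
Proof.
move=> cf; pose P a x : R := \int[lebesgue_measure]_(t in `[a, x]) f t.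
have dP a x : a < x -> is_derive x 1 (P a) (f x).
  move=> ax; have xx1 : x < x + 1 by rewrite ltrDl.
  have [|d e] := @continuous_FTC1_closed R f a x _ xx1 _ ax (cf x).
    apply: continuous_compact_integrable; first exact: segment_compact.
    exact: continuous_subspaceT.
  by constructor; [exact: d|rewrite -derive1E; exact: e].
have Pind (a' a x : R) : a' < a -> a < 0 -> a < x -> P a' x - P a' 0 = P a x - P a 0.
  move=> a'a a0 ax.
  have key (u v : R) : u <= v -> a < u -> P a' v - P a v = P a' u - P a u.
    move=> uv au.
    have dd t : u <= t <= v -> is_derive t 1 (fun y => P a' y - P a y) 0.
      move=> /andP[ut _].
      apply: is_derive_ext (is_deriveB (dP a' t _) (dP a t _)) _ _ => //.
      - exact: lt_le_trans (lt_trans a'a au) ut.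
      - exact: lt_le_trans au ut.
      - by rewrite subrr.
    have := real_mvt_bound uv dd (M := 0); rewrite normr0 mul0r.
    by move=> /(_ (fun _ _ => lexx 0)); rewrite normr_le0 subr_eq0 => /eqP.
  have := key (Num.min 0 x) 0; have := key (Num.min 0 x) x.
  rewrite !ge_min !lt_min !lexx orbT a0 ax => /(_ isT isT) h1 /(_ isT isT) h2.
  lra.
exists (fun x => P (- (`|x| + 1)) x - P (- (`|x| + 1)) 0) => t.
(* This base point lies below $-(|x|+1)$ for all $x$ with $|x-t|<1/2$, so one formula serves near
   [t]. *)
pose a := - (`|t| + 2).
apply: (@near_eq_is_derive _ _ _ (fun x => P a x - P a 0)).
  near=> x.
  have xt : `|x - t| < 1 / 2.
    by rewrite distrC; near: x; apply: cvgr_dist_lt => //; rewrite divr_gt0.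
  have xt' : `|x| < `|t| + 1 / 2.
    by rewrite -[x](subrK t) (le_lt_trans (ler_normD _ _))// addrC ltrD2l.
  have x0 := normr_ge0 x; have t0 := normr_ge0 t; have x1 := lerNnormlW (lexx `|x|).
  apply: Pind; rewrite /a; lra.
have -> : (fun x => P a x - P a 0) = P a - cst (P a 0) by [].
have at_ : a < t by have := lerNnormlW (lexx `|t|); have := normr_ge0 t; rewrite /a; lra.
by apply: is_derive_ext (is_deriveB (dP a t at_) (is_derive_cst _ _ _)) _ _ => //; rewrite subr0.
Unshelve. all: by end_near. Qed.

Lemma complex_primitive F : ccont F -> exists G, forall t, cderiv G t (F t).
Proof.
move=> [cF].
have [t|G1 dG1] := @real_primitive (fun t => Re (F t)).
  by have /ccvgReIm[h _] := cF t; exact: h.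
have [t|G2 dG2] := @real_primitive (fun t => Im (F t)).
  by have /ccvgReIm[_ h] := cF t; exact: h.
by exists (fun t => G1 t +i* G2 t) => t; constructor; [exact: dG1|exact: dG2].
Qed.

Definition cprim F : R -> C := xget (fun=> 0) [set G | forall t, cderiv G t (F t)].

Lemma cprimP F : ccont F -> forall t, cderiv (cprim F) t (F t).
Proof.
by move=> /complex_primitive[G dG]; rewrite /cprim; case: xgetP => [_ -> //|/(_ G)].
Qed.

(* The integral of a continuous function, as the increment of a primitive;
   locked because unfolding it makes conversion tests explode. *)
Fact cint_key : unit. Proof. exact: tt. Qed.

Definition cint := locked_with cint_key (fun a b F => cprim F b - cprim F a : C).

Lemma cint_def a b F : cint a b F = cprim F b - cprim F a.
Proof. by rewrite /cint unlock. Qed.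

Lemma cint_primitive a b F G : ccont F -> (forall t, cderiv G t (F t)) ->
  cint a b F = G b - G a.
Proof.
move=> cF dG.
have dz t : cderiv (fun t => cprim F t - G t) t 0.
  by rewrite -(subrr (F t)); apply: cderivB => //; exact: cprimP.
by have /eqP := cderiv0_cst dz b a; rewrite !cint_def subr_eq => /eqP ->; ring.
Qed.

Lemma cint_eq a b F G : F =1 G -> cint a b F = cint a b G.
Proof. by move=> /funext ->. Qed.

Lemma cintxx a F : cint a a F = 0.
Proof. by rewrite cint_def subrr. Qed.

Lemma cint_cat b a (c : R) F : cint a c F = cint a b F + cint b c F.
Proof. by rewrite !cint_def; ring. Qed.

Lemma cint_anti a b F : cint a b F = - cint b a F.
Proof. by rewrite !cint_def opprB. Qed.

Lemma cint_deriv a F t : ccont F -> cderiv (fun s => cint a s F) t (F t).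
Proof.
move=> cF; rewrite -[F t]subr0 (_ : (fun s => _) = fun s => cprim F s - cprim F a).
  by apply: cderivB (cprimP cF t) (cderiv_cst _ _).
by apply/funext => s; rewrite cint_def.
Qed.

Lemma ccont_cst (T : topologicalType) (k : C) : ccont (fun _ : T => k).
Proof. by constructor=> x; exact: cvg_cst. Qed.

Lemma ccontD (T : topologicalType) (f g : T -> C) :
  ccont f -> ccont g -> ccont (fun x => f x + g x).
Proof. by move=> [cf] [cg]; constructor=> x; apply: cvgD; [exact: cf|exact: cg]. Qed.

Lemma ccontN (T : topologicalType) (f : T -> C) : ccont f -> ccont (fun x => - f x).
Proof. by move=> [cf]; constructor=> x; apply: cvgN; exact: cf. Qed.

Lemma ccontM (T : topologicalType) (f g : T -> C) :
  ccont f -> ccont g -> ccont (fun x => f x * g x).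
Proof. by move=> [cf] [cg]; constructor=> x; apply: cvgM; [exact: cf|exact: cg]. Qed.

Lemma ccontZ (T : topologicalType) (k : C) (f : T -> C) :
  ccont f -> ccont (fun x => k * f x).
Proof. by move=> cf; apply: ccontM => //; exact: ccont_cst. Qed.

Lemma ccont_comp (S T : topologicalType) (g : S -> T) (f : T -> C) :
  ccont f -> continuous g -> ccont (fun x => f (g x)).
Proof.
by move=> [cf] cg; constructor=> x; apply: continuous_comp; [exact: cg|exact: cf].
Qed.

Lemma ccont_eq (T : topologicalType) (f g : T -> C) : ccont f -> f =1 g -> ccont g.
Proof. by move=> + /funext <-. Qed.

Lemma cint_cst a b (k : C) : cint a b (fun=> k) = k * (b - a)%:C.
Proof.
rewrite (@cint_primitive _ _ _ (fun t => k * t%:C)) => [||t].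
- by rewrite rmorphB /= mulrBr.
- exact: ccont_cst.
- rewrite -[X in cderiv _ _ X]mulr1; by apply: cderivZ; apply: cderiv_real.
Qed.

Lemma cintD a b F G : ccont F -> ccont G ->
  cint a b (fun t => F t + G t) = cint a b F + cint a b G.
Proof.
move=> cF cG; rewrite (@cint_primitive _ _ _ (fun t => cprim F t + cprim G t)).
- by rewrite !cint_def; ring.
- exact: ccontD.
- by move=> t; apply: cderivD; exact: cprimP.
Qed.

Lemma cintZ a b k F : ccont F -> cint a b (fun t => k * F t) = k * cint a b F.
Proof.
move=> cF; rewrite (@cint_primitive _ _ _ (fun t => k * cprim F t)).
- by rewrite !cint_def; ring.
- exact: ccontZ.
- by move=> t; apply: cderivZ; exact: cprimP.
Qed.

Lemma cintN a b F : ccont F -> cint a b (fun t => - F t) = - cint a b F.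
Proof.
by move=> cF; rewrite -mulN1r -cintZ//; apply: cint_eq => t; rewrite mulN1r.
Qed.

Lemma cint_bound a b F (M : R) : a <= b -> ccont F ->
  (forall t, a <= t <= b -> normc (F t) <= M) -> normc (cint a b F) <= 2 * M * (b - a).
Proof. by move=> ab cF; rewrite cint_def; apply: cderiv_bound => // t _; exact: cprimP. Qed.

Lemma cint_eq0 a b F : a <= b -> ccont F ->
  (forall t, a <= t <= b -> F t = 0) -> cint a b F = 0.
Proof.
move=> ab cF F0; apply/eq0_normc/eqP; rewrite eq_le normc_ge0 andbT.
have := @cint_bound a b F 0 ab cF; rewrite mulr0 mul0r; apply => t /F0 ->.
by rewrite normc0.
Qed.

Lemma cint_eq_in a b F G : a <= b -> ccont F -> ccont G ->
  (forall t, a <= t <= b -> F t = G t) -> cint a b F = cint a b G.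
Proof.
move=> ab cF cG FG; apply/eqP; rewrite -subr_eq0 -(cintN _ _ cG).
rewrite -(cintD _ _ cF (ccontN cG)); apply/eqP/cint_eq0 => //.
  by apply: ccontD => //; exact: ccontN.
by move=> t /FG ->; rewrite subrr.
Qed.

Lemma rcont_shift (k : R) : continuous (fun t : R => k + t).
Proof. by move=> t; apply: cvgD; [exact: cvg_cst|exact: cvg_id]. Qed.

Lemma rcont_opp (k : R) : continuous (fun t : R => k - t).
Proof. by move=> t; apply: cvgB; [exact: cvg_cst|exact: cvg_id]. Qed.

Lemma cint_shift a b k F : ccont F ->
  cint a b (fun t => F (k + t)) = cint (k + a) (k + b) F.
Proof.
move=> cF; rewrite (@cint_primitive _ _ _ (fun t => cprim F (k + t))).
- by rewrite cint_def.
- exact: ccont_comp cF (@rcont_shift k).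
- by move=> t; apply: cderiv_shift; exact: cprimP.
Qed.

Lemma cint_flip a b k F : ccont F ->
  cint a b (fun t => F (k - t)) = cint (k - b) (k - a) F.
Proof.
move=> cF; rewrite (@cint_primitive _ _ _ (fun t => - cprim F (k - t))) => //.
- by rewrite !cint_def; ring.
- exact: ccont_comp cF (@rcont_opp k).
- move=> t; rewrite -[F _]opprK; apply: cderivN.
  by apply: cderiv_opp; exact: cprimP.
Qed.

Lemma ccont_eq0_adh (T : topologicalType) (f : T -> C) (x : T) (Z : set T) :
  ccont f -> (forall y, Z y -> f y = 0) -> closure Z x -> f x = 0.
Proof.
move=> [cf] fZ clx; apply/eq0_normc/eqP; rewrite eq_le normc_ge0 andbT leNgt.
apply/negP => fx0; have /ccvgP/(_ _ fx0)/clx[y [/fZ ->]] := cf x.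
by rewrite /= subr0 ltxx.
Qed.

Lemma cint_supp a b a' b' F : ccont F -> a' <= a -> a <= b -> b <= b' ->
  (forall t, t < a \/ b < t -> F t = 0) -> cint a' b' F = cint a b F.
Proof.
move=> cF a'a ab bb' F0.
(* Vanishing is assumed strictly outside the interval only; the endpoints follow by continuity. *)
have Fa : F a = 0.
  apply: (@ccont_eq0_adh _ F a [set t | t < a]) => // [t ta|]; first by apply: F0; left.
  move=> B [e /= e0 eB]; exists (a - e / 2); split=> /=.
    by rewrite ltrBlDr ltrDl divr_gt0.
  apply: eB => /=; rewrite opprB addrC subrK ger0_norm ?divr_ge0 ?ltW//.
  by rewrite ltr_pdivrMr// mulr_natr mulr2n ltrDl.
have Fb : F b = 0.
  apply: (@ccont_eq0_adh _ F b [set t | b < t]) => // [t ta|]; first by apply: F0; right.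
  move=> B [e /= e0 eB]; exists (b + e / 2); split=> /=.
    by rewrite ltrDl divr_gt0.
  apply: eB => /=; rewrite opprD addrA subrr sub0r normrN ger0_norm ?divr_ge0 ?ltW//.
  by rewrite ltr_pdivrMr// mulr_natr mulr2n ltrDl.
rewrite (cint_cat a) (cint_cat b a).
rewrite (@cint_eq0 a' a)//; last first.
  by move=> t /andP[_]; rewrite le_eqVlt => /orP[/eqP -> //|h]; apply: F0; left.
rewrite (@cint_eq0 b b')//; last first.
  by move=> t /andP[+ _]; rewrite le_eqVlt => /orP[/eqP <- //|h]; apply: F0; right.
by rewrite add0r addr0.
Qed.

Lemma real_integral_supp (A : R) (f : R -> R) (G : R -> R) : 0 < A -> continuous f ->
  (forall t, is_derive t 1 G (f t)) ->
  (forall t, A < `|t| -> f t = 0) ->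
  \int[lebesgue_measure]_t f t = G A - G (- A).
Proof.
move=> A0 cf dG f0.
have -> : (\int[lebesgue_measure]_t f t = \int[lebesgue_measure]_(t in `[- A, A]) f t)%R.
  rewrite [RHS]Rintegral_mkcond; congr (Rintegral _ _ _); apply/funext => t.
  rewrite patchE; case: ifPn => // /negP; rewrite inE/= in_itv/= -ler_norml => /negP.
  by rewrite -ltNge => /f0.
rewrite /Rintegral (@continuous_FTC2 _ f G)//.
- by rewrite gtrN.
- exact: continuous_subspaceT.
- split.
  + by move=> x _; have [] := dG x.
  + apply: cvg_at_right_filter; apply: differentiable_continuous.
    by apply/derivable1_diffP; have [] := dG (- A).
  + apply: cvg_at_left_filter; apply: differentiable_continuous.
    by apply/derivable1_diffP; have [] := dG A.
- by move=> x _; rewrite derive1E; have [_ ->] := dG x.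
Qed.

(** The bridge from the Lebesgue integral behind [one_current] to increments of primitives: for a
    continuous integrand with compact support both are computed by the same antiderivative. *)
Lemma integral1_cint (A : R) F : 0 < A -> ccont F ->
  (forall t, A < `|t| -> F t = 0) -> integral1 F = cint (- A) A F.
Proof.
move=> A0 cF F0; rewrite /integral1.
have h1 t : is_derive t 1 (fun t => Re (cprim F t)) (Re (F t)) by case: (cprimP cF t).
have h2 t : is_derive t 1 (fun t => Im (cprim F t)) (Im (F t)) by case: (cprimP cF t).
rewrite (real_integral_supp A0 _ h1); first last.
- by move=> t /F0 ->.
- by move=> t; have /ccvgReIm[h _] := ccontE cF (x := t); exact: h.
rewrite (real_integral_supp A0 _ h2); first last.
- by move=> t /F0 ->.
- by move=> t; have /ccvgReIm[_ h] := ccontE cF (x := t); exact: h.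
by rewrite !cint_def; apply: eqC; rewrite ?ReD ?ImD ?ReN ?ImN.
Qed.

End ComplexLine.

(** * Integrals depending on a parameter *)

Section ParametricIntegrals.
Context (R : realType).
Local Notation C := R[i].

Lemma ccont_near (T : topologicalType) (f : T -> C) x (e : R) : ccont f -> 0 < e ->
  \forall y \near x, normc (f y - f x) < e.
Proof.
move=> [/(_ x) /ccvgP cf] e0; apply: filterS (cf _ e0) => y.
by rewrite normcB.
Qed.

Lemma ccontP (T : topologicalType) (f : T -> C) :
  (forall x (e : R), 0 < e -> \forall y \near x, normc (f y - f x) <= e) -> ccont f.
Proof.
move=> cf; constructor=> x; apply/ccvgP => e e0.
apply: filterS (cf x (e / 2) _); last by rewrite divr_gt0.
move=> y; rewrite normcB => /le_lt_trans -> //.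
by rewrite ltr_pdivrMr// mulr_natr mulr2n ltrDl.
Qed.

(** Joint continuity at each $(s_0,t)$ gives a product neighbourhood, and compactness of [K] reduces
    these to finitely many. *)
Lemma ccont_unif (S T : topologicalType) (K : set T) (g : S -> T -> C) s0 (e : R) :
  compact K -> ccont (fun q : S * T => g q.1 q.2) -> 0 < e ->
  \forall s \near s0, forall t, K t -> normc (g s t - g s0 t) < e.
Proof.
move=> /compact_near_coveringP cK cg e0.
apply: (cK S (nbhs s0) (fun s t => normc (g s t - g s0 t) < e)) => t Kt.
have e2 : 0 < e / 2 by rewrite divr_gt0.
have h1 := @ccont_near _ _ (s0, t) _ cg e2.
case: h1 => -[A B] /= [sA tB] AB.
exists (B, A) => //= -[t' s] /= [Bt' As].
have := AB (s, t') (conj As Bt'); have := AB (s0, t') (conj (nbhs_singleton sA) Bt').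
rewrite /= => h1 h2.
by rewrite (le_lt_trans (le_normc_sub (g s0 t) _ _))// [ltRHS]splitr ltrD// normcB.
Qed.

Lemma ccont_pair1 (S T : topologicalType) (g : S -> T -> C) s :
  ccont (fun q : S * T => g q.1 q.2) -> ccont (g s).
Proof.
move=> cg; apply: (ccont_comp cg (g := fun t => (s, t))) => t.
by apply: cvg_pair => //=; exact: cvg_cst.
Qed.

Lemma ccont_pair2 (S T : topologicalType) (g : S -> T -> C) t :
  ccont (fun q : S * T => g q.1 q.2) -> ccont (g^~ t).
Proof.
move=> cg; apply: (ccont_comp cg (g := fun s => (s, t))) => s.
by apply: cvg_pair => //=; exact: cvg_cst.
Qed.

Lemma ccont_swap (S T : topologicalType) (g : S -> T -> C) :
  ccont (fun q : S * T => g q.1 q.2) -> ccont (fun q : T * S => g q.2 q.1).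
Proof.
move=> cg; apply: (ccont_comp cg (g := fun q : T * S => (q.2, q.1))) => q.
by apply: cvg_pair => /=; [exact: cvg_snd|exact: cvg_fst].
Qed.

(** The [+ 1] keeps the quotient meaningful for an interval of length [L = 0]; the outer 2 is the
    factor in [cint_bound]. *)
Lemma mul_quot_le (e L : R) : 0 <= e -> 0 <= L -> 2 * (e / (2 * (L + 1))) * L <= e.
Proof.
move=> e0 L0; have L1 : 0 < L + 1 by rewrite ltr_wpDl.
have -> : 2 * (e / (2 * (L + 1))) * L = e * (L / (L + 1)).
  by field; rewrite gt_eqF.
by rewrite ler_piMr// ler_pdivrMr// mul1r lerDl.
Qed.

Lemma ccont_cint (T : topologicalType) (a b : R) (g : R -> T -> C) :
  ccont (fun q : R * T => g q.1 q.2) -> ccont (fun q => cint a b (g^~ q)).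
Proof.
wlog ab : a b / a <= b => [hw cg|cg].
  have [/hw|/ltW ba] := leP a b; first exact.
  by apply: (@ccont_eq _ _ (fun q => - cint b a (g^~ q)));
    [apply: ccontN; exact: hw|move=> q; rewrite -cint_anti].
have cg2 t : ccont (g^~ t) by exact: ccont_pair2.
apply: ccontP => q e e0.
have D0 : 0 < 2 * (b - a + 1) by rewrite mulr_gt0// ltr_wpDl// subr_ge0.
have dK : 0 < e / (2 * (b - a + 1)) by rewrite divr_gt0.
have := @ccont_unif _ _ _ (fun q t => g t q) q _ (@segment_compact R a b) (ccont_swap cg) dK.
apply: filterS => q' hq.
rewrite -cintN// -cintD//; last exact: ccontN.
rewrite (le_trans (@cint_bound _ a b _ (e / (2 * (b - a + 1))) ab _ _))//.
- by apply: ccontD => //; exact: ccontN.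
- by move=> t abt; apply/ltW/hq; rewrite /= in_itv.
- by rewrite mul_quot_le ?subr_ge0// ltW.
Qed.

Lemma is_derive_lim (f : R -> R) (t d : R) : (forall e : R, 0 < e ->
    \forall h \near (0 : R), `|f (t + h) - f t - h * d| <= e * `|h|) ->
  is_derive t 1 f d.
Proof.
move=> hf.
have : h^-1 *: (f (h *: 1 + t) - f t) @[h --> (0 : R)^'] --> d.
  apply/cvgrPdist_le => e e0; near=> h.
  have h0 : h != 0 by near: h; exact: nbhs_dnbhs_neq.
  have -> : d - h^-1 *: (f (h *: 1 + t) - f t) = - (h^-1 * (f (t + h) - f t - h * d)).
    by rewrite /GRing.scale /= mulr1 [h + t]addrC; field.
  rewrite normrN normrM normfV ler_pdivrMl ?normr_gt0// [leRHS]mulrC.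
  by near: h; apply: nbhs_dnbhs; exact: hf.
move=> cvgd; constructor; last exact: cvg_lim cvgd.
exact: cvgP cvgd.
Unshelve. all: by end_near. Qed.

Lemma cderiv_lim (F : R -> C) t c :
  (forall e : R, 0 < e ->
     \forall h \near (0 : R), normc (F (t + h) - F t - h%:C * c) <= e * `|h|) ->
  cderiv F t c.
Proof.
move=> hF.
constructor; apply: is_derive_lim => e e0; apply: filterS (hF e e0) => h; apply: le_trans.
  by have := Re_le_normc (F (t + h) - F t - h%:C * c); rewrite !ReD !ReN ReM mul0r subr0.
by have := Im_le_normc (F (t + h) - F t - h%:C * c); rewrite !ImD !ImN ImM mul0r addr0.
Qed.

(** The mean value bound is applied to $t\mapsto G(t,x)-t\,G'(s,x)$, whose derivative is uniformly
    small near $s$ by [ccont_unif]; [e / 2] absorbs the factor 2 of [cderiv_bound]. *)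
Lemma cderiv_unif (X : topologicalType) (K : set X) (G G' : R -> X -> C) s (e : R) :
  compact K -> (forall s x, cderiv (G^~ x) s (G' s x)) ->
  ccont (fun q : R * X => G' q.1 q.2) -> 0 < e ->
  \forall h \near (0 : R), forall x, K x ->
    normc (G (s + h) x - G s x - h%:C * G' s x) <= e * `|h|.
Proof.
move=> cK dG cG' e0; have e2 : 0 < e / 2 by rewrite divr_gt0.
have /nbhs_ballP[d /= d0 hd] := ccont_unif s cK cG' e2.
apply/nbhs_ballP; exists d => //= h; rewrite /ball/= sub0r normrN => hlt x Kx.
have key (u v : R) : u <= v -> s = u \/ s = v -> v - u = `|h| ->
    normc (G v x - G u x - (v - u)%:C * G' s x) <= e * `|h|.
  move=> uv suv vuh.
  have := @cderiv_bound _ (fun t => G t x - t%:C * G' s x) (fun t => G' t x - G' s x)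
    u v (e / 2) uv _ _.
  rewrite vuh [2 * _]mulrC divfK// => h1.
  have -> : G v x - G u x - `|h|%:C * G' s x =
      G v x - v%:C * G' s x - (G u x - u%:C * G' s x).
    by rewrite -vuh rmorphB; ring.
  apply: h1 => t tuv.
    apply: cderivB => //; rewrite -[X in cderiv _ _ X]mul1r.
    by rewrite -[1 * G' s x]addr0 -[X in _ + X](mulr0 t%:C);
      apply: cderivM (cderiv_cst _ _); exact: cderiv_real.
  apply/ltW/hd => //; rewrite /ball/= (le_lt_trans _ hlt)// -vuh.
  by case: suv => ->; [rewrite distrC|]; rewrite ger0_norm ?lerB ?subr_ge0//; case/andP: tuv.
have [h0|h0] := leP 0 h.
  have := key s (s + h); rewrite lerDl h0 [s + h - s]addrC addKr (ger0_norm h0).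
  by apply => //; left.
have := key (s + h) s; rewrite gerDl (ltW h0) opprD addrA subrr sub0r (ltr0_norm h0).
move=> /(_ isT (or_intror erefl) erefl); rewrite -normcN.
by congr (normc _ <= _); rewrite rmorphN; ring.
Qed.

Lemma cint_diff (a b : R) (g g' : R -> R -> C) s : a <= b ->
  (forall t s, cderiv (g t) s (g' t s)) -> (forall s, ccont (g^~ s)) ->
  ccont (fun q : R * R => g' q.1 q.2) ->
  cderiv (fun s => cint a b (g^~ s)) s (cint a b (g'^~ s)).
Proof.
move=> ab dg cg cg'; apply: cderiv_lim => e e0.
have D0 : 0 < 2 * (b - a + 1) by rewrite mulr_gt0// ltr_wpDl// subr_ge0.
have dK : 0 < e / (2 * (b - a + 1)) by rewrite divr_gt0.
have := @cderiv_unif _ _ (fun s t => g t s) (fun s t => g' t s) s _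
  (@segment_compact R a b) (fun s t => dg t s) (ccont_swap cg') dK.
apply: filterS => h hh.
have cg's : ccont (g'^~ s) by exact: ccont_pair2.
have cc := ccontD (ccontD (cg (s + h)) (ccontN (cg s))) (ccontN (ccontZ h%:C cg's)).
have -> : cint a b (g^~ (s + h)) - cint a b (g^~ s) - h%:C * cint a b (g'^~ s) =
    cint a b (fun t => g t (s + h) - g t s - h%:C * g' t s).
  rewrite cintD ?cintN ?cintZ ?cintD ?cintN//.
  - exact: ccontN.
  - exact: ccontZ.
  - by apply: ccontD => //; exact: ccontN.
  - by apply: ccontN; exact: ccontZ.
have hM t : a <= t <= b ->
    normc (g t (s + h) - g t s - h%:C * g' t s) <= e / (2 * (b - a + 1)) * `|h|.
  by move=> abt; apply: hh; rewrite /= in_itv.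
apply: le_trans (cint_bound ab cc hM) _.
by rewrite mulrA mulrAC ler_wpM2r// mul_quot_le ?subr_ge0// ltW.
Qed.

(** Both sides, as functions of the upper endpoint [b], have derivative $\int_c^d g(b,y)\,dy$ and
    vanish at [b = a]. *)
Lemma cint_fubini (a b c d : R) (g : R -> R -> C) : c <= d ->
  ccont (fun q : R * R => g q.1 q.2) ->
  cint a b (fun x => cint c d (g x)) = cint c d (fun y => cint a b (g^~ y)).
Proof.
move=> cd cg; have cgs := ccont_swap cg.
have cF : ccont (fun x => cint c d (g x)) := ccont_cint c d cgs.
have cG s : ccont (fun y => cint a s (g^~ y)) by exact: (ccont_cint a s cg).
have dG s : cderiv (fun s => cint c d (fun y => cint a s (g^~ y))) s (cint c d (g s)).
  apply: (@cint_diff c d (fun y s => cint a s (g^~ y)) (fun y s => g s y)) => //.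
  by move=> y t; apply: cint_deriv; exact: ccont_pair2.
rewrite (cint_primitive a b cF dG) [X in _ - X]cint_eq0 ?subr0// => y _.
by rewrite cintxx.
Qed.

End ParametricIntegrals.

(** * Smooth functions on complex space *)

Fact mv_key : unit. Proof. exact: tt. Qed.

Fact pd_key : unit. Proof. exact: tt. Qed.

Section SmoothFunctions.
Context (R : realType).
Local Notation C := R[i].

Variant ccont_at (T : topologicalType) (f : T -> C) (x : T) : Prop :=
  CContAt of f y @[y --> x] --> f x.

Lemma ccont_atP (T : topologicalType) (f : T -> C) : ccont f <-> forall x, ccont_at f x.
Proof.
split=> [[cf] x|cf]; constructor; first exact: cf.
by move=> x; case: (cf x).
Qed.

Lemma ccont_atW (T : topologicalType) (f : T -> C) x : ccont f -> ccont_at f x.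
Proof. by move=> /ccont_atP. Qed.

Lemma ccont_at_near (T : topologicalType) (f g : T -> C) x :
  (\near x, f x = g x) -> ccont_at f x -> ccont_at g x.
Proof.
move=> fg [cf]; constructor; rewrite -(nbhs_singleton fg).
apply: cvg_trans cf; apply: near_eq_cvg; exact: fg.
Qed.

Lemma ccont_atD (T : topologicalType) (f g : T -> C) x :
  ccont_at f x -> ccont_at g x -> ccont_at (fun y => f y + g y) x.
Proof. by move=> [cf] [cg]; constructor; apply: cvgD; [exact: cf|exact: cg]. Qed.

Lemma ccont_atM (T : topologicalType) (f g : T -> C) x :
  ccont_at f x -> ccont_at g x -> ccont_at (fun y => f y * g y) x.
Proof. by move=> [cf] [cg]; constructor; apply: cvgM; [exact: cf|exact: cg]. Qed.

Lemma ccont_atV (T : topologicalType) (f : T -> C) x :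
  f x != 0 -> ccont_at f x -> ccont_at (fun y => (f y)^-1) x.
Proof. by move=> fx0 [cf]; constructor; exact: cvgV. Qed.

Lemma continuous_pairr (S T : topologicalType) (s : S) : continuous (fun t : T => (s, t)).
Proof. by move=> t; apply: cvg_pair => //=; exact: cvg_cst. Qed.

Lemma continuous_pairl (S T : topologicalType) (t : T) : continuous (fun s : S => (s, t)).
Proof. by move=> s; apply: cvg_pair => //=; exact: cvg_cst. Qed.

Lemma ccont_at_comp (S T : topologicalType) (g : S -> T) (f : T -> C) x :
  continuous g -> ccont_at f (g x) -> ccont_at (fun y => f (g y)) x.
Proof. by move=> cg [cf]; constructor; apply: (cvg_comp g f _ cf); exact: cg. Qed.

Lemma continuous_rV (T : topologicalType) m (f : T -> 'rV[C]_m) :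
  (forall j, ccont (fun t => f t 0 j)) -> continuous f.
Proof.
move=> cf x; apply/cvg_ballP => e e0.
have h (ij : 'I_1 * 'I_m) : \forall y \near x, ball (f x ij.1 ij.2) e (f y ij.1 ij.2).
  have [/(_ x) /cvg_ballP c] := cf ij.2.
  by rewrite (ord1 ij.1); exact: c.
have H : \forall y \near x, forall ij : 'I_1 * 'I_m,
    ball (f x ij.1 ij.2) e (f y ij.1 ij.2) by exact: filter_forall.
apply: filterS H => y hy; split; first exact: e0.
by move=> i j; exact: (hy (i, j)).
Qed.

Lemma continuous_coord (T : topologicalType) m (f : T -> 'rV[C]_m) j :
  continuous f -> ccont (fun t => f t 0 j).
Proof.
move=> cf; constructor=> x.
apply: (@continuous_comp _ _ _ f (fun z : 'rV[C]_m => z 0 j)); first exact: cf.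
exact: coord_continuous.
Qed.

Section Fixed.
Context (n : nat).
Local Notation Cn := 'rV[C]_n.
Local Notation dir := ('I_n * bool)%type.
Implicit Types (f g : Cn -> C) (z : Cn) (d : dir) (W : set Cn).

Definition mv := locked_with mv_key (fun z d (t : R) => z + t%:C *: real_dir R d : Cn).

Lemma mv_def z d t : mv z d t = z + t%:C *: real_dir R d.
Proof. by rewrite /mv unlock. Qed.

Lemma mv0 z d : mv z d 0 = z.
Proof. by rewrite mv_def rmorph0 scale0r addr0. Qed.

Lemma mv_add z d s t : mv (mv z d s) d t = mv z d (s + t).
Proof. by rewrite !mv_def -addrA -scalerDl -rmorphD. Qed.

Lemma mvC z d e s t : mv (mv z d s) e t = mv (mv z e t) d s.
Proof. rewrite !mv_def; exact: addrAC. Qed.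

Lemma alongE f z d t : along f z d t = f (mv z d t).
Proof. by rewrite mv_def. Qed.

Lemma along_fun f z d : along f z d = fun t => f (mv z d t).
Proof. by apply/funext => t; rewrite alongE. Qed.

Definition crd d z : R := if d.2 then Im (z 0 d.1) else Re (z 0 d.1).

Lemma real_dirE d j : (real_dir R d : Cn) 0 j =
  if j == d.1 then (if d.2 then 'i else 1) else 0.
Proof. by rewrite !mxE eqxx /=; case: eqP => _; rewrite ?mulr1 ?mulr0. Qed.

Lemma mvE z d t j : mv z d t 0 j =
  z 0 j + (if j == d.1 then (if d.2 then 'i * t%:C else t%:C) else 0).
Proof.
rewrite mv_def mxE [X in _ + X]mxE real_dirE; case: eqP => _; last by rewrite mulr0.
by case: d.2; rewrite ?mulr1// mulrC.
Qed.

Lemma crd_mv d e z t : crd e (mv z d t) = crd e z + (if e == d then t else 0).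
Proof.
rewrite /crd !mvE; case: e d => [i b] [j c] /=; rewrite xpair_eqE.
have [->|ij] := eqVneq i j; last by rewrite addr0 addr0.
by case: b c => [] []; rewrite ?ReD ?ImD /= ?ReM ?ImM /=; ring.
Qed.

Lemma crdP z z' : (forall d, crd d z = crd d z') -> z = z'.
Proof.
move=> h; apply/rowP => j; apply: eqC.
  exact: (h (j, false)).
exact: (h (j, true)).
Qed.

Lemma ccont_real (T : topologicalType) (g : T -> R) : continuous g -> ccont (fun x => (g x)%:C).
Proof.
move=> cg; constructor=> x; apply/ccvgReIm; split; first exact: cg.
exact: cvg_cst.
Qed.

Lemma continuous_mv : forall d, continuous (fun q : R * Cn => mv q.2 d q.1).
Proof.
move=> d; apply: continuous_rV => j.
have c2 : ccont (fun q : R * Cn => q.2 0 j).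
  by apply: continuous_coord => q; exact: cvg_snd.
have c1 : ccont (fun q : R * Cn => q.1%:C) by apply: ccont_real => q; exact: cvg_fst.
apply: ccont_eq (ccontD c2 (ccontM c1 (ccont_cst _ ((real_dir R d : Cn) 0 j)))) _.
by move=> q; rewrite mv_def !mxE.
Qed.

Lemma continuous_mv_t z d : continuous (mv z d).
Proof.
move=> t; apply: (@continuous_comp _ _ _ (fun t : R => (t, z))
  (fun q : R * Cn => mv q.2 d q.1)); first exact: continuous_pairl.
exact: continuous_mv.
Qed.

Lemma continuous_mv_z d t : continuous (fun z => mv z d t).
Proof.
move=> z; apply: (@continuous_comp _ _ _ (fun z : Cn => (t, z))
  (fun q : R * Cn => mv q.2 d q.1)); first exact: continuous_pairr.
exact: continuous_mv.
Qed.

Lemma continuous_crd d : continuous (crd d).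
Proof.
have cid : continuous (fun z : Cn => z) by move=> z; exact: cvg_id.
have [h] := @continuous_coord _ _ _ d.1 cid.
move=> z; have /ccvgReIm[h1 h2] := h z.
by rewrite /crd; case: d.2; [exact: h2|exact: h1].
Qed.

Lemma open_mv W z d t : open W -> W (mv z d t) -> \forall s \near t, W (mv z d s).
Proof.
move=> oW Wz; have : nbhs (mv z d t) W by apply: open_nbhs_nbhs; split.
exact: (@continuous_mv_t z d t W).
Qed.

(* [pd] is locked, since comparing two partial derivatives by
   unfolding does not terminate in practice. *)
Definition pd := locked_with pd_key (@partial R n).

Lemma pdE : pd = @partial R n.
Proof. by rewrite /pd unlock. Qed.

Definition pds (s : seq dir) f : Cn -> C := foldr pd f s.

Lemma pdsE : pds = @partials R n.
Proof. by apply/funext => s; apply/funext => f; rewrite /pds pdE. Qed.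

Lemma has_partialP d f z : has_partial d f z <-> cderiv (along f z d) 0 (pd d f z).
Proof.
rewrite pdE; split=> [[h1 h2]|[[h1 _] [h2 _]]].
  constructor; constructor.
  - exact: h1.
  - by rewrite -derive1E.
  - exact: h2.
  - by rewrite -derive1E.
by split; [exact: h1|exact: h2].
Qed.

Lemma partial_cderiv d f z c : cderiv (along f z d) 0 c -> pd d f z = c.
Proof.
by move=> [[h1 h1'] [h2 h2']]; apply: eqC; rewrite pdE /partial /= derive1E.
Qed.

Lemma has_partial_cderiv d f z c : cderiv (along f z d) 0 c -> has_partial d f z.
Proof. by move=> h; apply/has_partialP; rewrite (partial_cderiv h). Qed.

Lemma cderiv_along d f z s c : cderiv (along f (mv z d s) d) 0 c <->
  cderiv (along f z d) s c.
Proof.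
split=> h.
  have -> : along f z d = fun t => along f (mv z d s) d (- s + t).
    by apply/funext => t; rewrite !alongE mv_add addrA subrr add0r.
  by apply: cderiv_shift; rewrite addNr.
have -> : along f (mv z d s) d = fun t => along f z d (s + t).
  by apply/funext => t; rewrite !alongE mv_add.
by apply: cderiv_shift; rewrite addr0.
Qed.

Lemma near_along W f g z d : open W -> W z -> (forall w, W w -> f w = g w) ->
  \forall t \near (0 : R), along f z d t = along g z d t.
Proof.
move=> oW Wz fg; have := @open_mv W z d 0 oW; rewrite mv0 => /(_ Wz).
by apply: filterS => t /fg; rewrite !alongE.
Qed.

Lemma partials_rcons s d f : pds (rcons s d) f = pds s (pd d f).
Proof. by rewrite /pds foldr_rcons. Qed.

Lemma partial_eq_on W f g d : open W -> (forall z, W z -> f z = g z) ->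
  forall z, W z -> pd d f z = pd d g z.
Proof.
move=> oW fg z Wz; rewrite pdE /partial.
have h := @near_along W f g z d oW Wz fg; congr (_ +i* _); rewrite !derive1E.
  by apply: near_eq_derive; apply: filterS h => t ->.
by apply: near_eq_derive; apply: filterS h => t ->.
Qed.

Lemma partials_eq_on W f g s : open W -> (forall z, W z -> f z = g z) ->
  forall z, W z -> pds s f z = pds s g z.
Proof. by move=> oW fg; elim: s => //= d s ih z Wz; exact: (partial_eq_on d oW ih). Qed.

Variant smooth_on W f : Prop := SmoothOn of forall s z, W z ->
  ccont_at (pds s f) z /\ forall d, has_partial d (pds s f) z.

Lemma smooth_onT f : smooth_on setT f <-> smooth f.
Proof.
split=> [[h] s|h]; last first.
  constructor=> s z _; rewrite pdsE; have [h1 h2] := h s; split; last by move=> d; exact: h2.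
  by constructor; exact: h1.
rewrite -pdsE; split=> [z|d z]; first by have [[]] := h s z I.
by have [_] := h s z I; exact.
Qed.

Lemma smooth_onW W W' f : W' `<=` W -> smooth_on W f -> smooth_on W' f.
Proof. by move=> W'W [h]; constructor=> s z /W'W; exact: h. Qed.

(** Iterated partials need no closed formula: by induction on the word [s], each of them agrees on
    [W] with some member of [S]. Openness lets partials be compared through values on [W]. *)
Lemma smooth_on_coind W (S : (Cn -> C) -> Prop) : open W ->
  (forall f, S f -> forall z, W z -> ccont_at f z) ->
  (forall f d, S f -> exists g, S g /\ forall z, W z -> cderiv (along f z d) 0 (g z)) ->
  forall f, S f -> smooth_on W f.
Proof.
move=> oW Sc Sd f Sf; constructor=> s.
have [g [Sg gf]] : exists g, S g /\ forall z, W z -> pds s f z = g z.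
  elim: s => [|d s [g [Sg gf]]]; first by exists f.
  have [h [Sh hg]] := Sd g d Sg; exists h; split => // z Wz /=.
  by rewrite (partial_eq_on d oW gf)//; apply: partial_cderiv; exact: hg.
have fg z : W z -> g z = pds s f z by move=> /gf.
move=> z Wz; split=> [|d].
  apply: ccont_at_near (Sc _ Sg _ Wz); have : nbhs z W by apply: open_nbhs_nbhs; split.
  by apply: filterS.
have [h [_ hg]] := Sd g d Sg.
apply: has_partial_cderiv (h z) _; apply: cderiv_near (hg _ Wz).
exact: (near_along d oW Wz fg).
Qed.

Lemma smooth_on_eq W f g : open W -> (forall z, W z -> f z = g z) ->
  smooth_on W f -> smooth_on W g.
Proof.
move=> oW fg [sf]; constructor=> s z Wz; have [h1 h2] := sf s z Wz.
have e : forall w, W w -> pds s f w = pds s g w by exact: partials_eq_on.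
split=> [|d].
  by apply: ccont_at_near h1; apply: filterS (open_nbhs_nbhs (conj oW Wz)).
have /has_partialP h := h2 d; apply: has_partial_cderiv _ _.
by apply: cderiv_near h; exact: (near_along d oW Wz e).
Qed.

Lemma smooth_on_partial W f d : smooth_on W f -> smooth_on W (pd d f).
Proof. by move=> [sf]; constructor=> s; rewrite -partials_rcons; exact: sf. Qed.

Lemma smooth_on_partials W f s : smooth_on W f -> smooth_on W (pds s f).
Proof. by move=> sf; elim: s => //= d s; exact: smooth_on_partial. Qed.

Lemma smooth_on_cont W f z : smooth_on W f -> W z -> ccont_at f z.
Proof. by move=> [sf] Wz; have [] := sf [::] z Wz. Qed.

Lemma smooth_on_cderiv W f d z : smooth_on W f -> W z ->
  cderiv (along f z d) 0 (pd d f z).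
Proof. by move=> [sf] Wz; apply/has_partialP; have [_] := sf [::] z Wz; exact. Qed.

Lemma smooth_on_cderiv_line W f d z t : smooth_on W f -> W (mv z d t) ->
  cderiv (along f z d) t (pd d f (mv z d t)).
Proof. by move=> sf Wz; apply/cderiv_along; exact: smooth_on_cderiv Wz. Qed.

Lemma smooth_on_cderiv_mv W f d z t : smooth_on W f -> W (mv z d t) ->
  cderiv (fun s => f (mv z d s)) t (pd d f (mv z d t)).
Proof. by rewrite -along_fun; exact: smooth_on_cderiv_line. Qed.

Lemma smooth_ccont f : smooth_on setT f -> ccont f.
Proof. by move=> sf; apply/ccont_atP => z; exact: smooth_on_cont sf I. Qed.

(** The Leibniz and quotient rules mix sums, products and inverses, so the closure properties have
    to be proved together, as stability of one class under differentiation. *)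
Inductive smooth_alg W : (Cn -> C) -> Prop :=
| SAbase f : smooth_on W f -> smooth_alg W f
| SAcst c : smooth_alg W (fun=> c)
| SAadd f g : smooth_alg W f -> smooth_alg W g -> smooth_alg W (fun z => f z + g z)
| SAmul f g : smooth_alg W f -> smooth_alg W g -> smooth_alg W (fun z => f z * g z)
| SAinv f : smooth_alg W f -> (forall z, W z -> f z != 0) -> smooth_alg W (fun z => (f z)^-1).

Lemma smooth_alg_on W f : open W -> smooth_alg W f -> smooth_on W f.
Proof.
move=> oW; apply: smooth_on_coind f => // f.
  move=> Sf z Wz; elim: Sf => {f} [f sf|c|f g _ cf _ cg|f g _ cf _ cg|f _ cf f0].
  - exact: smooth_on_cont sf Wz.
  - by apply: ccont_atW; exact: ccont_cst.
  - exact: ccont_atD.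
  - exact: ccont_atM.
  - by apply: ccont_atV => //; exact: f0.
move=> d; elim=> {f} [f sf|c|f g _ [f' [Sf' df']] _ [g' [Sg' dg']]|
    f g Sf [f' [Sf' df']] Sg [g' [Sg' dg']]|f Sf [f' [Sf' df']] f0].
- exists (pd d f); split; first exact/SAbase/smooth_on_partial.
  by move=> z Wz; exact: smooth_on_cderiv sf Wz.
- exists (fun=> 0); split; first exact: SAcst.
  by move=> z _; exact: cderiv_cst.
- exists (fun z => f' z + g' z); split; first exact: SAadd.
  by move=> z Wz; apply: cderivD; [exact: df'|exact: dg'].
- exists (fun z => f' z * g z + f z * g' z); split.
    by apply: SAadd; exact: SAmul.
  move=> z Wz; have := cderivM (df' _ Wz) (dg' _ Wz).
  by rewrite !alongE mv0.
- exists (fun z => (-1) * (f' z * ((f z)^-1 * (f z)^-1))); split.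
    apply: SAmul; first exact: SAcst.
    by apply: SAmul => //; apply: SAmul; exact: SAinv.
  move=> z Wz; have := @cderivV _ (along f z d) 0 _ _ (df' _ Wz).
  rewrite {1}alongE mv0 => /(_ (f0 _ Wz)).
  by congr (cderiv _ _ _); rewrite alongE mv0 expr2 invfM; ring.
Qed.

End Fixed.

Section Fixed2.
Context (n : nat) (W : set 'rV[C]_n).

Hypothesis oW : open W.

Implicit Types (f g : 'rV[C]_n -> C) (d : 'I_n * bool).

Lemma smooth_on_cst c : smooth_on W (fun=> c).
Proof. by apply: smooth_alg_on => //; exact: SAcst. Qed.

Lemma smooth_onD f g : smooth_on W f -> smooth_on W g -> smooth_on W (fun z => f z + g z).
Proof. by move=> sf sg; apply: smooth_alg_on => //; apply: SAadd; exact: SAbase. Qed.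

Lemma smooth_onM f g : smooth_on W f -> smooth_on W g -> smooth_on W (fun z => f z * g z).
Proof. by move=> sf sg; apply: smooth_alg_on => //; apply: SAmul; exact: SAbase. Qed.

Lemma smooth_onZ c f : smooth_on W f -> smooth_on W (fun z => c * f z).
Proof. by move=> sf; apply: smooth_onM => //; exact: smooth_on_cst. Qed.

Lemma smooth_onN f : smooth_on W f -> smooth_on W (fun z => - f z).
Proof.
move=> /(smooth_onZ (-1)); apply: smooth_on_eq => // z _; exact: mulN1r.
Qed.

Lemma smooth_onB f g : smooth_on W f -> smooth_on W g -> smooth_on W (fun z => f z - g z).
Proof. by move=> sf sg; apply: smooth_onD => //; exact: smooth_onN. Qed.

Lemma smooth_onV f : smooth_on W f -> (forall z, W z -> f z != 0) ->
  smooth_on W (fun z => (f z)^-1).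
Proof.
by move=> sf f0; apply: smooth_alg_on => //; apply: SAinv => //; exact: SAbase.
Qed.

Lemma smooth_on_prod (I : Type) (s : seq I) (F : I -> 'rV[C]_n -> C) :
  (forall i, smooth_on W (F i)) -> smooth_on W (fun z => \prod_(i <- s) F i z).
Proof.
move=> sF; elim: s => [|i s ih].
  by apply: smooth_on_eq (smooth_on_cst 1) => // z _; rewrite big_nil.
by apply: smooth_on_eq (smooth_onM (sF i) ih) => // z _; rewrite big_cons.
Qed.

Lemma partialD f g d z : smooth_on W f -> smooth_on W g -> W z ->
  pd d (fun z => f z + g z) z = pd d f z + pd d g z.
Proof.
move=> sf sg Wz; apply: partial_cderiv.
by apply: cderivD; [exact: smooth_on_cderiv sf Wz|exact: smooth_on_cderiv sg Wz].
Qed.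

Lemma partialM f g d z : smooth_on W f -> smooth_on W g -> W z ->
  pd d (fun z => f z * g z) z = pd d f z * g z + f z * pd d g z.
Proof.
move=> sf sg Wz; apply: partial_cderiv.
have := cderivM (smooth_on_cderiv d sf Wz) (smooth_on_cderiv d sg Wz).
by rewrite !alongE mv0.
Qed.

Lemma partial_cst c d z : pd d (fun _ : 'rV[C]_n => c) z = 0.
Proof. by apply: partial_cderiv; exact: cderiv_cst. Qed.

Lemma partialZ c f d z : smooth_on W f -> W z ->
  pd d (fun z => c * f z) z = c * pd d f z.
Proof. by move=> sf Wz; apply/partial_cderiv/cderivZ; exact: smooth_on_cderiv sf Wz. Qed.

End Fixed2.

Section Subst.
Context (m n : nat) (sg : 'rV[C]_m -> 'rV[C]_n) (tau : 'I_m * bool -> 'I_n * bool)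
  (k : 'I_m * bool -> R).

Hypothesis csg : continuous sg.

Hypothesis sg_mv : forall z d t, sg (mv z d t) = mv (sg z) (tau d) (k d * t).

Lemma cderiv_subst (f : 'rV[C]_n -> C) d z c : cderiv (along f (sg z) (tau d)) 0 c ->
  cderiv (along (fun z => f (sg z)) z d) 0 ((k d)%:C * c).
Proof.
move=> h.
have -> : along (fun z => f (sg z)) z d = fun t => along f (sg z) (tau d) (k d * t).
  by apply/funext => t; rewrite !alongE sg_mv.
apply: (@cderiv_comp _ (along f (sg z) (tau d)) (fun t => k d * t)).
  have -> : (fun t => k d * t) = cst (k d) * id by [].
  apply: is_derive_ext (is_deriveM (is_derive_cst _ _ _) (is_derive_id _ _)) _ _ => //.
  by rewrite /GRing.scale /= mulr1 mulr0 addr0.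
by rewrite mulr0.
Qed.

(** Three kinds of substitution are meant: translations, projections to a coordinate axis (speeds
    [k d] equal to 0 or 1) and reflected projections (speed -1). Up to constants, the partials of
    such a composite are again such composites. *)
Lemma smooth_on_subst W f : open W -> smooth_on W f ->
  smooth_on (sg @^-1` W) (fun z => f (sg z)).
Proof.
move=> oW sf; have oV : open (sg @^-1` W) by apply: open_comp => // z _; exact: csg.
apply: (@smooth_on_coind _ _ (fun h => exists c g, smooth_on W g /\ h = fun z => c * g (sg z))).
- exact: oV.
- move=> _ [c [g [sg' ->]]] z Wz; apply: ccont_atM.
    by apply: ccont_atW; exact: ccont_cst.
  by apply: ccont_at_comp => //; exact: smooth_on_cont sg' Wz.
- move=> _ d [c [g [sg' ->]]].
  exists (fun z => (c * (k d)%:C) * pd (tau d) g (sg z)); split.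
    by exists (c * (k d)%:C), (pd (tau d) g); split => //; exact: smooth_on_partial.
  move=> z Wz; rewrite -mulrA; apply: cderivZ; apply: cderiv_subst.
  exact: smooth_on_cderiv sg' Wz.
- by exists 1, f; split => //; apply/funext => z; rewrite mul1r.
Qed.

Lemma partial_subst W f d z : smooth_on W f -> W (sg z) ->
  pd d (fun z => f (sg z)) z = (k d)%:C * pd (tau d) f (sg z).
Proof.
by move=> sf Wz; apply: partial_cderiv; apply: cderiv_subst; exact: smooth_on_cderiv sf Wz.
Qed.

Lemma partials_subst f s z : smooth_on setT f ->
  pds s (fun z => f (sg z)) z =
  (\prod_(d <- s) k d)%:C * pds (map tau s) f (sg z).
Proof.
move=> sf; elim: s z => [|d s ih] z /=; first by rewrite big_nil mul1r.
rewrite (_ : pds s _ = fun z => (\prod_(d <- s) k d)%:C * pds (map tau s) f (sg z));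
  last exact/funext.
rewrite big_cons; apply: partial_cderiv; rewrite rmorphM mulrAC -mulrA mulrC.
rewrite -mulrA mulrCA; apply: cderivZ; rewrite mulrC; apply: cderiv_subst.
exact: smooth_on_cderiv (smooth_on_partials _ sf) I.
Qed.

End Subst.

Lemma smooth_translate (n : nat) (sg : 'rV[C]_n -> 'rV[C]_n) f : continuous sg ->
  (forall z d t, sg (mv z d t) = mv (sg z) d t) -> smooth_on setT f ->
  smooth_on setT (fun z => f (sg z)) /\ forall s z, pds s (fun z => f (sg z)) z = pds s f (sg z).
Proof.
move=> csg sg_mv sf.
have sg_mv' z d t : sg (mv z d t) = mv (sg z) (id d) ((fun=> 1) d * t) by rewrite sg_mv mul1r.
split=> [|s z]; first exact: (smooth_on_subst csg sg_mv' (@openT _) sf).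
by rewrite (partials_subst sg_mv' s z sf) big1_eq map_id mul1r.
Qed.

End SmoothFunctions.

(** * Integrals over boxes *)

Section Boxes.
Context (R : realType) (n : nat).
Local Notation C := R[i].
Local Notation Cn := 'rV[C]_n.
Local Notation dir := ('I_n * bool)%type.
Implicit Types (f g : Cn -> C) (z : Cn) (d : dir).

(** Joint continuity of every derivative in parameter and point is what differentiation under the
    integral sign, and later the application of a distribution to a family, require. *)
Variant sfam (P : topologicalType) (Phi : P -> Cn -> C) : Prop := SFam of
  (forall p, smooth_on setT (Phi p)) &
  (forall s, ccont (fun q : P * Cn => pds s (Phi q.1) q.2)).

Lemma partials_cint_smooth (a b : R) (Phi : R -> Cn -> C) : a <= b -> sfam Phi ->
  smooth_on setT (fun z => cint a b (Phi^~ z)) /\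
  forall s z, pds s (fun z => cint a b (Phi^~ z)) z =
    cint a b (fun t => pds s (Phi t) z).
Proof.
move=> ab [sPhi cPhi].
have dS s d z : cderiv (along (fun z => cint a b (fun t => pds s (Phi t) z)) z d) 0
    (cint a b (fun t => pds (d :: s) (Phi t) z)).
  have := @cint_diff R a b (fun t u => pds s (Phi t) (mv z d u))
    (fun t u => pds (d :: s) (Phi t) (mv z d u)) 0 ab _ _ _.
  rewrite (_ : (fun t => pds (d :: s) (Phi t) (mv z d 0)) =
    (fun t => pds (d :: s) (Phi t) z)); last by apply/funext => t; rewrite mv0.
  rewrite along_fun; apply.
  - move=> t u; have sp := smooth_on_partials s (sPhi t).
    exact: smooth_on_cderiv_mv sp I.
  - move=> u; apply: (ccont_comp (cPhi s) (g := fun t => (t, mv z d u))).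
    exact: continuous_pairl.
  - apply: (ccont_comp (cPhi (d :: s)) (g := fun q : R * R => (q.1, mv z d q.2))) => q.
    apply: (@cvg_pair _ _ _ _ (nbhs q.1) (nbhs (mv z d q.2))); first exact: cvg_fst.
    apply: (@continuous_comp _ _ _ (fun q : R * R => q.2) (mv z d)).
      exact: cvg_snd.
    exact: continuous_mv_t.
have E s : pds s (fun z => cint a b (Phi^~ z)) =
    fun z => cint a b (fun t => pds s (Phi t) z).
  elim: s => // d s ih; apply/funext => z; rewrite /= -/(pds _ _) ih.
  by apply: partial_cderiv; exact: dS.
split=> [|s z]; last by rewrite E.
constructor=> s z _; rewrite E; split; last first.
  by move=> d; apply: has_partial_cderiv (dS _ _ _).
by apply: ccont_atW; exact: (ccont_cint a b (cPhi s)).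
Qed.

Lemma sfam_cint (P : topologicalType) (a b : R) (Phi : R -> P -> Cn -> C) : a <= b ->
  sfam (fun q : R * P => Phi q.1 q.2) ->
  sfam (fun p z => cint a b (fun t => Phi t p z)).
Proof.
move=> ab [sPhi cPhi].
have sf p : sfam (fun t => Phi t p).
  constructor=> [t|s]; first exact: (sPhi (t, p)).
  apply: (ccont_comp (cPhi s) (g := fun q : R * Cn => ((q.1, p), q.2))) => q.
  apply: (@cvg_pair _ _ _ _ (nbhs (q.1, p)) (nbhs q.2)); last exact: cvg_snd.
  apply: (@continuous_comp _ _ _ (fun q : R * Cn => q.1) (fun t => (t, p))).
    exact: cvg_fst.
  exact: continuous_pairl.
constructor=> [p|s]; first by have [] := partials_cint_smooth ab (sf p).
have c : ccont (fun q : R * (P * Cn) => pds s (Phi q.1 q.2.1) q.2.2).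
  apply: (ccont_comp (cPhi s) (g := fun q : R * (P * Cn) => ((q.1, q.2.1), q.2.2))) => q.
  apply: (@cvg_pair _ _ _ _ (nbhs (q.1, q.2.1)) (nbhs q.2.2)).
    apply: (@cvg_pair _ _ _ _ (nbhs q.1) (nbhs q.2.1)); first exact: cvg_fst.
    by apply: (@cvg_comp _ _ _ snd fst); [exact: cvg_snd|exact: cvg_fst].
  by apply: (@cvg_comp _ _ _ snd snd); exact: cvg_snd.
apply: ccont_eq (ccont_cint a b (g := fun t q => pds s (Phi t q.1) q.2) c) _ => q.
by have [_ ->] := partials_cint_smooth ab (sf q.1).
Qed.

(** The increment of $\partial_d f$ along [e] is, by differentiation under the integral sign, the
    integral of $\partial_d\partial_e f$; differentiating in the upper endpoint gives the
    symmetry. *)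
Lemma partialC f d e z : smooth_on setT f ->
  pd d (pd e f) z = pd e (pd d f) z.
Proof.
move=> sf.
have sd := smooth_on_partial d sf; have se := smooth_on_partial e sf.
have ce : ccont (pd e f) by exact: smooth_ccont.
have cde : ccont (pd d (pd e f)).
  by apply: smooth_ccont; exact: smooth_on_partial.
have cmv u : continuous (fun q : R * R => mv (mv u e q.1) d q.2).
  move=> q; apply: (@continuous_comp _ _ _ (fun q : R * R => (q.2, mv u e q.1))
    (fun q : R * Cn => mv q.2 d q.1)); last exact: continuous_mv.
  apply: (@cvg_pair _ _ _ _ (nbhs q.2) (nbhs (mv u e q.1))); first exact: cvg_snd.
  apply: (@continuous_comp _ _ _ (fun q : R * R => q.1) (mv u e)); first exact: cvg_fst.
  exact: continuous_mv_t.
(* The lower endpoint -1 only has to lie below every upper endpoint [b] near 0. *)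
have key (b : R) : -1 <= b ->
    pd d f (mv z e b) - pd d f (mv z e (-1)) =
    cint (-1) b (fun t => pd d (pd e f) (mv z e t)).
  move=> b1.
  have H := @cint_diff R (-1) b (fun t s => pd e f (mv (mv z e t) d s))
    (fun t s => pd d (pd e f) (mv (mv z e t) d s)) 0 b1 _ _ _.
  have {H} : cderiv (fun s => f (mv (mv z d s) e b) - f (mv (mv z d s) e (-1))) 0
      (cint (-1) b (fun t => pd d (pd e f) (mv z e t))).
    have E0 : (fun t => pd d (pd e f) (mv (mv z e t) d 0)) =
        (fun t => pd d (pd e f) (mv z e t)) by apply/funext => t; rewrite mv0.
    rewrite E0 in H.
    have -> : (fun s => f (mv (mv z d s) e b) - f (mv (mv z d s) e (-1))) =
       fun s => cint (-1) b (fun t => pd e f (mv (mv z e t) d s)).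
      apply/funext => s; apply/esym.
      have cc : ccont (fun t => pd e f (mv (mv z e t) d s)).
        by apply: ccont_comp ce _ => t; apply: (@continuous_comp _ _ _ (mv z e)
          (fun z => mv z d s)); [exact: continuous_mv_t|exact: continuous_mv_z].
      rewrite (@cint_primitive _ _ _ _ (along f (mv z d s) e) cc); first by rewrite !alongE.
      by move=> t; rewrite mvC; exact: smooth_on_cderiv_line sf I.
    apply: H.
    - by move=> t s; exact: smooth_on_cderiv_mv se I.
    - move=> s; apply: ccont_comp ce _ => t; apply: (@continuous_comp _ _ _ (mv z e)
        (fun z => mv z d s)); [exact: continuous_mv_t|exact: continuous_mv_z].
    - by apply: ccont_comp cde _; exact: cmv.
  move=> H2; apply: cderiv_uniq H2; apply: cderivB.
    rewrite (_ : (fun s => _) = along f (mv z e b) d).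
      exact: smooth_on_cderiv sf I.
    by rewrite along_fun; apply/funext => s; rewrite mvC.
  rewrite (_ : (fun s => _) = along f (mv z e (-1)) d).
    exact: smooth_on_cderiv sf I.
  by rewrite along_fun; apply/funext => s; rewrite mvC.
apply/esym; apply: partial_cderiv.
have c0 : ccont (fun t => pd d (pd e f) (mv z e t)).
  by apply: ccont_comp cde _; exact: continuous_mv_t.
have := cderivD (cint_deriv (-1) 0 c0) (cderiv_cst (pd d f (mv z e (-1))) 0).
rewrite mv0 addr0; apply: cderiv_near.
have : \forall t \near (0 : R), -1 < t.
  by apply: lt_nbhsr; rewrite ltrN10.
apply: filterS => t t1; rewrite -key ?ltW// subrK.
by rewrite alongE.
Qed.

(** Cubes for the sup norm of the $2n$ real coordinates: membership can be tested, and supports can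
    grow, in one coordinate at a time. *)
Definition Qb (r : R) : set Cn := [set z | forall d, `|crd d z| <= r].

Definition Qo (r : R) : set Cn := [set z | forall d, `|crd d z| < r].

Lemma Qo_Qb r : Qo r `<=` Qb r.
Proof. by move=> z h d; exact/ltW/h. Qed.

Lemma Qb_Qo r r' : r < r' -> Qb r `<=` Qo r'.
Proof. by move=> rr' z h d; exact: le_lt_trans (h d) rr'. Qed.

Lemma Qb_sub r r' : r <= r' -> Qb r `<=` Qb r'.
Proof. by move=> rr' z h d; exact: le_trans (h d) rr'. Qed.

Lemma open_crd d (A : set R) : open A -> open [set z | A (crd d z)].
Proof. by move=> oA; apply: open_comp => // z _; exact: continuous_crd. Qed.

Lemma open_Qo r : open (Qo r).
Proof.
rewrite openE => z zQ; have h d : \forall w \near z, `|crd d w| < r.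
  have oB : open [set x : R | `|x| < r].
    have -> : [set x : R | `|x| < r] = ball 0 r.
      by apply/seteqP; split=> x; rewrite /ball/= sub0r normrN.
    exact: ball_open.
  have := @open_crd d _ oB; rewrite openE; apply; exact: zQ.
have H : \forall w \near z, forall d, `|crd d w| < r by exact: (@filter_forall _ _ (fun d w => `|crd d w| < r) _ _ h).
exact: H.
Qed.

Lemma compact_Qb r : compact (Qb r).
Proof.
have cK : compact [set w : C | `|Re w| <= r /\ `|Im w| <= r].
  have -> : [set w : C | `|Re w| <= r /\ `|Im w| <= r] =
      (fun q : R * R => q.1 +i* q.2) @` (`[- r, r] `*` `[- r, r]).
    apply/seteqP; split=> [w [h1 h2]|_ [[x y] [/= + + <-]]].
      exists (Re w, Im w); last by case: w {h1 h2}.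
      by split; rewrite /= in_itv/= -ler_norml.
    by rewrite !in_itv /= -!ler_norml.
  apply: continuous_compact; last by apply: compact_setX; exact: segment_compact.
  apply: continuous_subspaceT => q; apply/ccvgReIm; split; first exact: cvg_fst.
  exact: cvg_snd.
have -> : Qb r = [set z | forall j, [set w : C | `|Re w| <= r /\ `|Im w| <= r] (z ord0 j)].
  apply/seteqP; split=> [z h j|z h [j b]].
    by split; [exact: (h (j, false))|exact: (h (j, true))].
  by have [h1 h2] := h j; case: b.
exact: (@rV_compact C n (fun=> [set w : C | `|Re w| <= r /\ `|Im w| <= r]) (fun=> cK)).
Qed.

Lemma Qo0 r : 0 < r -> Qo r 0.
Proof. by move=> r0 d; rewrite /crd mxE; case: d.2; rewrite normr0. Qed.

Lemma nbhs0_Qb (U : set Cn) : nbhs (0 : Cn) U -> exists r : R, 0 < r /\ Qb r `<=` U.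
Proof.
move=> /nbhs_ballP[[e e']]; rewrite /= ltcE/= => /andP[/eqP e'0 e0] eU.
exists (e / 4); split; first by rewrite divr_gt0.
move=> z zQ; apply: eU; split; first by rewrite ltcE/= e'0 eqxx.
move=> i j; rewrite /ball/= mxE sub0r normrN normc_norm ltcE/= e'0 eqxx /=.
rewrite (ord1 i) (le_lt_trans (normc_le_ReIm _))//.
have h1 := zQ (j, false); have h2 := zQ (j, true); rewrite /crd /= in h1 h2.
lra.
Qed.

Lemma nbhs_Qo (r : R) : 0 < r -> nbhs (0 : Cn) (Qo r).
Proof. by move=> r0; apply: open_nbhs_nbhs; split; [exact: open_Qo|exact: Qo0]. Qed.

(** The integration variables are displacements from [z]; this makes partial integrals functions on
    all of [Cn] again and allows recursion on [s]. *)
Fixpoint bint (A : R) (s : seq dir) f z : C :=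
  if s is d :: s' then cint (- A) A (fun t => bint A s' f (mv z d t)) else f z.

Lemma ccont_bint A s f : ccont f -> ccont (bint A s f).
Proof.
move=> cf; elim: s => //= d s ih.
apply: (ccont_cint (- A) A (g := fun t z => bint A s f (mv z d t))).
by apply: (ccont_comp ih); exact: continuous_mv.
Qed.

Lemma ccont_bint_mv A s f z d : ccont f -> ccont (fun t => bint A s f (mv z d t)).
Proof. by move=> cf; apply: (ccont_comp (ccont_bint A s cf)); exact: continuous_mv_t. Qed.

Lemma bint_cat A s t f z : bint A (s ++ t) f z = bint A s (bint A t f) z.
Proof. by elim: s z => //= d s ih z; apply: cint_eq => u. Qed.

Lemma bintD A s f g z : ccont f -> ccont g ->
  bint A s (fun z => f z + g z) z = bint A s f z + bint A s g z.
Proof.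
move=> cf cg; elim: s z => //= d s ih z.
by rewrite -cintD; [apply: cint_eq => t|exact: ccont_bint_mv|exact: ccont_bint_mv].
Qed.

Lemma bintZ A s f c z : ccont f ->
  bint A s (fun z => c * f z) z = c * bint A s f z.
Proof.
move=> cf; elim: s z => //= d s ih z.
by rewrite -cintZ; [apply: cint_eq => t|exact: ccont_bint_mv].
Qed.

(** For [uniq s], the points at which [bint A s f z] evaluates [f]. *)
Definition reach A (s : seq dir) z w :=
  (forall e, e \notin s -> crd e w = crd e z) /\
  (forall e, e \in s -> `|crd e w - crd e z| <= A).

Lemma reach_cons A d s z t w : - A <= t <= A -> d \notin s -> reach A s (mv z d t) w ->
  reach A (d :: s) z w.
Proof.
move=> tA ds [h1 h2]; split=> e.
  rewrite inE negb_or => /andP[ed es]; rewrite h1// crd_mv (negPf ed) addr0//.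
rewrite inE => /orP[/eqP ->|es].
  by rewrite h1// crd_mv eqxx addrC addKr ler_norml.
have := h2 e es; rewrite crd_mv; case: eqP => [E|_]; last by rewrite addr0.
by rewrite -E es in ds.
Qed.

Lemma bint0 A s z : bint A s (fun=> 0) z = 0.
Proof.
elim: s z => //= d s ih z; rewrite (@cint_eq _ _ _ _ (fun=> 0)); first by rewrite cint_cst mul0r.
by move=> t; exact: ih.
Qed.

Lemma bint_ext A s f g z : 0 <= A -> uniq s -> ccont f -> ccont g ->
  (forall w, reach A s z w -> f w = g w) -> bint A s f z = bint A s g z.
Proof.
move=> A0 us cf cg; elim: s us z => /= [_ z h|d s ih /andP[ds us] z h].
  by apply: h; split.
apply: cint_eq_in; [by rewrite ge0_cp|exact: ccont_bint_mv|exact: ccont_bint_mv|].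
move=> t tA; apply: ih => // w hw; apply: h; exact: reach_cons hw.
Qed.

Lemma bint_bound A s f z (M : R) : 0 <= A -> uniq s -> ccont f ->
  (forall w, reach A s z w -> normc (f w) <= M) ->
  normc (bint A s f z) <= (4 * A) ^+ size s * M.
Proof.
move=> A0 us cf; elim: s us z => /= [_ z h|d s ih /andP[ds us] z h].
  by rewrite mul1r; apply: h; split.
have AA : - A <= A by rewrite ge0_cp.
apply: le_trans (cint_bound AA (ccont_bint_mv A s z d cf) (M := (4 * A) ^+ size s * M) _) _.
  by move=> t tA; apply: ih => // w hw; apply: h; exact: reach_cons hw.
by rewrite opprK exprS le_eqVlt; apply/orP; left; apply/eqP; ring.
Qed.

(** As the base point has coordinate 0 in the listed directions, a displacement beyond [A] leaves
    the support, and the integral over each line is one over $[-A,A]$. *)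
Lemma iterated_integralE A s f z : 0 < A -> uniq s -> ccont f -> supported_in (Qb A) f ->
  (forall d, d \in s -> crd d z = 0) -> iterated_integral s f z = bint A s f z.
Proof.
move=> A0 us cf fA; elim: s us z => //= d s ih /andP[ds us] z z0.
have E t : along (iterated_integral s f) z d t = bint A s f (mv z d t).
  rewrite alongE ih// => e es; rewrite crd_mv z0 ?inE ?es ?orbT//.
  by case: eqP => [E|_]; rewrite ?addr0//; rewrite -E es in ds.
have -> : along (iterated_integral s f) z d = fun t => bint A s f (mv z d t).
  exact/funext.
apply: integral1_cint => //; first exact: ccont_bint_mv.
move=> t tA; rewrite (@bint_ext _ _ _ (fun=> 0)) ?ltW//; first last.
- move=> w [h _]; apply: fA => /(_ d); rewrite h// crd_mv z0 ?mem_head// eqxx add0r.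
  by rewrite leNgt tA.
- exact: ccont_cst.
- exact: bint0.
Qed.

Lemma bint_swap A d e s f z : 0 <= A -> ccont f ->
  bint A (d :: e :: s) f z = bint A (e :: d :: s) f z.
Proof.
move=> A0 cf /=; have AA : - A <= A by rewrite ge0_cp.
have cg : ccont (fun q : R * R => bint A s f (mv (mv z d q.1) e q.2)).
  apply: (ccont_comp (ccont_bint A s cf)) => q.
  apply: (@continuous_comp _ _ _ (fun q : R * R => (q.2, mv z d q.1))
    (fun q : R * Cn => mv q.2 e q.1)); last exact: continuous_mv.
  apply: (@cvg_pair _ _ _ _ (nbhs q.2) (nbhs (mv z d q.1))); first exact: cvg_snd.
  apply: (@continuous_comp _ _ _ (fun q : R * R => q.1) (mv z d)); first exact: cvg_fst.
  exact: continuous_mv_t.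
have := @cint_fubini R (- A) A _ _ (fun x y => bint A s f (mv (mv z d x) e y)) AA cg.
move=> ->; apply: cint_eq => y; apply: cint_eq => x; rewrite mvC; reflexivity.
Qed.

Lemma bint_rcons A d s f z : 0 <= A -> ccont f ->
  bint A (d :: s) f z = bint A (rcons s d) f z.
Proof.
move=> A0 cf; elim: s z => // e s ih z.
rewrite bint_swap// rcons_cons; apply: cint_eq => t; exact: ih.
Qed.

Lemma bint_last A d s f z : 0 <= A -> ccont f -> d \in s ->
  bint A s f z = bint A (rem d s) (fun w => cint (- A) A (fun t => f (mv w d t))) z.
Proof.
move=> A0 cf; elim: s z => // e s ih z; rewrite inE /= eq_sym.
case: eqP => [-> _|_ /= ds].
  by rewrite -[LHS]/(bint A (d :: s) f z) bint_rcons// -cats1 bint_cat.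
by apply: cint_eq => t; exact: ih.
Qed.

Lemma integralCnE A f : 0 < A -> ccont f -> supported_in (Qb A) f ->
  integralCn f = bint A (enum {: dir}) f 0.
Proof.
move=> A0 cf fA; apply: iterated_integralE => //; first exact: enum_uniq.
by move=> d _; rewrite /crd !mxE; case: d.2.
Qed.

End Boxes.

(** * Bump functions *)

Section FlatExponential.
Context (R : realType).

(** Forced by $\frac{d}{dx}\bigl(P(1/x)e^{-1/x}\bigr)=x^{-2}(P-P')(1/x)\,e^{-1/x}$. *)
Fixpoint flat_poly (k : nat) : {poly R} :=
  if k is k'.+1 then 'X^2 * (flat_poly k' - (flat_poly k')^`()) else 1.

(* The k-th derivative of the function exp(-1/x) extended by 0 to x <= 0. *)
Definition flat_exp (k : nat) (x : R) : R :=
  if 0 < x then (flat_poly k).[x^-1] * expR (- x^-1) else 0.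

(** The factor $x^2$ gives derivative 0 at the origin; it comes from $e^y\ge y^{i+2}/(i+2)!$ for
    each monomial $y^i$, where $y=1/x$. *)
Lemma poly_exp_bound (P : {poly R}) : exists2 c : R, 0 < c &
  forall x : R, 0 < x -> `|P.[x^-1] * expR (- x^-1)| <= c * x ^+ 2.
Proof.
exists (1 + \sum_(i < size P) `|P`_i| * (i.+2)`!%:R).
  by rewrite ltr_pwDl// sumr_ge0// => i _; rewrite mulr_ge0.
move=> x x0; have y0 : 0 < x^-1 by rewrite invr_gt0.
rewrite normrM (ger0_norm (expR_ge0 _)) horner_coef expRN.
rewrite ler_pdivrMr ?expR_gt0//.
apply: le_trans (ler_norm_sum _ _ _) _.
have h (i : 'I_(size P)) : `|P`_i * x^-1 ^+ i| <=
    `|P`_i| * (i.+2)`!%:R * (x ^+ 2 * expR x^-1).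
  rewrite normrM -mulrA ler_wpM2l// (ger0_norm (exprn_ge0 _ (ltW y0))).
  have := expR_ge1Dxn i.+1 (ltW y0) => h.
  have {}h : x^-1 ^+ i.+2 <= i.+2`!%:R * expR x^-1.
    rewrite -ler_pdivrMl ?ltr0n ?fact_gt0// mulrC; apply: le_trans h.
    by rewrite lerDr.
  rewrite mulrCA; have -> : x^-1 ^+ i = x ^+ 2 * x^-1 ^+ i.+2.
    by rewrite !exprS; field; rewrite gt_eqF.
  by rewrite ler_wpM2l// exprn_ge0// ltW.
apply: le_trans (ler_sum _ (fun i _ => h i)) _.
by rewrite -mulr_suml mulrA ler_wpM2r ?expR_ge0// ler_wpM2r ?(exprn_ge0 _ (ltW x0))// lerDr.
Qed.

Lemma flat_exp_deriv (k : nat) (x : R) :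
  is_derive x (1 : R) (flat_exp k) (flat_exp k.+1 x).
Proof.
have [x0|x0|<-] := ltgtP 0 x.
- have x00 : x != 0 by rewrite gt_eqF.
  have e1 : is_derive x (1 : R) (fun y : R => y^-1) (- x ^- 2).
    have := @is_deriveV R id x 1 1 x00 (is_derive_id x 1).
    by rewrite /GRing.scale /= mulr1.
  have e2 := @is_derive1_comp R expR (fun y => - y^-1) x _ _
    (is_derive_expR (- x^-1)) (is_deriveN e1).
  have e3 := @is_derive1_comp R (horner (flat_poly k)) (fun y => y^-1) x _ _
    (is_derive_poly (flat_poly k) x^-1) e1.
  have e4 := is_deriveM e3 e2.
  apply: (@near_eq_is_derive _ _ _ _ _ _ _ _ _ (is_derive_ext e4 _ _)).
  + by near=> y; rewrite /flat_exp ifT//; near: y; exact: lt_nbhsr.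
  + by [].
  + rewrite /flat_exp x0 /= hornerM hornerXn hornerD hornerN /GRing.scale /=.
    by field.
- apply: (@near_eq_is_derive _ _ _ (fun=> 0)).
    near=> y; rewrite /flat_exp ifF//; apply/negbTE; rewrite -leNgt ltW//.
    by near: y; exact: lt_nbhsl.
  by rewrite /flat_exp ltNge ltW//=; exact: is_derive_cst.
- have -> : flat_exp k.+1 0 = 0 by rewrite /flat_exp ltxx.
  have [c c0 hc] := poly_exp_bound (flat_poly k).
  apply: is_derive_lim => e e0.
  have ec : 0 < e / c by rewrite divr_gt0.
  near=> h; rewrite add0r mulr0 subr0 {2}/flat_exp ltxx subr0 /flat_exp.
  have [h0|h0] := ltP 0 h; last by rewrite normr0 mulr_ge0// ltW.
  apply: le_trans (hc h h0) _; rewrite expr2 mulrA (ger0_norm (ltW h0)) ler_wpM2r ?(ltW h0)//.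
  rewrite mulrC -ler_pdivlMr//; apply: ltW.
  by near: h; exact: lt_nbhsl.
Unshelve. all: by end_near. Qed.

Lemma flat_exp_gt0 x : 0 < x -> 0 < flat_exp 0 x.
Proof. by move=> x0; rewrite /flat_exp x0 hornerC mul1r expR_gt0. Qed.

Lemma flat_exp_le0 k x : x <= 0 -> flat_exp k x = 0.
Proof. by move=> x0; rewrite /flat_exp ltNge x0. Qed.

Lemma flat_exp_ge0 x : 0 <= flat_exp 0 x.
Proof. by have [/flat_exp_le0 ->//|/flat_exp_gt0 /ltW] := leP x 0. Qed.

End FlatExponential.

Lemma continuous_affine (R : realType) (T : topologicalType) (g : T -> R) (a s : R) :
  continuous g -> continuous (fun x => a + s * g x).
Proof.
move=> cg x; apply: cvgD; first exact: cvg_cst.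
by apply: cvgM; [exact: cvg_cst|exact: cg].
Qed.

Section CoordinateFunctions.
Context (R : realType) (n : nat).
Local Notation C := R[i].
Local Notation Cn := 'rV[C]_n.
Local Notation dir := ('I_n * bool)%type.
Implicit Types (f g : Cn -> C) (z : Cn) (d : dir).

Lemma smooth_on_affine f (c : dir -> C) : ccont f ->
  (forall z d t, f (mv z d t) = f z + t%:C * c d) -> smooth_on setT f.
Proof.
move=> cf fE; apply: (@smooth_on_coind _ _ _ (fun g => g = f \/ exists k, g = fun=> k)).
- exact: openT.
- move=> _ [->|[k ->]] z _; apply: ccont_atW => //; exact: ccont_cst.
- move=> _ d [->|[k ->]]; last first.
    exists (fun=> 0); split; first by right; exists 0.
    by move=> z _; rewrite along_fun; exact: cderiv_cst.
  exists (fun=> c d); split; first by right; exists (c d).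
  move=> z _; rewrite along_fun (_ : (fun t => _) = fun t => f z + t%:C * c d); last exact/funext.
  rewrite -[X in cderiv _ _ X]add0r; apply: cderivD; first exact: cderiv_cst.
  have := cderivM (cderiv_real (is_derive_id (0 : R) 1)) (cderiv_cst (c d) 0).
  by rewrite mul1r mulr0 addr0.
- by left.
Qed.

Lemma partial_affine f (c : dir -> C) d z :
  (forall z d t, f (mv z d t) = f z + t%:C * c d) -> pd d f z = c d.
Proof.
move=> fE; apply: partial_cderiv.
rewrite along_fun (_ : (fun t => _) = fun t => f z + t%:C * c d); last exact/funext.
rewrite -[X in cderiv _ _ X]add0r; apply: cderivD; first exact: cderiv_cst.
have := cderivM (cderiv_real (is_derive_id (0 : R) 1)) (cderiv_cst (c d) 0).
by rewrite mul1r mulr0 addr0.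
Qed.

Lemma coord_mv (j : 'I_n) z d t : (mv z d t) 0 j =
  z 0 j + t%:C * (if j == d.1 then (if d.2 then 'i else 1) else 0).
Proof. by rewrite mvE; case: eqP => _; case: d.2; rewrite ?mulr0 ?mulr1// mulrC. Qed.

Lemma conj_coord_mv (j : 'I_n) z d t : ((mv z d t) 0 j)^* =
  (z 0 j)^* + t%:C * (if j == d.1 then (if d.2 then - 'i else 1) else 0).
Proof.
rewrite coord_mv rmorphD rmorphM /= oppr0; congr (_ + _ * _).
by case: eqP => _; case: d.2; apply: eqC; rewrite /= ?oppr0.
Qed.

Lemma ccont_coord (j : 'I_n) : ccont (fun z : Cn => z 0 j).
Proof. by apply: continuous_coord => z; exact: cvg_id. Qed.

Lemma ccont_conj (T : topologicalType) (f : T -> C) : ccont f -> ccont (fun x => (f x)^*).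
Proof.
move=> [cf].
have h1 : ccont (fun x => (Re (f x))%:C).
  by apply: ccont_real => x; have /ccvgReIm[h _] := cf x; exact: h.
have h2 : ccont (fun x => (Im (f x))%:C).
  by apply: ccont_real => x; have /ccvgReIm[_ h] := cf x; exact: h.
apply: ccont_eq (ccontD h1 (ccontZ (- 'i) h2)) _ => x.
by case: (f x) => u v; apply: eqC; rewrite /= ?ReD ?ImD ?ReM ?ImM /=; ring.
Qed.

Lemma smooth_coord (j : 'I_n) : smooth_on setT (fun z : Cn => z 0 j).
Proof. exact: smooth_on_affine (ccont_coord j) (coord_mv j). Qed.

Lemma smooth_conj_coord (j : 'I_n) : smooth_on setT (fun z : Cn => (z 0 j)^*).
Proof. exact: smooth_on_affine (ccont_conj (ccont_coord j)) (conj_coord_mv j). Qed.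

Lemma smooth_real_coord (G : nat -> R -> R) (a s : R) d :
  (forall k (t : R), is_derive t (1 : R) (G k) (G k.+1 t)) ->
  smooth_on setT (fun z : Cn => (G 0%N (a + s * crd d z))%:C).
Proof.
move=> dG; have cG k : continuous (G k).
  move=> t; apply: differentiable_continuous; apply/derivable1_diffP.
  by have [] := dG k t.
apply: (@smooth_on_coind _ _ _ (fun f => exists (c : C) k,
    f = fun z => c * (G k (a + s * crd d z))%:C)).
- exact: openT.
- move=> _ [c [k ->]] z _; apply: ccont_atW; apply: ccontZ; apply: ccont_real.
  move=> w; apply: (@continuous_comp _ _ _ (fun w => a + s * crd d w) (G k)).
    exact: continuous_affine (@continuous_crd _ _ d) _.
  exact: cG.
- move=> _ e [c [k ->]].
  exists (fun z => c * (if d == e then s else 0)%:C * (G k.+1 (a + s * crd d z))%:C); split.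
    by exists (c * (if d == e then s else 0)%:C), k.+1.
  move=> z _; rewrite along_fun -mulrA; apply: cderivZ; rewrite -rmorphM; apply: cderiv_real.
  set s' := (if d == e then s else 0).
  have dl : is_derive (0 : R) (1 : R) (fun t : R => a + s * crd d z + s' * t) s'.
    have := is_deriveD (is_derive_cst (a + s * crd d z) (0 : R) 1)
      (is_deriveM (is_derive_cst s' (0 : R) 1) (is_derive_id (0 : R) 1)).
    move=> h; apply: is_derive_ext h _ _ => //.
    by rewrite /GRing.scale /= add0r mulr0 addr0 mulr1.
  have dGk := dG k (a + s * crd d z + s' * 0).
  have := @is_derive1_comp R (G k) (fun t : R => a + s * crd d z + s' * t) 0 _ _ dGk dl.
  rewrite mulr0 addr0 [X in is_derive _ _ _ X]mulrC => h; apply: is_derive_ext h _ erefl => t; rewrite /comp crd_mv /s'.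
  by case: eqP => _; congr (G k _); ring.
- by exists 1, 0%N; apply/funext => z; rewrite mul1r.
Qed.

Lemma nbhs_cube z (U : set Cn) : nbhs z U ->
  exists r : R, 0 < r /\ forall w, (forall d, `|crd d w - crd d z| <= r) -> U w.
Proof.
move=> /nbhs_ballP[[e e']]; rewrite /= ltcE/= => /andP[/eqP e'0 e0] eU.
exists (e / 4); split; first by rewrite divr_gt0.
move=> w zQ; apply: eU; split; first by rewrite ltcE/= e'0 eqxx.
move=> i j; rewrite /ball/= -normrN opprB normc_norm ltcE/= e'0 eqxx /=.
rewrite (ord1 i) (le_lt_trans (normc_le_ReIm _))//.
have h1 := zQ (j, false); have h2 := zQ (j, true); rewrite /crd /= in h1 h2.
rewrite ReD ReN ImD ImN; lra.
Qed.

(** Product of two one-sided flat exponentials, positive exactly for $|x-c|<r$; the arguments have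
    the affine form that [smooth_real_coord] expects. *)
Definition bump (c r : R) d z : C :=
  (flat_exp 0 ((r - c) + 1 * crd d z))%:C * (flat_exp 0 ((r + c) + (-1) * crd d z))%:C.

Lemma bumpE c r d z : bump c r d z =
  (flat_exp 0 (r + (crd d z - c)) * flat_exp 0 (r - (crd d z - c)))%:C.
Proof. by rewrite /bump rmorphM; congr ((flat_exp 0 _)%:C * (flat_exp 0 _)%:C); ring. Qed.

Lemma smooth_bump c r d : smooth_on setT (bump c r d).
Proof.
apply: smooth_onM; first exact: openT.
  by apply: (@smooth_real_coord (fun k => @flat_exp R k)); exact: flat_exp_deriv.
by apply: (@smooth_real_coord (fun k => @flat_exp R k)); exact: flat_exp_deriv.
Qed.

Lemma bump_ge0 c r d z : 0 <= Re (bump c r d z) /\ Im (bump c r d z) = 0.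
Proof. by rewrite bumpE; split => //=; rewrite mulr_ge0// flat_exp_ge0. Qed.

Lemma bump_gt0 c r d z : `|crd d z - c| < r -> 0 < Re (bump c r d z).
Proof.
by rewrite ltr_norml bumpE /= => /andP[h1 h2]; rewrite mulr_gt0// flat_exp_gt0//; lra.
Qed.

Lemma bump_eq0 c r d z : r <= `|crd d z - c| -> bump c r d z = 0.
Proof.
rewrite bumpE ler_normr => /orP[h|h].
  by rewrite (@flat_exp_le0 _ _ (r - _)) ?mulr0//; lra.
by rewrite (@flat_exp_le0 _ _ (r + _)) ?mul0r//; lra.
Qed.

Lemma cint_Re_ge0 (a b : R) (F : R -> C) : a <= b -> ccont F ->
  (forall t, a <= t <= b -> 0 <= Re (F t)) -> 0 <= Re (cint a b F).
Proof.
move=> ab cF F0; rewrite cint_def ReD ReN.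
have [||x] := @MVT_segment R (fun t => Re (cprim F t)) (fun t => Re (F t)) a b ab.
- by move=> x _; have [] := cprimP cF x.
- apply: derivable_within_continuous => x _.
  by have [[]] := cprimP cF x.
rewrite in_itv/= => xab ->.
by rewrite mulr_ge0 ?subr_ge0// F0.
Qed.

Lemma cint_Re_gt0 (a b t0 : R) (F : R -> C) : a < b -> ccont F ->
  (forall t, a <= t <= b -> 0 <= Re (F t)) -> a <= t0 <= b -> 0 < Re (F t0) ->
  0 < Re (cint a b F).
Proof.
move=> ab cF F0 /andP[at0 t0b] Ft0.
pose m := Re (F t0) / 2; have m0 : 0 < m by rewrite divr_gt0.
have [e e0 he] : exists2 e : R, 0 < e & forall t, `|t - t0| <= e -> m <= Re (F t).
  have /nbhs_ballP[e /= e0 he] := @ccont_near _ _ F t0 m cF m0.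
  exists (e / 2); first by rewrite divr_gt0.
  move=> t tt0; have : ball t0 e t.
    by rewrite /ball/= distrC (le_lt_trans tt0)// ltr_pdivrMr// ltr_pMr// ltr1n.
  move=> /he h; have := le_lt_trans (Re_le_normc _) h; rewrite ReD ReN ltr_norml => /andP[h1 _].
  by rewrite /m in h1 *; lra.
pose u := Num.max a (t0 - e); pose v := Num.min b (t0 + e).
have uv : u < v by rewrite /u /v gt_max !lt_min ab /=; apply/and3P; split; lra.
have au : a <= u by rewrite /u le_max lexx.
have vb : v <= b by rewrite /v ge_min lexx.
have ut0 : t0 - e <= u by rewrite /u le_max lexx orbT.
have vt0 : v <= t0 + e by rewrite /v ge_min lexx orbT.
rewrite (cint_cat u a b) (cint_cat v u b) !ReD.
have h1 : 0 <= Re (cint a u F).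
  by apply: cint_Re_ge0 => // t /andP[h h']; apply: F0; lra.
have h3 : 0 <= Re (cint v b F).
  by apply: cint_Re_ge0 => // t /andP[h h']; apply: F0; lra.
suff h2 : 0 < Re (cint u v F) by lra.
have := @cint_Re_ge0 u v (fun t => F t - m%:C) (ltW uv).
rewrite cintD//; [|exact: ccont_cst].
rewrite -[fun _ => - _]/(fun _ => - m%:C) cint_cst -rmorphN -rmorphM ReD /= mulNr subr_ge0 => h.
apply: (@lt_le_trans _ _ (m * (v - u))); first by rewrite mulr_gt0// subr_gt0.
apply: h; first by apply: ccontD => //; exact: ccont_cst.
by move=> t tuv; rewrite ReD subr_ge0; apply: he; rewrite ler_norml; lra.
Qed.

Lemma bint_Re_ge0 A (s : seq dir) f z : 0 <= A -> ccont f ->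
  (forall w, 0 <= Re (f w)) -> 0 <= Re (bint A s f z).
Proof.
move=> A0 cf f0; elim: s z => //= d s ih z; apply: cint_Re_ge0 => //.
  by rewrite ge0_cp.
exact: ccont_bint_mv.
Qed.

Lemma bint_Re_gt0 A (s : seq dir) f z w : 0 < A -> ccont f -> uniq s ->
  (forall w, 0 <= Re (f w)) -> reach A s z w -> 0 < Re (f w) -> 0 < Re (bint A s f z).
Proof.
move=> A0 cf + f0; elim: s z => [|d s ih] z.
  move=> _ [h _] fw; rewrite /= (_ : z = w)//.
  by apply: crdP => e; rewrite h.
move=> /= /andP[ds us] [h1 h2] fw.
pose t0 := crd d w - crd d z.
have t0A : - A <= t0 <= A by rewrite -ler_norml; apply: h2; rewrite mem_head.
apply: (cint_Re_gt0 _ _ _ t0A).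
- by rewrite gtrN.
- exact: ccont_bint_mv.
- by move=> t _; apply: bint_Re_ge0 => //; exact: ltW.
- apply: ih => //; split=> e es.
    rewrite crd_mv; case: eqP => [->|ed]; first by rewrite /t0; lra.
    by rewrite addr0 h1// inE negb_or es andbT; exact/eqP.
  rewrite crd_mv; case: eqP => [E|_]; first by rewrite E in es; rewrite es in ds.
  by rewrite addr0 h2// inE es orbT.
Qed.

Lemma ccont_supp (f g : Cn -> C) (r r' : R) : r < r' -> (forall z, Qo r' z -> ccont_at f z) ->
  ccont g -> supported_in (Qb r) g -> ccont (fun z => f z * g z).
Proof.
move=> rr' cf cg gr; apply/ccont_atP => z.
have [Qz|Qz] := pselect (Qo r' z); first by apply: ccont_atM; [exact: cf|exact: ccont_atW].
apply: (@ccont_at_near _ _ (fun=> 0)); last by apply: ccont_atW; exact: ccont_cst.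
have oN : open (~` Qb r : set Cn).
  apply: closed_openC; apply: compact_closed; last exact: compact_Qb.
  exact: norm_hausdorff.
have : (~` Qb r : set Cn) z by move=> /(Qb_Qo rr').
move=> Nz; have : nbhs z (~` Qb r : set Cn) by apply: open_nbhs_nbhs; split.
by apply: filterS => w /gr ->; rewrite mulr0.
Qed.

Lemma crdD d z w : crd d (z + w) = crd d z + crd d w.
Proof. by rewrite /crd !mxE; case: d.2; [exact: ImD|exact: ReD]. Qed.

Lemma crdB d z w : crd d (z - w) = crd d z - crd d w.
Proof. by rewrite -[in RHS](subrK w z) [in RHS]crdD addrK. Qed.

Lemma crd0 d : crd d (0 : Cn) = 0.
Proof. by rewrite /crd mxE; case: d.2. Qed.

Lemma compact_Qo (r : R) (K : set Cn) : 0 < r -> compact K -> K `<=` Qo r ->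
  exists r', [/\ 0 < r', r' < r & K `<=` Qb r'].
Proof.
move=> r0 /compact_near_coveringP cK KQ.
have /cK : forall z, K z -> \forall z' \near z & r' \near r^'-, (fun r' z => Qb r' z) r' z'.
  move=> z Kz; have h d : \forall q \near (z, r^'-), `|crd d q.1| <= q.2.
    pose c := (`|crd d z| + r) / 2.
    have zc : `|crd d z| < c by have := KQ z Kz d; rewrite /c; lra.
    have cr : c < r by have := KQ z Kz d; rewrite /c; lra.
    have oB : open [set x : R | `|x| < c].
      have -> : [set x : R | `|x| < c] = ball 0 c.
        by apply/seteqP; split=> x; rewrite /ball/= sub0r normrN.
      exact: ball_open.
    exists ([set w | `|crd d w| < c], [set x | c < x]) => /=.
      split; last exact: nbhs_left_gt.
      by have := @open_crd R n d _ oB; rewrite openE; apply.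
    by move=> q /= [h1 h2]; exact: ltW (lt_trans h1 h2).
  have H : \forall q \near (z, r^'-), forall d, `|crd d q.1| <= q.2.
    exact: (@filter_forall _ _ (fun d (q : Cn * R) => `|crd d q.1| <= q.2) _ _ h).
  exact: H.
move=> KF; have : \forall r' \near r^'-, [/\ 0 < r', r' < r & K `<=` Qb r'].
  near=> r'; split.
  - by near: r'; exact: nbhs_left_gt.
  - by near: r'; exact: nbhs_left_lt.
  - by near: r'; exact: KF.
by move=> /filter_ex[r' h]; exists r'.
Unshelve. all: by end_near. Qed.

Lemma continuous_rV_id m : continuous (fun z : 'rV[C]_m => z).
Proof. by move=> z; exact: cvg_id. Qed.

Lemma continuous_rV_cst (T : topologicalType) m (z : 'rV[C]_m) : continuous (fun _ : T => z).
Proof. by move=> x; exact: cvg_cst. Qed.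

Lemma continuous_rVD (T : topologicalType) m (f g : T -> 'rV[C]_m) :
  continuous f -> continuous g -> continuous (fun x => f x + g x).
Proof.
move=> cf cg; apply: continuous_rV => j.
apply: ccont_eq (ccontD (continuous_coord j cf) (continuous_coord j cg)) _ => x.
by rewrite mxE.
Qed.

Lemma continuous_rVB (T : topologicalType) m (f g : T -> 'rV[C]_m) :
  continuous f -> continuous g -> continuous (fun x => f x - g x).
Proof.
move=> cf cg; apply: continuous_rV => j.
apply: ccont_eq (ccontD (continuous_coord j cf) (ccontN (continuous_coord j cg))) _ => x.
by rewrite !mxE.
Qed.

Lemma ccont_at_lt (T : topologicalType) (f : T -> C) x (e : R) : ccont_at f x -> 0 < e ->
  \forall y \near x, normc (f x - f y) < e.
Proof. by move=> [cf]; move: e; apply/ccvgP; exact: cf. Qed.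

Lemma supported_in_mul (K : set Cn) f g : supported_in K g -> supported_in K (fun z => f z * g z).
Proof. by move=> h z /h ->; rewrite mulr0. Qed.

(** If $G(z_0)\ne0$, then $\overline{G(z_0)}\,G$ has positive real part near $z_0$, and so has its
    integral against a product of bumps supported there. *)
Lemma integral_test_eq0 (r : R) G : 0 < r -> (forall z, Qo r z -> ccont_at G z) ->
  (forall (r' : R) phi, 0 < r' -> r' < r -> smooth_on setT phi -> supported_in (Qb r') phi ->
     integralCn (fun z => G z * phi z) = 0) ->
  forall z, Qo r z -> G z = 0.
Proof.
move=> r0 cG hG z0 Qz0; apply/eqP; apply: contraT => Gz0.
pose k := (G z0)^*.
have kG0 : 0 < Re (k * G z0).
  rewrite /k; case: (G z0) Gz0 => x y xy /=; rewrite mulNr opprK -!expr2.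
  rewrite lt_neqAle addr_ge0 ?sqr_ge0// andbT eq_sym paddr_eq0 ?sqr_ge0// !sqrf_eq0.
  by apply: contra xy => /andP[/eqP -> /eqP ->].
have ckG : ccont_at (fun z => k * G z) z0.
  by apply: ccont_atM; [apply: ccont_atW; exact: ccont_cst|exact: cG].
have near1 := ccont_at_lt ckG kG0.
have near2 : nbhs z0 (Qo r) by apply: open_nbhs_nbhs; split => //; exact: open_Qo.
have [e [e0 he]] := nbhs_cube (filterI near1 near2).
have heG w : (forall d, `|crd d w - crd d z0| <= e) -> 0 < Re (k * G w) /\ Qo r w.
  move=> /he[h Qw]; split=> //.
  have := le_lt_trans (Re_le_normc _) h; rewrite ReD ReN ltr_norml => /andP[_].
  by lra.
pose phi z := \prod_(d <- enum {: dir}) bump (crd d z0) e d z.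
have sphi : smooth_on setT phi.
  by apply: smooth_on_prod => [|d]; [exact: openT|exact: smooth_bump].
have phiRe z : 0 <= Re (phi z) /\ Im (phi z) = 0.
  rewrite /phi; elim/big_ind: _ => [|u v [u1 u2] [v1 v2]|d _]; first by split.
    by rewrite ReM ImM u2 v2 !mulr0 !mul0r subr0 addr0 mulr_ge0.
  exact: bump_ge0.
have phi0 w : (exists d, e <= `|crd d w - crd d z0|) -> phi w = 0.
  move=> [d hd]; apply/eqP; rewrite prodf_seq_eq0; apply/hasP; exists d => //.
    by rewrite mem_enum.
  by rewrite /= bump_eq0.
have phiz0 : 0 < Re (phi z0).
  have : 0 < Re (phi z0) /\ Im (phi z0) = 0.
    rewrite /phi; elim/big_ind: _ => [|u v [u1 u2] [v1 v2]|d _]; first by split.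
      by rewrite ReM ImM u2 v2 !mulr0 !mul0r subr0 addr0 mulr_gt0.
    by split; [apply: bump_gt0; rewrite subrr normr0|have [] := @bump_ge0 (crd d z0) e d z0].
  by case.
have [r' [r'0 r'r phir']] : exists r', [/\ 0 < r', r' < r & supported_in (Qb r') phi].
  pose K : set Cn := (fun w : Cn => (z0 + w : Cn)) @` (Qb e : set Cn).
  have cz0 : continuous (fun w : Cn => (z0 + w : Cn)).
    by apply: (@continuous_rVD Cn n (fun=> z0) id); [exact: continuous_rV_cst|exact: continuous_rV_id].
  have cK : compact K.
    apply: continuous_compact; last exact: compact_Qb.
    exact: continuous_subspaceT cz0.
  have KQ : K `<=` Qo r.
    move=> _ [w Qw <-]; apply: (heG _ _).2 => d.
    by rewrite crdD addrC addKr.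
  have [r' [r'0 r'r Kr']] := compact_Qo r0 cK KQ.
  exists r'; split=> // z Nz; apply: phi0; apply: contrapT => h.
  apply: Nz; apply: Kr'; exists (z - z0); last by rewrite addrC subrK.
  move=> d; rewrite crdB leNgt; apply/negP => hd.
  by apply: h; exists d; exact: ltW.
have cphi := smooth_ccont sphi.
have cGphi := ccont_supp r'r cG cphi phir'.
have := hG r' phi r'0 r'r sphi phir'.
rewrite (@integralCnE _ _ r)//; last first.
  apply: supported_in_mul => z Nz; apply: phir' => h; apply: Nz.
  exact: Qb_sub (ltW r'r) _ h.
move=> H; have := congr1 (fun x => k * x) H; rewrite mulr0 -bintZ// => /(congr1 (@complex.Re R)).
move=> H0; suff : 0 < Re (bint r (enum {: dir}) (fun z => k * (G z * phi z)) 0).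
  by rewrite H0 ltxx.
have cF : ccont (fun z => k * (G z * phi z)) by exact: ccontZ.
have FE z : Re (k * (G z * phi z)) = Re (k * G z) * Re (phi z).
  by rewrite mulrA ReM (phiRe z).2 mulr0 subr0.
apply: (bint_Re_gt0 r0 cF (enum_uniq _) _ (w := z0)).
- move=> w; rewrite FE.
  have [h|h] := pselect (forall d, `|crd d w - crd d z0| <= e).
    by rewrite mulr_ge0 ?(phiRe w).1// ltW// (heG _ h).1.
  rewrite phi0 ?mulr0//; apply: contrapT => h'; apply: h => d.
  by rewrite leNgt; apply/negP => hd; apply: h'; exists d; exact: ltW.
- split=> d; first by rewrite mem_enum.
  by rewrite crd0 subr0 => _; exact/ltW/Qz0.
- by rewrite FE mulr_gt0//.
Qed.

End CoordinateFunctions.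

(** * Test functions and distributions *)

Section CompactBounds.
Context (R : realType).
Local Notation C := R[i].

(** There are finitely many words of length at most [N] over a finite alphabet; this turns bounds on
    single derivatives into one bound on all derivatives of order at most [N]. *)
Lemma near_seqs (T : finType) (I : Type) (F : set_system I) (FF : Filter F)
    (Q : seq T -> I -> Prop) (N : nat) :
  (forall s, \forall i \near F, Q s i) ->
  \forall i \near F, forall s, (size s <= N)%N -> Q s i.
Proof.
elim: N Q => [|N ih] Q hQ.
  by apply: filterS (hQ [::]) => i Qi s; rewrite leqn0 => /nilP ->.
have h (d : T) : \forall i \near F, forall s, (size s <= N)%N -> Q (d :: s) i.
  by apply: ih => s; exact: hQ.
have H : \forall i \near F, forall d s, (size s <= N)%N -> Q (d :: s) i.
  exact: (@filter_forall _ _ (fun d i => forall s, (size s <= N)%N -> Q (d :: s) i) _ _ h).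
apply: filterS (filterI (hQ [::]) H) => i [Q0 Q1] [|d s] // sN.
exact: Q1.
Qed.

Lemma compact_bound (T : topologicalType) (K : set T) (f : T -> C) : compact K ->
  (forall z, K z -> ccont_at f z) -> \forall M \near +oo, forall z, K z -> normc (f z) <= M.
Proof.
move=> /compact_near_coveringP cK cf.
apply: (cK R (pinfty_nbhs R) (fun M z => normc (f z) <= M)) => z Kz.
have [A hA] : exists A : set T, nbhs z A /\ forall w, A w -> normc (f w) <= normc (f z) + 1.
  exists [set w | normc (f z - f w) < 1]; split; first exact: ccont_at_lt (cf z Kz) _.
  move=> w /= h; rewrite -(subrK (f z) (f w)) (le_trans (le_normcD _ _))// addrC lerD2l.
  by rewrite normcB ltW.
exists (A, [set M | normc (f z) + 1 < M]) => /=.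
  split; first exact: hA.1.
  by apply: nbhs_pinfty_gt; exact: num_real.
by move=> [w M] /= [/hA.2 h1 h2]; exact: le_trans h1 (ltW h2).
Qed.

End CompactBounds.

Section TestFunctions.
Context (R : realType) (n : nat).
Local Notation C := R[i].
Local Notation Cn := 'rV[C]_n.
Local Notation dir := ('I_n * bool)%type.
Implicit Types (f g h phi psi : Cn -> C) (z : Cn) (d : dir) (r : R) (u : functional R n).

Lemma smooth_on_setU (W1 W2 : set Cn) f : smooth_on W1 f -> smooth_on W2 f ->
  (forall z, W1 z \/ W2 z) -> smooth_on setT f.
Proof.
move=> [h1] [h2] W; constructor=> s z _.
by have [/h1|/h2] := W z; exact.
Qed.

Lemma open_notQb r : open (~` Qb r : set Cn).
Proof.
apply: closed_openC; apply: compact_closed; last exact: compact_Qb.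
exact: norm_hausdorff.
Qed.

Lemma partials_notin (W : set Cn) f s z : open W -> (forall w, W w -> f w = 0) -> W z ->
  pds s f z = 0.
Proof.
move=> oW f0 Wz; rewrite (@partials_eq_on _ _ W _ (fun=> 0) s oW)//.
elim: s {Wz} z => // d s ih z /=.
have -> : pds s (fun _ : Cn => 0 : C) = fun=> 0 by apply/funext.
exact: partial_cst.
Qed.

Definition tst r phi := smooth_on setT phi /\ supported_in (Qb r) phi.

Lemma tst_partials_out r phi s z : tst r phi -> ~ Qb r z -> pds s phi z = 0.
Proof. by move=> [_ h] Nz; apply: (@partials_notin (~` Qb r)) => //; exact: open_notQb. Qed.

Lemma tstD r phi psi : tst r phi -> tst r psi -> tst r (fun z => phi z + psi z).
Proof.
move=> [s1 h1] [s2 h2]; split; first by apply: smooth_onD => //; exact: openT.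
by move=> z Nz; rewrite h1// h2// addr0.
Qed.

Lemma tstZ r c phi : tst r phi -> tst r (fun z => c * phi z).
Proof.
move=> [s1 h1]; split; first by apply: smooth_onZ => //; exact: openT.
by move=> z Nz; rewrite h1// mulr0.
Qed.

Lemma tst0 r : tst r (fun=> 0).
Proof. by split => //; apply: smooth_on_cst; exact: openT. Qed.

Lemma tstW r r' phi : r <= r' -> tst r phi -> tst r' phi.
Proof. by move=> rr' [s1 h1]; split => // z Nz; apply: h1 => /(Qb_sub rr'). Qed.

Lemma tst_mul r r' h phi : r < r' -> smooth_on (Qo r') h -> tst r phi ->
  tst r (fun z => h z * phi z).
Proof.
move=> rr' sh [sphi phi0]; split; last exact: supported_in_mul.
apply: (@smooth_on_setU (Qo r') (~` Qb r)).
- by apply: smooth_onM => //; [exact: open_Qo|exact: smooth_onW sphi].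
- apply: (@smooth_on_eq _ _ _ (fun=> 0)); first exact: open_notQb.
    by move=> z /phi0 ->; rewrite mulr0.
  by apply: smooth_on_cst; exact: open_notQb.
- move=> z; have [/(Qb_Qo rr')|] := pselect (Qb r z); first by left.
  by right.
Qed.

Lemma partialsD (W : set Cn) f g s z : open W -> smooth_on W f -> smooth_on W g -> W z ->
  pds s (fun z => f z + g z) z = pds s f z + pds s g z.
Proof.
move=> oW sf sg; elim: s z => // d s ih z Wz /=.
rewrite (partial_eq_on d oW ih Wz) (partialD d _ _ Wz)//; exact: smooth_on_partials.
Qed.

Lemma partialsZ (W : set Cn) c f s z : open W -> smooth_on W f -> W z ->
  pds s (fun z => c * f z) z = c * pds s f z.
Proof.
move=> oW sf; elim: s z => // d s ih z Wz /=.
rewrite (partial_eq_on d oW ih Wz) (partialZ c d _ Wz)//; exact: smooth_on_partials.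
Qed.

(** Each differentiation doubles the number of Leibniz terms, whence the power of 2. *)
Lemma partialsM_bound (W : set Cn) f g s z (H B : R) : open W -> smooth_on W f ->
  smooth_on W g -> W z ->
  (forall t, (size t <= size s)%N -> normc (pds t f z) <= H) ->
  (forall t, (size t <= size s)%N -> normc (pds t g z) <= B) ->
  normc (pds s (fun z => f z * g z) z) <= 2 ^+ size s * (H * B).
Proof.
move=> oW; elim/last_ind: s f g => [|s d ih] f g sf sg Wz hf hg.
  rewrite mul1r normcM ler_pM ?normc_ge0//; [exact: (hf [::])|exact: (hg [::])].
rewrite partials_rcons size_rcons in hf hg *.
have sdf := smooth_on_partial d sf; have sdg := smooth_on_partial d sg.
have E w : W w -> pd d (fun z => f z * g z) w = pd d f w * g w + f w * pd d g w.
  by move=> Ww; rewrite (partialM d sf sg Ww).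
rewrite (partials_eq_on s oW E Wz).
rewrite (partialsD s oW (smooth_onM oW sdf sg) (smooth_onM oW sf sdg) Wz).
rewrite (le_trans (le_normcD _ _))// exprS -mulrA mulr_natl mulr2n lerD//.
  apply: ih => // t ts; last by apply: hg; exact: leqW.
  by rewrite -partials_rcons hf// size_rcons ltnS.
apply: ih => // t ts; first by apply: hf; exact: leqW.
by rewrite -partials_rcons hg// size_rcons ltnS.
Qed.

Definition sbound (N : nat) phi (B : R) :=
  forall s z, (size s <= N)%N -> normc (pds s phi z) <= B.

Lemma sbound_ge0 N phi B : sbound N phi B -> 0 <= B.
Proof. by move=> h; apply: le_trans (normc_ge0 _) (h [::] 0 _). Qed.

Lemma sboundW N N' phi B : (N' <= N)%N -> sbound N phi B -> sbound N' phi B.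
Proof. by move=> NN' h s z sN; apply: h; exact: leq_trans NN'. Qed.

Lemma tst_sbound r N phi : tst r phi -> exists B, sbound N phi B.
Proof.
move=> tphi.
have : \forall M \near +oo, forall s, (size s <= N)%N -> forall z, Qb r z ->
    normc (pds s phi z) <= M.
  apply: near_seqs => s; apply: compact_bound; first exact: compact_Qb.
  by move=> z _; apply: smooth_on_cont (smooth_on_partials s tphi.1) I.
move=> /(filterI (nbhs_pinfty_ge (num_real 0))) /filter_ex[M [M0 hM]].
exists M => s z sN; have [Qz|Qz] := pselect (Qb r z); first exact: hM.
by rewrite (tst_partials_out _ tphi)// normc0.
Qed.

Lemma tst_mul_bound r r' h N : r < r' -> smooth_on (Qo r') h -> exists c : R, 0 <= c /\
  forall phi B, tst r phi -> sbound N phi B -> sbound N (fun z => h z * phi z) (c * B).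
Proof.
move=> rr' sh.
have : \forall M \near +oo, forall s, (size s <= N)%N -> forall z, Qb r z ->
    normc (pds s h z) <= M.
  apply: near_seqs => s; apply: compact_bound; first exact: compact_Qb.
  by move=> z /(Qb_Qo rr'); exact: smooth_on_cont (smooth_on_partials s sh).
move=> /(filterI (nbhs_pinfty_ge (num_real 0))) /filter_ex[M [M0 hM]].
exists (2 ^+ N * M); split; first by rewrite mulr_ge0// exprn_ge0.
move=> phi B tphi hB s z sN; have B0 := sbound_ge0 hB.
have thphi := tst_mul rr' sh tphi.
have [Qz|Qz] := pselect (Qb r z); last first.
  by rewrite (tst_partials_out _ thphi)// normc0 !mulr_ge0// exprn_ge0.
have := @partialsM_bound (Qo r') h phi s z M B (@open_Qo _ _ _) sh (smooth_onW _ tphi.1) (Qb_Qo rr' Qz).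
move=> /(_ (@subsetT _ _)).
move=> /(_ (fun t ts => hM t (leq_trans ts sN) z Qz)) /(_ (fun t ts => hB t z (leq_trans ts sN))).
move=> /le_trans; apply => //.
rewrite mulrA ler_wpM2r// ler_wpM2r// ler_weXn2l// ler1n//.
Qed.

(** A distribution is used only through its restriction to test functions supported in one fixed
    closed cube, where it has finite order; values on other functions are left arbitrary. *)
Variant dist r u : Prop := Dist of
  (forall c phi psi, tst r phi -> tst r psi ->
     u (fun z => c * phi z + psi z) = c * u phi + u psi) &
  (exists N (M : R), 0 <= M /\ forall phi B, tst r phi -> sbound N phi B -> normc (u phi) <= M * B).

Lemma distP r u c phi psi : dist r u -> tst r phi -> tst r psi ->
  u (fun z => c * phi z + psi z) = c * u phi + u psi.
Proof. by case=> h _; exact: h. Qed.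

Lemma dist_eq u phi psi : phi =1 psi -> u phi = u psi.
Proof. by move=> /funext ->. Qed.

Lemma dist0 r u : dist r u -> u (fun=> 0) = 0.
Proof.
move=> du; have h := distP (-1) du (tst0 r) (tst0 r).
have : u (fun=> 0) = -1 * u (fun=> 0) + u (fun=> 0).
  by rewrite -h; apply: dist_eq => z; rewrite mulr0 addr0.
by rewrite mulN1r addNr.
Qed.

Lemma distD r u phi psi : dist r u -> tst r phi -> tst r psi ->
  u (fun z => phi z + psi z) = u phi + u psi.
Proof.
move=> du t1 t2; have := distP 1 du t1 t2; rewrite mul1r => <-.
by apply: dist_eq => z; rewrite mul1r.
Qed.

Lemma distZ r u c phi : dist r u -> tst r phi -> u (fun z => c * phi z) = c * u phi.
Proof.
move=> du t1; have := distP c du t1 (tst0 r); rewrite (dist0 du) addr0 => <-.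
by apply: dist_eq => z; rewrite addr0.
Qed.

Lemma distW r r' u : r' <= r -> dist r u -> dist r' u.
Proof.
move=> r'r [h1 [N [M [M0 h2]]]]; constructor.
  by move=> c phi psi t1 t2; apply: h1; exact: tstW r'r _.
by exists N, M; split=> // phi B t1; apply: h2; exact: tstW r'r _.
Qed.

Lemma distribution_dist (U : set Cn) u r : Qb r `<=` U -> distribution_on U u -> dist r u.
Proof.
move=> QU [lin bnd]; have tU phi : tst r phi -> test_fun U phi.
  move=> [sphi phir]; split; first exact/smooth_onT.
  by exists (Qb r); split=> //; exact: compact_Qb.
constructor; first by move=> c phi psi t1 t2; apply: lin; exact: tU.
have [N [M h]] := bnd _ (@compact_Qb R n r) QU.
(* The constant provided by [distribution_on] may be negative. *)
exists N, (Num.max 0 M); split; first by rewrite le_max lexx.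
move=> phi B t1 hB; have B0 := sbound_ge0 hB.
have : `|u phi| <= (M * B)%:C.
  apply: h; [by apply/smooth_onT; exact: t1.1|exact: t1.2|].
  by move=> s z sN; rewrite -pdsE normc_norm lecR hB.
rewrite normc_norm lecR => /le_trans; apply.
by rewrite ler_wpM2r// le_max lexx orbT.
Qed.

Lemma dist_addZ r u v c : dist r u -> dist r v -> dist r (fun phi => c * u phi + v phi).
Proof.
move=> du dv; have [_ [N [M [M0 h]]]] := du; have [_ [N' [M' [M'0 h']]]] := dv.
constructor.
  by move=> k phi psi t1 t2; rewrite !(distP _ du t1 t2) !(distP _ dv t1 t2); ring.
exists (maxn N N'), (normc c * M + M'); split; first by rewrite addr_ge0// mulr_ge0// normc_ge0.
move=> phi B t1 hB; rewrite (le_trans (le_normcD _ _))// mulrDl lerD//.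
  rewrite normcM -mulrA ler_wpM2l ?normc_ge0//; apply: h => //.
  by apply: sboundW hB; exact: leq_maxl.
by apply: h' => //; apply: sboundW hB; exact: leq_maxr.
Qed.

Lemma dist_zero r : dist r (fun=> 0).
Proof.
constructor; first by move=> c phi psi _ _; rewrite mulr0 addr0.
by exists 0%N, 0; split=> // phi B _ _; rewrite normc0 mul0r.
Qed.

Lemma distribZ r u c : dist r u -> dist r (fun phi => c * u phi).
Proof.
move=> du; have := dist_addZ c du (dist_zero r).
by congr (dist r _); apply/funext => phi; rewrite addr0.
Qed.

Lemma distribD r u v : dist r u -> dist r v -> dist r (fun phi => u phi + v phi).
Proof.
move=> du dv; have := dist_addZ 1 du dv.
by congr (dist r _); apply/funext => phi; rewrite mul1r.
Qed.

Lemma distribN r u : dist r u -> dist r (fun phi => - u phi).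
Proof.
move=> du; have := distribZ (-1) du.
by congr (dist r _); apply/funext => phi; rewrite mulN1r.
Qed.

Lemma distrib_sum r (I : Type) (s : seq I) (P : pred I) (F : I -> functional R n) :
  (forall i, P i -> dist r (F i)) -> dist r (fun phi => \sum_(i <- s | P i) F i phi).
Proof.
move=> dF; elim: s => [|i s ih].
  have -> : (fun phi => \sum_(i <- [::] | P i) F i phi) = fun=> 0.
    by apply/funext => phi; rewrite big_nil.
  exact: dist_zero.
have -> : (fun phi => \sum_(j <- i :: s | P j) F j phi) =
    fun phi => (if P i then F i phi else 0) + \sum_(j <- s | P j) F j phi.
  by apply/funext => phi; rewrite big_cons; case: ifP => _; rewrite ?add0r.
apply: distribD => //; case E : (P i); first exact: dF.
exact: dist_zero.
Qed.

(** Transposition: an operator on test functions that loses finitely many derivatives acts on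
    distributions. Multiplication, $\partial/\partial\bar z_j$ and the cut-off parametrix all enter
    this way. *)
Lemma dist_comp r r' u (T : (Cn -> C) -> Cn -> C) : dist r' u ->
  (forall phi, tst r phi -> tst r' (T phi)) ->
  (forall c phi psi, tst r phi -> tst r psi ->
     forall z, T (fun z => c * phi z + psi z) z = c * T phi z + T psi z) ->
  (forall N, exists N' (c : R), 0 <= c /\ forall phi B, tst r phi -> sbound N' phi B ->
     sbound N (T phi) (c * B)) ->
  dist r (fun phi => u (T phi)).
Proof.
move=> du tT lT bT; have [_ [N [M [M0 h]]]] := du; have [N' [c [c0 hc]]] := bT N.
constructor.
  move=> k phi psi t1 t2; rewrite -(distP _ du (tT _ t1) (tT _ t2)).
  by apply: dist_eq => z; exact: lT.
exists N', (M * c); split; first exact: mulr_ge0.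
by move=> phi B t1 hB; rewrite -mulrA; apply: h; [exact: tT|exact: hc].
Qed.

Lemma dist_mul r r' u h : r < r' -> smooth_on (Qo r') h -> dist r u ->
  dist r (fun phi => u (fun z => h z * phi z)).
Proof.
move=> rr' sh du; apply: (dist_comp (T := fun phi z => h z * phi z) du).
- by move=> phi; exact: (tst_mul rr').
- by move=> c phi psi _ _ z; ring.
- move=> N; have [c [c0 hc]] := tst_mul_bound N rr' sh; exists N, c; split=> //.
Qed.

(** Moving average of a bump of half-width [w] over a window of half-width [L], divided by its mass.
    With $L-w=a$ and $L+w=b$ the window contains the bump for $|x|\le a$ and misses it for $|x|\ge
    b$. The last clause, dependence on one coordinate only, yields cut-offs that commute with the
    other $\partial/\partial\bar z_k$. *)
Lemma plateau d (a b : R) : 0 < a -> a < b -> exists th : Cn -> C,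
  [/\ smooth_on setT th,
      forall z, `|crd d z| <= a -> th z = 1,
      forall z, b <= `|crd d z| -> th z = 0 &
      forall e z, e != d -> pd e th z = 0].
Proof.
move=> a0 ab; pose w := (b - a) / 2; pose L := (a + b) / 2.
have w0 : 0 < w by rewrite /w divr_gt0// subr_gt0.
have L0 : 0 < L by rewrite /L; lra.
pose g t : C := bump 0 w d (mv 0 d t).
have cg : ccont g by apply: (ccont_comp (smooth_ccont (smooth_bump 0 w d))); exact: continuous_mv_t.
have gE z t : bump 0 w d (mv z d t) = g (crd d z + t).
  by rewrite /g !bumpE !crd_mv !eqxx crd0 add0r.
have g0 t : w <= `|t| -> g t = 0.
  by move=> h; apply: bump_eq0; rewrite crd_mv eqxx crd0 add0r subr0.
pose m := cint (- w) w g.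
have m0 : m != 0.
  have : 0 < Re m.
    apply: (@cint_Re_gt0 R _ _ 0) => //.
    - by rewrite gtrN.
    - by move=> t _; have [] := bump_ge0 0 w d (mv 0 d t).
    - by rewrite oppr_le0 ltW//= ltW.
    - by apply: bump_gt0; rewrite mv0 crd0 subrr normr0.
  by apply: contraTneq => ->; rewrite ltxx.
have LL : - L <= L by rewrite ge0_cp// ltW.
have sf : sfam (fun t z => bump 0 w d (mv z d t)).
  have tr t := smooth_translate (@continuous_mv_z R n d t) (fun z e s => mvC z e d s t)
    (smooth_bump 0 w d).
  constructor=> [t|s]; first exact: (tr t).1.
  have c1 : ccont (pds s (@bump R n 0 w d)).
    by apply: smooth_ccont; apply: smooth_on_partials; exact: smooth_bump.
  by apply: ccont_eq (ccont_comp c1 (@continuous_mv R n d)) _ => q; rewrite (tr q.1).2.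
have [sint _] := partials_cint_smooth LL sf.
pose th z := m^-1 * cint (- L) L (fun t => bump 0 w d (mv z d t)).
have thE z : th z = m^-1 * cint (crd d z - L) (crd d z + L) g.
  rewrite /th (@cint_eq _ _ _ _ (fun t => g (crd d z + t))); last by move=> t; exact: gE.
  by rewrite cint_shift.
exists th; split.
- by apply: smooth_onZ => //; exact: openT.
- move=> z; rewrite ler_norml => /andP[za zb].
  rewrite thE (@cint_supp _ (- w) w)//; first by rewrite mulVf.
  + by rewrite /w /L; lra.
  + by rewrite ge0_cp// ltW.
  + by rewrite /w /L; lra.
  + by move=> t [tw|tw]; apply: g0; rewrite ler_normr; apply/orP; [right|left]; lra.
- move=> z zb; rewrite thE cint_eq0 ?mulr0//; first by lra.
  move=> t /andP[t1 t2]; apply: g0; move: zb; rewrite ler_normr => /orP[zb|zb];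
    rewrite ler_normr /w /L in t1 t2 *; apply/orP; [left|right]; lra.
- move=> e z ed; apply: partial_cderiv; rewrite along_fun.
  rewrite (_ : (fun t => _) = fun=> th z); first exact: cderiv_cst.
  by apply/funext => t; rewrite !thE crd_mv eq_sym (negPf ed) addr0.
Qed.

End TestFunctions.

Fact dz_key : unit. Proof. exact: tt. Qed.

Section Dzbar.
Context (R : realType) (n : nat).
Local Notation C := R[i].
Local Notation Cn := 'rV[C]_n.
Local Notation dir := ('I_n * bool)%type.
Implicit Types (f g h phi psi : Cn -> C) (z w : Cn) (d : dir) (j : 'I_n) (r : R).

Definition dz := locked_with dz_key (@dzbar R n).

Lemma dz_dzbar : dz = @dzbar R n.
Proof. by rewrite /dz unlock. Qed.

Lemma dzE j f z : dz j f z = (pd (j, false) f z + 'i * pd (j, true) f z) / 2.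
Proof. by rewrite dz_dzbar /dzbar -pdE. Qed.

Lemma dz_pd j f : dz j f = fun z => 2^-1 * (pd (j, false) f z + 'i * pd (j, true) f z).
Proof. by apply/funext => z; rewrite dzE mulrC. Qed.

Lemma dz_eq_on (W : set Cn) f g j : open W -> (forall z, W z -> f z = g z) ->
  forall z, W z -> dz j f z = dz j g z.
Proof. by move=> oW fg z Wz; rewrite !dzE !(partial_eq_on _ oW fg Wz). Qed.

Lemma dz_ext f g j : f =1 g -> dz j f = dz j g.
Proof. by move=> /funext ->. Qed.

Section OnW.
Context (W : set Cn).

Hypothesis oW : open W.

Lemma smooth_on_dz f j : smooth_on W f -> smooth_on W (dz j f).
Proof.
move=> sf; rewrite dz_pd.
apply: (smooth_onZ oW); apply: (smooth_onD oW); first exact: smooth_on_partial.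
by apply: (smooth_onZ oW); exact: smooth_on_partial.
Qed.

Lemma dzD f g j z : smooth_on W f -> smooth_on W g -> W z ->
  dz j (fun z => f z + g z) z = dz j f z + dz j g z.
Proof.
move=> sf sg Wz; rewrite !dzE !(partialD _ sf sg Wz).
by rewrite mulrDr addrACA mulrDl.
Qed.

Lemma dzZ c f j z : smooth_on W f -> W z ->
  dz j (fun z => c * f z) z = c * dz j f z.
Proof.
move=> sf Wz; rewrite !dzE !(partialZ _ _ sf Wz).
by rewrite mulrCA -mulrDr mulrA.
Qed.

Lemma dzM f g j z : smooth_on W f -> smooth_on W g -> W z ->
  dz j (fun z => f z * g z) z = dz j f z * g z + f z * dz j g z.
Proof.
move=> sf sg Wz; rewrite !dzE !(partialM _ sf sg Wz).
move: (pd _ f z) (pd _ f z) (pd _ g z) (pd _ g z) (f z) (g z) => a b c d k l.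
by rewrite [in LHS]mulrDr; ring.
Qed.

Lemma smooth_onX f m : smooth_on W f -> smooth_on W (fun z => f z ^+ m).
Proof.
move=> sf; elim: m => [|m ih]; first exact: smooth_on_cst.
by apply: (smooth_on_eq oW _ (smooth_onM oW sf ih)) => w _; rewrite exprS.
Qed.

Lemma dz_cst c j z : dz j (fun=> c) z = 0.
Proof. by rewrite dzE !partial_cst mulr0 addr0 mul0r. Qed.

Lemma dzX f (m : nat) j z : smooth_on W f -> W z ->
  dz j (fun z => f z ^+ m) z = m%:R * f z ^+ m.-1 * dz j f z.
Proof.
move=> sf Wz; elim: m => [|m ih].
  by rewrite mul0r mul0r; exact: dz_cst.
rewrite (@dz_eq_on W _ (fun z => f z * f z ^+ m) j oW _ z Wz); last by move=> w _; rewrite exprS.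
rewrite (dzM j sf (smooth_onX m sf) Wz) ih; move: (dz j f z) (f z) => a k.
case: m {ih} => [|m]; first by rewrite expr0 mulr1 !mul0r mulr0 addr0 mul1r mul1r.
by rewrite /= exprS -[m.+2%:R]natr1; ring.
Qed.

Lemma pdV f d z : smooth_on W f -> W z -> f z != 0 ->
  pd d (fun z => (f z)^-1) z = - pd d f z / f z ^+ 2.
Proof.
move=> sf Wz fz0; apply: partial_cderiv.
have := @cderivV _ (along f z d) 0 _ _ (smooth_on_cderiv d sf Wz).
rewrite {1}alongE mv0 => /(_ fz0); rewrite alongE mv0.
by rewrite /along.
Qed.

Lemma dzV f j z : smooth_on W f -> W z -> f z != 0 ->
  dz j (fun z => (f z)^-1) z = - dz j f z / f z ^+ 2.
Proof.
move=> sf Wz fz0; rewrite !dzE !(pdV _ sf Wz fz0).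
move: (pd _ f z) (pd _ f z) => a b.
by rewrite mulrA -mulrDl mulrN -opprD mulrAC mulNr.
Qed.

End OnW.

Lemma dz_coord j k z : dz j (fun w : Cn => w 0 k) z = 0.
Proof.
rewrite dzE !(partial_affine _ _ (coord_mv k)) /=.
by case: eqP => _; rewrite ?mulr0 ?addr0 ?mul0r// -expr2 sqr_i addrN mul0r.
Qed.

Lemma dz_conj_coord j k z : dz j (fun w : Cn => (w 0 k)^* ) z = (k == j)%:R.
Proof.
rewrite dzE !(partial_affine _ _ (conj_coord_mv k)) /=.
case: eqP => _; rewrite ?mulr0 ?addr0 ?mul0r// mulrN -expr2 sqr_i opprK.
by rewrite divff// pnatr_eq0.
Qed.

Lemma tst_dz r j phi : tst r phi -> tst r (dz j phi).
Proof.
move=> tphi; split; first by apply: smooth_on_dz; [exact: openT|exact: tphi.1].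
move=> z Nz; rewrite dzE.
have /= -> := tst_partials_out [:: (j, false)] tphi Nz.
by have /= -> := tst_partials_out [:: (j, true)] tphi Nz; rewrite mulr0 addr0 mul0r.
Qed.

Lemma pds_dz s j phi z : smooth_on setT phi ->
  pds s (dz j phi) z =
  (pds s (pd (j, false) phi) z + 'i * pds s (pd (j, true) phi) z) / 2.
Proof.
move=> sphi; have oT := @openT Cn.
have s1 := smooth_on_partial (j, false) sphi; have s2 := smooth_on_partial (j, true) sphi.
rewrite dz_pd (partialsZ _ s oT (smooth_onD oT s1 (smooth_onZ oT 'i s2)) I).
by rewrite (partialsD s oT s1 (smooth_onZ oT 'i s2) I) (partialsZ _ s oT s2 I) mulrC.
Qed.

Lemma sbound_dz N j phi B : smooth_on setT phi -> sbound N.+1 phi B ->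
  sbound N (dz j phi) B.
Proof.
move=> sphi hB s z sN; rewrite pds_dz// normcM normcV.
rewrite -partials_rcons -(partials_rcons s (j, true)).
have h1 : normc (pds (rcons s (j, false)) phi z) <= B by apply: hB; rewrite size_rcons.
have h2 : normc (pds (rcons s (j, true)) phi z) <= B by apply: hB; rewrite size_rcons.
have -> : normc (2 : C) = 2.
  by have := @normc_real R 2; rewrite rmorph_nat => ->; rewrite ger0_norm.
rewrite ler_pdivrMr// mulr_natr mulr2n (le_trans (le_normcD _ _))// lerD//.
by rewrite normcM normci mul1r.
Qed.

Lemma pd_dz d j phi z : smooth_on setT phi ->
  pd d (dz j phi) z = dz j (pd d phi) z.
Proof.
move=> sphi; have /= -> := pds_dz [:: d] j z sphi.
by rewrite dzE (partialC d (j, false) z sphi) (partialC d (j, true) z sphi).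
Qed.

Lemma dzC j k phi z : smooth_on setT phi ->
  dz j (dz k phi) z = dz k (dz j phi) z.
Proof.
move=> sphi; rewrite [LHS]dzE [RHS]dzE !pd_dz//.
rewrite [in LHS](dzE k (pd (j, false) phi)) [in LHS](dzE k (pd (j, true) phi)).
rewrite [in RHS](dzE j (pd (k, false) phi)) [in RHS](dzE j (pd (k, true) phi)).
rewrite (partialC (j, false) (k, false) z sphi) (partialC (j, false) (k, true) z sphi).
rewrite (partialC (j, true) (k, false) z sphi) (partialC (j, true) (k, true) z sphi).
move: (pd _ _ z) (pd _ _ z) (pd _ _ z) (pd _ _ z) => a b c d; ring.
Qed.

Lemma bint_partial0 A s d z r G : r < A -> 0 < A -> uniq s -> d \in s ->
  (forall e, e \in s -> crd e z = 0) -> tst r G -> bint A s (pd d G) z = 0.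
Proof.
move=> rA A0 us ds z0 tG; have cdG := smooth_ccont (smooth_on_partial d tG.1).
rewrite (bint_last _ (ltW A0) cdG ds).
rewrite (@bint_ext _ _ _ _ _ (fun=> 0)) ?bint0 ?rem_uniq ?(ltW A0)//.
- exact: (ccont_cint (- A) A (g := fun t w => pd d G (mv w d t)) (ccont_comp cdG (@continuous_mv _ _ d))).
- exact: ccont_cst.
move=> w [h _]; have wd : crd d w = 0.
  by rewrite h ?z0// mem_rem_uniqF.
have c1 : ccont (fun t => pd d G (mv w d t)).
  by apply: (ccont_comp cdG); exact: continuous_mv_t.
rewrite (cint_primitive _ _ c1 (fun t => smooth_on_cderiv_mv tG.1 (I : setT (mv w d t)))).
have G0 t : r < `|t| -> G (mv w d t) = 0.
  move=> rt; apply: tG.2 => /(_ d); rewrite crd_mv wd eqxx add0r.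
  by rewrite leNgt rt.
by rewrite !G0 ?subrr ?normrN ?(gtr0_norm A0).
Qed.

Lemma bint_dz0 A s j z r G : r < A -> 0 < A -> uniq s -> (j, false) \in s -> (j, true) \in s ->
  (forall e, e \in s -> crd e z = 0) -> tst r G -> bint A s (dz j G) z = 0.
Proof.
move=> rA A0 us j1 j2 z0 tG.
have c1 := smooth_ccont (smooth_on_partial (j, false) tG.1).
have c2 := smooth_ccont (smooth_on_partial (j, true) tG.1).
rewrite dz_pd bintZ; last by apply: ccontD => //; exact: ccontZ.
rewrite bintD//; last exact: ccontZ.
rewrite bintZ// (bint_partial0 rA A0 us j1 z0 tG) (bint_partial0 rA A0 us j2 z0 tG).
by rewrite mulr0 addr0 mulr0.
Qed.

Lemma bint_parts A s j z r K psi : r < A -> 0 < A -> uniq s ->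
  (j, false) \in s -> (j, true) \in s -> (forall e, e \in s -> crd e z = 0) ->
  smooth_on setT K -> tst r psi ->
  bint A s (fun w => K w * dz j psi w) z = - bint A s (fun w => dz j K w * psi w) z.
Proof.
move=> rA A0 us j1 j2 z0 sK tpsi; have oT := @openT Cn.
have tG : tst r (fun w => K w * psi w).
  by apply: (@tst_mul _ _ r (r + 1)) => //; [rewrite ltrDl|exact: smooth_onW sK].
have := bint_dz0 rA A0 us j1 j2 z0 tG.
have -> : dz j (fun w => K w * psi w) = fun w => dz j K w * psi w + K w * dz j psi w.
  by apply/funext => w; exact: (dzM j sK tpsi.1).
have cK := smooth_ccont sK; have cpsi := smooth_ccont tpsi.1.
have cdK := smooth_ccont (smooth_on_dz oT j sK).
have cdpsi := smooth_ccont (smooth_on_dz oT j tpsi.1).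
rewrite bintD; [|exact: ccontM..].
by move=> /eqP; rewrite addrC addr_eq0 => /eqP.
Qed.

End Dzbar.

(** * Convolution in one complex variable *)

Section Convolution.
Context (R : realType) (n : nat) (j : 'I_n).
Local Notation C := R[i].
Local Notation Cn := 'rV[C]_n.
Local Notation dx := (j, false).
Local Notation dy := (j, true).
Implicit Types (f g h phi psi : Cn -> C) (z w : Cn) (r A : R) (k : C -> C).

Definition kcont k := ccont (fun q : R * R => k (q.1 +i* q.2)).

Lemma continuous_pair (S T U : topologicalType) (f : S -> T) (g : S -> U) :
  continuous f -> continuous g -> continuous (fun s => (f s, g s)).
Proof.
by move=> cf cg s; apply: (@cvg_pair _ _ _ _ (nbhs (f s)) (nbhs (g s))); [exact: cf|exact: cg].
Qed.

Lemma continuous_fst (S T : topologicalType) : continuous (fun q : S * T => q.1).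
Proof. by move=> q; exact: cvg_fst. Qed.

Lemma continuous_snd (S T : topologicalType) : continuous (fun q : S * T => q.2).
Proof. by move=> q; exact: cvg_snd. Qed.

Lemma continuous_compo (S T U : topologicalType) (f : S -> T) (g : T -> U) :
  continuous f -> continuous g -> continuous (fun s => g (f s)).
Proof. by move=> cf cg s; apply: continuous_comp; [exact: cf|exact: cg]. Qed.

Lemma continuous_mv_gen (S : topologicalType) (f : S -> Cn) (g : S -> R) d :
  continuous f -> continuous g -> continuous (fun s => mv (f s) d (g s)).
Proof.
move=> cf cg; apply: (@continuous_compo _ _ _ (fun s => (g s, f s))
  (fun q : R * Cn => mv q.2 d q.1)); [exact: continuous_pair|exact: continuous_mv].
Qed.

Lemma continuous_opp (S : topologicalType) (g : S -> R) : continuous g -> continuous (fun s => - g s).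
Proof. by move=> cg s; apply: cvgN; exact: cg. Qed.

Definition cshift z (x y : R) : Cn := mv (mv z dx (- x)) dy (- y).

(** Convolution in the variable $z_j$ alone, the other variables being parameters. Integration is
    over the argument of the kernel, so derivatives in [z] fall on [phi] and the kernel need only be
    continuous. *)
Definition conv k A phi z : C :=
  cint (- A) A (fun x => cint (- A) A (fun y => k (x +i* y) * phi (cshift z x y))).

Lemma continuous_cshift : continuous (fun q : (R * R) * Cn => cshift q.2 q.1.1 q.1.2).
Proof.
have c1 := @continuous_fst (R * R)%type Cn; have c2 := @continuous_snd (R * R)%type Cn.
have c11 := continuous_compo c1 (@continuous_fst R R).
have c12 := continuous_compo c1 (@continuous_snd R R).
apply: continuous_mv_gen; last exact: continuous_opp.
by apply: continuous_mv_gen => //; exact: continuous_opp.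
Qed.

Lemma cshift_z_cont x y : continuous (fun z => cshift z x y).
Proof.
exact: (@continuous_compo _ _ _ (fun z : Cn => (((x, y) : R * R), z))
  (fun q : (R * R) * Cn => cshift q.2 q.1.1 q.1.2) (@continuous_pairr _ _ ((x, y) : R * R)) continuous_cshift).
Qed.

Lemma cshift_mv x y z e t : cshift (mv z e t) x y = mv (cshift z x y) e t.
Proof. by rewrite /cshift (mvC z) (mvC (mv z dx _)). Qed.

Lemma cshift_smooth phi x y : smooth_on setT phi ->
  smooth_on setT (fun z => phi (cshift z x y)) /\
  forall s z, pds s (fun z => phi (cshift z x y)) z = pds s phi (cshift z x y).
Proof. exact: (@smooth_translate _ _ (fun z => cshift z x y) phi (@cshift_z_cont x y) (cshift_mv x y)). Qed.

Lemma sfam_conv k phi : kcont k -> smooth_on setT phi ->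
  sfam (fun q : R * R => fun z => k (q.2 +i* q.1) * phi (cshift z q.2 q.1)).
Proof.
move=> ck sphi; have oT := @openT Cn.
have ssh q : smooth_on setT (fun z => phi (cshift z q.2 q.1)) := (cshift_smooth q.2 q.1 sphi).1.
constructor=> [q|s]; first exact: (smooth_onZ oT).
have csw : continuous (fun q : (R * R) * Cn => (q.1.2, q.1.1)).
  have c1 := @continuous_fst (R * R)%type Cn.
  apply: continuous_pair; first exact: continuous_compo c1 (@continuous_snd R R).
  exact: continuous_compo c1 (@continuous_fst R R).
have c1 : ccont (fun q : (R * R) * Cn => k (q.1.2 +i* q.1.1)) := ccont_comp ck csw.
have c2 : ccont (fun q : (R * R) * Cn => pds s phi (cshift q.2 q.1.2 q.1.1)).
  have cs := smooth_ccont (smooth_on_partials s sphi).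
  apply: (ccont_comp cs (g := fun q : (R * R) * Cn => cshift q.2 q.1.2 q.1.1)).
  apply: (continuous_compo (f := fun q : (R * R) * Cn => ((q.1.2, q.1.1), q.2))
    (g := fun q : (R * R) * Cn => cshift q.2 q.1.1 q.1.2)); last exact: continuous_cshift.
  by apply: continuous_pair => //; exact: continuous_snd.
apply: ccont_eq (ccontM c1 c2) _ => q.
by rewrite (partialsZ _ s oT (ssh q.1) I) (cshift_smooth _ _ sphi).2.
Qed.

Lemma conv_smooth k A phi : 0 <= A -> kcont k -> smooth_on setT phi ->
  smooth_on setT (conv k A phi) /\
  forall s z, pds s (conv k A phi) z = conv k A (pds s phi) z.
Proof.
move=> A0 ck sphi; have AA : - A <= A by rewrite ge0_cp.
have oT := @openT Cn.
have sf := sfam_conv ck sphi.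
have sf1 := sfam_cint (Phi := fun y x z => k (x +i* y) * phi (cshift z x y)) AA sf.
have [h1 h2] := partials_cint_smooth AA sf1.
split=> // s z; rewrite h2; apply: cint_eq => x.
have sfx : sfam (fun y z => k (x +i* y) * phi (cshift z x y)).
  have [g1 g2] := sf; constructor=> [y|t]; first exact: (g1 (y, x)).
  apply: (ccont_comp (g2 t) (g := fun q : R * Cn => ((q.1, x), q.2))).
  apply: continuous_pair; last exact: continuous_snd.
  exact: (@continuous_compo _ _ _ (fun q : R * Cn => q.1) (fun y : R => (y, x))
    (@continuous_fst R Cn) (@continuous_pairl _ _ x)).
have [_ ->] := partials_cint_smooth AA sfx; apply: cint_eq => y.
have [ssh e] := cshift_smooth x y sphi.
by rewrite (partialsZ _ s oT ssh I) e.
Qed.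

Lemma kcont_x k x : kcont k -> ccont (fun y => k (x +i* y)).
Proof. by move=> ck; exact: (ccont_pair1 (g := fun x y => k (x +i* y)) x ck). Qed.

Lemma conv_integrand k phi z : kcont k -> ccont phi ->
  ccont (fun q : R * R => k (q.1 +i* q.2) * phi (cshift z q.1 q.2)).
Proof.
move=> ck cphi; apply: ccontM => //; apply: (ccont_comp cphi).
exact: (continuous_compo (@continuous_pairl _ _ z) continuous_cshift).
Qed.

Lemma conv_inner k A phi z : kcont k -> ccont phi ->
  ccont (fun x => cint (- A) A (fun y => k (x +i* y) * phi (cshift z x y))).
Proof.
move=> ck cphi; apply: (ccont_cint (- A) A (g := fun y x => k (x +i* y) * phi (cshift z x y))).
exact: (ccont_swap (g := fun x y => k (x +i* y) * phi (cshift z x y)) (conv_integrand z ck cphi)).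
Qed.

Lemma conv_integrand1 k phi z x : kcont k -> ccont phi ->
  ccont (fun y => k (x +i* y) * phi (cshift z x y)).
Proof.
move=> ck cphi.
exact: (ccont_pair1 (g := fun x y => k (x +i* y) * phi (cshift z x y)) x (conv_integrand z ck cphi)).
Qed.

Lemma convP k A c phi psi z : kcont k -> ccont phi -> ccont psi ->
  conv k A (fun z => c * phi z + psi z) z = c * conv k A phi z + conv k A psi z.
Proof.
move=> ck c1 c2; have I1 := conv_inner A z ck c1; have I2 := conv_inner A z ck c2.
rewrite /conv -cintZ// -cintD//; last exact: ccontZ.
apply: cint_eq => x; have J1 := conv_integrand1 z x ck c1; have J2 := conv_integrand1 z x ck c2.
rewrite -cintZ// -cintD//; last exact: ccontZ.
by apply: cint_eq => y; ring.
Qed.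

Lemma convBk k l A phi z : kcont k -> kcont l -> ccont phi ->
  conv k A phi z - conv l A phi z = conv (fun w : C => k w - l w) A phi z.
Proof.
move=> ck cl c1; have I1 := conv_inner A z ck c1; have I2 := conv_inner A z cl c1.
rewrite /conv -cintN// -cintD//; last exact: ccontN.
apply: cint_eq => x; have J1 := conv_integrand1 z x ck c1; have J2 := conv_integrand1 z x cl c1.
rewrite -cintN// -cintD//; last exact: ccontN.
by apply: cint_eq => y; ring.
Qed.

Lemma conv_bound k A phi z (K B : R) : 0 <= A -> kcont k -> ccont phi -> 0 <= K ->
  (forall x y, - A <= x <= A -> - A <= y <= A -> normc (k (x +i* y)) <= K) ->
  (forall w, normc (phi w) <= B) -> normc (conv k A phi z) <= 16 * A ^+ 2 * (K * B).
Proof.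
move=> A0 ck cphi K0 hk hphi; have AA : - A <= A by rewrite ge0_cp.
apply: le_trans (cint_bound AA (conv_inner A z ck cphi) (M := 4 * A * (K * B)) _) _; last first.
  by rewrite opprK le_eqVlt; apply/orP; left; apply/eqP; ring.
move=> x xA.
apply: le_trans (cint_bound AA (conv_integrand1 z x ck cphi) (M := K * B) _) _; last first.
  by rewrite opprK le_eqVlt; apply/orP; left; apply/eqP; ring.
by move=> y yA; rewrite normcM ler_pM ?normc_ge0// hk.
Qed.

Lemma cint_flip_supp (r A A' c : R) (G : R -> C) : ccont G -> 0 <= r ->
  (forall t, r < `|t| -> G t = 0) -> `|c| + r <= A -> r <= A' ->
  cint (- A) A (fun x => G (c - x)) = cint (- A') A' G.
Proof.
move=> cG r0 G0 cA rA'; rewrite cint_flip//.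
have ZG t : t < - r \/ r < t -> G t = 0.
  by move=> h; apply: G0; rewrite ltr_normr; apply/orP; case: h; [right|left]; lra.
have := ler_normr c `|c|; have := ler_norm c; have := lerNnormlW (lexx `|c|) => c1 c2 _.
rewrite (@cint_supp _ (- r) r)//; [|lra|lra|lra].
by rewrite (@cint_supp _ (- r) r (- A'))//; lra.
Qed.

Definition czero z : Cn := mv (mv z dx (- crd dx z)) dy (- crd dy z).

Lemma crd_czero z e : e \in [:: dx; dy] -> crd e (czero z) = 0.
Proof.
by rewrite !inE /czero !crd_mv => /orP[/eqP ->|/eqP ->]; rewrite !xpair_eqE !eqxx /=; ring.
Qed.

(** Substituting $w_j=z_j-\zeta$ moves the dependence on $z_j$ into the kernel, the form needed for
    integration by parts. The size conditions make both squares of integration contain the support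
    of the integrand, so [A] may be traded for [A']. *)
Lemma conv_bint k A A' r phi z : kcont k -> ccont phi -> supported_in (Qb r) phi -> 0 <= r ->
  `|crd dx z| + r <= A -> `|crd dy z| + r <= A -> r <= A' ->
  conv k A phi z = bint A' [:: dx; dy] (fun w => k (z 0 j - w 0 j) * phi w) (czero z).
Proof.
move=> ck cphi phir r0 zxA zyA rA'.
set a := crd dx z; set b := crd dy z.
pose H s t := k ((a - s) +i* (b - t)) * phi (cshift z (a - s) (b - t)).
have cab : continuous (fun q : R * R => (a - q.1, b - q.2)).
  apply: continuous_pair.
    exact: (continuous_compo (@continuous_fst R R) (@rcont_opp R a)).
  exact: (continuous_compo (@continuous_snd R R) (@rcont_opp R b)).
have cH : ccont (fun q : R * R => H q.1 q.2).
  exact: (ccont_comp (conv_integrand z ck cphi) cab).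
have H0 s t : r < `|s| \/ r < `|t| -> H s t = 0.
  move=> h; rewrite /H phir ?mulr0// => Q; case: h => h.
    have := Q dx; rewrite /cshift !crd_mv !xpair_eqE !eqxx /= addr0.
    by rewrite opprB addrCA subrr addr0 leNgt h.
  have := Q dy; rewrite /cshift !crd_mv !xpair_eqE !eqxx /= addr0.
  by rewrite opprB addrCA subrr addr0 leNgt h.
have E1 x : cint (- A) A (fun y => k (x +i* y) * phi (cshift z x y)) =
    cint (- A') A' (H (a - x)).
  rewrite -(@cint_flip_supp r A A' b (H (a - x)))//.
  - by apply: cint_eq => y; rewrite /H !subKr.
  - exact: (ccont_pair1 (g := H) _ cH).
  - by move=> t h; apply: H0; right.
rewrite /conv (cint_eq _ _ E1) (@cint_flip_supp r A A' a (fun s => cint (- A') A' (H s)))//.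
- apply: cint_eq => s; apply: cint_eq => t; rewrite /H.
  have -> : cshift z (a - s) (b - t) = mv (mv (czero z) dx s) dy t.
    rewrite /czero -/a -/b /cshift (mvC (mv z dx (- a)) dy) mv_add mv_add.
    by congr (mv (mv _ _ _) _ _); ring.
  congr (k _ * _); rewrite !mvE !eqxx /=; apply: eqC;
    rewrite !(ReD, ImD, ReN, ImN, ReM, ImM) /= /a /b /crd /=; ring.
- exact: (ccont_cint (- A') A' (g := fun t s => H s t) (ccont_swap cH)).
- move=> s h; rewrite (@cint_eq _ _ _ _ (fun=> 0)) ?cint_cst ?mul0r// => t.
  by apply: H0; left.
Qed.

End Convolution.

(** * The kernel and its regularization *)

Section Kernels.
Context (R : realType).
Local Notation C := R[i].
Implicit Types (zeta : C) (x y delta A : R).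

(* [cker 0] is conj(zeta)^2 / zeta, with the value 0 at 0. Being continuous, it is easier
   to convolve with than the Cauchy kernel, which is half of its second derivative with respect
   to conj(zeta). *)
Definition cker delta zeta : C := zeta^* ^+ 3 / (zeta * zeta^* + (delta ^+ 2)%:C).

(* The third derivative of [- cker delta] with respect to conj(zeta). *)
Definition capprox delta zeta : C :=
  6 * (delta ^+ 2)%:C ^+ 3 / (zeta * zeta^* + (delta ^+ 2)%:C) ^+ 4.

Lemma mul_conjC zeta : zeta * zeta^* = (normc zeta ^+ 2)%:C.
Proof. case: zeta => a b; apply: eqC => /=; last by ring.
by rewrite sqr_sqrtr ?addr_ge0 ?sqr_ge0//; ring. Qed.

Lemma normc_conj zeta : normc zeta^* = normc zeta.
Proof. by case: zeta => a b /=; rewrite sqrrN. Qed.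

(** With $t=|\zeta|$ the difference has modulus $t\delta^2/(t^2+\delta^2)$, and $2t\delta\le
    t^2+\delta^2$. Uniformity in $\zeta$ yields the continuity of [cker 0] and lets convolutions
    pass to the limit. *)
Lemma cker_sub delta zeta : 0 < delta -> normc (cker 0 zeta - cker delta zeta) <= delta / 2.
Proof.
move=> d0; rewrite /cker mul_conjC -!rmorphD expr0n addr0 /=.
have N0 := normc_ge0 zeta.
have [z0|z0] := eqVneq zeta 0.
  by rewrite z0 rmorph0 expr0n !mul0r subr0 normc0 divr_ge0// ltW.
have t0 : 0 < normc zeta.
  by rewrite lt_neqAle N0 andbT eq_sym; apply: contra z0 => /eqP /eq0_normc ->.
rewrite -mulrBr normcM normcX normc_conj -!rmorphV ?unitfE; last first.
- by rewrite gt_eqF// exprn_gt0.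
- by rewrite gt_eqF// addr_gt0 ?exprn_gt0.
rewrite -rmorphB normc_real; set t := normc zeta in t0 *.
have q0 : 0 < t ^+ 2 + delta ^+ 2 by rewrite addr_gt0 ?exprn_gt0.
rewrite (_ : _ - _ = delta ^+ 2 / (t ^+ 2 * (t ^+ 2 + delta ^+ 2))); last first.
  by field; rewrite !gt_eqF.
rewrite ger0_norm; last by rewrite divr_ge0 ?mulr_ge0 ?exprn_ge0 ?ltW.
rewrite (_ : _ * _ = t * delta ^+ 2 / (t ^+ 2 + delta ^+ 2)); last first.
  by field; rewrite !gt_eqF.
rewrite ler_pdivrMr// mulrAC ler_pdivlMr//.
have := mulr_ge0 (ltW d0) (sqr_ge0 (t - delta)); rewrite sqrrB; nra.
Qed.

Lemma continuous_conj_pair : ccont (fun q : R * R => (q.1 +i* q.2)^* ).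
Proof.
by constructor=> q; apply/ccvgReIm; split; [exact: cvg_fst|apply: cvgN; exact: cvg_snd].
Qed.

Lemma continuous_cpair : ccont (fun q : R * R => q.1 +i* q.2).
Proof.
by constructor=> q; apply/ccvgReIm; split; [exact: cvg_fst|exact: cvg_snd].
Qed.

Lemma qker_neq0 delta zeta : 0 < delta -> zeta * zeta^* + (delta ^+ 2)%:C != 0.
Proof.
move=> d0; rewrite mul_conjC -rmorphD /=; apply/eqP => /(congr1 (@complex.Re R)) /= /eqP.
by rewrite gt_eqF// ltr_wpDl ?sqr_ge0 ?exprn_gt0.
Qed.

Lemma ccontX (T : topologicalType) (f : T -> C) m : ccont f -> ccont (fun t => f t ^+ m).
Proof.
move=> cf; elim: m => [|m ih]; first exact: ccont_cst.
by apply: ccont_eq (ccontM cf ih) _ => x; rewrite exprS.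
Qed.

Lemma ccontV (T : topologicalType) (f : T -> C) : ccont f -> (forall t, f t != 0) ->
  ccont (fun t => (f t)^-1).
Proof.
move=> cf f0; constructor=> x.
by have [] := ccont_atV (f0 x) (ccont_atW x cf).
Qed.

Lemma kcont_q delta : ccont (fun q : R * R =>
  (q.1 +i* q.2) * (q.1 +i* q.2)^* + (delta ^+ 2)%:C).
Proof.
apply: ccontD; last exact: ccont_cst.
by apply: ccontM; [exact: continuous_cpair|exact: continuous_conj_pair].
Qed.

Lemma kcont_cker_gt0 delta : 0 < delta -> kcont (cker delta).
Proof.
move=> d0; apply: ccontM; first exact/ccontX/continuous_conj_pair.
by apply: ccontV => [|q]; [exact: kcont_q|exact: qker_neq0].
Qed.

Lemma kcont_capprox delta : 0 < delta -> kcont (capprox delta).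
Proof.
move=> d0; apply: ccontM; first exact: ccont_cst.
apply: ccontV => [|q]; first exact/ccontX/kcont_q.
by rewrite expf_neq0// qker_neq0.
Qed.

Lemma kcont_cker0 : kcont (cker 0).
Proof.
apply: ccontP => x e e0; have d0 : 0 < e / 2 by rewrite divr_gt0.
have := ccont_near x (kcont_cker_gt0 d0) d0; apply: filterS => y h.
have h1 := cker_sub (y.1 +i* y.2) d0; have h2 := cker_sub (x.1 +i* x.2) d0.
rewrite normcB in h2.
have := le_normc_sub (cker (e / 2) (y.1 +i* y.2)) (cker 0 (y.1 +i* y.2)) (cker 0 (x.1 +i* x.2)).
have := le_normc_sub (cker (e / 2) (x.1 +i* x.2)) (cker (e / 2) (y.1 +i* y.2)) (cker 0 (x.1 +i* x.2)).
by lra.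
Qed.

End Kernels.

(** * Antiholomorphic derivatives of the regularized kernel *)

Section KernelDerivatives.
Context (R : realType) (n : nat) (j : 'I_n) (c : R[i]) (delta : R).
Local Notation C := R[i].
Local Notation Cn := 'rV[C]_n.

Hypothesis d0 : 0 < delta.

Let Z (w : Cn) : C := c - w 0 j.

Let S (w : Cn) : C := (c - w 0 j)^*.

Let V (w : Cn) : C := (Z w * S w + (delta ^+ 2)%:C)^-1.

Let oT : open [set: Cn]. Proof. exact: openT. Qed.

Let sZ : smooth_on setT Z.
Proof. by apply: (smooth_onB oT); [exact: smooth_on_cst|exact: smooth_coord]. Qed.

Let S_E w : S w = c^* + -1 * (w 0 j)^*.
Proof. by rewrite /S rmorphB mulN1r. Qed.

Let sS : smooth_on setT S.
Proof.
apply: (smooth_on_eq oT (fun w _ => esym (S_E w))); apply: (smooth_onD oT).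
  exact: smooth_on_cst.
by apply: (smooth_onZ oT); exact: smooth_conj_coord.
Qed.

Let dZ w : dz j Z w = 0.
Proof.
rewrite (@dz_ext _ _ _ (fun w : Cn => c + -1 * w 0 j)); last by move=> w'; rewrite mulN1r.
rewrite (dzD _ (smooth_on_cst oT c) (smooth_onZ oT _ (smooth_coord R j)) I).
by rewrite dz_cst (dzZ _ _ (smooth_coord R j))// dz_coord mulr0 addr0.
Qed.

Let dS w : dz j S w = -1.
Proof.
rewrite (@dz_ext _ _ _ (fun w : Cn => c^* + -1 * (w 0 j)^* ) j S_E).
rewrite (dzD _ (smooth_on_cst oT c^* ) (smooth_onZ oT _ (smooth_conj_coord R j)) I).
by rewrite dz_cst (dzZ _ _ (smooth_conj_coord R j))// dz_conj_coord eqxx mulr1 add0r.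
Qed.

Let q0 w : Z w * S w + (delta ^+ 2)%:C != 0.
Proof. exact: qker_neq0. Qed.

Let sq : smooth_on setT (fun w => Z w * S w + (delta ^+ 2)%:C).
Proof.
by apply: (smooth_onD oT); [exact: (smooth_onM oT)|exact: smooth_on_cst].
Qed.

Let sV : smooth_on setT V.
Proof. by apply: (smooth_onV oT). Qed.

Let dV w : dz j V w = Z w * V w ^+ 2.
Proof.
rewrite (dzV _ sq)//.
rewrite (dzD _ (smooth_onM oT sZ sS) (smooth_on_cst _ _))// dz_cst addr0.
by rewrite (dzM _ sZ sS)// dZ dS mul0r add0r mulrN1 opprK exprVn.
Qed.

Let smono a b m : smooth_on setT (fun w => Z w ^+ a * (S w ^+ b * V w ^+ m)).
Proof. by do !apply: (smooth_onM oT); exact: (smooth_onX oT). Qed.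

Let dmono a b m w : dz j (fun w => Z w ^+ a * (S w ^+ b * V w ^+ m)) w =
  Z w ^+ a * (- b%:R * S w ^+ b.-1 * V w ^+ m + m%:R * Z w * S w ^+ b * V w ^+ m.+1).
Proof.
have h1 := smooth_onX oT a sZ; have h2 := smooth_onX oT b sS; have h3 := smooth_onX oT m sV.
rewrite (dzM _ h1 (smooth_onM oT h2 h3) I) (dzM _ h2 h3 I).
rewrite (dzX oT _ _ sZ I) (dzX oT _ _ sS I) (dzX oT _ _ sV I) dZ dS dV.
rewrite mulr0 mul0r add0r; congr (_ * _).
case: m {h3} => [|m] /=; first by rewrite !mul0r mulr0 addr0; ring.
by rewrite !exprS; ring.
Qed.

(** With $\zeta=c-w_j$ and $S=\bar\zeta$, the functions [K1] and [K2] are the first two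
    $\bar\zeta$-derivatives of [K0]; each derivative in $\bar w_j$ brings a minus sign since
    $\partial\bar\zeta/\partial\bar w_j=-1$. The trivial powers put every term into the monomial
    form of [dmono]. *)
Let K0 w := Z w ^+ 0 * (S w ^+ 3 * V w ^+ 1).

Let K1 w := 3 * (Z w ^+ 0 * (S w ^+ 2 * V w ^+ 1)) + -1 * (Z w ^+ 1 * (S w ^+ 3 * V w ^+ 2)).

Let K2 w := 6 * (Z w ^+ 0 * (S w ^+ 1 * V w ^+ 1)) +
  (-6 * (Z w ^+ 1 * (S w ^+ 2 * V w ^+ 2)) + 2 * (Z w ^+ 2 * (S w ^+ 3 * V w ^+ 3))).

Let dK0 w : dz j K0 w = - K1 w.
Proof. by rewrite dmono /K1 /=; ring. Qed.

Let dK1 w : dz j K1 w = - K2 w.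
Proof.
rewrite (dzD _ (smooth_onZ oT _ (smono _ _ _)) (smooth_onZ oT _ (smono _ _ _)) I).
rewrite (dzZ _ _ (smono _ _ _) I) (dzZ _ _ (smono _ _ _) I) !dmono /K2 /=.
by ring.
Qed.

Let dK2 w : dz j K2 w = - capprox delta (c - w 0 j).
Proof.
have s1 k a b m := smooth_onZ oT k (smono a b m).
rewrite (dzD _ (s1 _ _ _ _) (smooth_onD oT (s1 _ _ _ _) (s1 _ _ _ _)) I).
rewrite (dzD _ (s1 _ _ _ _) (s1 _ _ _ _) I) !(dzZ _ _ (smono _ _ _) I) !dmono /capprox /=.
have -> : (c - w 0 j) * (c - w 0 j)^* + (delta ^+ 2)%:C = (V w)^-1 by rewrite invrK.
(* The third $\bar\zeta$-derivative is $6V(1-ZSV)^3$, and $1-ZSV=\delta^2V$. *)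
have : Z w * S w * V w = 1 - (delta ^+ 2)%:C * V w.
  by apply/eqP; rewrite eq_sym subr_eq -mulrDl divff.
move: (Z w) (S w) (V w) ((delta ^+ 2)%:C) => a b v D h.
rewrite exprVn invrK.
have -> : 6 * D ^+ 3 * v ^+ 4 = 6 * v * (1 - (1 - D * v)) ^+ 3 by ring.
by rewrite -h; ring.
Qed.

(** Three integrations by parts carry the derivatives over to the kernel; the signs of [bint_parts]
    cancel those of the chain rule. *)
Lemma bint_cker A r phi z : r < A -> 0 < A ->
  (forall e, e \in [:: (j, false); (j, true)] -> crd e z = 0) -> tst r phi ->
  bint A [:: (j, false); (j, true)] (fun w => cker delta (c - w 0 j) * dz j (dz j (dz j phi)) w) z =
  bint A [:: (j, false); (j, true)] (fun w => capprox delta (c - w 0 j) * phi w) z.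
Proof.
move=> rA A0 z0 t0; have t1 := tst_dz j t0; have t2 := tst_dz j t1.
have us : uniq [:: (j, false); (j, true)] by rewrite /= inE xpair_eqE andbF.
have s0 : smooth_on setT K0 := smono _ _ _.
have s1 : smooth_on setT K1.
  by apply: (smooth_onD oT); exact: (smooth_onZ oT).
have s2 : smooth_on setT K2.
  by apply: (smooth_onD oT); [|apply: (smooth_onD oT)]; exact: (smooth_onZ oT).
have E (K L psi : Cn -> C) (dK : forall w, dz j K w = - L w) : smooth_on setT K -> tst r psi ->
  bint A [:: (j, false); (j, true)] (fun w => K w * dz j psi w) z =
  bint A [:: (j, false); (j, true)] (fun w => L w * psi w) z.
  move=> sK tpsi; rewrite (bint_parts rA A0 us _ _ z0 sK tpsi) ?inE ?eqxx ?orbT//.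
  have -> : (fun w => dz j K w * psi w) = fun w => -1 * (L w * psi w).
    by apply/funext => w; rewrite dK mulN1r mulNr.
  rewrite bintZ; first by rewrite mulN1r opprK.
  have sdK := smooth_ccont (smooth_onN oT (smooth_on_dz oT j sK)).
  apply: ccontM; last exact: smooth_ccont tpsi.1.
  by apply: ccont_eq sdK _ => w; rewrite dK opprK.
have -> : (fun w : Cn => cker delta (c - w 0 j) * dz j (dz j (dz j phi)) w) =
    fun w => K0 w * dz j (dz j (dz j phi)) w.
  by apply/funext => w; rewrite /K0 mul1r.
by rewrite (E K0 K1)// (E K1 K2)// (E K2 (fun w => capprox delta (c - w 0 j))).
Qed.

End KernelDerivatives.

(** * Domination of integrals by Lorentz profiles *)

Section Domination.
Context (R : realType).
Local Notation C := R[i].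

(** Real domination applied to $\operatorname{Re}(k\int F)$ for $k=\pm1,\pm i$ bounds both
    components by the increment of [G]. *)
Lemma cint_dom (a b : R) (F : R -> C) (g G : R -> R) : a <= b -> ccont F ->
  ccont (fun t => (g t)%:C) -> (forall t, cderiv (fun s => (G s)%:C) t (g t)%:C) ->
  (forall t, a <= t <= b -> normc (F t) <= g t) ->
  normc (cint a b F) <= 2 * (G b - G a).
Proof.
move=> ab cF cg hG hF.
have Ig : cint a b (fun t => (g t)%:C) = (G b - G a)%:C.
  by rewrite (cint_primitive _ _ cg hG) rmorphB.
have E k : normc k = 1 -> Re (k * cint a b F) <= G b - G a.
  move=> k1; have cN : ccont (fun t => - (k * F t)) by apply: ccontN; exact: ccontZ.
  have : 0 <= Re (cint a b (fun t => (g t)%:C + - (k * F t))).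
    apply: cint_Re_ge0 => //; first exact: ccontD.
    move=> t tab; rewrite ReD ReN subr_ge0 (le_trans _ (hF t tab))//.
    apply: le_trans (ler_norm _) _; apply: le_trans (Re_le_normc _) _.
    by rewrite normcM k1 mul1r.
  rewrite cintD// Ig ReD cintN; last exact: ccontZ.
  by rewrite cintZ// ReN subr_ge0.
have n1 : normc (1 : C) = 1 by rewrite normc1.
have := E 1 n1; have := E (-1); rewrite normcN n1 => /(_ erefl).
have := E 'i (normci R); have := E (- 'i); rewrite normcN normci => /(_ erefl).
move: (cint a b F) => w h1 h2 h3 h4; apply: le_trans (normc_le_ReIm w) _.
case: w h1 h2 h3 h4 => u v; rewrite !ReM /= => h1 h2 h3 h4.
have : `|u| <= G b - G a by rewrite ler_norml; apply/andP; split; lra.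
have : `|v| <= G b - G a by rewrite ler_norml; apply/andP; split; lra.
by lra.
Qed.

Lemma cderiv_lorentz (delta k t : R) : 0 < delta ->
  cderiv (fun s => (k * (atan (delta^-1 * s) / delta))%:C) t (k / (t ^+ 2 + delta ^+ 2))%:C.
Proof.
move=> d0; apply: cderiv_real.
have e1 : is_derive t (1 : R) (fun s : R => delta^-1 * s) delta^-1.
  have h : is_derive t (1 : R) (delta^-1 \*: (id : R -> R)) (delta^-1 *: (1 : R)).
    exact: is_deriveZ.
  by apply: (is_derive_ext h) => [s|]; rewrite /GRing.scale /= ?mulr1.
have e2 := @is_derive1_comp R atan (fun s => delta^-1 * s) t _ _ (is_derive1_atan _) e1.
apply: is_derive_ext (@is_deriveZ R R R _ (k / delta) t 1 _ e2) _ _.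
  by move=> s /=; rewrite /GRing.scale /=; ring.
rewrite /GRing.scale /=; field.
by apply/andP; split; rewrite gt_eqF// ltr_wpDl ?sqr_ge0 ?exprn_gt0.
Qed.

Lemma ccont_lorentz (delta k : R) : 0 < delta ->
  ccont (fun t : R => (k / (t ^+ 2 + delta ^+ 2))%:C).
Proof.
move=> d0; have cid : ccont (fun t : R => t%:C) by apply: ccont_real => t; exact: cvg_id.
apply: ccont_eq (ccontZ k%:C (ccontV (ccontD (ccontX 2 cid) (ccont_cst _ (delta ^+ 2)%:C)) _)) _.
  move=> t; rewrite -rmorphXn -rmorphD /=; apply/eqP => /(congr1 (@complex.Re R)) /= /eqP.
  by rewrite gt_eqF// ltr_wpDl ?sqr_ge0 ?exprn_gt0.
move=> t; rewrite -rmorphXn -rmorphD rmorphM fmorphV.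
by [].
Qed.

Lemma cint_dom_lorentz (A delta k : R) (F : R -> C) : 0 <= A -> 0 < delta -> ccont F -> 0 <= k ->
  (forall t, normc (F t) <= k / (t ^+ 2 + delta ^+ 2)) ->
  normc (cint (- A) A F) <= 8 * k / delta.
Proof.
move=> A0 d0 cF k0 hF; have AA : - A <= A by rewrite ge0_cp.
apply: le_trans (cint_dom AA cF (ccont_lorentz k d0) (fun t => cderiv_lorentz k t d0) _) _ => //.
(* The increment of arctan is below $\pi<4$, which makes the bound independent of [A]:
   $8=2\cdot4$. *)
have := atan_ltpi2 (delta^-1 * A); have := atan_gtNpi2 (delta^-1 * - A); have := pihalf_lt2 R.
move: (atan _) (atan _) (pi / 2) => p q c h1 h2 h3.
rewrite -mulrBr mulrA -mulrBl mulrA ler_pM2r ?invr_gt0//.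
rewrite (_ : 8 * k = (2 * k) * 4); last by ring.
by rewrite ler_wpM2l ?mulr_ge0//; lra.
Qed.

End Domination.

(** * The reproducing formula *)

Section Reproduction.
Context (R : realType) (n : nat) (j : 'I_n).
Local Notation C := R[i].
Local Notation Cn := 'rV[C]_n.
Local Notation dx := (j, false).
Local Notation dy := (j, true).
Implicit Types (phi psi : Cn -> C) (z w : Cn) (r A delta : R).

Lemma capproxE delta (x y : R) : capprox delta (x +i* y) =
  (6 * delta ^+ 6 / (x ^+ 2 + y ^+ 2 + delta ^+ 2) ^+ 4)%:C.
Proof.
rewrite /capprox mul_conjC /= sqr_sqrtr ?addr_ge0 ?sqr_ge0//.
have -> : (6 : C) = (6 : R)%:C by rewrite rmorph_nat.
rewrite -rmorphD -!rmorphXn -fmorphV -!rmorphM /=; congr (_%:C).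
by rewrite -exprM.
Qed.

(** Of the four factors $N$ in the denominator, two dominate $p$ and $q$, and two dominate
    $(|x|+|y|)\delta$ and $\delta^2$. The product form of the right side allows integrating one
    variable at a time. *)
Lemma capprox_le delta (x y : R) : 0 < delta ->
  normc (capprox delta (x +i* y)) * (`|x| + `|y|) <=
  6 * delta ^+ 3 / (x ^+ 2 + delta ^+ 2) / (y ^+ 2 + delta ^+ 2).
Proof.
move=> d0; rewrite capproxE normc_real.
have x0 := sqr_ge0 x; have y0 := sqr_ge0 y; have dd : 0 < delta ^+ 2 by rewrite exprn_gt0.
set p := x ^+ 2 + delta ^+ 2; set q := y ^+ 2 + delta ^+ 2.
set N := x ^+ 2 + y ^+ 2 + delta ^+ 2.
have N0 : 0 < N by rewrite ltr_wpDl// addr_ge0.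
have p0 : 0 < p by rewrite ltr_wpDl.
have q0 : 0 < q by rewrite ltr_wpDl.
rewrite ger0_norm; last by rewrite divr_ge0 ?mulr_ge0 ?exprn_ge0 ?ltW.
have pN : p <= N by rewrite /p /N lerD2r lerDl.
have qN : q <= N by rewrite /q /N lerD2r lerDr.
have dN : delta ^+ 2 <= N by rewrite lerDr addr_ge0.
have sN : (`|x| + `|y|) * delta <= N.
  have := sqr_ge0 (`|x| - delta / 2); have := sqr_ge0 (`|y| - delta / 2).
  rewrite !sqrrB !real_normK ?num_real// /N; nra.
have -> : 6 * delta ^+ 3 / p / q = 6 * delta ^+ 3 / (p * q) by rewrite -mulrA -invfM.
rewrite [leLHS]mulrAC ler_pdivrMr ?exprn_gt0// [leRHS]mulrAC ler_pdivlMr ?mulr_gt0//.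
have -> : 6 * delta ^+ 6 * (`|x| + `|y|) * (p * q) =
  6 * delta ^+ 3 * (((`|x| + `|y|) * delta) * delta ^+ 2 * (p * q)) by ring.
apply: ler_wpM2l; first by rewrite mulr_ge0// exprn_ge0 ?ltW.
rewrite (_ : N ^+ 4 = N * N * (N * N)); last by ring.
have s0 := mulr_ge0 (addr_ge0 (normr_ge0 x) (normr_ge0 y)) (ltW d0).
apply: ler_pM (mulr_ge0 s0 (ltW dd)) (mulr_ge0 (ltW p0) (ltW q0)) _ _.
  exact: (ler_pM s0 (ltW dd)).
exact: (ler_pM (ltW p0) (ltW q0)).
Qed.

Lemma mv_lipschitz phi (B : R) d z (t : R) : smooth_on setT phi -> (forall w, normc (pd d phi w) <= B) ->
  normc (phi (mv z d t) - phi z) <= 2 * B * `|t|.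
Proof.
move=> sphi hB.
have D s := smooth_on_cderiv_mv (z := z) (t := s) (d := d) sphi I.
have [t0|t0] := leP 0 t.
  rewrite ger0_norm// -[in phi z](mv0 z d) -[t in 2 * B * t]subr0.
  by apply: (cderiv_bound t0 (F := fun s => phi (mv z d s)) (F' := fun s => pd d phi (mv z d s))) => s _; [exact: D|exact: hB].
rewrite ltr0_norm// normcB -[in phi z](mv0 z d) -[- t]sub0r.
by apply: (cderiv_bound (ltW t0) (F := fun s => phi (mv z d s)) (F' := fun s => pd d phi (mv z d s))) => s _; [exact: D|exact: hB].
Qed.

Lemma cshift_lipschitz phi (B : R) z (x y : R) : smooth_on setT phi -> sbound 1 phi B ->
  normc (phi (cshift j z x y) - phi z) <= 2 * B * (`|x| + `|y|).
Proof.
move=> sphi hB; rewrite mulrDr /cshift.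
have b d w : normc (pd d phi w) <= B by exact: (hB [:: d]).
have h1 := mv_lipschitz z (- x) sphi (b dx).
have h2 := mv_lipschitz (mv z dx (- x)) (- y) sphi (b dy).
rewrite !normrN in h1 h2.
by rewrite (le_trans (le_normc_sub (phi (mv z dx (- x))) _ _))// addrC lerD.
Qed.

Definition cmass A delta : C :=
  cint (- A) A (fun x => cint (- A) A (fun y => capprox delta (x +i* y))).

(** [capprox delta] is an approximate identity up to a factor: by the Lipschitz bound on [phi] the
    error is controlled by a first moment. The constants are $12=2\cdot6$, $96=8\cdot12$ and
    $768=8\cdot96$, each integration contributing $8/\delta$. *)
Lemma conv_capprox A delta phi (B : R) z : 0 <= A -> 0 < delta -> smooth_on setT phi ->
  sbound 1 phi B ->
  normc (conv j (capprox delta) A phi z - cmass A delta * phi z) <= 768 * B * delta.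
Proof.
move=> A0 d0 sphi hB; have B0 := sbound_ge0 hB.
have ck := kcont_capprox d0; have cphi := smooth_ccont sphi.
have cz : ccont (fun _ : Cn => - phi z) by exact: ccont_cst.
have -> : conv j (capprox delta) A phi z - cmass A delta * phi z =
    conv j (capprox delta) A (fun w => 1 * phi w + - phi z) z.
  rewrite convP// mul1r; congr (_ + _); rewrite /cmass /conv mulrC -mulNr.
  have c1 : ccont (fun x : R => cint (- A) A (fun y => capprox delta (x +i* y))).
    apply: (ccont_cint (- A) A (g := fun y x => capprox delta (x +i* y))).
    exact: (ccont_swap (g := fun x y => capprox delta (x +i* y)) ck).
  rewrite -cintZ//; apply: cint_eq => x.
  by rewrite -cintZ; [apply: cint_eq => y; rewrite mulrC|exact: kcont_x].
have c2 : ccont (fun w => 1 * phi w + - phi z) by apply: ccontD => //; exact: ccontZ.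
rewrite /conv; pose F x y := capprox delta (x +i* y) * (1 * phi (cshift j z x y) + - phi z).
have cF x : ccont (F x) := conv_integrand1 j z x ck c2.
have cFF : ccont (fun x => cint (- A) A (F x)) := conv_inner j A z ck c2.
have bF x y : normc (F x y) <= (12 * B * delta ^+ 3 / (x ^+ 2 + delta ^+ 2)) / (y ^+ 2 + delta ^+ 2).
  rewrite /F mul1r normcM.
  have := cshift_lipschitz z x y sphi hB => h.
  apply: le_trans (ler_wpM2l (normc_ge0 _) h) _.
  rewrite mulrCA; have B20 : 0 <= 2 * B by rewrite mulr_ge0.
  apply: le_trans (ler_wpM2l B20 (capprox_le x y d0)) _.
  by rewrite le_eqVlt; apply/orP; left; apply/eqP; ring.
have k0 x : 0 <= 12 * B * delta ^+ 3 / (x ^+ 2 + delta ^+ 2).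
  apply: divr_ge0; last by rewrite addr_ge0 ?sqr_ge0.
  by rewrite mulr_ge0 ?exprn_ge0 ?(ltW d0)// mulr_ge0.
have k1 : 0 <= 96 * B * delta ^+ 2 by rewrite mulr_ge0 ?sqr_ge0 ?mulr_ge0.
rewrite -/(F _ _); apply: le_trans (@cint_dom_lorentz _ _ _ (96 * B * delta ^+ 2) _ A0 d0 cFF k1 _) _; last first.
  by rewrite le_eqVlt; apply/orP; left; apply/eqP; field; rewrite gt_eqF.
move=> x; apply: le_trans (cint_dom_lorentz A0 d0 (cF x) (k0 x) (bF x)) _.
rewrite le_eqVlt; apply/orP; left; apply/eqP; field.
by apply/andP; split; rewrite gt_eqF// ltr_wpDl ?sqr_ge0 ?exprn_gt0.
Qed.

Lemma cint_Re_sub (a b a' b' m : R) (F : R -> C) : a <= a' -> a' <= b' -> b' <= b -> ccont F ->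
  (forall t, a <= t <= b -> 0 <= Re (F t)) -> (forall t, a' <= t <= b' -> m <= Re (F t)) ->
  m * (b' - a') <= Re (cint a b F).
Proof.
move=> h1 h2 h3 cF F0 Fm; rewrite (cint_cat a' a b F) (cint_cat b' a' b F) !ReD.
have e1 : 0 <= Re (cint a a' F).
  by apply: cint_Re_ge0 => // t /andP[p q]; apply: F0; rewrite p; lra.
have e2 : 0 <= Re (cint b' b F).
  by apply: cint_Re_ge0 => // t /andP[p q]; apply: F0; apply/andP; split; lra.
have : 0 <= Re (cint a' b' (fun t => F t + (- m)%:C)).
  apply: cint_Re_ge0 => //; first by apply: ccontD => //; exact: ccont_cst.
  by move=> t /Fm; rewrite ReD /= subr_ge0.
rewrite cintD//; last exact: ccont_cst.
rewrite cint_cst -rmorphM ReD /=; lra.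
Qed.

(** On $[-\delta,\delta]^2$ the density is at least $6\delta^6/(3\delta^2)^4$, and this square has
    area $4\delta^2$. *)
Lemma cmass_ge A delta : 0 < delta -> delta <= A -> 24 / 81 <= Re (cmass A delta).
Proof.
move=> d0 dA; have ck := kcont_capprox d0.
have kRe x y : Re (capprox delta (x +i* y)) = 6 * delta ^+ 6 / (x ^+ 2 + y ^+ 2 + delta ^+ 2) ^+ 4.
  by rewrite capproxE.
have q0 (x y : R) : 0 < x ^+ 2 + y ^+ 2 + delta ^+ 2.
  by rewrite ltr_wpDl ?exprn_gt0// addr_ge0 ?sqr_ge0.
have kge0 x y : 0 <= Re (capprox delta (x +i* y)).
  rewrite kRe; apply: divr_ge0; last by rewrite exprn_ge0 ?(ltW (q0 x y)).
  by rewrite mulr_ge0 ?exprn_ge0 ?(ltW d0).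
have kgeD x y : - delta <= x <= delta -> - delta <= y <= delta ->
    6 / (81 * delta ^+ 2) <= Re (capprox delta (x +i* y)).
  move=> hx hy; rewrite kRe ler_pdivrMr ?mulr_gt0 ?exprn_gt0//.
  rewrite [leRHS]mulrAC ler_pdivlMr ?exprn_gt0//.
  rewrite (_ : 6 * delta ^+ 6 * (81 * delta ^+ 2) = 6 * (3 * delta ^+ 2) ^+ 4); last by ring.
  have d3 : 0 <= 3 * delta ^+ 2 by apply: mulr_ge0 => //; exact: sqr_ge0.
  rewrite ler_wpM2l//; apply: lerXn2r; rewrite ?nnegrE ?(ltW (q0 x y)) ?d3//.
  have sq t : - delta <= t <= delta -> t ^+ 2 <= delta ^+ 2.
    rewrite -ler_norml => h; rewrite -[t ^+ 2]real_normK ?num_real//.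
    by apply: lerXn2r => //; rewrite nnegrE// ltW.
  by have := sq x hx; have := sq y hy; lra.
have NA : - A <= - delta by rewrite lerN2.
have dd : - delta <= delta by rewrite ge0_cp// ltW.
have cx x : ccont (fun y => capprox delta (x +i* y)) := kcont_x x ck.
have cin : ccont (fun x : R => cint (- A) A (fun y => capprox delta (x +i* y))).
  apply: (ccont_cint (- A) A (g := fun y x => capprox delta (x +i* y))).
  exact: (ccont_swap (g := fun x y => capprox delta (x +i* y)) ck).
have inner x : - delta <= x <= delta ->
    6 / (81 * delta ^+ 2) * (delta - - delta) <= Re (cint (- A) A (fun y => capprox delta (x +i* y))).
  by move=> hx; apply: (cint_Re_sub NA dd dA (cx x)) => // y hy; exact: kgeD.
have := cint_Re_sub NA dd dA cin _ inner.
rewrite (_ : 6 / (81 * delta ^+ 2) * _ * _ = 24 / 81); last by field; rewrite gt_eqF.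
apply=> x _; apply: cint_Re_ge0 => //.
by rewrite ge0_cp// (le_trans (ltW d0)).
Qed.

Lemma cutoff (r r' : R) : 0 < r -> r < r' -> exists chi : Cn -> C,
  tst r' chi /\ forall z, Qb r z -> chi z = 1.
Proof.
move=> r0 rr'.
have /choice [th hth] := fun d => @plateau R n d r r' r0 rr'.
exists (fun z => \prod_(d <- enum {: 'I_n * bool}) th d z); split; last first.
  by move=> z Qz; rewrite big1// => d _; have [_ -> //] := hth d; exact: Qz.
split; first by apply: smooth_on_prod => [|d]; [exact: openT|have [] := hth d].
move=> z Nz; have [d hd] : exists d, r' < `|crd d z|.
  apply: contrapT => h; apply: Nz => d; rewrite leNgt; apply/negP => hd.
  by apply: h; exists d.
apply/eqP; rewrite prodf_seq_eq0; apply/hasP; exists d; first by rewrite mem_enum.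
by have [_ _ -> //=] := hth d; exact: ltW.
Qed.

(** Two errors add up: replacing [cker 0] by [cker delta] costs
    $16(3r)^2\cdot\frac{\delta}{2}B=72r^2B\delta$, and the approximate identity costs the rest. The
    half-width [3 * r] leaves room for both coordinates of $z_j$ plus [r]. *)
Lemma reproduction_approx (r delta : R) phi (B : R) z : 0 < r -> 0 < delta -> tst r phi ->
  sbound 3 phi B -> `|crd dx z| <= r -> `|crd dy z| <= r ->
  normc (conv j (cker 0) (3 * r) (dz j (dz j (dz j phi))) z - cmass (3 * r) delta * phi z) <=
  (72 * r ^+ 2 + 768) * B * delta.
Proof.
move=> r0 d0 t0 hB hx hy; have A0 : 0 <= 3 * r by rewrite mulr_ge0 ?ltW.
have t1 := tst_dz j t0; have t2 := tst_dz j t1; have t3 := tst_dz j t2.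
have ck := kcont_cker_gt0 d0; have c3 := smooth_ccont t3.1; have ca := kcont_capprox d0.
have hB3 w : normc (dz j (dz j (dz j phi)) w) <= B.
  exact: (sbound_dz j t2.1 (sbound_dz j t1.1 (sbound_dz j t0.1 hB)) (s := [::])).
have xA : `|crd dx z| + r <= 3 * r by lra.
have yA : `|crd dy z| + r <= 3 * r by lra.
have rA : r <= 2 * r by lra.
have E : conv j (cker delta) (3 * r) (dz j (dz j (dz j phi))) z =
    conv j (capprox delta) (3 * r) phi z.
  rewrite (conv_bint ck c3 t3.2 (ltW r0) xA yA rA).
  rewrite (conv_bint ca (smooth_ccont t0.1) t0.2 (ltW r0) xA yA rA).
  have us : r < 2 * r by lra.
  have A2 : 0 < 2 * r by lra.
  have c0 e : e \in [:: dx; dy] -> crd e (czero j z) = 0 by exact: crd_czero.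
  by rewrite (bint_cker (z 0 j) d0 us A2 c0 t0).
apply: le_trans (le_normc_sub (conv j (cker delta) (3 * r) (dz j (dz j (dz j phi))) z) _ _) _.
rewrite {2}E (convBk j (3 * r) z (kcont_cker0 R) ck c3).
have ckk : kcont (fun w : C => cker 0 w - cker delta w).
  by apply: ccontD; [exact: kcont_cker0|apply: ccontN].
have h1 := @conv_bound _ _ j _ _ _ z (delta / 2) B A0 ckk c3 ltac:(lra)
  (fun x y _ _ => cker_sub (x +i* y) d0) hB3.
have h2 := conv_capprox z A0 d0 t0.1 (sboundW (isT : (1 <= 3)%N) hB).
have := lerD h1 h2; move=> /le_trans; apply.
by rewrite le_eqVlt; apply/orP; left; apply/eqP; field.
Qed.

(** Evaluating the left side at 0 on a cut-off equal to 1 there defines [kappa]. It differs from the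
    masses by $O(\delta)$, so the masses converge to it, and the limit serves every [phi]. *)
Lemma reproduction (r : R) : 0 < r -> exists kappa : C, kappa != 0 /\
  forall phi z, tst r phi -> `|crd dx z| <= r -> `|crd dy z| <= r ->
    conv j (cker 0) (3 * r) (dz j (dz j (dz j phi))) z = kappa * phi z.
Proof.
move=> r0; have [th [tth th1]] := @cutoff (r / 2) r ltac:(lra) ltac:(lra).
have th0 : th 0 = 1 by apply: th1 => d; rewrite crd0 normr0 divr_ge0// ltW.
pose kappa := conv j (cker 0) (3 * r) (dz j (dz j (dz j th))) 0.
have [B hB] := tst_sbound 3 tth.
have c0 d : `|crd d (0 : Cn)| <= r by rewrite crd0 normr0 ltW.
have K delta : 0 < delta -> normc (kappa - cmass (3 * r) delta) <= (72 * r ^+ 2 + 768) * B * delta.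
  move=> d0; have := reproduction_approx r0 d0 tth hB (c0 dx) (c0 dy).
  by rewrite th0 mulr1.
have small (M e : R) : 0 <= M -> 0 < e -> exists delta, [/\ 0 < delta, delta <= 3 * r & M * delta <= e].
  move=> M0 e0; exists (Num.min (3 * r) (e / (M + 1))); split.
  - by rewrite lt_min mulr_gt0//= divr_gt0// ltr_wpDl.
  - by rewrite ge_min lexx.
  - have h : Num.min (3 * r) (e / (M + 1)) <= e / (M + 1) by rewrite ge_min lexx orbT.
    apply: le_trans (ler_wpM2l M0 h) _; rewrite mulrA ler_pdivrMr ?ltr_wpDl//.
    by rewrite mulrC ler_pM2l// lerDl.
have M1 : 0 <= 72 * r ^+ 2 + 768 by have := sqr_ge0 r; lra.
have M0 := mulr_ge0 M1 (sbound_ge0 hB).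
exists kappa; split.
  (* The masses stay above $24/81>1/10$, so their limit is not 0. *)
  apply/eqP => k0; have [delta [d0 dA]] := small _ (1 / 10) M0 ltac:(lra).
  move=> /(le_trans (K _ d0)); rewrite k0 sub0r normcN => h.
  have := cmass_ge d0 dA; have := le_trans (ler_norm _) (Re_le_normc (cmass (3 * r) delta)).
  by lra.
move=> phi z tphi hx hy; have [B' hB'] := tst_sbound 3 tphi.
have M0' := mulr_ge0 M1 (sbound_ge0 hB').
apply/eqP; rewrite -subr_eq0; apply/eqP; apply: eq0_normc; apply/eqP.
rewrite eq_le normc_ge0 andbT; apply/ler_addgt0Pr => e e0; rewrite add0r.
have [delta [d0 dA h]] := small ((72 * r ^+ 2 + 768) * B' + (72 * r ^+ 2 + 768) * B * normc (phi z)) e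
  (addr_ge0 M0' (mulr_ge0 M0 (normc_ge0 _))) e0.
apply: le_trans (le_normc_sub (cmass (3 * r) delta * phi z) _ _) _.
have h1 := reproduction_approx r0 d0 tphi hB' hx hy.
have h2 := ler_wpM2r (normc_ge0 (phi z)) (K delta d0).
rewrite -normcM mulrBl normcB in h2.
by apply: le_trans (lerD h1 h2) _; rewrite mulrDl in h; lra.
Qed.

End Reproduction.

(** * Solving the inhomogeneous Cauchy-Riemann equation in one variable *)

Section Solve.
Context (R : realType) (n : nat).
Local Notation C := R[i].
Local Notation Cn := 'rV[C]_n.
Implicit Types (phi psi : Cn -> C) (z w : Cn) (r : R) (u : functional R n) (j k : 'I_n).

Lemma dz_conv j k ker (A : R) phi z : 0 <= A -> kcont ker -> smooth_on setT phi ->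
  dz k (conv j ker A phi) z = conv j ker A (dz k phi) z.
Proof.
move=> A0 ck sphi; have [sc hc] := @conv_smooth _ _ j ker A phi A0 ck sphi.
have c1 := smooth_ccont (smooth_on_partial (k, false) sphi).
have c2 := smooth_ccont (smooth_on_partial (k, true) sphi).
rewrite dzE.
have /= -> := hc [:: (k, false)] z; have /= -> := hc [:: (k, true)] z.
have -> : dz k phi = fun z => 2^-1 * pd (k, false) phi z + 2^-1 * 'i * pd (k, true) phi z.
  by rewrite dz_pd; apply/funext => w; rewrite mulrDr mulrA.
have cz : ccont (fun w => 2^-1 * 'i * pd (k, true) phi w) by exact: ccontZ.
rewrite (convP _ A _ z ck c1 cz).
have -> : (fun w => 2^-1 * 'i * pd (k, true) phi w) = fun w => (2^-1 * 'i) * pd (k, true) phi w + (fun=> 0) w.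
  by apply/funext => w; rewrite addr0.
rewrite (convP _ A _ z ck c2 (ccont_cst _ 0)).
have -> : conv j ker A (fun=> 0) z = 0.
  have := @conv_bound _ _ j ker A (fun=> 0) z; rewrite /conv.
  move=> _; rewrite (@cint_eq _ _ _ _ (fun=> 0)) ?cint_cst ?mul0r// => x.
  by rewrite (@cint_eq _ _ _ _ (fun=> 0)) ?cint_cst ?mul0r// => y; rewrite mulr0.
by rewrite addr0 mulrC mulrDr mulrA.
Qed.

Lemma cker0_le (zeta : C) : normc (cker 0 zeta) <= normc zeta.
Proof.
rewrite /cker mul_conjC expr0n addr0 normcM normcX normc_conj normcV normc_real.
rewrite ger0_norm ?sqr_ge0//; have [->|z0] := eqVneq (normc zeta) 0.
  by rewrite expr0n mul0r.
by rewrite exprS mulfK// expf_neq0.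
Qed.

Lemma dz_lin j c phi psi : smooth_on setT phi -> smooth_on setT psi ->
  dz j (fun z => c * phi z + psi z) = fun z => c * dz j phi z + dz j psi z.
Proof.
move=> s1 s2; have oT := @openT Cn; apply/funext => z.
by rewrite (dzD _ (smooth_onZ oT c s1) s2 I) (dzZ _ _ s1 I).
Qed.

(** [S] convolves with [cker 0] after two derivatives, and the derivative in [S (dz j phi)]
    completes the reproducing formula. It does not preserve compact support in $z_j$, hence the
    restriction to a strip in that variable; in the other variables supports do not grow. *)
Lemma parametrix j r : 0 < r -> exists S : (Cn -> C) -> Cn -> C,
  [/\ forall phi, smooth_on setT phi -> smooth_on setT (S phi) /\
        forall k z, dz k (S phi) z = S (dz k phi) z,
      forall c phi psi z, smooth_on setT phi -> smooth_on setT psi ->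
        S (fun z => c * phi z + psi z) z = c * S phi z + S psi z,
      forall phi z, tst r phi -> (forall b, `|crd (j, b) z| <= r) -> S (dz j phi) z = phi z,
      forall phi r' d z, d.1 != j -> tst r' phi -> r' < `|crd d z| -> S phi z = 0 &
      exists c : R, 0 <= c /\ forall N phi B, smooth_on setT phi -> sbound N.+2 phi B ->
        sbound N (S phi) (c * B)].
Proof.
move=> r0; have [kappa [k0 hk]] := reproduction j r0; have oT := @openT Cn.
have A0 : 0 <= 3 * r by lra.
have ck := @kcont_cker0 R.
pose S phi z := kappa^-1 * conv j (cker 0) (3 * r) (dz j (dz j phi)) z.
have s2 phi : smooth_on setT phi -> smooth_on setT (dz j (dz j phi)).
  by move=> sphi; do 2!apply: (smooth_on_dz oT).
have sS phi : smooth_on setT phi -> smooth_on setT (S phi).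
  by move=> sphi; apply: (smooth_onZ oT); exact: (conv_smooth j A0 ck (s2 _ sphi)).1.
exists S; split.
- move=> phi sphi; split=> [|k z]; first exact: sS.
  rewrite (dzZ _ _ (conv_smooth j A0 ck (s2 _ sphi)).1 I) (dz_conv j k z A0 ck (s2 _ sphi)).
  rewrite /S; congr (_ * conv _ _ _ _ z); apply/funext => w.
  rewrite (dzC k j w (smooth_on_dz oT j sphi)); congr (dz j _ w).
  by apply/funext => w'; exact: dzC.
- move=> c phi psi z sphi spsi; rewrite /S (dz_lin _ _ sphi spsi).
  rewrite (dz_lin _ _ (smooth_on_dz oT j sphi) (smooth_on_dz oT j spsi)).
  rewrite (convP _ _ _ _ ck (smooth_ccont (s2 _ sphi)) (smooth_ccont (s2 _ spsi))).
  by rewrite mulrDr mulrCA.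
- by move=> phi z tphi hz; rewrite /S (hk _ _ tphi (hz false) (hz true)) mulKf.
- move=> phi r' [l b] z /= lj tphi hd; rewrite /S.
  have t2 := tst_dz j (tst_dz j tphi).
  have out x y : dz j (dz j phi) (cshift j z x y) = 0.
    apply: t2.2 => /(_ (l, b)); rewrite /cshift !crd_mv !xpair_eqE (negbTE lj) /= !addr0.
    by rewrite leNgt hd.
  rewrite /conv (@cint_eq _ _ _ _ (fun=> 0)) ?cint_cst ?mul0r ?mulr0// => x.
  by rewrite (@cint_eq _ _ _ _ (fun=> 0)) ?cint_cst ?mul0r// => y; rewrite out mulr0.
- exists (normc kappa^-1 * (16 * (3 * r) ^+ 2 * (6 * r))); split.
    by rewrite !mulr_ge0 ?normc_ge0 ?sqr_ge0//; lra.
  move=> N phi B sphi hB s z sN.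
  have [sc hc] := conv_smooth j A0 ck (s2 _ sphi).
  rewrite /S (partialsZ _ s oT sc I) hc normcM -!mulrA ler_wpM2l ?normc_ge0//.
  have sb := sbound_dz j (smooth_on_dz oT j sphi) (sbound_dz j sphi hB).
  have cs := smooth_ccont (smooth_on_partials s (s2 _ sphi)).
  apply: le_trans (@conv_bound _ _ j (cker 0) (3 * r) _ z (6 * r) B A0 ck cs _ _ _) _.
  + by lra.
  + move=> x y hx hy; apply: le_trans (cker0_le _) _; apply: le_trans (normc_le_ReIm _) _ => /=.
    by rewrite -!ler_norml in hx hy; lra.
  + by move=> w; exact: sb.
  + by rewrite !mulrA.
Qed.

Lemma sboundM N f g (H B : R) : smooth_on setT f -> smooth_on setT g -> sbound N f H ->
  sbound N g B -> sbound N (fun z : Cn => f z * g z) (2 ^+ N * H * B).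
Proof.
move=> sf sg hf hg s z sN; have oT := @openT Cn.
apply: le_trans (partialsM_bound oT sf sg I (H := H) (B := B) _ _) _.
- by move=> t tN; apply: hf; exact: leq_trans sN.
- by move=> t tN; apply: hg; exact: leq_trans sN.
rewrite -mulrA ler_wpM2r ?mulr_ge0 ?(sbound_ge0 hf) ?(sbound_ge0 hg)//.
by rewrite ler_eXn2l ?ltr1n.
Qed.

(* v is a solution of dv/dzbar_j = u; it is [- u (chi * S phi)] for a
   parametrix S of d/dzbar_j and a cut-off chi in the variable z_j only, so that
   it inherits the other equations satisfied by u. *)
Lemma dz_solve u r r' j : 0 < r' -> r' < r -> dist r u ->
  exists v, [/\ dist r' v,
    forall phi, tst r' phi -> v (dz j phi) = - u phi &
    forall k, k != j -> (forall phi, tst r phi -> u (dz k phi) = 0) ->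
      forall phi, tst r' phi -> v (dz k phi) = 0].
Proof.
move=> r'0 rr' du; have r0 := lt_trans r'0 rr'; have oT := @openT Cn.
have [S [Ssm Slin Srep Ssupp [c [c0 Sb]]]] := parametrix j r0.
have [th1 [sth1 th11 th10 dth1]] := @plateau R n (j, false) r' r r'0 rr'.
have [th2 [sth2 th21 th20 dth2]] := @plateau R n (j, true) r' r r'0 rr'.
pose chi z := th1 z * th2 z.
have schi : smooth_on setT chi by exact: (smooth_onM oT).
have chi1 z : Qb r' z -> chi z = 1 by move=> Q; rewrite /chi th11 ?th21 ?mulr1//; exact: Q.
have chi0 z b : r <= `|crd (j, b) z| -> chi z = 0.
  by case: b => h; rewrite /chi ?(th20 _ h) ?(th10 _ h) ?mulr0 ?mul0r.
have dchi k z : k != j -> dz k chi z = 0.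
  move=> kj; rewrite dzE /chi !(partialM _ sth1 sth2 I).
  by rewrite !dth1 ?dth2 ?xpair_eqE ?(negbTE kj)// !(mul0r, mulr0, addr0).
have cS phi : tst r' phi -> tst r (fun z => chi z * S phi z).
  move=> tphi; split; first exact: (smooth_onM oT schi (Ssm _ tphi.1).1).
  move=> z Nz; have [[l b] hd] : exists d, r < `|crd d z|.
    apply: contrapT => h; apply: Nz => d; rewrite leNgt; apply/negP => hd.
    by apply: h; exists d.
  have [e|lj] := eqVneq l j; first by rewrite (chi0 z b) ?mul0r// -e ltW.
  by rewrite (Ssupp phi r' (l, b)) ?mulr0// (lt_trans rr').
(* [chi] depends on $z_j$ only and need not have compact support, so [tst_sbound] does not apply to
   it; [chi2] changes nothing where [chi * S phi] lives and supplies the seminorm bound. *)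
have [chi2 [tchi2 hchi2]] := @cutoff R n r (r + 1) r0 ltac:(lra).
have chiE phi z : tst r' phi -> chi z * S phi z = (chi z * chi2 z) * S phi z.
  move=> tphi; have [Q|NQ] := pselect (Qb r z); first by rewrite hchi2// mulr1.
  have /= e := (cS _ tphi).2 z NQ; by rewrite [RHS]mulrAC e mul0r.
have tchi : tst (r + 1) (fun z => chi z * chi2 z).
  by apply: (@tst_mul _ _ (r + 1) (r + 2)) => //; [lra|exact: smooth_onW schi].
exists (fun phi => - u (fun z => chi z * S phi z)); split.
- apply: distribN; apply: (dist_comp (r := r') (T := fun phi z => chi z * S phi z) du) => //.
  + move=> a phi psi t1 t2 z; rewrite (Slin _ _ _ _ t1.1 t2.1) mulrDr.
    by congr (_ + _); rewrite mulrCA.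
  + move=> N; have [H hH] := tst_sbound N tchi.
    exists N.+2, (2 ^+ N * H * c); split.
      by rewrite !mulr_ge0 ?(sbound_ge0 hH) ?exprn_ge0.
    move=> phi B tphi hB s z sN.
    have -> : (fun z => chi z * S phi z) = fun z => (chi z * chi2 z) * S phi z.
      by apply/funext => w; exact: chiE.
    rewrite -mulrA; exact: (sboundM tchi.1 (Ssm _ tphi.1).1 hH (Sb N _ _ tphi.1 hB)).
(* On the strip where both coordinates of $z_j$ are at most [r], the parametrix inverts
   $\partial/\partial\bar z_j$ and [chi] is 1 where [phi] lives; off the strip [chi] and [phi] both
   vanish. *)
- move=> phi tphi; congr (- _); apply: dist_eq => z.
  have [Q|NQ] := pselect (forall b, `|crd (j, b) z| <= r).
    rewrite (Srep _ _ (tstW (ltW rr') tphi) Q).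
    have [Q'|NQ'] := pselect (Qb r' z); first by rewrite chi1// mul1r.
    by rewrite tphi.2// mulr0.
  have [b hb] : exists b, r < `|crd (j, b) z|.
    apply: contrapT => h; apply: NQ => b; rewrite leNgt; apply/negP => hb.
    by apply: h; exists b.
  rewrite (chi0 z b) ?mul0r ?ltW// tphi.2// => /(_ (j, b)).
  by rewrite leNgt (lt_trans rr' hb).
- move=> k kj uk phi tphi; rewrite (dist_eq u (psi := dz k (fun z => chi z * S phi z))).
    by rewrite uk ?oppr0//; exact: cS.
  move=> z; rewrite (dzM _ schi (Ssm _ tphi.1).1 I) dchi// mul0r add0r.
  by rewrite (Ssm _ tphi.1).2.
Qed.

End Solve.

(** * Dolbeault's lemma for currents *)

(** Terms below and above the diagonal cancel. The diagonal is excluded, as $x=-x$ does not force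
    $x=0$ in an additive group. *)
Lemma sum_antisym (V : zmodType) (p : nat) (P : pred 'I_p) (F : 'I_p -> 'I_p -> V) :
  (forall i j, P i -> P j -> i != j -> F i j = - F j i) ->
  \sum_(j | P j) \sum_(i | P i && (i != j)) F i j = 0.
Proof.
move=> FN; rewrite (eq_bigr (fun j : 'I_p => \sum_(i | P i && (i < j)%N) F i j +
  \sum_(i | P i && (j < i)%N) F i j)); last first.
  move=> j _; rewrite (bigID (fun i : 'I_p => (i < j)%N)) /=; congr (_ + _); apply: eq_bigl => i.
    by rewrite -andbA; case: ltngtP => [||/val_inj ->]; rewrite ?andbF ?andbT// => h;
      rewrite -val_eqE /= ?(ltn_eqF h) ?andbT.
  rewrite -andbA -leqNgt; case: ltngtP => [||/val_inj ->]; rewrite ?eqxx ?andbF ?andbT// => h.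
  by rewrite -val_eqE /= eq_sym (ltn_eqF h) andbT.
rewrite big_split /= [X in _ + X](exchange_big_dep P) /=; last by move=> i j _ /andP[].
rewrite -big_split /= big1// => j Pj.
rewrite [X in _ + X](eq_bigl (fun i : 'I_p => P i && (i < j)%N)); last first.
  by move=> i; rewrite Pj.
rewrite -big_split /= big1// => i /andP[Pi ij].
by rewrite (FN i j) ?addNr// -val_eqE /= ltn_eqF.
Qed.

Lemma ext_signD1 (p : nat) (L : {set 'I_p}) (i j : 'I_p) : i \in L -> i != j ->
  ext_sign j L = ((i < j) + ext_sign j (L :\ i))%N.
Proof.
move=> iL ij; rewrite /ext_sign (cardD1 i) !inE iL /=; congr (_ + _)%N.
by apply: eq_card => k; rewrite !inE andbA.
Qed.

(** The rule $e_i\wedge e_j=-e_j\wedge e_i$ in terms of [ext_sign]: removing the smaller index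
    lowers the count of the larger one, and not conversely. *)
Lemma ext_sign_swap (A : pzRingType) (p : nat) (L : {set 'I_p}) (i j : 'I_p) :
  i \in L -> j \in L -> i != j ->
  (-1) ^+ ext_sign j L * (-1) ^+ ext_sign i (L :\ j) =
  - ((-1) ^+ ext_sign i L * (-1) ^+ ext_sign j (L :\ i)) :> A.
Proof.
move=> iL jL ij; rewrite -!exprD (ext_signD1 iL ij) (ext_signD1 jL) 1?eq_sym//.
move: (ext_sign j _) (ext_sign i _) => a b; case: (ltngtP i j) => h.
- by rewrite add0n add1n addSn exprS mulN1r addnC.
- by rewrite add0n add1n addSn exprS mulN1r opprK addnC.
by move: ij; rewrite (val_inj h) eqxx.
Qed.

Section Dbar.
Context (R : realType) (n : nat).
Local Notation C := R[i].
Local Notation Cn := 'rV[C]_n.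
Implicit Types (phi psi : Cn -> C) (z w : Cn) (r : R) (u : functional R n) (j k : 'I_n)
  (T S : current R n) (I L : {set 'I_n}).

Lemma dbarE T I phi :
  dbar T I phi = \sum_(j in I) (-1) ^+ ext_sign j I * - T (I :\ j) (dz j phi).
Proof. by rewrite dz_dzbar. Qed.

Lemma dist_dz r u j : dist r u -> dist r (fun phi => u (dz j phi)).
Proof.
move=> du; apply: (dist_comp (r := r) (T := fun phi => dz j phi) du).
- by move=> phi; exact: tst_dz.
- by move=> c phi psi t1 t2 z; rewrite (dz_lin _ _ t1.1 t2.1).
- move=> N; exists N.+1, 1; split=> // phi B tphi hB; rewrite mul1r.
  exact: sbound_dz tphi.1 hB.
Qed.

Lemma dist_dbar r T I : (forall I, dist r (T I)) -> dist r (dbar T I).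
Proof.
move=> dT; have h : dist r (fun phi => \sum_(j in I) (-1) ^+ ext_sign j I * - T (I :\ j) (dz j phi)).
  apply: distrib_sum => j _; apply: distribZ; apply: distribN; exact: dist_dz.
by have -> : dbar T I = (fun phi => \sum_(j in I) (-1) ^+ ext_sign j I * - T (I :\ j) (dz j phi))
  by apply/funext => phi; exact: dbarE.
Qed.

Lemma dbarD T S I phi : dbar (fun I phi => T I phi + S I phi) I phi = dbar T I phi + dbar S I phi.
Proof. by rewrite !dbarE -big_split; apply: eq_bigr => j _; rewrite opprD mulrDr. Qed.

Lemma dbarN T I phi : dbar (fun I phi => - T I phi) I phi = - dbar T I phi.
Proof. by rewrite !dbarE -sumrN; apply: eq_bigr => j _; rewrite mulrN. Qed.

Lemma dbar_dbar r T I phi : (forall I, dist r (T I)) -> tst r phi -> dbar (dbar T) I phi = 0.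
Proof.
move=> dT tphi; rewrite dbarE.
rewrite (eq_bigr (fun j => \sum_(i | (i \in I) && (i != j))
  ((-1) ^+ ext_sign j I * (-1) ^+ ext_sign i (I :\ j)) * T (I :\ j :\ i) (dz i (dz j phi)))).
  apply: sum_antisym => i j iI jI ij; rewrite (ext_sign_swap _ iI jI ij) mulNr.
  congr (- (_ * _)); rewrite !finset.setDDl finset.setUC; congr (T _ _).
  by apply/funext => z; exact: dzC tphi.1.
move=> j jI; rewrite dbarE mulrN -mulNr big_distrr /=; apply: eq_big => [i|i _].
  by rewrite !inE andbC.
by rewrite mulrN mulNr mulrN opprK mulrA.
Qed.

Lemma dbar_degree r q T I phi : (forall I psi, #|I| <> q -> tst r psi -> T I psi = 0) ->
  #|I| <> q.+1 -> tst r phi -> dbar T I phi = 0.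
Proof.
move=> dT Iq tphi; rewrite dbarE big1// => j jI.
rewrite dT ?oppr0 ?mulr0//; last exact: tst_dz.
by move=> h; apply: Iq; rewrite (cardsD1 j) jI h.
Qed.

Definition low_index (k : nat) I := [forall i in I, (i < k)%N].

Lemma low_indexP (k : nat) I : reflect (forall i, i \in I -> (i < k)%N) (low_index k I).
Proof. by apply: (iffP forall_inP). Qed.

(** Induction on the number [k] of differentials $d\bar z_i$ that may occur. The part of $T$
    containing the last one, $d\bar z_K$, is removed by solving in $z_K$. As $T$ is closed and free
    of later differentials, its coefficients are killed by $\partial/\partial\bar z_j$ for $j>K$;
    [dz_solve] preserves this, so the correction creates no later differentials. *)
Lemma dolbeault_step (k q : nat) T r r' : (k <= n)%N -> 0 < r' -> r' < r ->
  (forall I, dist r (T I)) ->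
  (forall I phi, #|I| <> q.+1 -> tst r phi -> T I phi = 0) ->
  (forall I phi, ~~ low_index k I -> tst r phi -> T I phi = 0) ->
  (forall I phi, tst r phi -> dbar T I phi = 0) ->
  exists S, [/\ forall I, dist r' (S I),
    forall I phi, #|I| <> q -> tst r' phi -> S I phi = 0 &
    forall I phi, tst r' phi -> dbar S I phi = T I phi].
Proof.
elim: k T r => [|k ih] T r kn r'0 rr' dT qT lT cT.
  exists (fun _ _ => 0); split=> [I|//|I phi tphi]; first exact: dist_zero.
  rewrite dbarE big1; last by move=> j _; rewrite oppr0 mulr0.
  have t := tstW (ltW rr') tphi; symmetry.
  have [I0|[i iI]] := set_0Vmem I; first by apply: qT => //; rewrite I0 cards0.
  by apply: lT => //; apply/negP => h; have := elimT (low_indexP 0%N I) h i iI.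
(* Each step spends half of the remaining margin between the two radii. *)
pose K : 'I_n := Ordinal kn; pose s := (r + r') / 2.
have s0 : 0 < s by rewrite /s; lra.
have r's : r' < s by rewrite /s; lra.
have sr : s < r by rewrite /s; lra.
have tsr phi : tst s phi -> tst r phi := tstW (ltW sr).
have /choice[v hv] := fun I => dz_solve K s0 sr (dT I).
(* The sign undoes the one in [dbar], whose minus sign is cancelled by
   $v(\partial\varphi/\partial\bar z_K)=-u(\varphi)$. *)
pose S : current R n := fun I phi =>
  if low_index k I && (#|I| == q) then (-1) ^+ ext_sign K (K |: I) * v (K |: I) phi else 0.
have dS I : dist s (S I).
  rewrite /S; case: (low_index k I && (#|I| == q)); last exact: dist_zero.
  by apply: distribZ; have [] := hv (K |: I).
have qS I phi : #|I| <> q -> S I phi = 0 by move=> /eqP/negPf h; rewrite /S h andbF.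
have lS I phi : ~~ low_index k I -> S I phi = 0 by move=> /negPf h; rewrite /S h.
have hdS I phi : ~~ low_index k I -> tst s phi -> dbar S I phi = T I phi.
  move=> lI tphi; rewrite dbarE.
  have [Iq|Iq] := eqVneq #|I| q.+1; last first.
    rewrite qT//; [|exact/eqP|exact: tsr].
    rewrite big1// => j jI; rewrite qS ?oppr0 ?mulr0// => h.
    by move/eqP: Iq; apply; rewrite (cardsD1 j) jI h.
  have [hI|hI] := boolP (low_index k.+1 I); last first.
    rewrite lT//; last exact: tsr.
    rewrite big1// => j jI; have [l|l] := boolP (low_index k (I :\ j)); last first.
      by rewrite lS// oppr0 mulr0.
    have {}hI : ~~ (j <= k)%N.
      apply: contra hI => jk; apply/low_indexP => i iI; rewrite ltnS.
      have [->//|ij] := eqVneq i j.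
      by apply: ltnW; move/low_indexP: l; apply; rewrite !inE ij.
    have jK : j != K by apply: contra hI => /eqP ->.
    rewrite /S l /= (_ : #|_| == q); last first.
      by apply/eqP; apply/eqP; rewrite -eqSS -Iq (cardsD1 j I) jI.
    have [_ _ /(_ j jK) h] := hv (K |: I :\ j); rewrite h ?mulr0 ?oppr0 ?mulr0//.
    (* In this coefficient of $\bar\partial T$ every term but the one differentiating in $z_j$
       leaves $j>K$ in the index set and vanishes. *)
    move=> psi tpsi; have := cT (j |: (K |: I :\ j)) psi tpsi.
    rewrite dbarE (bigD1 j) ?setU11//= big1; last first.
      move=> i /andP[_ ij]; rewrite lT ?oppr0 ?mulr0//; last exact: tst_dz.
      apply: contra hI => /low_indexP /(_ j); rewrite !inE eqxx eq_sym ij /=.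
      by rewrite ltnS; apply.
    have -> : (j |: (K |: I :\ j)) :\ j = K |: I :\ j.
      by rewrite setU1K// !inE (negbTE jK) eqxx.
    rewrite addr0 => /eqP; rewrite mulf_eq0 signr_eq0 oppr_eq0 /= => /eqP.
    by [].
  have KI : K \in I.
    apply: contraR lI => KI; apply/low_indexP => i iI.
    move/low_indexP: hI => /(_ i iI); rewrite ltnS leq_eqVlt => /orP[/eqP h|//].
    by move: KI; rewrite (_ : K = i) ?iI//; apply: val_inj.
  rewrite (bigD1 K)//= big1 ?addr0; last first.
    move=> j /andP[jI jK]; rewrite lS ?oppr0 ?mulr0//.
    by apply/negP => /low_indexP /(_ K); rewrite !inE eq_sym jK KI ltnn => /(_ isT).
  rewrite /S (_ : low_index k _ && _); last first.
    apply/andP; split; last by rewrite -eqSS -Iq (cardsD1 K I) KI.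
    apply/low_indexP => i; rewrite !inE => /andP[iK iI].
    move/low_indexP: hI => /(_ i iI); rewrite ltnS leq_eqVlt => /orP[/eqP h|//].
    by case/eqP: iK; apply: val_inj.
  rewrite finset.setD1K//; have [_ -> // _] := hv I.
  by rewrite !mulrN opprK mulrA -expr2 sqrr_sign mul1r.
(* What is left involves only differentials with index below [k] and is still closed, so the
   induction hypothesis applies to it. *)
pose T' : current R n := fun I phi => T I phi + - dbar S I phi.
have dT' I : dist s (T' I).
  by apply: distribD; [exact: (distW (ltW sr))|apply: distribN; exact: dist_dbar].
have qT' I phi : #|I| <> q.+1 -> tst s phi -> T' I phi = 0.
  move=> Iq tphi; rewrite /T' qT// ?(dbar_degree _ Iq tphi) ?subr0//; last exact: tsr.
  by move=> J psi Jq _; exact: qS.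
have lT' I phi : ~~ low_index k I -> tst s phi -> T' I phi = 0.
  by move=> lI tphi; rewrite /T' hdS// subrr.
have cT' I phi : tst s phi -> dbar T' I phi = 0.
  move=> tphi; rewrite /T' dbarD dbarN cT ?(dbar_dbar _ dS tphi) ?subr0//; exact: tsr.
have [S' [dS' qS' hS']] := ih T' s (ltnW kn) r'0 r's dT' qT' lT' cT'.
exists (fun I phi => S I phi + S' I phi); split=> [I|I phi Iq tphi|I phi tphi].
- by apply: distribD => //; exact: (distW (ltW r's)).
- by rewrite qS// qS'// addr0.
- by rewrite dbarD hS'// /T' addrC subrK.
Qed.

Theorem dolbeault (q : nat) T r r' : 0 < r' -> r' < r ->
  (forall I, dist r (T I)) ->
  (forall I phi, #|I| <> q.+1 -> tst r phi -> T I phi = 0) ->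
  (forall I phi, tst r phi -> dbar T I phi = 0) ->
  exists S, [/\ forall I, dist r' (S I),
    forall I phi, #|I| <> q -> tst r' phi -> S I phi = 0 &
    forall I phi, tst r' phi -> dbar S I phi = T I phi].
Proof.
move=> r'0 rr' dT qT cT; apply: (dolbeault_step (leqnn n) r'0 rr' dT qT _ cT).
by move=> I phi /negP[]; apply/low_indexP => i _; exact: ltn_ord.
Qed.

End Dbar.

(** * Weyl's lemma *)

Section Smoothing.
Context (R : realType) (n : nat) (j : 'I_n).
Local Notation C := R[i].
Local Notation Cn := 'rV[C]_n.
Local Notation dx := (j, false).
Local Notation dy := (j, true).
Implicit Types (f phi psi : Cn -> C) (z w : Cn) (r A eps : R) (d : 'I_n * bool).

(** The smoothness calculus is set up for functions on [Cn]; a kernel of one complex variable is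
    therefore read as a function on the $j$-th coordinate axis. *)
Definition axis (x y : R) : Cn := mv (mv 0 dx x) dy y.

Definition proj w : Cn := axis (crd dx w) (crd dy w).

Lemma continuous_axis : continuous (fun q : R * R => axis q.1 q.2).
Proof.
apply: (@continuous_mv_gen _ _ _ (fun q : R * R => mv (0 : Cn) dx q.1) (fun q => q.2)).
  apply: (@continuous_mv_gen _ _ _ (fun _ : R * R => (0 : Cn)) (fun q => q.1)).
    exact: continuous_rV_cst.
  exact: continuous_fst.
exact: continuous_snd.
Qed.

Lemma continuous_proj : continuous proj.
Proof.
apply: (@continuous_compo _ _ _ (fun w : Cn => (crd dx w, crd dy w)) (fun q : R * R => axis q.1 q.2)).
  by apply: continuous_pair; exact: continuous_crd.
exact: continuous_axis.
Qed.

Lemma crd_axis (x y : R) d : crd d (axis x y) = if d.1 == j then (if d.2 then y else x) else 0.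
Proof.
rewrite /axis !crd_mv crd0 add0r; case: d => k b /=; rewrite !xpair_eqE.
by case: eqP => _ /=; case: b; rewrite /= ?addr0 ?add0r.
Qed.

Lemma crd_proj d w : crd d (proj w) = if d.1 == j then crd d w else 0.
Proof. by rewrite /proj crd_axis; case: d => k b /=; case: eqP => // ->; case: b. Qed.

Lemma proj_mv w d (t : R) : proj (mv w d t) = mv (proj w) d ((d.1 == j)%:R * t).
Proof.
apply: crdP => e; rewrite crd_mv !crd_proj !crd_mv.
case: (eqVneq e d) => [->|_]; last by rewrite !addr0.
by case: eqP => _; rewrite ?mul1r ?mul0r ?addr0.
Qed.

Lemma axis_coord (x y : R) : axis x y 0 j = x +i* y.
Proof.
rewrite /axis !mvE eqxx /= mxE; apply: eqC;
  rewrite !(ReD, ImD, ReM, ImM) /=; ring.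
Qed.

Lemma proj_coord w : proj w 0 j = w 0 j.
Proof. by rewrite /proj axis_coord /crd /=; case: (w 0 j). Qed.

Lemma smooth_on_proj (W : set Cn) f : open W -> smooth_on W f ->
  smooth_on (proj @^-1` W) (fun w => f (proj w)).
Proof. exact: (smooth_on_subst continuous_proj proj_mv). Qed.

Lemma conv_eq0 ker A phi z : (forall x y, ker (x +i* y) * phi (cshift j z x y) = 0) ->
  conv j ker A phi z = 0.
Proof.
move=> h; rewrite /conv (@cint_eq _ _ _ _ (fun=> 0)) ?cint_cst ?mul0r// => x.
by rewrite (@cint_eq _ _ _ _ (fun=> 0)) ?cint_cst ?mul0r// => y.
Qed.

Lemma crd_cshift z (x y : R) d : crd d (cshift j z x y) =
  crd d z - (if d.1 == j then (if d.2 then y else x) else 0).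
Proof.
rewrite /cshift !crd_mv; case: d => k b /=; rewrite !xpair_eqE.
by case: eqP => _ /=; case: b; rewrite /= ?addr0 ?subr0.
Qed.

Definition box_kernel eps (ker : C -> C) :=
  forall zeta, eps < `|Re zeta| \/ eps < `|Im zeta| -> ker zeta = 0.

Lemma conv_box ker A phi z r r' eps : box_kernel eps ker -> tst r phi ->
  (forall z b, r' < `|crd (j, b) z| -> phi z = 0) -> r' + eps <= r ->
  ~ Qb r z -> conv j ker A phi z = 0.
Proof.
move=> bk tphi sphi re Nz.
have [[l b] hd] : exists d, r < `|crd d z|.
  apply: contrapT => h; apply: Nz => d; rewrite leNgt; apply/negP => hd.
  by apply: h; exists d.
apply: conv_eq0 => x y; have [e|lj] := eqVneq l j; last first.
  rewrite tphi.2 ?mulr0// => /(_ (l, b)); rewrite crd_cshift /= (negPf lj) subr0.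
  by rewrite leNgt hd.
have [hk|hk] := ltP eps `|(if b then y else x)|.
  by rewrite bk ?mul0r//; move: hk; case: (b) => h; [right|left].
rewrite (sphi _ b) ?mulr0// crd_cshift /= eqxx; rewrite e in hd.
by have := ler_distD `|(if b then y else x)| (crd (j, b) z) 0; have := lerB_dist (crd (j, b) z) (if b then y else x); lra.
Qed.

Lemma conv_box_supp ker A phi r' eps : box_kernel eps ker ->
  (forall z b, r' < `|crd (j, b) z| -> phi z = 0) ->
  forall z b, r' + eps < `|crd (j, b) z| -> conv j ker A phi z = 0.
Proof.
move=> bk sphi z b hd; apply: conv_eq0 => x y.
have [hk|hk] := ltP eps `|(if b then y else x)|.
  by rewrite bk ?mul0r//; move: hk; case: (b) => h; [right|left].
rewrite (sphi _ b) ?mulr0// crd_cshift /= eqxx.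
by have := lerB_dist (crd (j, b) z) (if b then y else x); lra.
Qed.

(* The third derivative of the smooth part [F], unlike [F], is compactly supported in the
   variable w_j. *)
Lemma kernel_splitting eps : 0 < eps -> exists (k0 : C -> C) (F : Cn -> C),
  [/\ kcont k0, box_kernel eps k0, smooth_on setT F,
      forall w, cker 0 (w 0 j) = k0 (w 0 j) + F w &
      (forall w, F w = F (proj w)) /\
      forall w, eps < `|crd dx w| \/ eps < `|crd dy w| -> dz j (dz j (dz j F)) w = 0].
Proof.
move=> e0; have oT := @openT Cn.
have [th1 [sth1 th11 th10 _]] := @plateau R n dx (eps / 2) eps ltac:(lra) ltac:(lra).
have [th2 [sth2 th21 th20 _]] := @plateau R n dy (eps / 2) eps ltac:(lra) ltac:(lra).
pose chi0 w := th1 w * th2 w; have schi0 : smooth_on setT chi0 by exact: (smooth_onM oT).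
pose chi w := chi0 (proj w).
have schi : smooth_on setT chi by exact: (smooth_on_proj oT schi0).
have proj_proj w : proj (proj w) = proj w by apply: crdP => d; rewrite !crd_proj; case: eqP.
have chi_p w : chi (proj w) = chi w by rewrite /chi proj_proj.
have chi_out w : eps <= `|crd dx w| \/ eps <= `|crd dy w| -> chi w = 0.
  rewrite /chi /chi0; case=> h; first by rewrite th10 ?mul0r// crd_proj eqxx.
  by rewrite th20 ?mulr0// crd_proj eqxx.
have chi_in w : `|crd dx w| <= eps / 2 -> `|crd dy w| <= eps / 2 -> chi w = 1.
  by move=> h1 h2; rewrite /chi /chi0 th11 ?th21 ?mulr1// crd_proj eqxx.
pose k0 (zeta : C) := chi (axis (Re zeta) (Im zeta)) * cker 0 zeta.
have k0E w : k0 (w 0 j) = chi w * cker 0 (w 0 j).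
  by rewrite /k0 -[axis _ _]/(proj w) chi_p.
(* Near $w_j=0$ the factor [1 - chi] vanishes, and elsewhere the kernel is the smooth function [E];
   so [F] is smooth although [cker 0] is not. *)
pose F w := (1 - chi w) * cker 0 (w 0 j).
pose E w := (w 0 j)^* ^+ 2 * (w 0 j)^-1 : C.
have cE w : w 0 j != 0 -> cker 0 (w 0 j) = E w.
  move=> h; have hc : (w 0 j)^* != 0 by rewrite conjc_eq0.
  by rewrite /cker /E expr0n addr0; move: (w 0 j)^* (w 0 j) hc h => a c hc h; field; rewrite hc h.
pose W := [set w : Cn | w 0 j != 0].
have oW : open W.
  have -> : W = [set w | [set x : R | x != 0] (crd dx w)] `|` [set w | [set x : R | x != 0] (crd dy w)].
    apply/seteqP; split=> w /=; rewrite /W /crd /=; case: (w 0 j) => a b /=.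
      by rewrite eq_complex /= negb_and => /orP.
    by move=> h; rewrite eq_complex /= negb_and; apply/orP.
  have oN : open [set x : R | x != 0] by exact: open_neq.
  by apply: openU; exact: open_crd.
have sZ := smooth_onW (@subsetT _ W) (smooth_coord R j).
have sC := smooth_onW (@subsetT _ W) (smooth_conj_coord R j).
have sV : smooth_on W (fun w : Cn => (w 0 j)^-1) by apply: (smooth_onV oW sZ).
have sE : smooth_on W E by apply: (smooth_onM oW) => //; exact: (smooth_onX oW).
have sF : smooth_on setT F.
  pose W0 := [set w : Cn | [set x : R | `|x| < eps / 2] (crd dx w)] `&` [set w | [set x : R | `|x| < eps / 2] (crd dy w)].
  have oB : open [set x : R | `|x| < eps / 2].
    apply: (@open_comp _ _ (fun x : R => `|x|) [set y | y < eps / 2]); last exact: open_lt.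
    by move=> x _; exact: norm_continuous.
  have oW0 : open W0 by apply: openI; exact: open_crd.
  apply: (@smooth_on_setU _ _ W0 W).
  - apply: (smooth_on_eq oW0 _ (smooth_on_cst oW0 0)) => w [/= h1 h2].
    by rewrite /F chi_in ?subrr ?mul0r// ltW.
  - apply: (@smooth_on_eq _ _ _ (fun w => (1 - chi w) * E w)) => //.
      by move=> w Ww; rewrite /F cE.
    apply: (smooth_onM oW) => //; apply: (smooth_onB oW); first exact: smooth_on_cst.
    exact: (smooth_onW (@subsetT _ W) schi).
  - move=> w; have [w0|w0] := eqVneq (w 0 j) 0; last by right.
    by left; rewrite /W0 /= /crd /= w0 /= normr0; split; lra.
exists k0, F; split.
- apply: ccontM; last exact: kcont_cker0.
  exact: (ccont_comp (smooth_ccont schi) continuous_axis).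
- by move=> zeta h; rewrite /k0 chi_out ?mul0r// !crd_axis eqxx /=; case: h => /ltW; [left|right].
- exact: sF.
- by move=> w; rewrite k0E /F mulrBl mul1r addrC subrK.
- split=> [w|]; first by rewrite /F chi_p proj_coord.
(* The successive $\bar w_j$-derivatives of $\bar w_j^2/w_j$ are $2\bar w_j/w_j$, $2/w_j$ and 0. *)
have d1 w : W w -> dz j E w = 2 * ((w 0 j)^* * (w 0 j)^-1).
  move=> Ww; rewrite (dzM _ (smooth_onX oW 2 sC) sV Ww) (dzX oW _ _ sC Ww) dz_conj_coord eqxx.
  by rewrite (dzV _ sZ Ww Ww) dz_coord oppr0 mul0r mulr0 addr0 /=; ring.
have d2 w : W w -> dz j (dz j E) w = 2 * (w 0 j)^-1.
  move=> Ww; rewrite (dz_eq_on j oW d1 Ww) (dzZ _ _ (smooth_onM oW sC sV) Ww) (dzM _ sC sV Ww).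
  by rewrite dz_conj_coord eqxx (dzV _ sZ Ww Ww) dz_coord oppr0 mul0r mulr0 addr0 mul1r.
have d3 w : W w -> dz j (dz j (dz j E)) w = 0.
  move=> Ww; rewrite (dz_eq_on j oW d2 Ww) (dzZ _ _ sV Ww).
  by rewrite (dzV _ sZ Ww Ww) dz_coord oppr0 mul0r mulr0.
pose W1 := [set w : Cn | [set x : R | eps < `|x|] (crd dx w)] `|` [set w | [set x : R | eps < `|x|] (crd dy w)].
have oW1 : open W1.
  have oB : open [set x : R | eps < `|x|].
    apply: (@open_comp _ _ (fun x : R => `|x|) [set y | eps < y]); last exact: open_gt.
    by move=> x _; exact: norm_continuous.
  by apply: openU; exact: open_crd.
have FE w' : W1 w' -> F w' = E w'.
  move=> hw; rewrite /F chi_out ?subr0 ?mul1r; last by case: hw => /= /ltW; [left|right].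
  apply: cE; apply/eqP => w0; move: hw; rewrite /W1 /= /crd /= w0 /= normr0.
  by case; lra.
move=> w h; have Ww : W w.
  by apply/eqP => w0; move: h; rewrite /crd /= w0 /= normr0; case; lra.
rewrite (dz_eq_on j oW1 (dz_eq_on j oW1 (dz_eq_on j oW1 FE)) (h : W1 w)).
exact: d3.
Qed.

Lemma dz_proj f w : smooth_on setT f -> dz j (fun w => f (proj w)) w = dz j f (proj w).
Proof.
move=> sf; rewrite !dzE.
rewrite (partial_subst proj_mv dx sf I).
rewrite (partial_subst proj_mv dy sf I).
by rewrite /= eqxx !mul1r.
Qed.

(** The point of the axis with coordinate $c-w_j$; through it a convolution kernel becomes a
    function of the integration variable. *)
Definition reflect_axis (c : C) w : Cn := axis (Re c - crd dx w) (Im c - crd dy w).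

Lemma reflect_axisE c w : reflect_axis c w = axis (Re (c - w 0 j)) (Im (c - w 0 j)).
Proof. by rewrite /reflect_axis /crd /= !ReD !ImD ReN ImN. Qed.

Lemma continuous_reflect_axis c : continuous (reflect_axis c).
Proof.
apply: (@continuous_compo _ _ _ (fun w : Cn => (Re c - crd dx w, Im c - crd dy w)) (fun q : R * R => axis q.1 q.2)).
  apply: continuous_pair.
    exact: (@continuous_compo _ _ _ (fun w : Cn => crd dx w) (fun t => Re c - t)
      (@continuous_crd R n dx) (@rcont_opp R _)).
  exact: (@continuous_compo _ _ _ (fun w : Cn => crd dy w) (fun t => Im c - t)
    (@continuous_crd R n dy) (@rcont_opp R _)).
exact: continuous_axis.
Qed.

Lemma reflect_axis_mv c w d (t : R) :
  reflect_axis c (mv w d t) = mv (reflect_axis c w) d ((if d.1 == j then -1 else 0) * t).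
Proof.
apply: crdP => e; rewrite crd_mv !crd_axis !crd_mv.
case: e d => [e b] [d a] /=; rewrite !xpair_eqE.
have [->|ej] := eqVneq e j; last first.
  case: (eqVneq e d) => [ed|_]; last by rewrite addr0.
  by rewrite -ed (negPf ej) mul0r; case: ifP; rewrite addr0.
case: (eqVneq d j) => [_|_]; last by rewrite !addr0; case: b.
by case: a; case: b; rewrite /= ?addr0// mulN1r opprD addrA.
Qed.

Lemma dz_reflect f c w : smooth_on setT f ->
  dz j (fun w => f (reflect_axis c w)) w = - dz j f (reflect_axis c w).
Proof.
move=> sf; rewrite !dzE.
rewrite (partial_subst (reflect_axis_mv c) dx sf I).
rewrite (partial_subst (reflect_axis_mv c) dy sf I).
rewrite /= eqxx rmorphN rmorph1; move: (pd _ _ _) (pd _ _ _) => a b.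
by rewrite !mulN1r mulrN -opprD mulNr.
Qed.

Lemma smooth_reflect f c : smooth_on setT f -> smooth_on setT (fun w => f (reflect_axis c w)).
Proof. exact: (smooth_on_subst (@continuous_reflect_axis c) (reflect_axis_mv c) (@openT _)). Qed.

Definition axis_kernel f (zeta : C) : C := f (axis (Re zeta) (Im zeta)).

Lemma axis_kernelE f c w : axis_kernel f (c - w 0 j) = f (reflect_axis c w).
Proof. by rewrite reflect_axisE. Qed.

Lemma kcont_axis_kernel f : smooth_on setT f -> kcont (axis_kernel f).
Proof. by move=> sf; exact: (ccont_comp (smooth_ccont sf) continuous_axis). Qed.

Lemma conv_parts f A r phi z : 0 < r -> smooth_on setT f -> tst r phi ->
  `|crd dx z| + r <= A -> `|crd dy z| + r <= A ->
  conv j (axis_kernel f) A (dz j phi) z = conv j (axis_kernel (dz j f)) A phi z.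
Proof.
move=> r0 sf tphi hx hy; have oT := @openT Cn.
have t1 := tst_dz j tphi; have sdf := smooth_on_dz oT j sf.
have rA : r <= 2 * r by lra.
rewrite (conv_bint (kcont_axis_kernel sf) (smooth_ccont t1.1) t1.2 (ltW r0) hx hy rA).
rewrite (conv_bint (kcont_axis_kernel sdf) (smooth_ccont tphi.1) tphi.2 (ltW r0) hx hy rA).
have us : uniq [:: dx; dy] by rewrite /= inE xpair_eqE andbF.
have E g (psi : Cn -> C) : (fun w => axis_kernel g (z 0 j - w 0 j) * psi w) =
    fun w => g (reflect_axis (z 0 j) w) * psi w.
  by apply/funext => w; rewrite axis_kernelE.
have rr : r < 2 * r by lra.
have A2 : 0 < 2 * r by lra.
have c0 e : e \in [:: dx; dy] -> crd e (czero j z) = 0 by exact: crd_czero.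
have ssr := smooth_reflect (z 0 j) sf.
rewrite !E (bint_parts rr A2 us _ _ c0 ssr tphi) ?inE ?eqxx ?orbT//.
have -> : (fun w => dz j (fun w0 => f (reflect_axis (z 0 j) w0)) w * phi w) =
    fun w => -1 * (dz j f (reflect_axis (z 0 j) w) * phi w).
  by apply/funext => w; rewrite dz_reflect// mulN1r mulNr.
rewrite bintZ ?mulN1r ?opprK//; apply: ccontM; last exact: smooth_ccont tphi.1.
exact: smooth_ccont (smooth_reflect _ sdf).
Qed.

(** On the cube, $\kappa\psi$ is $\partial/\partial\bar z_j$ of the convolution of $k_0$ with the
    second derivative of $\psi$, plus the convolution of $\psi$ with $F_3$, the third derivative of
    the smooth part of the kernel. A functional that kills $\partial/\partial\bar z_j$-derivatives
    sees only the second term. Both kernels live in the box of half-width [eps], so supports grow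
    from [r'] to at most [r] in $z_j$. *)
Lemma smoothing r r' eps : 0 < eps -> 0 < r' -> r' + eps <= r -> exists g : C -> C,
  [/\ kcont g, box_kernel eps g, smooth_on setT (fun w : Cn => g (w 0 j)) &
    forall u psi, dist r u -> (forall phi, tst r phi -> u (dz j phi) = 0) ->
      tst r psi -> (forall z b, r' < `|crd (j, b) z| -> psi z = 0) ->
      u psi = u (conv j g (3 * r) psi)].
Proof.
move=> e0 r'0 re; have r0 : 0 < r by lra.
have oT := @openT Cn; have A0 : 0 <= 3 * r by lra.
have [kappa [kap0 hk]] := reproduction j r0.
have [k0 [F [ck0 bk0 sF Fsplit [Fp F0]]]] := kernel_splitting e0.
have sF1 := smooth_on_dz oT j sF; have sF2 := smooth_on_dz oT j sF1; have sF3 := smooth_on_dz oT j sF2.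
set F3 := dz j (dz j (dz j F)) in sF3 F0.
have proj_f f : smooth_on setT f -> (forall w, f w = f (proj w)) -> forall w, dz j f w = dz j f (proj w).
  move=> sf fp w; rewrite -(dz_proj w sf); congr (dz j _ w).
  by apply/funext => w'; exact: fp.
have F3p := proj_f _ sF2 (proj_f _ sF1 (proj_f _ sF Fp)).
have bF3 : box_kernel eps (axis_kernel F3).
  by move=> zeta h; rewrite /axis_kernel F0// !crd_axis eqxx /=; case: h; [left|right].
exists (fun zeta => kappa^-1 * axis_kernel F3 zeta); split.
- by apply: ccontZ; exact: kcont_axis_kernel.
- by move=> zeta h; rewrite bF3 ?mulr0.
- apply: (smooth_onZ oT); apply: (smooth_on_eq oT _ sF3) => w _.
  by rewrite /F3 F3p; rewrite /axis_kernel /proj /crd.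
move=> u psi du cu tpsi spsi.
have t1 := tst_dz j tpsi; have t2 := tst_dz j t1; have t3 := tst_dz j t2.
have ckF := kcont_axis_kernel sF; have ckF3 := kcont_axis_kernel sF3.
have supp1 phi : (forall z b, r' < `|crd (j, b) z| -> phi z = 0) ->
    forall z b, r' < `|crd (j, b) z| -> dz j phi z = 0.
  move=> h z b hb; pose W := [set z | [set x : R | r' < `|x|] (crd (j, b) z)].
  have oW : open W.
    apply: open_crd; apply: (@open_comp _ _ (fun x : R => `|x|) [set y | r' < y]); last exact: open_gt.
    by move=> x _; exact: norm_continuous.
  by rewrite (dz_eq_on j oW (g := fun=> 0) _ (hb : W z)) ?dz_cst// => w Ww; exact: h Ww.
have s1 := supp1 _ spsi; have s2 := supp1 _ s1; have s3 := supp1 _ s2.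
have tc k phi : kcont k -> box_kernel eps k -> tst r phi ->
    (forall z b, r' < `|crd (j, b) z| -> phi z = 0) -> tst r (conv j k (3 * r) phi).
  move=> ck bk tphi sphi; split; first exact: (conv_smooth j A0 ck tphi.1).1.
  by move=> z Nz; exact: (conv_box _ bk tphi sphi re Nz).
have E z : kappa * psi z = 1 * dz j (conv j k0 (3 * r) (dz j (dz j psi))) z +
    conv j (axis_kernel F3) (3 * r) psi z.
  rewrite mul1r (dz_conv j j z A0 ck0 t2.1).
  have [h|h] := pselect (forall b, `|crd (j, b) z| <= r); last first.
    have [b hb] : exists b, r < `|crd (j, b) z|.
      by apply: contrapT => h'; apply: h => b; rewrite leNgt; apply/negP => hb; apply: h'; exists b.
    have hb' : r' + eps < `|crd (j, b) z| by exact: le_lt_trans hb.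
    rewrite (conv_box_supp (3 * r) bk0 s3 hb') (conv_box_supp (3 * r) bF3 spsi hb').
    by rewrite (spsi z b) ?mulr0 ?addr0//; lra.
  have hx : `|crd dx z| + r <= 3 * r by have := h false; lra.
  have hy : `|crd dy z| + r <= 3 * r by have := h true; lra.
  rewrite -(hk _ _ tpsi (h false) (h true)).
  rewrite -(conv_parts r0 sF2 tpsi hx hy) -(conv_parts r0 sF1 t1 hx hy) -(conv_parts r0 sF t2 hx hy).
  have -> : axis_kernel F = fun zeta => cker 0 zeta - k0 zeta.
    apply/funext => zeta; have := Fsplit (axis (Re zeta) (Im zeta)).
    rewrite axis_coord (_ : Re zeta +i* Im zeta = zeta); last by case: (zeta).
    by move=> ->; rewrite addrAC subrr add0r.
  rewrite -(convBk j (3 * r) z (kcont_cker0 R) ck0 (smooth_ccont t3.1)).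
  by rewrite addrC subrK.
have tG := tc _ _ ckF3 bF3 tpsi spsi.
have tT := tc _ _ ck0 bk0 t2 s2.
have : u (fun z => kappa * psi z) = u (conv j (axis_kernel F3) (3 * r) psi).
  rewrite (dist_eq u E) (distP _ du (tst_dz j tT) tG) cu// mulr0 add0r.
  exact: dist_eq.
rewrite (distZ _ du tpsi) => /(congr1 (fun x => kappa^-1 * x)); rewrite mulKf// => ->.
rewrite -(distZ _ du tG); apply: dist_eq => z.
rewrite /conv -cintZ; last exact: (conv_inner j _ z ckF3 (smooth_ccont tpsi.1)).
apply: cint_eq => x; rewrite -cintZ; last exact: (conv_integrand1 j z x ckF3 (smooth_ccont tpsi.1)).
by apply: cint_eq => y; rewrite mulrA.
Qed.

End Smoothing.

(** * Distributions applied to smooth families *)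

Section Families.
Context (R : realType) (n : nat).
Local Notation C := R[i].
Local Notation Cn := 'rV[C]_n.
Implicit Types (f phi psi : Cn -> C) (z w : Cn) (r A : R) (d : 'I_n * bool) (u : functional R n).

Lemma sfam_comp (P Q : topologicalType) (Phi : P -> Cn -> C) (g : Q -> P) : continuous g ->
  sfam Phi -> sfam (fun q => Phi (g q)).
Proof.
move=> cg [h1 h2]; constructor=> [q|s]; first exact: h1.
apply: (ccont_comp (h2 s) (g := fun q : Q * Cn => (g q.1, q.2))).
apply: (@continuous_pair _ _ _ (fun q : Q * Cn => g q.1) (fun q => q.2)); last exact: continuous_snd.
exact: (@continuous_compo _ _ _ (fun q : Q * Cn => q.1) g (@continuous_fst _ _) cg).
Qed.

Lemma sfam_pd (P : topologicalType) (Phi : P -> Cn -> C) d : sfam Phi -> sfam (fun p => pd d (Phi p)).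
Proof.
move=> [h1 h2]; constructor=> [p|s]; first exact: smooth_on_partial.
by apply: ccont_eq (h2 (rcons s d)) _ => q; rewrite partials_rcons.
Qed.

Lemma sfamM (P : topologicalType) (Phi Psi : P -> Cn -> C) : sfam Phi -> sfam Psi ->
  sfam (fun p z => Phi p z * Psi p z).
Proof.
move=> hPhi hPsi; have oT := @openT Cn; constructor=> [p|s].
  by apply: (smooth_onM oT); [case: hPhi|case: hPsi].
elim/last_ind: s Phi Psi hPhi hPsi => [|s d ih] Phi Psi hPhi hPsi.
  by have [h1 h2] := hPhi; have [k1 k2] := hPsi; exact: ccontM (h2 [::]) (k2 [::]).
have c1 := ih _ _ (sfam_pd d hPhi) hPsi; have c2 := ih _ _ hPhi (sfam_pd d hPsi).
apply: ccont_eq (ccontD c1 c2) _ => q; have [h1 _] := hPhi; have [k1 _] := hPsi.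
rewrite partials_rcons -(partialsD s oT (smooth_onM oT (smooth_on_partial d (h1 q.1)) (k1 q.1))
  (smooth_onM oT (h1 q.1) (smooth_on_partial d (k1 q.1))) I).
by congr (pds s _ _); apply/funext => z; rewrite (partialM d (h1 q.1) (k1 q.1) I).
Qed.

Lemma sfam_cst (P : topologicalType) f : smooth_on setT f -> sfam (fun _ : P => f).
Proof.
move=> sf; constructor=> [//|s].
exact: (ccont_comp (smooth_ccont (smooth_on_partials s sf)) (@continuous_snd P Cn)).
Qed.

Lemma sfam_scalar (g : Cn -> C) : ccont g -> sfam (fun (w : Cn) (_ : Cn) => g w).
Proof.
move=> cg; constructor=> [p|[|d s]]; first exact: smooth_on_cst (@openT _) _.
  exact: (ccont_comp cg (@continuous_fst Cn Cn)).
apply: ccont_eq (ccont_cst _ 0) _ => q; rewrite /=; symmetry.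
rewrite (@partial_eq_on R n setT _ (fun=> pds s (fun=> g q.1) 0) d openT)//; first exact: partial_cst.
move=> z _; elim: s z => //= e s ih z.
rewrite (@partial_eq_on R n setT _ (fun=> pds s (fun=> g q.1) 0) e openT)// ?partial_cst//.
by rewrite (@partial_eq_on R n setT _ (fun=> pds s (fun=> g q.1) 0) e openT)// partial_cst.
Qed.

Lemma sfam_translate psi : smooth_on setT psi -> sfam (fun (w : Cn) z => psi (z - w)).
Proof.
move=> spsi.
have ct (w : Cn) : continuous (fun z : Cn => z - w).
  by apply: continuous_rVB; [exact: continuous_rV_id|exact: continuous_rV_cst].
have mvB (w z : Cn) d (t : R) : mv z d t - w = mv (z - w) d t.
  by rewrite !mv_def addrAC.
have tr w := smooth_translate (@ct w) (mvB w) spsi.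
constructor=> [w|s]; first exact: (tr w).1.
have cs : continuous (fun q : Cn * Cn => q.2 - q.1).
  by apply: continuous_rVB; [exact: continuous_snd|exact: continuous_fst].
by apply: ccont_eq (ccont_comp (smooth_ccont (smooth_on_partials s spsi)) cs) _ => q; rewrite (tr q.1).2.
Qed.

Lemma tst_cint r (a b : R) (Phi : R -> Cn -> C) : sfam Phi -> (forall t, tst r (Phi t)) ->
  tst r (fun z => cint a b (Phi^~ z)) /\
  forall s z, pds s (fun z => cint a b (Phi^~ z)) z = cint a b (fun t => pds s (Phi t) z).
Proof.
move=> sPhi tPhi; have oT := @openT Cn.
have out z : ~ Qb r z -> cint a b (Phi^~ z) = 0.
  move=> Nz; rewrite (@cint_eq _ _ _ _ (fun=> 0)) ?cint_cst ?mul0r// => t.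
  exact: (tPhi t).2.
have [ab|ba] := leP a b.
  by have [h1 h2] := partials_cint_smooth ab sPhi.
have [h1 h2] := partials_cint_smooth (ltW ba) sPhi.
have e : (fun z => cint a b (Phi^~ z)) = fun z => -1 * cint b a (Phi^~ z).
  by apply/funext => z; rewrite mulN1r cint_anti.
split; first by split=> //; rewrite e; exact: (smooth_onZ oT).
by move=> s z; rewrite e (partialsZ _ s oT h1 I) h2 mulN1r [RHS]cint_anti.
Qed.

Lemma dist_cont (P : topologicalType) (Phi : P -> Cn -> C) r u : dist r u -> sfam Phi ->
  (forall p, tst r (Phi p)) -> ccont (fun p => u (Phi p)).
Proof.
move=> du [sP cP] tP; apply: ccontP => x e e0; have oT := @openT Cn.
have [_ [N [M [M0 hM]]]] := du.
pose e' := e / (M + 1); have M1 : 0 < M + 1 by rewrite ltr_wpDl.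
have e'0 : 0 < e' by rewrite divr_gt0.
have := near_seqs (T := ('I_n * bool)%type) (F := nbhs x) (Q := fun s p => forall z, Qb r z ->
  normc (pds s (Phi p) z - pds s (Phi x) z) < e') _ N _.
move=> /(_ _ (fun s => ccont_unif x (@compact_Qb R n r) (cP s) e'0)).
apply: filterS => y hy.
have tN : tst r (fun z => -1 * Phi x z + Phi y z) by apply: tstD => //; exact: tstZ.
have -> : u (Phi y) - u (Phi x) = u (fun z => -1 * Phi x z + Phi y z).
  by rewrite (distP _ du (tP x) (tP y)) mulN1r addrC.
apply: le_trans (hM _ e' tN _) _; last first.
  by rewrite /e' mulrA ler_pdivrMr// mulrC ler_pM2l// lerDl.
move=> s z sN; have [Q|NQ] := pselect (Qb r z); last first.
  by rewrite (tst_partials_out s tN NQ) normc0 ltW.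
rewrite (partialsD s oT (smooth_onZ oT (-1) (sP x)) (sP y) I) (partialsZ _ s oT (sP x) I).
by rewrite mulN1r addrC; exact/ltW/hy.
Qed.

(** Instead of Riemann sums: $s\mapsto u(\int_a^s\Phi_t\,dt)$ has derivative $u(\Phi_s)$, because
    the difference quotients converge in all derivatives up to the order of $u$, uniformly on the
    cube. *)
Lemma dist_cint (a b : R) (Phi : R -> Cn -> C) r u : dist r u -> sfam Phi ->
  (forall p, tst r (Phi p)) -> u (fun z => cint a b (Phi^~ z)) = cint a b (fun t => u (Phi t)).
Proof.
move=> du sPhi tPhi; have cu := dist_cont du sPhi tPhi; have oT := @openT Cn.
pose F s := u (fun z => cint a s (Phi^~ z)).
suff D s : cderiv F s (u (Phi s)).
  rewrite (cint_primitive a b cu D) /F.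
  rewrite [X in _ - X](_ : _ = 0) ?subr0//.
  by rewrite -[RHS](dist0 du); apply: dist_eq => z; rewrite cintxx.
apply: cderiv_lim => e e0; have [_ [N [M [M0 hM]]]] := du; have [sP cP] := sPhi.
pose e' := e / (M + 1); have M1 : 0 < M + 1 by rewrite ltr_wpDl.
have e'0 : 0 < e' by rewrite divr_gt0.
pose G s' (sg : R) (z : Cn) := cint a sg (fun t => pds s' (Phi t) z).
have cPz s' z : ccont (fun t => pds s' (Phi t) z).
  exact: (ccont_pair2 (g := fun t z => pds s' (Phi t) z) z (cP s')).
have hG s' : \forall h \near (0 : R), forall x, Qb r x ->
    normc (G s' (s + h) x - G s' s x - h%:C * pds s' (Phi s) x) <= e' * `|h|.
  apply: (@cderiv_unif _ _ (Qb r) (G s') (fun s x => pds s' (Phi s) x) s e') => //.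
  - exact: compact_Qb.
  - by move=> t x; exact: cint_deriv.
have := near_seqs (T := ('I_n * bool)%type) (F := nbhs (0 : R)) (Q := fun s' h => forall x, Qb r x ->
    normc (G s' (s + h) x - G s' s x - h%:C * pds s' (Phi s) x) <= e' * `|h|) _ N hG.
move=> /(_ _)/filterS; apply => h hh.
have [t1 p1] := tst_cint a (s + h) sPhi tPhi; have [t2 p2] := tst_cint a s sPhi tPhi.
have t3 : tst r (fun z => -1 * cint a s (Phi^~ z) + cint a (s + h) (Phi^~ z)).
  by apply: tstD => //; exact: tstZ.
have t4 : tst r (fun z => (- h%:C) * Phi s z + (-1 * cint a s (Phi^~ z) + cint a (s + h) (Phi^~ z))).
  by apply: tstD => //; exact: tstZ.
have -> : F (s + h) - F s - h%:C * u (Phi s) =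
    u (fun z => (- h%:C) * Phi s z + (-1 * cint a s (Phi^~ z) + cint a (s + h) (Phi^~ z))).
  rewrite (distP _ du (tPhi s) t3) (distP _ du t2 t1) /F; ring.
apply: le_trans (hM _ (e' * `|h|) t4 _) _; last first.
  by rewrite /e' mulrA ler_wpM2r// mulrA ler_pdivrMr// mulrC ler_pM2l// lerDl.
move=> s' z sN; have [Q|NQ] := pselect (Qb r z); last first.
  by rewrite (tst_partials_out s' t4 NQ) normc0 mulr_ge0// ltW.
rewrite (partialsD s' oT (smooth_onZ oT _ (sP s)) t3.1 I) (partialsZ _ s' oT (sP s) I).
rewrite (partialsD s' oT (smooth_onZ oT _ t2.1) t1.1 I) (partialsZ _ s' oT t2.1 I) p1 p2.
have := hh s' sN z Q; rewrite /G; congr (normc _ <= _); ring.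
Qed.

Lemma dist_cderiv (Phi Phi' : R -> Cn -> C) r u : dist r u -> sfam Phi -> sfam Phi' ->
  (forall p, tst r (Phi p)) -> (forall p, tst r (Phi' p)) ->
  (forall t z, cderiv (Phi^~ z) t (Phi' t z)) ->
  forall t, cderiv (fun t => u (Phi t)) t (u (Phi' t)).
Proof.
move=> du s1 s2 t1 t2 D t; have cu := dist_cont du s2 t2.
have cz z : ccont (Phi'^~ z).
  by have [_ c2] := s2; exact: (ccont_pair2 (g := Phi') z (c2 [::])).
have E s : u (Phi s) = 1 * u (Phi 0) + cint 0 s (fun t => u (Phi' t)).
  rewrite -(dist_cint _ _ du s2 t2) -(distP _ du (t1 0) (tst_cint 0 s s2 t2).1).
  apply: dist_eq => z; rewrite mul1r (cint_primitive 0 s (cz z) (D ^~ z)).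
  by rewrite addrC subrK.
have -> : (fun t => u (Phi t)) = fun s => 1 * u (Phi 0) + cint 0 s (fun t => u (Phi' t)).
  exact/funext.
by rewrite -[u (Phi' t)]add0r; apply: cderivD; [exact: cderiv_cst|exact: cint_deriv].
Qed.

Lemma sfam_bint A s (Phi : Cn -> Cn -> C) : 0 <= A -> sfam Phi ->
  sfam (fun w0 z => bint A s (Phi^~ z) w0).
Proof.
move=> A0; have AA : - A <= A by rewrite ge0_cp.
elim: s Phi => [//|d s ih] Phi sPhi /=.
apply: (@sfam_cint R n Cn (- A) A (fun t w0 z => bint A s (Phi^~ z) (mv w0 d t)) AA).
exact: (sfam_comp (g := fun q : R * Cn => mv q.2 d q.1) (@continuous_mv R n d) (ih _ sPhi)).
Qed.

Lemma dist_bint A s (Phi : Cn -> Cn -> C) r u w0 : 0 <= A -> dist r u -> sfam Phi ->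
  (forall p, tst r (Phi p)) ->
  u (fun z => bint A s (Phi^~ z) w0) = bint A s (fun w => u (Phi w)) w0.
Proof.
move=> A0 du sPhi tPhi; elim: s w0 => [//|d s ih] w0 /=.
have tB w : tst r (fun z => bint A s (Phi^~ z) w).
  have [h _] := sfam_bint s A0 sPhi; split; first exact: h.
  move=> z Nz; rewrite (_ : Phi^~ z = fun=> 0) ?bint0//.
  by apply/funext => p; exact: (tPhi p).2.
rewrite (@dist_cint (- A) A (fun t z => bint A s (Phi^~ z) (mv w0 d t)) r u du).
- by apply: cint_eq => t; exact: ih.
- exact: (sfam_comp (g := fun t => mv w0 d t) (@continuous_mv_t R n w0 d) (sfam_bint s A0 sPhi)).
- by move=> t; exact: tB.
Qed.

Lemma bint_perm A s t f z : 0 <= A -> ccont f -> perm_eq s t -> bint A s f z = bint A t f z.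
Proof.
move=> A0; elim: t s f => [|d t ih] s f cf st.
  by have := perm_nilP st; move=> ->.
have ds : d \in s by rewrite (perm_mem st) mem_head.
have cg : ccont (fun w => cint (- A) A (fun t => f (mv w d t))).
  exact: (ccont_cint (- A) A (g := fun t w => f (mv w d t)) (ccont_comp cf (@continuous_mv _ _ d))).
rewrite (bint_last _ A0 cf ds) (bint_last _ A0 cf (mem_head d t)).
rewrite [rem d (d :: t)]/= eqxx; apply: ih => //.
by rewrite -(perm_cons d) (perm_trans _ st)// perm_sym perm_to_rem.
Qed.

(** Differentiating in [w] puts $-\partial_d$ on [psi], so functions of this shape form a class
    stable under partials; [chi] keeps the arguments of [u] test functions. *)
Lemma regularization_smooth r u chi : dist r u -> tst r chi -> forall psi, smooth_on setT psi ->
  smooth_on setT (fun w => u (fun z => chi z * psi (z - w))).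
Proof.
move=> du tchi psi spsi; have oT := @openT Cn.
have sP psi' : smooth_on setT psi' -> sfam (fun (w : Cn) z => chi z * psi' (z - w)).
  by move=> s'; apply: sfamM; [exact: sfam_cst tchi.1|exact: sfam_translate].
have tP psi' w : smooth_on setT psi' -> tst r (fun z => chi z * psi' (z - w)).
  move=> s'; split; first by have [h _] := sP _ s'; exact: h.
  by move=> z Nz; rewrite tchi.2// mul0r.
apply: (@smooth_on_coind R n setT (fun h => exists psi', smooth_on setT psi' /\
  h = fun w => u (fun z => chi z * psi' (z - w))) oT) => //.
- move=> _ [psi' [s' ->]] w _; apply: ccont_atW.
  exact: (dist_cont du (sP _ s') (fun w => tP _ w s')).
- move=> _ d [psi' [s' ->]].
  have sd : smooth_on setT (fun z => -1 * pd d psi' z).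
    by apply: (smooth_onZ oT); exact: smooth_on_partial.
  exists (fun w => u (fun z => chi z * (-1 * pd d psi' (z - w)))); split; first by exists (fun z => -1 * pd d psi' z).
  move=> w _; have cm := @continuous_mv_t R n w d.
  have := @dist_cderiv (fun t z => chi z * psi' (z - mv w d t))
    (fun t z => chi z * (-1 * pd d psi' (z - mv w d t))) r u du
    (sfam_comp cm (sP _ s')) (sfam_comp cm (sP _ sd)) (fun t => tP _ _ s') (fun t => tP _ _ sd) _ 0.
  rewrite mv0 => h.
  have -> : along (fun w => u (fun z => chi z * psi' (z - w))) w d =
      fun t => u (fun z => chi z * psi' (z - mv w d t)).
    by apply/funext => t; rewrite alongE.
  apply: h => t z; apply: cderivZ.
  have e (s : R) : z - mv w d s = mv (z - w) d (0 - s).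
    by rewrite !mv_def sub0r rmorphN scaleNr opprD addrA.
  have := @cderiv_opp _ (fun s => psi' (mv (z - w) d s)) 0 t _ (smooth_on_cderiv_mv s' I).
  by rewrite mulN1r e; congr (cderiv _ _ _); apply/funext => s; rewrite e.
- by exists psi.
Qed.

End Families.

(** * Smoothing in all variables *)

Section Weyl.
Context (R : realType) (n : nat).
Local Notation C := R[i].
Local Notation Cn := 'rV[C]_n.
Local Notation dir := ('I_n * bool)%type.
Implicit Types (f phi psi : Cn -> C) (z w v : Cn) (r A eps : R) (d e : dir) (u : functional R n)
  (j : 'I_n) (s : seq 'I_n) (g : 'I_n -> C -> C).

Fixpoint zero_coords s z : Cn := if s is j :: s' then zero_coords s' (czero j z) else z.

Definition dirs s : seq dir := flatten [seq [:: (j, false); (j, true)] | j <- s].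

Lemma crd_czeroE j e z : crd e (czero j z) = if e.1 == j then 0 else crd e z.
Proof.
rewrite /czero !crd_mv; case: e => i b /=; rewrite !xpair_eqE.
by have [->|_] := eqVneq i j; case: b; rewrite /= ?addr0// subrr.
Qed.

Lemma crd_zero_coords s e z : crd e (zero_coords s z) = if e.1 \in s then 0 else crd e z.
Proof.
elim: s z => [//|j s ih] z /=; rewrite ih crd_czeroE in_cons.
by case: (e.1 \in s); rewrite ?orbT// orbF.
Qed.

Lemma mem_dirs s e : (e \in dirs s) = (e.1 \in s).
Proof.
elim: s => [//|j s ih]; rewrite /dirs /= !in_cons -/(dirs s) ih.
by case: e {ih} => i b /=; rewrite !xpair_eqE; case: eqP => _ //=; case: b.
Qed.

Lemma uniq_dirs s : uniq s -> uniq (dirs s).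
Proof.
elim: s => [//|j s ih] /= /andP[js us]; rewrite -/(dirs s) ih// !in_cons !mem_dirs /=.
by rewrite xpair_eqE andbF (negPf js).
Qed.

Lemma coord_eq j z w : (forall b, crd (j, b) z = crd (j, b) w) -> z 0 j = w 0 j.
Proof. by move=> h; apply: eqC; [exact: (h false)|exact: (h true)]. Qed.

Lemma ccont_kernel_sub (k : C -> C) (c : C) j : kcont k -> ccont (fun w : Cn => k (c - w 0 j)).
Proof.
move=> ck.
have cc : continuous (fun w : Cn => (Re c - crd (j, false) w, Im c - crd (j, true) w)).
  apply: continuous_pair.
    exact: (@continuous_compo _ _ _ (fun w : Cn => crd (j, false) w) (fun t => Re c - t)
      (@continuous_crd R n (j, false)) (@rcont_opp R _)).
  exact: (@continuous_compo _ _ _ (fun w : Cn => crd (j, true) w) (fun t => Im c - t)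
    (@continuous_crd R n (j, true)) (@rcont_opp R _)).
apply: ccont_eq (ccont_comp ck cc) _ => w; congr k.
by apply: eqC; rewrite /= /crd /= ?ReD ?ImD ?ReN ?ImN.
Qed.

Lemma ccont_prod (I : Type) (s : seq I) (T : topologicalType) (F : I -> T -> C) :
  (forall i, ccont (F i)) -> ccont (fun x => \prod_(i <- s) F i x).
Proof.
move=> cF; elim: s => [|i s ih].
  by apply: ccont_eq (ccont_cst _ 1) _ => x; rewrite big_nil.
by apply: ccont_eq (ccontM (cF i) ih) _ => x; rewrite big_cons.
Qed.

(** Convolution in all variables listed in [s] at once, as a single box integral against a product
    kernel. The listed coordinates of the base point are 0, so that the integration variables are
    the coordinates of [w] themselves. *)
Definition mconv A g s phi z : C := bint A (dirs s)
  (fun w => (\prod_(j <- s) g j (z 0 j - w 0 j)) * phi w) (zero_coords s z).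

Lemma ccont_mconv_integrand g s phi z : (forall j, kcont (g j)) -> ccont phi ->
  ccont (fun w => (\prod_(j <- s) g j (z 0 j - w 0 j)) * phi w).
Proof.
by move=> cg cphi; apply: ccontM => //; apply: ccont_prod => j; exact: ccont_kernel_sub.
Qed.

(** The outer integral moves $z_j$ only, and the inner kernels do not see $z_j$ because [j] is not
    in [s], so the integrands agree on the points that are reached. *)
Lemma mconv_cons A g j s phi z : 0 <= A -> (forall j, kcont (g j)) -> ccont phi -> uniq (j :: s) ->
  bint A [:: (j, false); (j, true)] (fun w => g j (z 0 j - w 0 j) * mconv A g s phi w) (czero j z) =
  mconv A g (j :: s) phi z.
Proof.
move=> A0 cg cphi /= /andP[js us]; apply: cint_eq => x; apply: cint_eq => y.
set w := mv (mv (czero j z) _ x) _ y.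
have -> : mv (mv (zero_coords s (czero j z)) (j, false) x) (j, true) y = zero_coords s w.
  apply: crdP => e; rewrite /w !crd_mv !crd_zero_coords !crd_mv.
  case: (boolP (e.1 \in s)) => // es.
  by case: e es => i b /= es; rewrite !xpair_eqE; case: eqP => [ij|]; rewrite ?addr0//;
    move: js; rewrite -ij es.
have c1 := ccont_mconv_integrand s w cg cphi.
rewrite /mconv -bintZ//; apply: bint_ext => //; first exact: uniq_dirs.
- exact: ccontZ.
- exact: (ccont_mconv_integrand (j :: s) z cg cphi).
move=> w' [hw' _]; rewrite big_cons mulrA; congr (_ * _ * _).
  congr (g j (_ - _)); apply: coord_eq => b.
  by rewrite hw' ?mem_dirs//= crd_zero_coords /= (negPf js).
rewrite !big_seq; apply: eq_bigr => i is'; congr (g i (_ - _)); apply: coord_eq => b.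
rewrite /w 2!crd_mv crd_czeroE /= !xpair_eqE; case: eqP => [ij|]; last by rewrite !addr0.
by move: js; rewrite -ij is'.
Qed.

Lemma mconv_eq0 r r' eps g s phi z : 0 <= r -> (forall j, kcont (g j)) -> ccont phi -> uniq s ->
  (forall j, box_kernel eps (g j)) -> supported_in (Qb r') phi ->
  (exists d, (if d.1 \in s then r' + eps else r') < `|crd d z|) -> mconv r g s phi z = 0.
Proof.
move=> r0 cg cphi us bg sphi [[i b] hd]; rewrite /mconv.
rewrite (@bint_ext _ _ _ _ _ (fun=> 0)) ?bint0 ?uniq_dirs//.
- exact: ccont_mconv_integrand.
- exact: ccont_cst.
move=> w [hw _]; have [Q|NQ] := pselect (Qb r' w); last by rewrite sphi ?mulr0.
have Qi := Q (i, b); move: hd => /=; case: ifP => is' hd; last first.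
  by move: Qi; rewrite hw ?mem_dirs ?is'// crd_zero_coords /= is' leNgt hd.
apply/eqP; rewrite mulf_eq0 prodf_seq_eq0; apply/orP; left; apply/hasP; exists i => //=.
apply/eqP; apply: bg.
have h := lerB_dist (crd (i, b) z) (crd (i, b) w).
have : eps < `|crd (i, b) z - crd (i, b) w| by lra.
by rewrite /crd /=; case: (b) => /= hh; [right; rewrite ImD ImN|left; rewrite ReD ReN].
Qed.

(** Smoothing in $z_j$ enlarges supports in $z_j$ only. Before each step the support in the next
    variable is still within [r'], so the margin [r - r'] is spent once in each variable and not
    cumulatively. *)
Lemma weyl_mconv u r r' : 0 < r' -> r' < r -> dist r u ->
  (forall j phi, tst r phi -> u (dz j phi) = 0) ->
  exists g, [/\ forall j, kcont (g j), forall j, box_kernel (r - r') (g j),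
    forall j, smooth_on setT (fun w : Cn => g j (w 0 j)) &
    forall s phi, uniq s -> tst r' phi -> tst r (mconv r g s phi) /\ u phi = u (mconv r g s phi)].
Proof.
move=> r'0 rr' du cu; have r0 : 0 < r by lra.
have e0 : 0 < r - r' by lra.
have re : r' + (r - r') <= r by lra.
have /choice[g hg] := fun j => smoothing j e0 r'0 re.
have cg j : kcont (g j) by have [] := hg j.
have bg j : box_kernel (r - r') (g j) by have [] := hg j.
exists g; split => //; first by move=> j; have [] := hg j.
move=> s phi; elim: s => [_|j s ih us] tphi.
  have e : mconv r g [::] phi = phi.
    by apply/funext => z; rewrite /mconv /= big_nil mul1r.
  by rewrite e; split=> //; exact: tstW (ltW rr') tphi.
have us' : uniq s by move: us => /= /andP[].
have js : j \notin s by move: us => /= /andP[].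
have [tm um] := ih us' tphi; have cphi := smooth_ccont tphi.1.
have supp z b : r' < `|crd (j, b) z| -> mconv r g s phi z = 0.
  move=> h; apply: (mconv_eq0 (ltW r0) cg cphi us' bg tphi.2).
  by exists (j, b); rewrite /= (negPf js).
have A0 : 0 <= 3 * r by lra.
have tc : tst r (conv j (g j) (3 * r) (mconv r g s phi)).
  split; first exact: (conv_smooth j A0 (cg j) tm.1).1.
  by move=> z Nz; exact: (conv_box _ (bg j) tm supp re Nz).
have e : mconv r g (j :: s) phi = conv j (g j) (3 * r) (mconv r g s phi).
  apply/funext => z; have [Q|NQ] := pselect (Qb r z).
    rewrite (conv_bint (cg j) (smooth_ccont tm.1) tm.2 (ltW r0) _ _ (lexx r)).
    - by rewrite mconv_cons ?ltW.
    - by have := Q (j, false); lra.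
    - by have := Q (j, true); lra.
  rewrite tc.2//; apply: (mconv_eq0 (ltW r0) cg cphi us bg tphi.2).
  have [d hd] : exists d, r < `|crd d z|.
    apply: contrapT => h; apply: NQ => d; rewrite leNgt; apply/negP => hd.
    by apply: h; exists d.
  by exists d; case: ifP => _; lra.
rewrite e; split; first exact: tc.
have [_ _ _ hu] := hg j; exact: (etrans um (hu u _ du (cu j) tm supp)).
Qed.

Theorem weyl u r r' : 0 < r' -> r' < r -> dist r u ->
  (forall j phi, tst r phi -> u (dz j phi) = 0) ->
  exists h, [/\ smooth_on setT h,
    forall phi, tst r' phi -> u phi = integralCn (fun z => h z * phi z) &
    forall j z, Qo r' z -> dz j h z = 0].
Proof.
move=> r'0 rr' du cu; pose r1 := (r + r') / 2; have oT := @openT Cn.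
have r10 : 0 < r1 by rewrite /r1; lra.
have r'r1 : r' < r1 by rewrite /r1; lra.
have r1r : r1 < r by rewrite /r1; lra.
have du1 := distW (ltW r1r) du.
have cu1 j phi : tst r1 phi -> u (dz j phi) = 0 by move=> t; apply: cu; exact: tstW (ltW r1r) t.
have [g [cg bg sg hg]] := weyl_mconv r'0 r'r1 du1 cu1.
(* Smoothing in all variables replaces $\varphi$ by $\int\rho(z-w)\varphi(w)\,dw$ without changing
   $u(\varphi)$; moving $u$ under the integral identifies [h]. The cut-off [chi] is 1 on the cube
   containing the support of the smoothed function. *)
pose rho v := \prod_(j <- enum 'I_n) g j (v 0 j).
have srho : smooth_on setT rho by exact: (smooth_on_prod oT).
have [chi [tchi chi1]] := @cutoff R n r1 r r10 r1r.
pose h w := u (fun z => chi z * rho (z - w)).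
have sh : smooth_on setT h := regularization_smooth du tchi srho.
have sF : sfam (fun (w : Cn) z => chi z * rho (z - w)).
  by apply: sfamM; [exact: sfam_cst tchi.1|exact: sfam_translate].
have tF w : tst r (fun z => chi z * rho (z - w)).
  split; first by have [k _] := sF; exact: k.
  by move=> z Nz; rewrite tchi.2// mul0r.
have rep phi : tst r' phi -> u phi = integralCn (fun z => h z * phi z).
  move=> tphi; have cphi := smooth_ccont tphi.1.
  have [tm um] := hg (enum 'I_n) phi (enum_uniq _) tphi.
  have zc z : zero_coords (enum 'I_n) z = 0.
    by apply: crdP => e; rewrite crd_zero_coords mem_enum crd0.
  have chF : ccont (fun z => h z * phi z) := ccontM (smooth_ccont sh) cphi.
  rewrite um (@integralCnE _ _ r1)//; last first.
    by apply: supported_in_mul => z Nz; apply: tphi.2 => Q; apply: Nz; exact: Qb_sub (ltW r'r1) _ Q.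
  have pe : perm_eq (enum {: dir}) (dirs (enum 'I_n)).
    apply: uniq_perm; rewrite ?enum_uniq ?uniq_dirs ?enum_uniq//.
    by move=> e; rewrite mem_enum mem_dirs mem_enum.
  rewrite (bint_perm _ (ltW r10) chF pe).
  have -> : (fun z => h z * phi z) = fun w => u (fun z => phi w * (chi z * rho (z - w))).
    by apply/funext => w; rewrite (distZ _ du (tF w)) mulrC.
  rewrite -(@dist_bint R n r1 (dirs (enum 'I_n)) (fun w z => phi w * (chi z * rho (z - w))) r u 0 (ltW r10) du).
  - apply: dist_eq => z.
    have -> : mconv r1 g (enum 'I_n) phi z = chi z * mconv r1 g (enum 'I_n) phi z.
      have [Q|NQ] := pselect (Qb r1 z); first by rewrite chi1// mul1r.
      by rewrite tm.2// mulr0.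
    rewrite /mconv zc -bintZ; last exact: ccont_mconv_integrand.
    congr (bint _ _ _ _); apply/funext => w; rewrite mulrC -mulrA mulrCA; congr (_ * _).
    rewrite mulrC; congr (_ * _); apply: eq_bigr => j _; congr (g j _).
    by rewrite !mxE.
  - by apply: sfamM => //; exact: sfam_scalar.
  - by move=> w; exact: tstZ.
(* Integration by parts turns $u(\partial\varphi/\partial\bar z_j)=0$ into the vanishing of
   $\partial h/\partial\bar z_j$ against all test functions. *)
exists h; split=> // j; apply: integral_test_eq0 => //.
  by move=> z _; apply: smooth_on_cont (smooth_on_dz oT j sh) I.
move=> r2 phi r20 r2r' sphi supphi; have tphi : tst r2 phi by [].
have cphi := smooth_ccont sphi; have tdphi := tst_dz j tphi.
have cdh := smooth_ccont (smooth_on_dz oT j sh).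
have sub f : supported_in (Qb r2) f -> supported_in (Qb r') f.
  by move=> sf z Nz; apply: sf => Q; apply: Nz; exact: Qb_sub (ltW r2r') _ Q.
rewrite (@integralCnE _ _ r')//; [|exact: ccontM|exact/supported_in_mul/sub].
have := cu j phi (tstW (ltW (lt_trans r2r' rr')) tphi).
rewrite (rep _ (tstW (ltW r2r') tdphi)) (@integralCnE _ _ r')//; last first.
- exact/supported_in_mul/sub/tdphi.2.
- exact: ccontM (smooth_ccont sh) (smooth_ccont tdphi.1).
rewrite (bint_parts r2r' r'0 (enum_uniq _) _ _ _ sh tphi) ?mem_enum//; last by move=> e _; exact: crd0.
by move=> /eqP; rewrite oppr_eq0 => /eqP.
Qed.

End Weyl.

(** * Goursat's theorem *)

Section Bisection.
Context (R : realType).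
Implicit Types (a b s : R) (Q : R * R * R).

(* [D a b s] is attached to the square [a, a + s] x [b, b + s]. *)
Lemma bisection (D : R -> R -> R -> R) a0 b0 s0 : 0 < s0 ->
  (forall a b s, 0 < s -> D a b (2 * s) <=
     D a b s + D (a + s) b s + D a (b + s) s + D (a + s) (b + s) s) ->
  (forall p q e, 0 < e -> exists2 del : R, 0 < del & forall a b s, 0 < s -> s < del ->
     a <= p <= a + s -> b <= q <= b + s -> D a b s <= e * s ^+ 2) ->
  D a0 b0 s0 <= 0.
Proof.
move=> s00 sub loc; rewrite leNgt; apply/negP => D0.
(* Halving the side divides $s^2$ by 4, so some quarter has a ratio $D/s^2$ that has not dropped.
   Thus [e] bounds the ratio from below along a nested sequence of squares, which contradicts the
   local estimate with [e / 2] at the limit point. *)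
pose e := D a0 b0 s0 / s0 ^+ 2; have e0 : 0 < e by rewrite divr_gt0 ?exprn_gt0.
pose bad Q := 0 < Q.2 /\ e * Q.2 ^+ 2 <= D Q.1.1 Q.1.2 Q.2.
pose child Q Q' := [/\ Q'.2 = Q.2 / 2, Q.1.1 <= Q'.1.1, Q'.1.1 + Q'.2 <= Q.1.1 + Q.2,
  Q.1.2 <= Q'.1.2 & Q'.1.2 + Q'.2 <= Q.1.2 + Q.2].
have /choice[nx hnx] : forall Q, exists Q', bad Q -> bad Q' /\ child Q Q'.
  move=> [[a b] s]; have [[/= s1 hb]|nb] := pselect (bad (a, b, s)); last by exists (a, b, s).
  pose t := s / 2; have t0 : 0 < t by rewrite divr_gt0.
  have st : s = 2 * t by rewrite /t; field.
  have ex a' b' : a' = a \/ a' = a + t -> b' = b \/ b' = b + t -> e * t ^+ 2 <= D a' b' t ->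
      exists Q', bad (a, b, s) -> bad Q' /\ child (a, b, s) Q'.
    move=> ha hb' h; exists (a', b', t) => _; split; first by split.
    by move: ha hb' {h} => [->|->] [->|->]; split=> /=; lra.
  have [h1|h1] := leP (e * t ^+ 2) (D a b t); first by apply: (ex a b) h1; left.
  have [h2|h2] := leP (e * t ^+ 2) (D (a + t) b t); first by apply: (ex (a + t) b) h2; [right|left].
  have [h3|h3] := leP (e * t ^+ 2) (D a (b + t) t); first by apply: (ex a (b + t)) h3; [left|right].
  have [h4|h4] := leP (e * t ^+ 2) (D (a + t) (b + t) t); first by apply: (ex (a + t) (b + t)) h4; right.
  have hs : s ^+ 2 = 4 * t ^+ 2 by rewrite st; ring.
  by exfalso; have := sub a b t t0; rewrite -st; rewrite hs in hb; lra.
pose Q k := iter k nx (a0, b0, s0).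
have badQ k : bad (Q k).
  elim: k => [|k ih]; last by have [] := hnx _ ih.
  by split=> //=; rewrite /e divfK// gt_eqF// exprn_gt0.
have chQ k : child (Q k) (Q k.+1) by have [] := hnx _ (badQ k).
have sk k : (Q k).2 = s0 / 2 ^+ k.
  elim: k => [|k ih]; first by rewrite expr0 divr1.
  by have [-> _ _ _ _] := chQ k; rewrite ih exprSr invfM mulrA.
have lim (l : R * R * R -> R) : (forall k, l (Q k) <= l (Q k.+1) /\ l (Q k.+1) + (Q k.+1).2 <= l (Q k) + (Q k).2) ->
    exists p, forall k, l (Q k) <= p <= l (Q k) + (Q k).2.
  move=> hl; pose E := [set l (Q k) | k in setT].
  have mono k m : l (Q k) <= l (Q (k + m)%N) /\ l (Q (k + m)%N) + (Q (k + m)%N).2 <= l (Q k) + (Q k).2.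
    elim: m => [|m [ih1 ih2]]; first by rewrite addn0; split.
    by rewrite addnS; have [h1 h2] := hl (k + m)%N; split; [exact: le_trans h1|exact: le_trans ih2].
  have ub k m : l (Q m) <= l (Q k) + (Q k).2.
    have [km|mk] := leqP k m.
      have [_ h] := mono k (m - k)%N; rewrite subnKC// in h.
      by apply: le_trans h; have [h _] := badQ m; rewrite lerDl ltW.
    have [h _] := mono m (k - m)%N; rewrite subnKC ?(ltnW mk)// in h.
    by apply: le_trans h _; have [h' _] := badQ k; rewrite lerDl ltW.
  have sE : has_sup E.
    by split; [exists (l (Q 0%N)), 0%N|exists (l (Q 0%N) + (Q 0%N).2) => _ [m _ <-]; exact: ub].
  exists (sup E) => k; apply/andP; split.
    by apply: sup_upper_bound => //; exists k.
  by apply: ge_sup; [exact: sE.1|move=> _ [m _ <-]; exact: ub].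
have [p hp] := lim (fun Q => Q.1.1) (fun k => let: And5 _ h1 h2 _ _ := chQ k in conj h1 h2).
have [q hq] := lim (fun Q => Q.1.2) (fun k => let: And5 _ _ _ h1 h2 := chQ k in conj h1 h2).
have [del del0 hdel] := loc p q (e / 2) ltac:(lra).
have [k hk] : exists k : nat, s0 / 2 ^+ k < del.
  exists (Num.bound (s0 / del)); rewrite ltr_pdivrMr ?exprn_gt0// -ltr_pdivrMl// mulrC.
  have h : s0 / del < (Num.bound (s0 / del))%:R by apply: archi_boundP; rewrite divr_ge0 ?ltW.
  apply: lt_le_trans h _.
  by rewrite -natrX ler_nat ltnW// ltn_expl.
have [sk0 hb] := badQ k; rewrite -sk in hk.
have := hdel _ _ _ sk0 hk (hp k) (hq k) => /(le_trans hb).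
have : 0 < e * (Q k).2 ^+ 2 by rewrite mulr_gt0 ?exprn_gt0.
by lra.
Qed.

End Bisection.

Section Goursat.
Context (R : realType).
Local Notation C := R[i].
Implicit Types (a b s x y : R) (G H : R -> R -> C).

Definition jcont G := ccont (fun q : R * R => G q.1 q.2).

Lemma jcont_near G p q (e : R) : jcont G -> 0 < e -> exists2 del : R, 0 < del &
  forall x y, `|x - p| <= del -> `|y - q| <= del -> normc (G x y - G p q) <= e.
Proof.
move=> cG e0; have := ccont_near (p, q) cG e0 => -[[A B] /= [hA hB] hAB].
move/nbhs_ballP: hA => [dA /= dA0 hA]; move/nbhs_ballP: hB => [dB /= dB0 hB].
exists (Num.min dA dB / 2); first by rewrite divr_gt0// lt_min dA0.
have m1 : Num.min dA dB <= dA by rewrite ge_min lexx.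
have m2 : Num.min dA dB <= dB by rewrite ge_min lexx orbT.
have m0 : 0 < Num.min dA dB by rewrite lt_min dA0.
move=> x y hx hy; apply/ltW/(hAB (x, y)); split => /=; [apply: hA|apply: hB].
  by rewrite -ball_normE /= distrC; lra.
by rewrite -ball_normE /= distrC; lra.
Qed.

(* The defect in Green's formula on the square [a, a + s] x [b, b + s]. *)
Definition green G H a b s : C :=
  cint a (a + s) (G^~ b) + 'i * cint b (b + s) (G (a + s))
  - cint a (a + s) (G^~ (b + s)) - 'i * cint b (b + s) (G a)
  - 'i * cint a (a + s) (fun x => cint b (b + s) (H x)).

Lemma jcont_x G y : jcont G -> ccont (G^~ y).
Proof. exact: ccont_pair2. Qed.

Lemma jcont_y G x : jcont G -> ccont (G x).
Proof. exact: ccont_pair1. Qed.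

Lemma jcont_cint H b b' : jcont H -> ccont (fun x => cint b b' (H x)).
Proof.
by move=> cH; apply: (ccont_cint b b' (g := fun y x => H x y)); exact: (ccont_swap (g := H)).
Qed.

Lemma greenD G1 G2 H1 H2 a b s : jcont G1 -> jcont G2 -> jcont H1 -> jcont H2 ->
  green (fun x y => G1 x y + G2 x y) (fun x y => H1 x y + H2 x y) a b s =
  green G1 H1 a b s + green G2 H2 a b s.
Proof.
move=> c1 c2 d1 d2; rewrite /green.
rewrite !cintD; try by [exact: jcont_x|exact: jcont_y].
have -> : (fun x => cint b (b + s) (fun y => H1 x y + H2 x y)) =
    fun x => cint b (b + s) (H1 x) + cint b (b + s) (H2 x).
  by apply/funext => x; rewrite cintD//; exact: jcont_y.
rewrite cintD; try exact: jcont_cint.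
ring.
Qed.

(** The inner edges are traversed twice, in opposite directions. *)
Lemma green_bisect G H a b s : jcont G -> jcont H ->
  green G H a b (2 * s) = green G H a b s + green G H (a + s) b s + green G H a (b + s) s +
    green G H (a + s) (b + s) s.
Proof.
move=> cG cH; rewrite /green.
have e c : c + 2 * s = c + s + s by rewrite mulr2n mulrDl !mul1r addrA.
have ec (F : R -> C) c : cint c (c + 2 * s) F = cint c (c + s) F + cint (c + s) (c + s + s) F.
  by rewrite e; exact: cint_cat.
have I1 c d : cint c d (fun x => cint b (b + 2 * s) (H x)) =
    cint c d (fun x => cint b (b + s) (H x)) + cint c d (fun x => cint (b + s) (b + s + s) (H x)).
  by rewrite -cintD; [apply: cint_eq => x; exact: ec|exact: jcont_cint|exact: jcont_cint].
rewrite !I1 !ec !e; ring.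
Qed.

(** Each of the four edges contributes at most $2Ms$, and the area term $2\cdot2M's^2$. *)
Lemma green_bound G H a b s (M M' : R) : 0 < s -> jcont G -> jcont H ->
  (forall x y, a <= x <= a + s -> b <= y <= b + s -> normc (G x y) <= M) ->
  (forall x y, a <= x <= a + s -> b <= y <= b + s -> normc (H x y) <= M') ->
  normc (green G H a b s) <= 8 * M * s + 4 * M' * s ^+ 2.
Proof.
move=> s0 cG cH hG hH.
have ab : a <= a + s by lra.
have bb : b <= b + s by lra.
have Ia : a <= a <= a + s by lra.
have Ia' : a <= a + s <= a + s by lra.
have Ib : b <= b <= b + s by lra.
have Ib' : b <= b + s <= b + s by lra.
have e c : c + s - c = s by rewrite addrAC subrr add0r.
have h1 := cint_bound ab (jcont_x b cG) (M := M) (fun x hx => hG x b hx Ib).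
have h2 := cint_bound ab (jcont_x (b + s) cG) (M := M) (fun x hx => hG x _ hx Ib').
have h3 := cint_bound bb (jcont_y (a + s) cG) (M := M) (fun y hy => hG _ y Ia' hy).
have h4 := cint_bound bb (jcont_y a cG) (M := M) (fun y hy => hG _ y Ia hy).
have h5 := cint_bound ab (jcont_cint b (b + s) cH) (M := 2 * M' * s)
  (fun x hx => le_trans (cint_bound bb (jcont_y x cH) (M := M') (fun y hy => hH x y hx hy)) _).
rewrite !e in h1 h2 h3 h4 h5.
have N5 (A B X Y Z : C) : normc (A + B - X - Y - Z) <=
    normc A + normc B + normc X + normc Y + normc Z.
  apply: le_trans (le_normcB _ _) _; rewrite lerD2r.
  apply: le_trans (le_normcB _ _) _; rewrite lerD2r.
  by apply: le_trans (le_normcB _ _) _; rewrite lerD2r; exact: le_normcD.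
apply: le_trans (N5 _ _ _ _ _) _.
rewrite !normcM !normci !mul1r.
have {}h5 := h5 (lexx _).
rewrite (_ : 2 * (2 * M' * s) * s = 4 * M' * s ^+ 2) in h5; last by ring.
lra.
Qed.

Lemma cint_affine a b (al be : C) : cint a b (fun t => al + be * t%:C) =
  al * (b - a)%:C + be * ((b ^+ 2 - a ^+ 2) / 2)%:C.
Proof.
have cid : ccont (fun t : R => t%:C) by apply: ccont_real => t; exact: cvg_id.
rewrite cintD; [|exact: ccont_cst|exact: ccontZ].
rewrite cint_cst cintZ//; congr (_ + _ * _).
rewrite (cint_primitive a b cid (G := fun t => (t ^+ 2 / 2)%:C)) -?rmorphB -?mulrBl//.
move=> t; apply: cderiv_real.
have h : is_derive t (1 : R) (2^-1 \*: (fun t : R => t ^+ 2)) (2^-1 *: (t *+ 2)).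
  apply: is_deriveZ; have h2 := is_deriveM (is_derive_id t (1 : R)) (is_derive_id t (1 : R)).
  by apply: (is_derive_ext h2) => [x|]; rewrite /GRing.scale /= ?expr2// !mulr1 mulr2n.
apply: (is_derive_ext h) => [x|]; rewrite /GRing.scale /=; first exact: mulrC.
by rewrite mulr2n; field.
Qed.

(** Green's formula is exact for affine functions, so only the remainder of the first-order
    expansion counts on a small square. *)
Lemma green_affine (g0 al be : C) (p q : R) a b s :
  green (fun x y => g0 + (x - p)%:C * al + (y - q)%:C * be) (fun _ _ => al + 'i * be) a b s = 0.
Proof.
have Ex y : (fun x => g0 + (x - p)%:C * al + (y - q)%:C * be) =
    fun x => (g0 - p%:C * al + (y - q)%:C * be) + al * x%:C.
  by apply/funext => x; rewrite rmorphB /=; ring.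
have Ey x : (fun y => g0 + (x - p)%:C * al + (y - q)%:C * be) =
    fun y => (g0 + (x - p)%:C * al - q%:C * be) + be * y%:C.
  by apply/funext => y; rewrite rmorphB /=; ring.
rewrite /green !Ex !Ey !cint_affine.
under cint_eq do rewrite cint_cst.
rewrite cint_cst.
have i2 : 'i * 'i = -1 :> C by rewrite -expr2 sqr_i.
rewrite !(rmorphB, rmorphD, rmorphM, fmorphV, rmorphXn, rmorph1, rmorph_nat) /=.
move: (a%:C) (b%:C) (s%:C) (p%:C) (q%:C) => A B S P Q.
have -> : 'i * ((al + 'i * be) * (B + S - B) * (A + S - A)) = 'i * al * S * S + ('i * 'i) * be * S * S by ring.
by rewrite i2; field.
Qed.

(** Besides [G], only the combination $H=G_x+iG_y$ has to be continuous, not the two partials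
    separately. This is the situation for $G=f\varphi$ with $f$ complex differentiable, where
    $H=2f\,\partial\varphi/\partial\bar z$. *)
Lemma green_eq0 G H a b s : 0 < s -> jcont G -> jcont H ->
  (forall p q, exists al be : C, al + 'i * be = H p q /\ forall e : R, 0 < e ->
     exists2 del : R, 0 < del & forall x y, `|x - p| <= del -> `|y - q| <= del ->
       normc (G x y - (G p q + (x - p)%:C * al + (y - q)%:C * be)) <= e * (`|x - p| + `|y - q|)) ->
  green G H a b s = 0.
Proof.
move=> s0 cG cH loc; apply: eq0_normc; apply/eqP; rewrite eq_le normc_ge0 andbT.
apply: (@bisection R (fun a b s => normc (green G H a b s))) => // {a b s s0}.
  move=> a b s s0; rewrite green_bisect//.
  by apply: le_trans (le_normcD _ _) _; rewrite lerD2r; apply: le_trans (le_normcD _ _) _;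
    rewrite lerD2r; exact: le_normcD.
move=> p q e e0; have [al [be [hH hG]]] := loc p q.
(* [green_bound] with $M=2e's$ and $M'=e'$ gives $20e's^2$. *)
pose e' := e / 20; have e'0 : 0 < e' by rewrite divr_gt0.
have [d1 d10 h1] := hG e' e'0.
have [d2 d20 h2] := jcont_near p q cH e'0.
exists (Num.min d1 d2); first by rewrite lt_min d10.
move=> a b s s0 sd ha hb.
have m1 : Num.min d1 d2 <= d1 by rewrite ge_min lexx.
have m2 : Num.min d1 d2 <= d2 by rewrite ge_min lexx orbT.
have inx x : a <= x <= a + s -> `|x - p| <= s by move=> hx; rewrite ler_norml; apply/andP; split; lra.
have iny y : b <= y <= b + s -> `|y - q| <= s by move=> hy; rewrite ler_norml; apply/andP; split; lra.
pose L x y := G p q + (x - p)%:C * al + (y - q)%:C * be.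
have cL : jcont L.
  apply: ccontD; [apply: ccontD; first exact: ccont_cst|].
    apply: ccontM; last exact: ccont_cst.
    by apply: ccont_real => z; apply: cvgB; [exact: cvg_fst|exact: cvg_cst].
  apply: ccontM; last exact: ccont_cst.
  by apply: ccont_real => z; apply: cvgB; [exact: cvg_snd|exact: cvg_cst].
have cK : jcont (fun _ _ => al + 'i * be) by exact: ccont_cst.
have cGL : jcont (fun x y => G x y - L x y) by apply: ccontD => //; exact: ccontN.
have cHK : jcont (fun x y => H x y - (al + 'i * be)) by apply: ccontD => //; exact: ccontN.
have -> : green G H a b s = green (fun x y => G x y - L x y) (fun x y => H x y - (al + 'i * be)) a b s.
  rewrite -[RHS]addr0 -(green_affine (G p q) al be p q a b s) -greenD//; congr (green _ _ _ _ _).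
    by apply/funext => x; apply/funext => y; rewrite subrK.
  by apply/funext => x; apply/funext => y; rewrite subrK.
apply: le_trans (green_bound (M := 2 * e' * s) (M' := e') s0 cGL cHK _ _) _.
- move=> x y /inx hx /iny hy; apply: le_trans (h1 x y _ _) _; [lra|lra|].
  by rewrite (_ : 2 * e' * s = e' * (2 * s)); [rewrite ler_pM2l//; lra|ring].
- by move=> x y /inx hx /iny hy; rewrite hH; apply: h2; lra.
by rewrite le_eqVlt; apply/orP; left; apply/eqP; rewrite /e'; field.
Qed.

End Goursat.

(** * Real differentiability in the plane *)

Section PlanarDifferentiability.
Context (R : realType).
Local Notation C := R[i].
Implicit Types (x y p q : R) (G H : R -> R -> C) (al be : C).

Definition rdiff G p q al be := forall e : R, 0 < e ->
  exists2 del : R, 0 < del & forall x y, `|x - p| <= del -> `|y - q| <= del ->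
    normc (G x y - (G p q + (x - p)%:C * al + (y - q)%:C * be)) <= e * (`|x - p| + `|y - q|).

Lemma cderiv_bound_abs (F F' : R -> C) (p x M : R) : (forall t, cderiv F t (F' t)) ->
  (forall t, `|t - p| <= `|x - p| -> normc (F' t) <= M) ->
  normc (F x - F p) <= 2 * M * `|x - p|.
Proof.
move=> D hM; have [px|xp] := leP p x.
  rewrite ger0_norm ?subr_ge0//; apply: (cderiv_bound px (F' := F')) => t ht; first exact: D.
  by apply: hM; rewrite !ger0_norm ?subr_ge0//; lra.
rewrite normcB distrC ger0_norm ?subr_ge0 ?(ltW xp)//.
apply: (cderiv_bound (ltW xp) (F' := F')) => t ht; first exact: D.
by apply: hM; rewrite distrC [in leRHS]distrC !ger0_norm ?subr_ge0//; lra.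
Qed.

Lemma cderiv_lin (c : C) p t : cderiv (fun s => (s - p)%:C * c) t c.
Proof.
have -> : (fun s => (s - p)%:C * c) = fun s => c * (s - p)%:C by apply/funext => s; rewrite mulrC.
rewrite -[X in cderiv _ _ X]mulr1; apply: cderivZ; apply: cderiv_real.
have h := is_deriveB (is_derive_id t (1 : R)) (is_derive_cst p t (1 : R)).
by apply: (is_derive_ext h) => [//|]; rewrite subr0.
Qed.

(** The increment is split at the corner $(x,q)$; each of the two mean value estimates uses one
    partial derivative close to its value at $(p,q)$. *)
Lemma rdiff_C1 G Gx Gy p q : (forall x y, cderiv (G^~ y) x (Gx x y)) ->
  (forall x y, cderiv (G x) y (Gy x y)) -> jcont Gx -> jcont Gy ->
  rdiff G p q (Gx p q) (Gy p q).
Proof.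
move=> Dx Dy cx cy e e0; have e2 : 0 < e / 2 by rewrite divr_gt0.
have [d1 d10 h1] := jcont_near p q cx e2; have [d2 d20 h2] := jcont_near p q cy e2.
exists (Num.min d1 d2); first by rewrite lt_min d10.
move=> x y; rewrite !le_min => /andP[hx1 hx2] /andP[hy1 hy2].
have -> : G x y - (G p q + (x - p)%:C * Gx p q + (y - q)%:C * Gy p q) =
    ((G x y - (y - q)%:C * Gy p q) - (G x q - (q - q)%:C * Gy p q)) +
    ((G x q - (x - p)%:C * Gx p q) - (G p q - (p - p)%:C * Gx p q)).
  by rewrite !subrr mul0r !subr0; ring.
rewrite mulrDr addrC; apply: le_trans (le_normcD _ _) _; apply: lerD.
  have := @cderiv_bound_abs (fun x => G x q - (x - p)%:C * Gx p q)
    (fun t => Gx t q - Gx p q) p x (e / 2) _ _.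
  rewrite (_ : 2 * (e / 2) = e); last by field.
  apply=> [t|t ht]; first by apply: cderivB; [exact: Dx|exact: cderiv_lin].
  by apply: h1; [exact: le_trans hx1|rewrite subrr normr0 ltW].
have := @cderiv_bound_abs (fun y => G x y - (y - q)%:C * Gy p q)
  (fun t => Gy x t - Gy p q) q y (e / 2) _ _.
rewrite (_ : 2 * (e / 2) = e); last by field.
apply=> [t|t ht]; first by apply: cderivB; [exact: Dy|exact: cderiv_lin].
by apply: h2 => //; exact: le_trans hy2.
Qed.

Lemma rdiffM G H p q al be ga de : rdiff G p q al be -> rdiff H p q ga de -> jcont H ->
  rdiff (fun x y => G x y * H x y) p q (al * H p q + G p q * ga) (be * H p q + G p q * de).
Proof.
move=> hG hH cH e e0.
(* [K] collects the factors of $e'(|x-p|+|y-q|)$ in the three terms of the remainder; [e' <= 1]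
   bounds $|H(x,y)|$ by $|H(p,q)|+1$. *)
pose K := normc (G p q) + (normc (H p q) + 1) + (normc al + normc be) + 1.
have K0 : 0 < K.
  have := normc_ge0 (G p q); have := normc_ge0 (H p q); have := normc_ge0 al; have := normc_ge0 be.
  by rewrite /K; lra.
pose e' := Num.min (e / K) 1; have e'0 : 0 < e' by rewrite lt_min divr_gt0 ?ltr01.
have e'1 : e' <= 1 by rewrite ge_min lexx orbT.
have e'K : e' * K <= e.
  have : e' <= e / K by rewrite ge_min lexx.
  by move=> /(ler_wpM2r (ltW K0)); rewrite divfK// gt_eqF.
have [d1 d10 h1] := hG e' e'0; have [d2 d20 h2] := hH e' e'0.
have [d3 d30 h3] := jcont_near p q cH e'0.
exists (Num.min d1 (Num.min d2 d3)); first by rewrite !lt_min d10 d20.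
move=> x y; rewrite !le_min => /and3P[hx1 hx2 hx3] /and3P[hy1 hy2 hy3].
have {}h1 := h1 x y hx1 hy1; have {}h2 := h2 x y hx2 hy2; have {}h3 := h3 x y hx3 hy3.
set r1 := G x y - _ in h1; set r2 := H x y - _ in h2; set s := `|x - p| + `|y - q| in h1 h2 *.
have s0 : 0 <= s by rewrite addr_ge0.
pose l := (x - p)%:C * al + (y - q)%:C * be.
have -> : G x y * H x y - (G p q * H p q + (x - p)%:C * (al * H p q + G p q * ga) +
    (y - q)%:C * (be * H p q + G p q * de)) = G p q * r2 + r1 * H x y + l * (H x y - H p q).
  by rewrite /r1 /r2 /l; ring.
have nl : normc l <= (normc al + normc be) * s.
  apply: le_trans (le_normcD _ _) _; rewrite !normcM !normc_real /s.
  have := normc_ge0 al; have := normc_ge0 be; have := normr_ge0 (x - p); have := normr_ge0 (y - q).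
  by nra.
have nH : normc (H x y) <= normc (H p q) + 1.
  have -> : H x y = H p q + (H x y - H p q) by ring.
  by apply: le_trans (le_normcD _ _) _; rewrite lerD2l (le_trans h3).
apply: le_trans (le_normcD _ _) _; rewrite normcM.
have b3 : normc l * normc (H x y - H p q) <= (normc al + normc be) * s * e'.
  by apply: ler_pM => //; exact: normc_ge0.
have b12 : normc (G p q * r2 + r1 * H x y) <= normc (G p q) * (e' * s) + e' * s * (normc (H p q) + 1).
  apply: le_trans (le_normcD _ _) _; rewrite !normcM; apply: lerD.
    by rewrite ler_wpM2l ?normc_ge0.
  by apply: ler_pM => //; exact: normc_ge0.
apply: le_trans (lerD b12 b3) _.
have := ler_wpM2r s0 e'K; have := mulr_ge0 (ltW e'0) s0; rewrite /K.
set A := normc (G p q); set B := normc (H p q); set D := normc al + normc be.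
by rewrite (_ : e' * (A + (B + 1) + D + 1) * s = A * (e' * s) + e' * s * (B + 1) + D * s * e' + e' * s);
  [lra|ring].
Qed.

Lemma green_supp G H (r A : R) : r < A -> 0 < A -> jcont G -> jcont H ->
  (forall x y, r < `|x| \/ r < `|y| -> G x y = 0) ->
  (forall p q, exists al be, al + 'i * be = H p q /\ rdiff G p q al be) ->
  cint (- A) A (fun x => cint (- A) A (H x)) = 0.
Proof.
move=> rA A0 cG cH G0 loc.
have s0 : 0 < 2 * A by rewrite mulr_gt0.
have e : - A + 2 * A = A by ring.
have := green_eq0 (- A) (- A) s0 cG cH loc; rewrite /green !e.
have z1 (F : R -> C) : (forall t, F t = 0) -> cint (- A) A F = 0.
  by move=> h; rewrite (@cint_eq _ _ _ _ (fun=> 0)) ?cint_cst ?mul0r.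
have nA : r < `|A| by rewrite gtr0_norm.
have nA' : r < `|- A| by rewrite normrN gtr0_norm.
rewrite (z1 (G^~ (- A))); last by move=> t; apply: G0; right.
rewrite (z1 (G A)); last by move=> t; apply: G0; left.
rewrite (z1 (G^~ A)); last by move=> t; apply: G0; right.
rewrite (z1 (G (- A))); last by move=> t; apply: G0; left.
rewrite !mulr0 !subr0 addr0 sub0r => /eqP.
have i0 : ('i : C) != 0 by rewrite eq_complex /= oner_eq0 andbF.
by rewrite oppr_eq0 mulf_eq0 (negPf i0) => /eqP.
Qed.

End PlanarDifferentiability.

(** * Complex differentiability with real error bounds *)

Section FrechetDerivatives.
Context (R : realType) (n : nat).
Local Notation C := R[i].
Local Notation Cn := 'rV[C]_n.
Implicit Types (f h : Cn -> C) (z w v : Cn) (d : 'I_n * bool) (j : 'I_n).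

(** The norm of [Cn] takes values in [R[i]]; its imaginary part is 0. *)
Definition vnorm v : R := Re `|v|.

Lemma vnormE v : `|v| = (vnorm v)%:C.
Proof.
have := normr_ge0 v; rewrite /vnorm; case: `|v| => a b; rewrite lecE /= => /andP[/eqP -> _].
by [].
Qed.

Lemma vnorm_ge0 v : 0 <= vnorm v.
Proof. by have := normr_ge0 v; rewrite vnormE lecR. Qed.

Lemma coord_le_vnorm v j : normc (v 0 j) <= vnorm v.
Proof.
rewrite -lecR -normc_norm -vnormE -[`|v|]/(mx_norm v) mx_normE.
rewrite -[`|v 0 j|]nngE num_le.
exact: (@le_bigmax _ _ _ _ (fun i : 'I_1 * 'I_n => `|v i.1 i.2|%:nng) (0, j)).
Qed.

Lemma vnormZ (c : C) v : vnorm (c *: v) = normc c * vnorm v.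
Proof.
have : (vnorm (c *: v))%:C = (normc c * vnorm v)%:C.
  by rewrite -vnormE normrZ normc_norm vnormE -rmorphM.
by move=> /(congr1 (@complex.Re R)).
Qed.

Lemma differentiable_approx f z : differentiable f z -> exists L : {linear Cn -> C^o},
  forall e : R, 0 < e -> exists2 rho : R, 0 < rho &
    forall v, (forall d, `|crd d v| <= rho) -> normc (f (v + z) - (f z + L v)) <= e * vnorm v.
Proof.
move=> /diff_locallyP[_ /eqaddoP df]; exists ('d f z) => e e0.
have ec0 : 0 < e%:C by rewrite ltcR.
have [rho [rho0 hrho]] := nbhs_cube (df _ ec0).
exists rho => // v hv.
rewrite -lecR rmorphM /= -vnormE -normc_norm; apply: (hrho v) => d.
by rewrite crd0 subr0; exact: hv.
Qed.

Lemma approx_differentiable f z (L : {linear Cn -> C^o}) : continuous L ->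
  (forall e : R, 0 < e -> exists2 rho : R, 0 < rho &
    forall v, (forall d, `|crd d v| <= rho) -> normc (f (v + z) - (f z + L v)) <= e * vnorm v) ->
  differentiable f z.
Proof.
move=> cL hL.
have E : f \o shift z = cst (f z) + L +o_ (0 : Cn) id.
  apply/eqaddoP => e e0.
  have [e1 [e10 e1e]] : exists e1 : R, 0 < e1 /\ e1%:C = e.
    case: e e0 => a b; rewrite ltcE /= => /andP[/eqP -> a0]; exists a; split=> //.
  have [rho rho0 hrho] := hL e1 e10.
  apply: filterS (nbhs_Qo n rho0) => v hv.
  rewrite -e1e vnormE -rmorphM /= normc_norm lecR.
  by apply: (hrho v) => d; exact/ltW/hv.
by apply/diff_locallyP; rewrite (diff_unique cL E).
Qed.

End FrechetDerivatives.

(** * Complex differentiability and the Cauchy-Riemann equations *)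

Section HolomorphicSmooth.
Context (R : realType) (n : nat).
Local Notation C := R[i].
Local Notation Cn := 'rV[C]_n.
Local Notation dir := ('I_n * bool)%type.
Implicit Types (f h phi : Cn -> C) (z w v : Cn) (d : dir) (j : 'I_n) (r : R).

Lemma axisZ j (s t : R) : axis j s t = (s +i* t) *: (delta_mx 0 j : Cn).
Proof.
apply/rowP => k; rewrite /axis !mvE !mxE /= ?eqxx.
case: eqP => _ /=; last by rewrite !addr0 mulr0.
by rewrite add0r mulr1; apply: eqC; rewrite !(ReD, ImD, ReM, ImM) /=; ring.
Qed.

Lemma mv_axis j w (x y p q : R) : mv (mv w (j, false) x) (j, true) y =
  axis j (x - p) (y - q) + mv (mv w (j, false) p) (j, true) q.
Proof.
apply: crdP => -[k b]; rewrite crdD crd_axis !crd_mv /= !xpair_eqE.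
by case: eqP => _; case: b; rewrite /= ?addr0 ?add0r//; ring.
Qed.

(** Complex linearity of the derivative makes the $y$-partial equal to $i$ times the $x$-partial. *)
Lemma rdiff_holo f j w (p q : R) : differentiable f (mv (mv w (j, false) p) (j, true) q) ->
  exists c : C, rdiff (fun x y => f (mv (mv w (j, false) x) (j, true) y)) p q c ('i * c).
Proof.
move=> /differentiable_approx[L hL]; exists (L (delta_mx 0 j)) => e e0.
set N := vnorm (delta_mx 0 j : Cn); have N0 : 0 <= N := vnorm_ge0 _.
have N1 : 0 < N + 1 by rewrite ltr_wpDl.
have [rho rho0 hrho] := hL (e / (N + 1)) (divr_gt0 e0 N1).
exists rho => // x y hx hy; rewrite (mv_axis j w x y p q).
set P := mv (mv w _ p) _ q.
have hv d : `|crd d (axis j (x - p) (y - q) : Cn)| <= rho.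
  by rewrite crd_axis; case: eqP => _; [case: d.2|rewrite normr0 ltW].
have {}hrho := hrho _ hv.
have e1 : (x - p)%:C * L (delta_mx 0 j) + (y - q)%:C * ('i * L (delta_mx 0 j)) =
    L (axis j (x - p) (y - q)).
  rewrite axisZ linearZ /= /GRing.scale /= mulrA -mulrDl; congr (_ * _).
  by apply: eqC; rewrite !(ReD, ImD, ReM, ImM) /=; ring.
rewrite -addrA e1; apply: le_trans hrho _.
rewrite axisZ vnormZ -/N -mulrA ler_wpM2l ?(ltW e0)//.
rewrite ler_pdivrMl//; apply: le_trans (ler_wpM2r N0 (normc_le_ReIm _)) _ => /=.
rewrite mulrC ler_wpM2r ?addr_ge0//; lra.
Qed.

Lemma rdiff_smooth phi j w (p q : R) : smooth_on setT phi ->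
  rdiff (fun x y => phi (mv (mv w (j, false) x) (j, true) y)) p q
    (pd (j, false) phi (mv (mv w (j, false) p) (j, true) q))
    (pd (j, true) phi (mv (mv w (j, false) p) (j, true) q)).
Proof.
move=> sphi.
have cP : continuous (fun q : R * R => mv (mv w (j, false) q.1) (j, true) q.2).
  apply: (@continuous_mv_gen _ _ _ (fun q : R * R => mv w (j, false) q.1) (fun q => q.2)).
    apply: (@continuous_mv_gen _ _ _ (fun _ : R * R => w) (fun q => q.1)).
      exact: continuous_rV_cst.
    exact: continuous_fst.
  exact: continuous_snd.
have cd d : jcont (fun x y => pd d phi (mv (mv w (j, false) x) (j, true) y)).
  exact: (ccont_comp (smooth_ccont (smooth_on_partial d sphi)) cP).
apply: (rdiff_C1 p q (Gx := fun x y => pd (j, false) phi (mv (mv w (j, false) x) (j, true) y))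
  (Gy := fun x y => pd (j, true) phi (mv (mv w (j, false) x) (j, true) y))) => //.
  move=> x y; rewrite mvC.
  have -> : (fun t : R => phi (mv (mv w (j, false) t) (j, true) y)) =
      fun t => phi (mv (mv w (j, true) y) (j, false) t) by apply/funext => t; rewrite mvC.
  exact: (smooth_on_cderiv_mv sphi I).
by move=> x y; exact: (smooth_on_cderiv_mv sphi I).
Qed.

(** With the other variables fixed, the integral over the $z_j$-plane is, up to a factor, the area
    term of Green's formula for $f\varphi$, whose boundary terms vanish by compact support. *)
Lemma integral_holo_dz f r r' phi j : 0 < r' -> r' < r ->
  (forall z, Qo r z -> differentiable f z) -> tst r' phi ->
  integralCn (fun z => f z * dz j phi z) = 0.
Proof.
move=> r'0 r'r df tphi; have r0 : 0 < r by lra.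
have cf z : Qo r z -> ccont_at f z.
  by move=> Qz; constructor; apply: differentiable_continuous; exact: df.
have td := tst_dz j tphi.
have cF := ccont_supp r'r cf (smooth_ccont td.1) td.2.
have cfphi := ccont_supp r'r cf (smooth_ccont tphi.1) tphi.2.
rewrite (@integralCnE _ _ r)//; last first.
  by apply: supported_in_mul => z Nz; apply: td.2 => Q; apply: Nz; exact: Qb_sub (ltW r'r) _ Q.
pose rest : seq dir := [seq e <- enum {: dir} | e.1 != j].
have urest : uniq rest by rewrite filter_uniq ?enum_uniq.
have pe : perm_eq (enum {: dir}) (rest ++ [:: (j, false); (j, true)]).
  apply: uniq_perm; rewrite ?enum_uniq//.
    rewrite cat_uniq urest /= !mem_filter /= eqxx /= !in_cons xpair_eqE andbF.
    by [].
  move=> [k b]; rewrite mem_enum mem_cat mem_filter mem_enum /= !in_cons !xpair_eqE /= andbT.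
  by case: eqP => //= _; case: b.
rewrite (bint_perm _ (ltW r0) cF pe) bint_cat.
rewrite (@bint_ext _ _ _ _ _ (fun=> 0)) ?bint0 ?(ltW r0)//; [exact: ccont_bint|exact: ccont_cst|].
move=> w [hw _].
have w0 b : crd (j, b) w = 0 by rewrite hw ?crd0// mem_filter eqxx.
pose P x y := mv (mv w (j, false) x) (j, true) y.
have cP : continuous (fun q : R * R => P q.1 q.2).
  apply: (@continuous_mv_gen _ _ _ (fun q : R * R => mv w (j, false) q.1) (fun q => q.2)).
    apply: (@continuous_mv_gen _ _ _ (fun _ : R * R => w) (fun q => q.1)).
      exact: continuous_rV_cst.
    exact: continuous_fst.
  exact: continuous_snd.
pose G x y := f (P x y) * phi (P x y).
(* The factor is that of $\partial_x+i\partial_y=2\,\partial/\partial\bar z_j$. *)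
pose H x y := 2 * (f (P x y) * dz j phi (P x y)).
have cG : jcont G := ccont_comp cfphi cP.
have cH : jcont H := ccontZ 2 (ccont_comp cF cP).
have crdP1 x y : crd (j, false) (P x y) = x.
  by rewrite /P !crd_mv w0 !xpair_eqE eqxx /= add0r addr0.
have crdP2 x y : crd (j, true) (P x y) = y.
  by rewrite /P !crd_mv w0 !xpair_eqE eqxx /= addr0 add0r.
have G0 x y : r' < `|x| \/ r' < `|y| -> G x y = 0.
  move=> hxy; rewrite /G tphi.2 ?mulr0// => Q; case: hxy => hh.
    by have := Q (j, false); rewrite crdP1 leNgt hh.
  by have := Q (j, true); rewrite crdP2 leNgt hh.
have loc p q : exists al be, al + 'i * be = H p q /\ rdiff G p q al be.
  have [Q|NQ] := pselect (Qo r (P p q)).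
    have [c hc] := rdiff_holo (df _ Q).
    have hphi := rdiff_smooth j w p q tphi.1.
    have cphi : jcont (fun x y => phi (P x y)) := ccont_comp (smooth_ccont tphi.1) cP.
    do 2!eexists; split; last exact: (rdiffM hc hphi cphi).
    rewrite /H dzE -/(P p q); move: (f _) (phi _) (pd _ _ _) (pd _ _ _) => a b y x.
    have i2 : 'i * 'i = -1 :> C by rewrite -expr2 sqr_i.
    have -> : c * b + a * x + 'i * ('i * c * b + a * y) = c * b + a * x + ('i * 'i) * c * b + 'i * a * y by ring.
    by rewrite i2; field.
  (* Here [f] need not be differentiable, but [phi] vanishes near the point, so the product has
     derivative 0. *)
  have [d hd] : exists d, r' < `|crd d (P p q)|.
    apply: contrapT => hh; apply: NQ => d; apply: le_lt_trans r'r; rewrite leNgt; apply/negP => hd.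
    by apply: hh; exists d.
  have N0 x y : `|x - p| < `|crd d (P p q)| - r' -> `|y - q| < `|crd d (P p q)| - r' -> phi (P x y) = 0.
    move=> hx hy; apply: tphi.2 => /(_ d); rewrite {1}/P (mv_axis j w x y p q) crdD crd_axis -/(P p q).
    rewrite leNgt => /negP; apply.
    set c := crd d (P p q) in hx hy *; set t := (if _ then _ else _).
    have := lerB_dist c (- t); rewrite opprK normrN [c + t]addrC /t.
    by case: eqP => _; [case: d.2|rewrite normr0]; lra.
  exists 0, 0; split.
    rewrite mulr0 addr0 /H (_ : dz j phi (P p q) = 0) ?mulr0//.
    by apply: td.2 => /(_ d); rewrite leNgt hd.
  move=> e e0; exists ((`|crd d (P p q)| - r') / 2); first by lra.
  move=> x y hx hy; rewrite /G !N0 ?subrr ?normr0 ?mulr0 ?addr0 ?subr0 ?normc0 ?mulr_ge0 ?addr_ge0 ?(ltW e0)//; lra.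
have := green_supp r'r r0 cG cH G0 loc; rewrite /H.
have E x : cint (- r) r (fun y => 2 * (f (P x y) * dz j phi (P x y))) =
    2 * cint (- r) r (fun y => f (P x y) * dz j phi (P x y)).
  by apply: cintZ; exact: (jcont_y x (ccont_comp cF cP : jcont (fun x y => f (P x y) * dz j phi (P x y)))).
rewrite (cint_eq _ _ E) cintZ; last exact: (jcont_cint _ _ (ccont_comp cF cP : jcont (fun x y => f (P x y) * dz j phi (P x y)))).
by move=> /eqP; rewrite mulf_eq0 pnatr_eq0 => /eqP.
Qed.

Lemma dist_integral f r r' : 0 < r' -> r' < r -> (forall z, Qo r z -> ccont_at f z) ->
  dist r' (fun phi => integralCn (fun z => f z * phi z)).
Proof.
move=> r'0 r'r cf.
have cphi phi : tst r' phi -> ccont (fun z => f z * phi z).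
  by move=> tphi; exact: ccont_supp r'r cf (smooth_ccont tphi.1) tphi.2.
have E phi : tst r' phi -> integralCn (fun z => f z * phi z) = bint r' (enum {: dir}) (fun z => f z * phi z) 0.
  by move=> tphi; rewrite (@integralCnE _ _ r')//; [exact: cphi|exact/supported_in_mul/tphi.2].
constructor.
  move=> c phi psi t1 t2; rewrite !E//; last by apply: tstD => //; exact: tstZ.
  have c1 := cphi _ t1; have c2 := cphi _ t2.
  rewrite -bintZ// -bintD//; last exact: ccontZ.
  by congr (bint _ _ _ _); apply/funext => z; ring.
have cQ z : Qb r' z -> ccont_at f z by move=> Q; apply: cf; exact: Qb_Qo r'r _ Q.
have /filter_ex[M hM] : \forall M \near +oo, 0 <= M /\ forall z, Qb r' z -> normc (f z) <= M.
  near=> M; split; first by near: M; exact: nbhs_pinfty_ge.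
  by near: M; exact: (compact_bound (@compact_Qb R n r') cQ).
case: hM => M0 hM.
exists 0%N, ((4 * r') ^+ size (enum {: dir}) * M); split.
  by rewrite mulr_ge0 ?exprn_ge0// mulr_ge0 ?ltW.
move=> phi B tphi hB; rewrite E// -mulrA.
apply: bint_bound; rewrite ?(ltW r'0) ?enum_uniq//; first exact: cphi.
move=> w _; have [Q|NQ] := pselect (Qb r' w).
  by rewrite normcM ler_pM ?normc_ge0 ?hM//; exact: (hB [::]).
by rewrite tphi.2// mulr0 normc0 mulr_ge0 ?(sbound_ge0 hB).
Unshelve. all: by end_near. Qed.

Lemma holo_smooth f r r' : 0 < r' -> r' < r -> (forall z, Qo r z -> differentiable f z) ->
  smooth_on (Qo r') f /\ forall j z, Qo r' z -> dz j f z = 0.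
Proof.
move=> r'0 r'r df; pose r1 := (r + r') / 2.
have r'r1 : r' < r1 by rewrite /r1; lra.
have r1r : r1 < r by rewrite /r1; lra.
have r10 : 0 < r1 by lra.
have cf z : Qo r z -> ccont_at f z.
  by move=> Qz; constructor; apply: differentiable_continuous; exact: df.
have du := dist_integral r10 r1r cf.
have [h [sh hh dh]] := weyl r'0 r'r1 du (fun j phi t => integral_holo_dz j r10 r1r df t).
have sub z : Qo r' z -> Qo r z by move=> Q d; exact: lt_trans (Q d) r'r.
have fh z : Qo r' z -> f z = h z.
  move=> Qz; apply/eqP; rewrite -subr_eq0; apply/eqP; move: z Qz.
  apply: (@integral_test_eq0 R n r' (fun z => f z - h z) r'0).
    move=> z Qz; apply: ccont_atD; first exact/cf/sub.
    by apply: ccont_atW; apply: ccontN; exact: smooth_ccont.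
  move=> r2 phi r20 r2r' sphi supphi; have tphi : tst r' phi := tstW (ltW r2r') (conj sphi supphi).
  have c1 : ccont (fun z => f z * phi z) by exact: ccont_supp r'r cf (smooth_ccont sphi) tphi.2.
  have c2 : ccont (fun z => h z * phi z) := ccontM (smooth_ccont sh) (smooth_ccont sphi).
  have -> : (fun z => (f z - h z) * phi z) = fun z => f z * phi z + -1 * (h z * phi z).
    by apply/funext => z; rewrite mulrBl mulN1r.
  rewrite (@integralCnE _ _ r')//; last first.
  - by move=> z Nz; rewrite tphi.2// !mulr0 addr0.
  - by apply: ccontD => //; exact: ccontZ.
  have := hh _ tphi; rewrite (@integralCnE _ _ r')//; last exact/supported_in_mul/tphi.2.
  rewrite (@integralCnE _ _ r')//; last exact/supported_in_mul/tphi.2.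
  by rewrite bintD ?bintZ//; [move=> ->; rewrite mulN1r subrr|exact: ccontZ].
split.
  apply: (smooth_on_eq (@open_Qo R n r') (fun z Qz => esym (fh z Qz))).
  exact: smooth_onW sh.
by move=> j z Qz; rewrite (dz_eq_on j (@open_Qo R n r') fh Qz) dh.
Qed.

Definition lin_form (c : 'I_n -> C) (v : Cn) : C^o := \sum_j v 0 j * c j.

Lemma lin_form_linear c : linear (lin_form c).
Proof.
move=> a v w; rewrite /lin_form scaler_sumr -big_split /=; apply: eq_bigr => j _.
by rewrite !mxE mulrDl /GRing.scale /= mulrA.
Qed.

HB.instance Definition _ c := GRing.isLinear.Build C Cn C^o _ (lin_form c) (lin_form_linear c).

Definition mvs (s : seq dir) v z : Cn := foldr (fun d w => mv w d (crd d v)) z s.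

Lemma crd_mvs s v z e : uniq s -> crd e (mvs s v z) = crd e z + (if e \in s then crd e v else 0).
Proof.
elim: s => [|d s ih] /=; first by rewrite addr0.
move=> /andP[ds us]; rewrite crd_mv ih// in_cons.
by case: (eqVneq e d) => [->|ed]; rewrite ?(negPf ds) /= ?addr0.
Qed.

(** The displacement [v] is made one coordinate at a time; each move changes [h] by the partial at
    [z] up to the oscillation [e], with the factor 2 of [cderiv_bound]. *)
Lemma mvs_bound h z v (e rho : R) s : 0 <= e -> 0 <= rho -> smooth_on setT h -> uniq s ->
  (forall d w, (forall d, `|crd d w - crd d z| <= rho) -> normc (pd d h w - pd d h z) <= e) ->
  (forall d, `|crd d v| <= rho) ->
  normc (h (mvs s v z) - (h z + \sum_(d <- s) (crd d v)%:C * pd d h z)) <=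
    \sum_(d <- s) 2 * e * `|crd d v|.
Proof.
move=> e0 rho0 sh + hpd hv; elim: s => [|d s ih].
  by rewrite !big_nil addr0 subrr normc0.
move=> /= /andP[ds us]; rewrite !big_cons.
set w := mvs s v z.
have -> : h (mv w d (crd d v)) - (h z + ((crd d v)%:C * pd d h z + \sum_(j <- s) (crd j v)%:C * pd j h z)) =
    ((h (mv w d (crd d v)) - (crd d v - 0)%:C * pd d h z) - (h (mv w d 0) - (0 - 0)%:C * pd d h z)) +
    (h w - (h z + \sum_(j <- s) (crd j v)%:C * pd j h z)).
  by rewrite mv0 !subr0 mul0r subr0; ring.
apply: le_trans (le_normcD _ _) _; apply: lerD; last exact: ih.
rewrite -[X in _ * `|X|]subr0.
apply: (@cderiv_bound_abs R (fun t => h (mv w d t) - (t - 0)%:C * pd d h z)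
  (fun t => pd d h (mv w d t) - pd d h z)) => t.
  by apply: cderivB; [exact: (smooth_on_cderiv_mv sh I)|exact: cderiv_lin].
rewrite !subr0 => ht; apply: hpd => k.
rewrite crd_mv crd_mvs//; case: (eqVneq k d) => [->|kd].
  by rewrite (negPf ds) addr0 addrC addKr (le_trans ht).
by rewrite addr0 addrC addKr; case: ifP => _; rewrite ?normr0.
Qed.

(** The Cauchy-Riemann equations make the real differential complex linear. Germs are defined by
    complex differentiability, so the function produced by [weyl] becomes a germ only through this
    converse. *)
Lemma smooth_holo h z : smooth_on setT h -> (forall j, dz j h z = 0) -> differentiable h z.
Proof.
move=> sh dh; have cpd d : ccont (pd d h) := smooth_ccont (smooth_on_partial d sh).
have cr d : pd (d.1, true) h z = 'i * pd (d.1, false) h z.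
  have := dh d.1; rewrite dzE => /eqP; rewrite mulf_eq0 invr_eq0 pnatr_eq0 orbF.
  rewrite addr_eq0 => /eqP ->; rewrite mulrN mulrA -expr2 sqr_i mulN1r opprK.
  by [].
apply: (@approx_differentiable _ _ h z (lin_form (fun j => pd (j, false) h z))).
  have c1 : ccont (lin_form (fun j => pd (j, false) h z)).
    rewrite /lin_form.
    have cs (s : seq 'I_n) : ccont (fun v : Cn => \sum_(j <- s) v 0 j * pd (j, false) h z).
      elim: s => [|j s ih]; first by apply: ccont_eq (ccont_cst _ 0) _ => v; rewrite big_nil.
      apply: ccont_eq (ccontD (ccontM (ccont_coord R j) (ccont_cst _ (pd (j, false) h z))) ih) _ => v.
      by rewrite big_cons.
    exact: cs.
  exact: ccontE c1.
move=> e e0; pose N : R := (size (enum {: dir}))%:R.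
have N0 : 0 <= N by exact: ler0n.
pose e' := e / (2 * (N + 1)); have e'0 : 0 < e' by rewrite divr_gt0 ?mulr_gt0 ?ltr_wpDl.
have near1 : \forall w \near z, forall d, normc (pd d h w - pd d h z) < e'.
  exact: (@filter_forall _ _ (fun d w => normc (pd d h w - pd d h z) < e') _ _ (fun d => ccont_near z (cpd d) e'0)).
have [rho [rho0 hrho]] := nbhs_cube near1.
exists rho => // v hv.
have := @mvs_bound h z v e' rho (enum {: dir}) (ltW e'0) (ltW rho0) sh (enum_uniq _)
  (fun d w hw => ltW (hrho w hw d)) hv.
have -> : mvs (enum {: dir}) v z = v + z.
  by apply: crdP => d; rewrite crd_mvs ?enum_uniq// mem_enum crdD addrC.
have -> : \sum_(d <- enum {: dir}) (crd d v)%:C * pd d h z = lin_form (fun j => pd (j, false) h z) v.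
  pose F j b : C := (crd (j, b) v)%:C * pd (j, b) h z.
  rewrite big_enum /= (eq_bigr (fun d : dir => F d.1 d.2)); last by case.
  rewrite -(pair_bigA _ F) /=.
  apply: eq_bigr => j _; rewrite big_bool /F /= (cr (j, true)) mulrA -mulrDl; congr (_ * _).
  by rewrite /crd /=; case: (v 0 j) => a b; apply: eqC; rewrite /=; ring.
move=> /le_trans; apply.
apply: (@le_trans _ _ (\sum_(d <- enum {: dir}) 2 * e' * vnorm v)).
  apply: ler_sum => -[j b] _; apply: ler_wpM2l; first by apply: mulr_ge0 => //; exact: ltW.
  apply: le_trans (coord_le_vnorm v j).
  by rewrite /crd; case: b; [exact: Im_le_normc|exact: Re_le_normc].
rewrite big_const_seq count_predT iter_addr_0 -[_ *+ size _]mulr_natr -/N /e'.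
rewrite (_ : 2 * (e / (2 * (N + 1))) * vnorm v * N = e * vnorm v * (N / (N + 1))); last first.
  by field; rewrite gt_eqF// ltr_wpDl.
rewrite ler_piMr ?mulr_ge0 ?vnorm_ge0 ?(ltW e0)// ler_pdivrMr ?ltr_wpDl//; lra.
Qed.

End HolomorphicSmooth.

(** * Germs of currents *)

Section CurrentGerms.
Context (R : realType) (n : nat).
Local Notation C := R[i].
Local Notation Cn := 'rV[C]_n.
Implicit Types (phi psi : Cn -> C) (z w : Cn) (r : R) (j : 'I_n) (I : {set 'I_n})
  (T S : current R n) (g h : hgerm R n).

Definition null_germ T := exists r : R, 0 < r /\ forall I phi, tst r phi -> T I phi = 0.

(** All coefficients are required to be distributions, also those of the wrong degree, which vanish
    near 0; then [dbar] and sums need no case distinction on [#|I|]. *)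
Definition current_near (q : nat) T := exists r : R, [/\ 0 < r, forall I, dist r (T I) &
  forall I phi, #|I| <> q -> tst r phi -> T I phi = 0].

Lemma tst_test_fun (U : set Cn) r phi : Qb r `<=` U -> tst r phi -> test_fun U phi.
Proof.
move=> QU [sphi supp]; split; first exact/smooth_onT.
by exists (Qb r); split=> //; exact: compact_Qb.
Qed.

Lemma eq_current_germP T S : eq_current_germ T S <-> null_germ (T - S).
Proof.
split=> [[U [[oU U0] h]]|[r [r0 h]]].
  have [r [r0 QU]] := nbhs0_Qb (open_nbhs_nbhs (conj oU U0)).
  exists r; split=> // I phi tphi.
  by rewrite -[LHS]/(T I phi - S I phi) h ?subrr//; exact: tst_test_fun tphi.
exists (Qo r); split; first by split; [exact: open_Qo|exact: Qo0].
move=> I phi [/smooth_onT sphi [K [_ KQ supp]]]; apply/eqP; rewrite -subr_eq0; apply/eqP.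
apply: h; split=> // z Nz; apply: supp => Kz; apply: Nz; exact/Qo_Qb/KQ.
Qed.

Lemma current_germ_good q T : current_germ q T -> current_near q T.
Proof.
move=> [U [[oU U0] dT qT]]; have [r [r0 QU]] := nbhs0_Qb (open_nbhs_nbhs (conj oU U0)).
exists r; split=> // I.
  have [Iq|Iq] := eqVneq #|I| q; first exact: distribution_dist QU (dT I Iq).
  constructor=> [c phi psi t1 t2|].
    have Iq' : #|I| <> q by exact/eqP.
    have t3 := tst_test_fun QU (tstD (tstZ c t1) t2).
    have t1' := tst_test_fun QU t1; have t2' := tst_test_fun QU t2.
    by rewrite (qT I _ Iq' t3) (qT I _ Iq' t1') (qT I _ Iq' t2') mulr0 addr0.
  exists 0%N, 0; split=> // phi B tphi _; rewrite qT ?normc0 ?mul0r//; first exact/eqP.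
  exact: tst_test_fun QU tphi.
by move=> phi Iq tphi; apply: qT => //; exact: tst_test_fun QU tphi.
Qed.

Lemma null0 : null_germ 0.
Proof. by exists 1; split. Qed.

Lemma nullD T S : null_germ T -> null_germ S -> null_germ (T + S).
Proof.
move=> [r [r0 h]] [s [s0 k]]; exists (Num.min r s); split; first by rewrite lt_min r0.
move=> I phi tphi; rewrite -[LHS]/(T I phi + S I phi).
by rewrite h ?k ?addr0//; apply: tstW tphi; rewrite ge_min lexx ?orbT.
Qed.

Lemma nullN T : null_germ T -> null_germ (- T).
Proof.
by move=> [r [r0 h]]; exists r; split=> // I phi t; rewrite -[LHS]/(- T I phi) h ?oppr0.
Qed.

Lemma dist_zero_on r (u : functional R n) : (forall phi, tst r phi -> u phi = 0) -> dist r u.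
Proof.
move=> h; constructor=> [c phi psi t1 t2|].
  by rewrite !h ?mulr0 ?addr0//; apply: tstD => //; exact: tstZ.
by exists 0%N, 0; split=> // phi B tphi _; rewrite h ?normc0 ?mul0r.
Qed.

Lemma null_good q T : null_germ T -> current_near q T.
Proof.
move=> [r [r0 h]]; exists r; split=> // [I|I phi _ t]; last exact: h.
by apply: dist_zero_on => phi; exact: h.
Qed.

Lemma goodD q T S : current_near q T -> current_near q S -> current_near q (T + S).
Proof.
move=> [r [r0 dT qT]] [s [s0 dS qS]]; exists (Num.min r s).
have m1 : Num.min r s <= r by rewrite ge_min lexx.
have m2 : Num.min r s <= s by rewrite ge_min lexx orbT.
split; first by rewrite lt_min r0.
  by move=> I; exact: (distribD (distW m1 (dT I)) (distW m2 (dS I))).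
move=> I phi Iq tphi; rewrite -[LHS]/(T I phi + S I phi) qT ?qS ?addr0//.
  exact: tstW m2 tphi.
exact: tstW m1 tphi.
Qed.

Lemma goodN q T : current_near q T -> current_near q (- T).
Proof.
move=> [r [r0 dT qT]]; exists r; split=> // [I|I phi Iq tphi].
  exact: distribN (dT I).
by rewrite -[LHS]/(- T I phi) qT ?oppr0.
Qed.

Lemma near_Qo (P : Cn -> Prop) : (\forall z \near (0 : Cn), P z) ->
  exists r : R, 0 < r /\ forall z, Qo r z -> P z.
Proof.
by move=> /nbhs0_Qb[r [r0 h]]; exists r; split=> // z Q; apply: h; exact: Qo_Qb.
Qed.

Lemma germ_eq_near (f1 f2 : holo_fun R n) :
  \pi_(hgerm R n)%qT f1 = \pi_(hgerm R n)%qT f2 -> \forall z \near (0 : Cn), f1 z = f2 z.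
Proof.
move=> /eqP; rewrite -Quotient.idealrBE unfold_in => /asboolP; apply: filterS => z.
by rewrite -[X in X = 0]/(f1 z - f2 z) => /eqP; rewrite subr_eq0 => /eqP.
Qed.

Lemma pi_germ_rep g : \pi_(hgerm R n)%qT (repr g) = g.
Proof. exact: reprK. Qed.

Lemma germ_repD g h : \forall z \near (0 : Cn), germ_rep (g + h) z = germ_rep g z + germ_rep h z.
Proof.
apply: (@germ_eq_near (repr (g + h)) (repr g + repr h)).
by rewrite pi_germ_rep rmorphD /= !pi_germ_rep.
Qed.

Lemma germ_repM g h : \forall z \near (0 : Cn), germ_rep (g * h) z = germ_rep g z * germ_rep h z.
Proof.
apply: (@germ_eq_near (repr (g * h)) (repr g * repr h)).
by rewrite pi_germ_rep rmorphM /= !pi_germ_rep.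
Qed.

Lemma germ_smooth g : exists r : R, [/\ 0 < r, smooth_on (Qo r) (germ_rep g) &
  forall j z, Qo r z -> dz j (germ_rep g) z = 0].
Proof.
have : holo_val (repr g) \in @holo0 R n by case: (repr g).
rewrite unfold_in => /asboolP /near_Qo[r [r0 h]].
have [h1 h2] := @holo_smooth R n (germ_rep g) r (r / 2) ltac:(lra) ltac:(lra) h.
by exists (r / 2); split=> //; lra.
Qed.

Lemma tst_germ g : exists r : R, 0 < r /\ forall r' phi, r' < r -> tst r' phi ->
  tst r' (fun z => germ_rep g z * phi z).
Proof.
have [r [r0 sg _]] := germ_smooth g; exists r; split=> // r' phi r'r tphi.
exact: tst_mul r'r sg tphi.
Qed.

Lemma act_null g T : null_germ T -> null_germ (mul_current g T).
Proof.
move=> [r [r0 h]]; have [s [s0 k]] := tst_germ g; exists (Num.min r (s / 2)).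
split; first by rewrite lt_min r0; lra.
move=> I phi tphi; apply: h; have ms : Num.min r (s / 2) < s.
  have : Num.min r (s / 2) <= s / 2 by rewrite ge_min lexx orbT.
  by lra.
by apply: tstW (k _ _ ms tphi); rewrite ge_min lexx.
Qed.

Lemma act_good q g T : current_near q T -> current_near q (mul_current g T).
Proof.
move=> [r [r0 dT qT]]; have [s [s0 sg _]] := germ_smooth g; exists (Num.min r (s / 2)).
have ms : Num.min r (s / 2) < s.
  have : Num.min r (s / 2) <= s / 2 by rewrite ge_min lexx orbT.
  by lra.
have mr : Num.min r (s / 2) <= r by rewrite ge_min lexx.
split; first by rewrite lt_min r0; lra.
  by move=> I; exact: (dist_mul ms sg (distW mr (dT I))).
by move=> I phi Iq tphi; apply: qT => //; apply: tstW mr _; exact: tst_mul ms sg tphi.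
Qed.

(** The representative of [g + h] is a choice and agrees with the sum of the representatives only
    near 0; splitting $T$ over the sum uses its linearity, available on test functions with small
    support. *)
Lemma act_addl q g h T : current_near q T ->
  null_germ (mul_current (g + h) T - (mul_current g T + mul_current h T)).
Proof.
move=> [r [r0 dT _]]; have [s [s0 sg]] := tst_germ g; have [t [t0 sh]] := tst_germ h.
have [e [e0 he]] := near_Qo (germ_repD g h).
pose m := Num.min r (Num.min (s / 2) (Num.min (t / 2) (e / 2))).
have m0 : 0 < m by rewrite !lt_min r0 !divr_gt0.
have [mr ms mt me] : [/\ m <= r, m < s, m < t & m < e].
  have : m <= m by [].
  by rewrite {2}/m !le_min => /and4P[h1 h2 h3 h4]; split=> //; lra.
exists m; split=> // I phi tphi.
rewrite -[LHS]/(T I (fun z => germ_rep (g + h) z * phi z) -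
  (T I (fun z => germ_rep g z * phi z) + T I (fun z => germ_rep h z * phi z))).
rewrite -(distD (distW mr (dT I)) (sg _ _ ms tphi) (sh _ _ mt tphi)).
apply/eqP; rewrite subr_eq0; apply/eqP; apply: dist_eq => z.
have [Q|NQ] := pselect (Qb m z); last by rewrite tphi.2// !mulr0 addr0.
by rewrite he ?mulrDl//; exact: Qb_Qo me _ Q.
Qed.

Lemma act_mul g h T : null_germ (mul_current (g * h) T - mul_current g (mul_current h T)).
Proof.
have [e [e0 he]] := near_Qo (germ_repM g h).
exists (e / 2); split; first by lra.
move=> I phi tphi.
rewrite -[LHS]/(T I (fun z => germ_rep (g * h) z * phi z) -
  T I (fun z => germ_rep h z * (germ_rep g z * phi z))).
apply/eqP; rewrite subr_eq0; apply/eqP; apply: dist_eq => z.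
have [Q|NQ] := pselect (Qb (e / 2) z); last by rewrite tphi.2// !mulr0.
by rewrite he ?mulrA ?(mulrC (germ_rep h z))//; apply: Qb_Qo _ _ Q; lra.
Qed.

Lemma actD g T S : mul_current g (T + S) = mul_current g T + mul_current g S.
Proof. by []. Qed.

Lemma dbar_addr T S : dbar (T + S) = dbar T + dbar S.
Proof. by apply/funext => I; apply/funext => phi; exact: dbarD. Qed.

Lemma dbar_null T : null_germ T -> null_germ (dbar T).
Proof.
move=> [r [r0 h]]; exists r; split=> // I phi tphi; rewrite dbarE big1// => j _.
by rewrite h ?oppr0 ?mulr0//; exact: tst_dz.
Qed.

Lemma dbar_good q T : current_near q T -> current_near q.+1 (dbar T).
Proof.
move=> [r [r0 dT qT]]; exists r; split=> // [I|I phi Iq tphi]; first exact: dist_dbar.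
exact: dbar_degree qT Iq tphi.
Qed.

Lemma dbar_dbar_null q T : current_near q T -> null_germ (dbar (dbar T)).
Proof.
by move=> [r [r0 dT _]]; exists r; split=> // I phi tphi; exact: dbar_dbar dT tphi.
Qed.

(** Leibniz rule with $\bar\partial g=0$, valid near 0, where the representative is holomorphic. *)
Lemma dbar_act g T : null_germ (dbar (mul_current g T) - mul_current g (dbar T)).
Proof.
have [s [s0 sg dg]] := germ_smooth g; pose r := s / 2.
have rs : r < s by rewrite /r; lra.
exists r; split; first by rewrite /r; lra.
move=> I phi tphi; rewrite -[LHS]/(dbar (mul_current g T) I phi -
  dbar T I (fun z => germ_rep g z * phi z)) !dbarE.
apply/eqP; rewrite subr_eq0; apply/eqP; apply: eq_bigr => j _; congr (_ * - _).
rewrite /mul_current; apply: dist_eq => z; have tg := tst_mul rs sg tphi.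
have [Q|NQ] := pselect (Qo s z); last first.
  have NQ' : ~ Qb r z by move=> Q; apply: NQ; exact: Qb_Qo rs _ Q.
  by rewrite (tst_dz j tg).2// (tst_dz j tphi).2// mulr0.
have sphi := smooth_onW (@subsetT _ (Qo s)) tphi.1.
by rewrite (dzM j sg sphi Q) dg// mul0r add0r.
Qed.

Lemma dbar_exact q T : current_near q.+1 T -> null_germ (dbar T) -> exists S, current_near q S /\ null_germ (dbar S - T).
Proof.
move=> [r [r0 dT qT]] [s [s0 cT]]; pose m := Num.min r s.
have m0 : 0 < m by rewrite lt_min r0.
have mr : m <= r by rewrite ge_min lexx.
have ms : m <= s by rewrite ge_min lexx orbT.
have [S [dS qS hS]] := @dolbeault R n q T m (m / 2) ltac:(lra) ltac:(lra)
  (fun I => distW mr (dT I)) (fun I phi Iq t => qT I phi Iq (tstW mr t))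
  (fun I phi t => cT I phi (tstW ms t)).
exists S; split; first by exists (m / 2); split=> //; lra.
exists (m / 2); split; first by lra.
by move=> I phi tphi; rewrite -[LHS]/(dbar S I phi - T I phi) hS ?subrr.
Qed.

Lemma one_current_good : current_near 0 (@one_current R n).
Proof.
exists 1; split=> // [I|I phi Iq tphi]; last first.
  rewrite /one_current; case: eqP => // I0; by move: Iq; rewrite I0 cards0.
rewrite /one_current; case: (I == finset.set0); last exact: dist_zero.
have := @dist_integral R n (fun=> 1) 2 1 ltr01 ltac:(lra) (fun z _ => ccont_atW z (ccont_cst _ 1)).
by under [X in dist _ X -> _]eq_fun do under eq_fun do rewrite mul1r.
Qed.

Lemma dbar_one_current : null_germ (dbar (@one_current R n)).
Proof.
exists 1; split=> // I phi tphi; rewrite dbarE big1// => j _; rewrite /one_current.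
case: eqP => _; last by rewrite oppr0 mulr0.
have t1 := tst_dz j tphi.
rewrite (@integralCnE _ _ 2)//; [|exact: smooth_ccont t1.1|].
  rewrite (bint_dz0 (r := 1)) ?oppr0 ?mulr0 ?enum_uniq ?mem_enum//; first by lra.
  by move=> e _; exact: crd0.
move=> z Nz; apply: t1.2 => Q; apply: Nz; apply: Qb_sub Q; lra.
Qed.

Lemma act_one_inj g : null_germ (mul_current g one_current) -> g = 0.
Proof.
move=> [r [r0 h]]; have [s [s0 sg _]] := germ_smooth g; pose m := Num.min r s.
have m0 : 0 < m by rewrite lt_min r0.
have mr : m <= r by rewrite ge_min lexx.
have ms : m <= s by rewrite ge_min lexx orbT.
have g0 : forall z, Qo m z -> germ_rep g z = 0.
  apply: integral_test_eq0 => //.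
    move=> z Qz; apply: smooth_on_cont sg _ => d; exact: lt_le_trans (Qz d) ms.
  move=> r' phi r'0 r'm sphi supp.
  have := h finset.set0 phi (tstW (le_trans (ltW r'm) mr) (conj sphi supp)).
  by rewrite /mul_current /one_current eqxx.
rewrite -(pi_germ_rep g) -[RHS](rmorph0 \pi_(hgerm R n)%qT).
apply/eqP; rewrite -Quotient.idealrBE subr0 unfold_in; apply/asboolP.
by apply: filterS (nbhs_Qo n m0) => z; exact: g0.
Qed.

(** At a singleton index, $\bar\partial T=0$ says that the single coefficient of $T$ is killed by
    $\partial/\partial\bar z_j$, so [weyl] applies and [smooth_holo] makes its density a germ. *)
Lemma dbar_exact0 T : current_near 0 T -> null_germ (dbar T) ->
  exists g, null_germ (T - mul_current g one_current).
Proof.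
move=> [r [r0 dT qT]] [s [s0 cT]]; pose m := Num.min r s.
have m0 : 0 < m by rewrite lt_min r0.
have mr : m <= r by rewrite ge_min lexx.
have ms : m <= s by rewrite ge_min lexx orbT.
have cu j phi : tst m phi -> T finset.set0 (dz j phi) = 0.
  move=> tphi; have := cT (finset.set1 j) phi (tstW ms tphi).
  rewrite dbarE big_set1 finset.setDv => /eqP.
  by rewrite mulf_eq0 signr_eq0 oppr_eq0 => /eqP.
have [h [sh hh dh]] := @weyl R n (T finset.set0) m (m / 2) ltac:(lra) ltac:(lra)
  (distW mr (dT _)) cu.
have m20 : 0 < m / 2 by lra.
have hol : h \in @holo0 R n.
  rewrite unfold_in; apply/asboolP; apply: filterS (nbhs_Qo n m20) => z Qz.
  by apply: smooth_holo => // j; exact: dh.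
pose g : hgerm R n := \pi_(hgerm R n)%qT (HoloFun hol).
have [e [e0 he]] : exists e : R, 0 < e /\ forall z, Qo e z -> germ_rep g z = h z.
  by apply: near_Qo; apply: (@germ_eq_near (repr g) (HoloFun hol)); rewrite pi_germ_rep.
exists g; pose k := Num.min (m / 2) (e / 2).
have k0 : 0 < k by rewrite lt_min m20 divr_gt0.
have km : k <= m / 2 by rewrite ge_min lexx.
have ke : k < e.
  have : k <= e / 2 by rewrite ge_min lexx orbT.
  by lra.
exists k; split=> // I phi tphi.
rewrite -[LHS]/(T I phi - one_current I (fun z => germ_rep g z * phi z)) /one_current.
case: eqP => [->|I0]; last first.
  rewrite qT ?subr0//; last by apply: tstW tphi; lra.
  by move=> /eqP; rewrite cards_eq0 => /eqP.
rewrite hh; last exact: tstW km tphi.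
apply/eqP; rewrite subr_eq0; apply/eqP; congr integralCn; apply/funext => z.
have [Q|NQ] := pselect (Qb k z); last by rewrite tphi.2// !mulr0.
by rewrite he//; exact: Qb_Qo ke _ Q.
Qed.

End CurrentGerms.

(** * Homotopies on the Koszul complex *)

Lemma linear_at0 (A : pzRingType) (U V : lmodType A) (h : U -> V) : linear h -> h 0 = 0.
Proof. by move=> l; have := l (-1) 0 0; rewrite scaler0 addr0 scaleN1r addNr. Qed.

Lemma linear_atZ (A : pzRingType) (U V : lmodType A) (h : U -> V) c x :
  linear h -> h (c *: x) = c *: h x.
Proof. by move=> l; have := l c x 0; rewrite (linear_at0 l) !addr0. Qed.

Section KoszulComplex.
Context (A : comNzRingType) (p : nat) (f : 'I_p -> A).
Implicit Types (I J : {set 'I_p}) (i j : 'I_p) (w : {set 'I_p} -> A).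

Definition koszul_of (k : nat) w : koszul A p k := [ffun I => w (val I)].

Lemma koszul_coefE k w I : koszul_coef (koszul_of k w) I = if #|I| == k then w I else 0.
Proof.
rewrite /koszul_coef; case: insubP => [I' Ik <-|/negbTE->//].
by rewrite ffunE (valP I').
Qed.

Lemma koszul_coefP k (c : A) (x y : koszul A p k) I :
  koszul_coef (c *: x + y) I = c * koszul_coef x I + koszul_coef y I.
Proof.
rewrite /koszul_coef; case: insubP => [I' _ _|_]; last by rewrite mulr0 addr0.
by rewrite !ffunE.
Qed.

Lemma koszul_eq k (x y : koszul A p k) :
  (forall I, #|I| = k -> koszul_coef x I = koszul_coef y I) -> x = y.
Proof.
move=> xy; apply/ffunP => I; have := xy (val I) (eqP (valP I)).
by rewrite /koszul_coef valK.
Qed.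

Lemma koszul_coef0 k I : koszul_coef (0 : koszul A p k) I = 0.
Proof. by rewrite /koszul_coef; case: insubP => [I' _ _|//]; rewrite ffunE. Qed.

Lemma koszul_coefZ k (c : A) (x : koszul A p k) I : koszul_coef (c *: x) I = c * koszul_coef x I.
Proof. by rewrite -[c *: x]addr0 koszul_coefP koszul_coef0 addr0. Qed.

Lemma koszul_coef_sum k (T : finType) (P : pred T) (F : T -> koszul A p k) I :
  koszul_coef (\sum_(t | P t) F t) I = \sum_(t | P t) koszul_coef (F t) I.
Proof.
apply: (big_morph (fun x : koszul A p k => koszul_coef x I)) => [x y|]; last exact: koszul_coef0.
by rewrite -{1}[x]scale1r koszul_coefP mul1r.
Qed.

(** Contraction with $e_j^*$ alone: the part of the differential with index [j], without the factor
    $f_j$. *)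
Definition contract k j (x : koszul A p k.+1) : koszul A p k :=
  koszul_of k (fun J => if j \in J then 0 else (-1) ^+ ext_sign j J * koszul_coef x (j |: J)).

Lemma koszul_diffE k (x : koszul A p k.+1) : koszul_diff f x = \sum_j f j *: contract j x.
Proof.
apply: koszul_eq => J Jk; rewrite koszul_coef_sum.
rewrite -[koszul_diff f x]/(koszul_of k (fun J => \sum_(j | j \notin J)
  (-1) ^+ ext_sign j J * f j * koszul_coef x (j |: J))) koszul_coefE Jk eqxx big_mkcond.
apply: eq_bigr => j _; rewrite koszul_coefZ koszul_coefE Jk eqxx.
by case: (j \in J); rewrite ?mulr0// mulrA [f j * _]mulrC.
Qed.

Lemma contract_linear k j : linear (@contract k j).
Proof.
move=> c x y; apply: koszul_eq => J Jk.
rewrite koszul_coefP !koszul_coefE Jk eqxx; case: (j \in J); first by rewrite mulr0 addr0.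
by rewrite koszul_coefP; ring.
Qed.

Lemma koszul_diff_linear k : linear (@koszul_diff A p f k).
Proof.
move=> c x y; rewrite !koszul_diffE scaler_sumr -big_split /=; apply: eq_bigr => j _.
by rewrite contract_linear scalerDr !scalerA mulrC.
Qed.

(** Contractions with two different dual vectors anticommute, while $f_if_j$ is symmetric. *)
Lemma koszul_diff_diff k (x : koszul A p k.+2) : koszul_diff f (koszul_diff f x) = 0.
Proof.
apply: koszul_eq => J Jk; rewrite koszul_diffE koszul_coef_sum.
rewrite koszul_coef0.
pose F i j := (-1) ^+ ext_sign j J * (-1) ^+ ext_sign i (j |: J) * (f j * f i) *
  koszul_coef x (i |: (j |: J)).
rewrite -[RHS](@sum_antisym A p [pred j | j \notin J] F); last first.
  move=> i j /= iJ jJ ij; rewrite /F finset.setUCA [f i * f j]mulrC -!mulNr; congr (_ * _ * _).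
  rewrite mulNr -!exprD (ext_signD1 (L := j |: J) (i := j) (j := i)) ?setU11 1?eq_sym//.
  rewrite (ext_signD1 (L := i |: J) (i := i) (j := j)) ?setU11//.
  rewrite !finset.setU1K//; move: (ext_sign j J) (ext_sign i J) => a b.
  case: (ltngtP i j) => h.
  - by rewrite add0n add1n addnS exprS mulN1r opprK addnC.
  - by rewrite add0n add1n addnS exprS mulN1r addnC.
  by move: ij; rewrite (val_inj h) eqxx.
rewrite [RHS]big_mkcond; apply: eq_bigr => j _ /=.
rewrite koszul_coefZ koszul_coefE Jk eqxx; case: ifP => jJ /=; first by rewrite mulr0.
rewrite koszul_diffE koszul_coef_sum !mulr_sumr [RHS]big_mkcond; apply: eq_bigr => i _ /=.
have jJk : #|j |: J| = k.+1 by rewrite cardsU1 jJ Jk.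
rewrite koszul_coefZ koszul_coefE jJk eqxx in_setU1.
by rewrite andbC; case: (i == j) => /=; case: (i \in J) => /=; rewrite ?mulr0// /F; ring.
Qed.

(** Freeness of the Koszul modules: images of basis elements are lifted by choice. Maps are bare
    functions with a proof of linearity, as the lifts come out of an existence statement. *)
Lemma koszul_lift k m m' (h : koszul A p k -> 'rV[A]_m) (g : {linear 'rV[A]_m' -> 'rV[A]_m}) :
  linear h -> (forall x, exists y, g y = h x) ->
  exists s : koszul A p k -> 'rV[A]_m', linear s /\ forall x, g (s x) = h x.
Proof.
move=> lh ex; pose e I := koszul_of k (fun J => (J == I)%:R).
have [y hy] := choice (fun I => ex (e I)).
exists (fun x => \sum_(I : {set 'I_p} | #|I| == k) koszul_coef x I *: y I); split.
  move=> c u v; rewrite scaler_sumr -big_split /=; apply: eq_bigr => I _.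
  by rewrite koszul_coefP scalerDl scalerA.
move=> x; pose H : {linear _ -> _} := HB.pack h (GRing.isLinear.Build _ _ _ _ h lh).
have {2}-> : x = \sum_(I : {set 'I_p} | #|I| == k) koszul_coef x I *: e I.
  apply: koszul_eq => J /eqP Jk; rewrite koszul_coef_sum (bigD1 J)//= big1 ?addr0 => [|I /andP[_ IJ]].
    by rewrite koszul_coefZ koszul_coefE Jk eqxx mulr1.
  by rewrite koszul_coefZ koszul_coefE Jk eq_sym (negbTE IJ) mulr0.
rewrite linear_sum -[h]/(H : _ -> _) linear_sum; apply: eq_bigr => I _.
by rewrite !linearZ hy.
Qed.

(** The element $e_{k-1}\wedge\dots\wedge e_0$ in the indexing from 0. With factors in decreasing
    order, contracting the leading factor of one chain gives the previous chain without a sign. *)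
Definition koszul_chain (k : nat) : koszul A p k :=
  koszul_of k (foldl (fun w j => wedge_left j w) (fun I => (I == finset.set0)%:R)
    (take k (enum 'I_p))).

Lemma koszul_frame_chain : koszul_frame A p = koszul_chain p.
Proof. by rewrite /koszul_chain take_oversize ?size_enum_ord. Qed.

Lemma wedge_take_last (w0 : {set 'I_p} -> A) (k : 'I_p) :
  foldl (fun w j => wedge_left j w) w0 (take k.+1 (enum 'I_p)) =
  wedge_left k (foldl (fun w j => wedge_left j w) w0 (take k (enum 'I_p))).
Proof. by rewrite (take_nth k) ?size_enum_ord// nth_ord_enum -cats1 foldl_cat. Qed.

Lemma wedge_take_eq0 (k : nat) I j : (k <= j)%N -> j \in I ->
  foldl (fun w j => wedge_left j w) (fun I => (I == finset.set0)%:R : A)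
    (take k (enum 'I_p)) I = 0.
Proof.
elim: k I => [|k IHk] I kj jI; first by rewrite take0 /=; case: eqP => // I0; rewrite I0 inE in jI.
have kp : (k < p)%N by exact: leq_trans kj (ltnW (ltn_ord j)).
rewrite (wedge_take_last _ (Ordinal kp)) /wedge_left /=; case: ifP => // kI.
rewrite IHk ?mulr0 ?(ltnW kj)// !inE jI andbT -val_eqE /= gtn_eqF//.
Qed.

Lemma contract_chain_gt (k : nat) j : (k < j)%N -> contract j (koszul_chain k.+1) = 0.
Proof.
move=> kj; apply: koszul_eq => J Jk.
rewrite koszul_coef0 koszul_coefE Jk eqxx.
case: ifP => // jJ; rewrite koszul_coefE cardsU1 jJ Jk eqxx.
by rewrite (wedge_take_eq0 (j := j)) ?setU11 ?mulr0.
Qed.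

Lemma contract_chain_eq (k : 'I_p) : contract k (koszul_chain k.+1) = koszul_chain k.
Proof.
apply: koszul_eq => J Jk; rewrite !koszul_coefE Jk eqxx.
case: ifP => kJ; first by rewrite (wedge_take_eq0 (j := k)).
rewrite cardsU1 kJ Jk eqxx wedge_take_last /wedge_left setU11 finset.setU1K ?kJ//.
rewrite mulrA -exprD -[RHS]mul1r; congr (_ * _).
suff -> : ext_sign k (k |: J) = ext_sign k J by rewrite addnn -muln2 mulnC exprM sqrrN !expr1n.
by apply: eq_card => i; rewrite !inE; case: eqP => [->|//]; rewrite ltnn !andbF.
Qed.

End KoszulComplex.

(** A null-homotopy of $ga$ is built by lifting along the resolution; it starts because $g\in J$
    makes [eps] vanish on $ga_0$. In the induction the homotopy identity is kept only after applying
    $\varphi$, which is the cycle condition for the next lift. *)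
Lemma contraction_homotopy (A : comNzRingType) (N : nat) (J : idealr A) (r : nat -> nat)
    (phi : forall k, {linear 'rV[A]_(r k.+1) -> 'rV[A]_(r k)}) (eps : 'rV[A]_(r 0%N) -> {ideal_quot J})
    (f : 'I_N.+1 -> A) (a : forall k, {linear koszul A N.+1 k -> 'rV[A]_(r k)}) (g : A) :
  free_resolution N.+1 phi eps -> koszul_morphism f phi eps a -> g \in J ->
  exists s : koszul A N.+1 N -> 'rV[A]_(r N.+1), linear s /\
    forall x, s (koszul_diff f x) = a N.+1 (g *: x).
Proof.
move=> res mor gJ.
have H k : exists s : koszul A N.+1 k -> 'rV[A]_(r k.+1), linear s /\
    forall x, phi k (s (koszul_diff f x)) = phi k (a k.+1 (g *: x)).
  elim: k => [|k [s [ls hs]]].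
    have [||s [ls hs]] := @koszul_lift A N.+1 0 _ _ (fun x => a 0%N (g *: x)) (phi 0%N).
    - by move=> c x y; rewrite scalerDr !scalerA mulrC -scalerA linearP.
    - move=> x; apply/(resolution_exact0 res); rewrite (morphism_extends mor).
      rewrite koszul_coefZ rmorphM /=.
      suff -> : \pi_({ideal_quot J})%qT g = 0 by rewrite mul0r.
      by rewrite -(rmorph0 \pi_({ideal_quot J})%qT); apply/eqP; rewrite -Quotient.idealrBE subr0.
    exists s; split=> // x; rewrite hs (morphism_comm mor).
    by rewrite (linear_atZ _ _ (@koszul_diff_linear _ _ f _)).
  have [||t [lt ht]] := @koszul_lift A N.+1 k.+1 _ _
    (fun x => a k.+1 (g *: x) - s (koszul_diff f x)) (phi k.+1).
  - move=> c x y; rewrite koszul_diff_linear ls scalerDr !scalerA [g * c]mulrC -scalerA linearP.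
    by rewrite scalerBr opprD addrACA.
  - by move=> x; apply/(resolution_exact res); rewrite linearB /= hs subrr.
  exists t; split=> // x; rewrite ht koszul_diff_diff (linear_at0 ls) subr0.
  by rewrite (morphism_comm mor) (linear_atZ _ _ (@koszul_diff_linear _ _ f _)).
have [s [ls hs]] := H N; exists s; split=> // x.
(* At the top $\varphi$ is injective, since the next module is 0, and can be cancelled. *)
apply/eqP; rewrite -subr_eq0; apply/eqP.
have : phi N (s (koszul_diff f x) - a N.+1 (g *: x)) = 0 by rewrite linearB /= hs subrr.
move=> /(resolution_exact res)[y <-].
have -> : y = 0; last exact: linear0.
apply/rowP => i; exfalso; have := ltn_ord i; move: (nat_of_ord i) => m.
by rewrite (resolution_length res).
Qed.

(** * The double complex of currents *)

Section CurrentTuples.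
Context (R : realType) (n : nat).
Local Notation A := (hgerm R n).
Local Notation act := (@mul_current R n).
Local Notation D := (current R n).
Implicit Types (T S : current R n) (g h : hgerm R n).

Definition near_eq T S := null_germ (T - S).

Lemma near_eq_refl T : near_eq T T.
Proof. by rewrite /near_eq subrr; exact: null0. Qed.

Lemma near_eq_sym T S : near_eq T S -> near_eq S T.
Proof. by move=> /nullN; rewrite opprB. Qed.

Lemma near_eq_trans S T U : near_eq T S -> near_eq S U -> near_eq T U.
Proof. by move=> TS SU; rewrite /near_eq -(subrKA S); exact: nullD. Qed.

Lemma near_eq_null T : near_eq T 0 <-> null_germ T.
Proof. by rewrite /near_eq subr0. Qed.

Lemma near_eqD T S T' S' : near_eq T T' -> near_eq S S' -> near_eq (T + S) (T' + S').
Proof. by move=> h k; rewrite /near_eq opprD addrACA; exact: nullD. Qed.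

Lemma near_eqN T T' : near_eq T T' -> near_eq (- T) (- T').
Proof. by move=> h; rewrite /near_eq -opprD; exact: nullN. Qed.

Lemma near_eq_sum (I : finType) (F G : I -> D) : (forall i, near_eq (F i) (G i)) ->
  near_eq (\sum_i F i) (\sum_i G i).
Proof. by move=> h; apply: (big_ind2 near_eq) => //; [exact: near_eq_refl|move=> *; exact: near_eqD]. Qed.

Lemma act_sum g (I : finType) (F : I -> D) : act g (\sum_i F i) = \sum_i act g (F i).
Proof. by apply: (big_morph (act g)) => // ; exact: actD. Qed.

Lemma dbar_sum (I : finType) (F : I -> D) : near_eq (dbar (\sum_i F i)) (\sum_i dbar (F i)).
Proof.
apply: (big_ind2 (fun S T => near_eq (dbar S) T)); [|move=> S T S' T' h h'; rewrite dbar_addr; exact: near_eqD|].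
  by apply/near_eq_null/dbar_null; exact: null0.
by move=> i _; exact: near_eq_refl.
Qed.

Lemma actN g T : act g (- T) = - act g T.
Proof. by []. Qed.

Lemma near_eq_act g T S : near_eq T S -> near_eq (act g T) (act g S).
Proof. by move=> h; rewrite /near_eq -actN -actD; exact: act_null. Qed.

Lemma dbar_oppr T : dbar (- T) = - dbar T.
Proof. by apply/funext => I; apply/funext => phi; exact: dbarN. Qed.

Lemma near_eq_dbar T S : near_eq T S -> near_eq (dbar T) (dbar S).
Proof. by move=> h; rewrite /near_eq -dbar_oppr -dbar_addr; exact: dbar_null. Qed.

Lemma act0 q T : current_near q T -> null_germ (act 0 T).
Proof.
move=> gT; have := act_addl 0 0 gT; rewrite addr0 => /nullN.
by rewrite opprB -addrA subrr addr0.
Qed.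

Lemma act_suml q T (I : finType) (F : I -> A) : current_near q T ->
  near_eq (act (\sum_i F i) T) (\sum_i act (F i) T).
Proof.
move=> gT; apply: (big_ind2 (fun g S => near_eq (act g T) S)).
- by apply/near_eq_null; exact: act0 gT.
- by move=> g S h S' gS hS; apply: near_eq_trans (act_addl g h gT) _; exact: near_eqD.
- by move=> i _; exact: near_eq_refl.
Qed.

Lemma good0 q : current_near q (0 : D).
Proof. by apply: null_good; exact: null0. Qed.

Lemma good_sum q (I : finType) (F : I -> D) : (forall i, current_near q (F i)) -> current_near q (\sum_i F i).
Proof. by move=> h; apply: (big_ind (current_near q)) => //; [exact: good0|exact: goodD]. Qed.

Definition tens m T (x : 'rV[A]_m) (l : 'I_m) : D := act (x 0 l) T.

(** The matrix of [g] acting on a tuple of currents. Currents satisfy the module laws only near 0,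
    so [g] cannot simply be extended by scalars. *)
Definition appl m m' (g : 'rV[A]_m -> 'rV[A]_m') (V : 'I_m -> D) (l : 'I_m') : D :=
  \sum_i act (g (delta_mx 0 i) 0 l) (V i).

Lemma appl_good q m m' (g : 'rV[A]_m -> 'rV[A]_m') (V : 'I_m -> D) l :
  (forall i, current_near q (V i)) -> current_near q (appl g V l).
Proof. by move=> h; apply: good_sum => i; exact: act_good. Qed.

Lemma appl_eqn m m' (g : 'rV[A]_m -> 'rV[A]_m') (V W : 'I_m -> D) l :
  (forall i, near_eq (V i) (W i)) -> near_eq (appl g V l) (appl g W l).
Proof. by move=> h; apply: near_eq_sum => i; exact: near_eq_act. Qed.

Lemma applB m m' (g : 'rV[A]_m -> 'rV[A]_m') (V W : 'I_m -> D) l :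
  appl g (fun i => V i - W i) l = appl g V l - appl g W l.
Proof. by rewrite /appl -sumrB; apply: eq_bigr. Qed.

Lemma appl_dbar m m' (g : 'rV[A]_m -> 'rV[A]_m') (V : 'I_m -> D) l :
  near_eq (dbar (appl g V l)) (appl g (fun i => dbar (V i)) l).
Proof. by apply: near_eq_trans (dbar_sum _) _; apply: near_eq_sum => i; exact: dbar_act. Qed.

Lemma appl_tens q m m' (g : {linear 'rV[A]_m -> 'rV[A]_m'}) T x l : current_near q T ->
  near_eq (appl g (tens T x) l) (tens T (g x) l).
Proof.
move=> gT; apply: (@near_eq_trans (\sum_i act (x 0 i * g (delta_mx 0 i) 0 l) T)).
  by apply: near_eq_sum => i; rewrite mulrC; apply: near_eq_sym; exact: act_mul.
rewrite /tens {2}[x]row_sum_delta linear_sum summxE; apply: near_eq_sym.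
under eq_bigr do rewrite linearZ mxE.
exact: act_suml gT.
Qed.

Lemma appl_comp0 q m m' m'' (g : {linear 'rV[A]_m -> 'rV[A]_m'})
    (h : {linear 'rV[A]_m' -> 'rV[A]_m''}) (V : 'I_m -> D) l :
  (forall x, h (g x) = 0) -> (forall i, current_near q (V i)) ->
  null_germ (appl h (appl g V) l).
Proof.
move=> hg gV; apply/near_eq_null.
apply: (@near_eq_trans (\sum_i appl h (tens (V i) (g (delta_mx 0 i))) l)).
  rewrite /appl exchange_big /=.
  by under eq_bigr do rewrite act_sum; exact: near_eq_refl.
rewrite -[X in near_eq _ X](@big1_eq _ 0 +%R _ (index_enum 'I_m) xpredT); apply: near_eq_sum => i.
apply: near_eq_trans (appl_tens _ _ _ (gV i)) _.
by rewrite hg /tens mxE; apply/near_eq_null; exact: act0 (gV i).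
Qed.

(* dbar-closed corrections V'_k of the V_k with phi V'_k = phi V_k are constructed
   downwards from the top: V'_(k+1) is dbar-exact, say dbar W, and one subtracts phi W from V_k. *)
Lemma descent (r : nat -> nat) (phi : forall k, {linear 'rV[A]_(r k.+1) -> 'rV[A]_(r k)})
    (N : nat) (V : forall k, 'I_(r k.+1) -> D) :
  (forall k x, phi k (phi k.+1 x) = 0) ->
  (forall k l, (k <= N)%N -> current_near k (V k l)) ->
  (forall k l, (k < N)%N -> near_eq (appl (phi k.+1) (V k.+1) l) (dbar (V k l))) ->
  (forall l, null_germ (dbar (V N l))) ->
  exists V0 : 'I_(r 1%N) -> D, [/\ forall l, current_near 0 (V0 l), forall l, null_germ (dbar (V0 l)) &
    forall l, near_eq (appl (phi 0%N) V0 l) (appl (phi 0%N) (V 0%N) l)].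
Proof.
move=> cpx gV hV top.
suff H m : (m <= N)%N -> exists V' : 'I_(r (N - m).+1) -> D, [/\ forall l, current_near (N - m) (V' l),
    forall l, null_germ (dbar (V' l)) &
    forall l, near_eq (appl (phi (N - m)%N) V' l) (appl (phi (N - m)%N) (V (N - m)%N) l)].
  by have := H N (leqnn N); rewrite subnn.
elim: m => [_|m IHm mN].
  by rewrite subn0; exists (V N); split=> [l||] //; [exact: gV|move=> l; exact: near_eq_refl].
have /subnSK Nm := mN; have [] := IHm (ltnW mN); rewrite -Nm.
move: (N - m.+1)%N (leq_subr m.+1 N) Nm => k kN Nm V1 [g1 d1 e1].
(* [V1] is closed of degree $k+1$, hence $\bar\partial W$ near 0. The new $V_k-\varphi W$ is closed
   because $\varphi\,\bar\partial W=\varphi V_1=\varphi V_{k+1}=\bar\partial V_k$, and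
   $\varphi\varphi=0$ leaves its image unchanged. *)
have [W hW] := choice (fun l => dbar_exact (g1 l) (d1 l)).
have gk l : current_near k (V k l) by exact: gV.
exists (fun l => V k l - appl (phi k.+1) W l); split=> l.
- by apply: goodD => //; apply: goodN; apply: appl_good => i; have [] := hW i.
- apply/near_eq_null; rewrite dbar_addr dbar_oppr -(subrr (dbar (V k l))).
  apply: near_eqD (near_eq_refl _) (near_eqN _); apply: near_eq_trans (appl_dbar _ _ _) _.
  apply: (@near_eq_trans (appl (phi k.+1) V1 l)); first by apply: appl_eqn => i; have [] := hW i.
  by apply: near_eq_trans (e1 l) _; apply: hV; rewrite Nm leq_subr.
rewrite applB -[X in near_eq _ X]subr0; apply: near_eqD (near_eq_refl _) (near_eqN _); apply/near_eq_null.
by apply: (@appl_comp0 k) => // i; have [] := hW i.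
Qed.

(** Of the terms $f_j$ times a contraction, those with $j<k$ die because $f_jT=0$, those with $j>k$
    because $e_j$ does not occur in the chain; the term $j=k$ shortens the chain and moves $f_k$
    onto $T$. *)
Lemma tens_koszul q (p m : nat) (f : 'I_p -> A) (k : 'I_p) (b : koszul A p k -> 'rV[A]_m) T
    (l : 'I_m) :
  linear b -> current_near q T -> (forall j : 'I_p, (j < k)%N -> null_germ (act (f j) T)) ->
  near_eq (tens T (b (koszul_diff f (koszul_chain A p k.+1))) l)
      (tens (act (f k) T) (b (koszul_chain A p k)) l).
Proof.
move=> lb gT low; pose B : {linear _ -> _} := HB.pack b (GRing.isLinear.Build _ _ _ _ b lb).
rewrite koszul_diffE -[b (\sum_j _)]/(B _) linear_sum /tens summxE.
apply: near_eq_trans (act_suml _ gT) _; rewrite (bigD1 k)//= -[X in near_eq _ X]addr0.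
apply: near_eqD.
  by rewrite contract_chain_eq (linear_atZ _ _ lb) mxE mulrC; exact: act_mul.
apply/near_eq_null; apply: (big_ind (@null_germ R n)); [exact: null0|exact: nullD|move=> j jk].
rewrite (linear_atZ _ _ lb) mxE; have [jltk|kltj|/val_inj jek] := ltngtP j k.
- apply/near_eq_null; rewrite mulrC; apply: near_eq_trans (act_mul _ _ _) _; apply/near_eq_null.
  by apply: act_null; exact: low.
- by rewrite contract_chain_gt// (linear_at0 lb) mxE mulr0; exact: act0 gT.
- by rewrite jek eqxx in jk.
Qed.

End CurrentTuples.

Lemma act_subl (R : realType) (n q : nat) (g h : hgerm R n) (T : current R n) : current_near q T ->
  near_eq (mul_current (g - h) T) (mul_current g T - mul_current h T).
Proof.
move=> gT; have := act_addl (g - h) h gT; rewrite subrK => /near_eq_sym e.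
by rewrite -[mul_current (g - h) T](addrK (mul_current h T)); exact: near_eqD e (near_eq_refl _).
Qed.

(** * The two inclusions *)

Section Duality.
Context (R : realType) (n N : nat).
Local Notation A := (hgerm R n).
Context (J : idealr A) (r : nat -> nat)
  (phi : forall k, {linear 'rV[A]_(r k.+1) -> 'rV[A]_(r k)})
  (eps : 'rV[A]_(r 0%N) -> {ideal_quot J})
  (E_res : free_resolution N.+1 phi eps)
  (f : 'I_N.+1 -> A)
  (a : forall k, {linear koszul A N.+1 k -> 'rV[A]_(r k)})
  (a_morph : koszul_morphism f phi eps a)
  (X : 'I_N.+1 -> current R n)
  (X_good : forall k : 'I_N.+1, current_near k (X k))
  (fX_one : near_eq (mul_current (f ord0) (X ord0)) one_current)
  (fX_zero : forall j k : 'I_N.+1, (j < k)%N -> null_germ (mul_current (f j) (X k)))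
  (fX_dbar : forall j k : 'I_N.+1, k = j.+1 :> nat ->
     near_eq (mul_current (f k) (X k)) (dbar (X j))).
Local Notation top := (a N.+1 (koszul_frame A N.+1)).

(** $f_j\bar\partial X_p=\bar\partial(f_jX_p)$, and $f_jX_p$ is 0 or, for the last index,
    $\bar\partial X_{p-1}$. *)
Lemma act_dbar_last (j : 'I_N.+1) : null_germ (mul_current (f j) (dbar (X ord_max))).
Proof.
apply/near_eq_null; apply: near_eq_trans (near_eq_sym (dbar_act _ _)) _; apply/near_eq_null.
have [jN|] := ltnP j (@ord_max N); first by apply: dbar_null; exact: fX_zero.
move=> Nj; have -> : j = ord_max by apply/val_inj/eqP; rewrite eqn_leq -ltnS ltn_ord.
(* For $p=1$ the constant current 1 takes the place of $\bar\partial X_{p-1}$. *)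
case: (posnP N) => [N0|N0].
  have -> : ord_max = ord0 :> 'I_N.+1 by apply/val_inj.
  by apply/near_eq_null; apply: near_eq_trans (near_eq_dbar fX_one) _; apply/near_eq_null/dbar_one_current.
have N1 : (N.-1 < N.+1)%N by rewrite ltnS leq_pred.
have e : near_eq (mul_current (f ord_max) (X ord_max)) (dbar (X (Ordinal N1))).
  by apply: fX_dbar; rewrite /= prednK.
by apply/near_eq_null; apply: near_eq_trans (near_eq_dbar e) _; apply/near_eq_null/dbar_dbar_null/X_good.
Qed.

Lemma ideal_sub_ann g l : g \in J ->
  null_germ (mul_current g (mul_current (top 0 l) (dbar (X ord_max)))).
Proof.
move=> gJ; have [s [ls hs]] := contraction_homotopy E_res a_morph gJ.
have gd : current_near N.+1 (dbar (X ord_max)) := dbar_good (X_good ord_max).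
apply/near_eq_null; apply: near_eq_trans (near_eq_sym (act_mul _ _ _)) _.
have -> : g * top 0 l = s (koszul_diff f (koszul_chain A N.+1 N.+1)) 0 l.
  by rewrite hs koszul_frame_chain linearZ mxE.
(* Every term of $s(\psi_pe)$ carries some $f_j$, and each $f_j$ kills $\bar\partial X_p$;
   [tens_koszul] disposes of all but the last. *)
apply: near_eq_trans (tens_koszul l (k := ord_max) ls gd _) _.
  by move=> j _; exact: act_dbar_last.
apply/near_eq_null; exact/act_null/act_dbar_last.
Qed.

Lemma ann_sub_ideal g :
  (forall l, null_germ (mul_current g (mul_current (top 0 l) (dbar (X ord_max))))) -> g \in J.
Proof.
(* [descent] works with families indexed by [nat], so [X] is prolonged by a default value, which is
   met only above [N], outside the range of its conditions. *)
move=> ann_g; pose Y k := X (insubd ord_max k).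
have YE (k : 'I_N.+1) : Y k = X k by congr X; apply/val_inj; rewrite val_insubd ltn_ord.
pose b k x := a k (g *: x).
have lb k : linear (b k) by move=> c x y; rewrite /b scalerDr !scalerA mulrC -scalerA linearP.
have bE k x : phi k (b k.+1 x) = b k (koszul_diff f x).
  by rewrite /b (morphism_comm a_morph) (linear_atZ _ _ (@koszul_diff_linear _ _ f _)).
pose V k : 'I_(r k.+1) -> current R n := tens (Y k) (b k.+1 (koszul_chain A N.+1 k.+1)).
have gY k : (k <= N)%N -> current_near k (Y k).
  by move=> kN; have := X_good (Ordinal (kN : k < N.+1)%N); rewrite -YE.
have hV k l (kN : (k < N.+1)%N) : near_eq (appl (phi k) (@V k) l)
    (tens (mul_current (f (Ordinal kN)) (Y k)) (b k (koszul_chain A N.+1 k)) l).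
  apply: near_eq_trans (appl_tens _ _ _ (gY _ kN)) _; rewrite bE.
  apply: (tens_koszul (k := Ordinal kN) l (lb k) (gY _ kN)) => j jk.
  by rewrite (YE (Ordinal kN)); exact: fX_zero.
have cpx k x : phi k (phi k.+1 x) = 0 by apply/(resolution_exact E_res); exists x.
have [|k l kN||V0 [g0 d0 e0]] := descent (N := N) cpx (V := V).
- by move=> k l kN; apply: act_good; exact: gY.
- apply: near_eq_trans (hV k.+1 l kN) _; apply: near_eq_trans _ (near_eq_sym (dbar_act _ _)).
  apply: near_eq_act; have kN' := ltnW kN.
  rewrite (YE (Ordinal (kN : (k.+1 < N.+1)%N))) (YE (Ordinal (kN' : (k < N.+1)%N))).
  exact: fX_dbar.
- move=> l; apply/near_eq_null; apply: near_eq_trans (dbar_act _ _) _.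
  rewrite (YE ord_max) /b -koszul_frame_chain linearZ mxE.
  by apply: near_eq_trans (act_mul _ _ _) _; apply/near_eq_null/ann_g.
have [h hh] := choice (fun l => dbar_exact0 (g0 l) (d0 l)).
pose y : 'rV[A]_(r 1%N) := \row_l h l.
(* Both sides agree after multiplication with [one_current], on which germs act faithfully: the left
   one because [h] represents the closed tuple [V0], the right one because $f_1X_1=1$. *)
have key : phi 0%N y = b 0%N (koszul_chain A N.+1 0).
  apply/rowP => l; apply/eqP; rewrite -subr_eq0; apply/eqP/act_one_inj/near_eq_null.
  apply: near_eq_trans (act_subl _ _ (one_current_good R n)) _; apply/near_eq_null.
  apply: near_eq_trans (near_eq_sym (appl_tens (phi 0%N) y l (one_current_good R n))) _.
  apply: (@near_eq_trans _ _ (appl (phi 0%N) V0 l)).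
    by apply: appl_eqn => i; rewrite /tens mxE; apply: near_eq_sym; exact: hh.
  apply: near_eq_trans (e0 l) _; apply: near_eq_trans (hV 0%N l isT) _; apply: near_eq_act.
  rewrite (YE ord0) (_ : Ordinal _ = ord0)//; exact: val_inj.
(* [eps] kills the image of $\varphi_1$ and sends $b_0(1)=ga_0(1)$ to the class of $g$. *)
have := congr1 eps key; rewrite (proj2 (resolution_exact0 E_res _)); last by exists y.
rewrite (morphism_extends a_morph) koszul_coefZ koszul_coefE cards0 eqxx take0 /= eqxx mulr1.
by move=> /esym/eqP; rewrite -(rmorph0 \pi_({ideal_quot J})%qT) -Quotient.idealrBE subr0.
Qed.

End Duality.

(* Indices are shifted: f i and X i stand for f_(i+1) and X_(i+1), and last is
   the index of X_p; in particular p >= 1. *)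
Theorem theorem1p1 (R : realType) (n p : nat)
    (J : idealr (hgerm R n))
    (J_CM : cohen_macaulay J p)
    (r : nat -> nat)
    (phi : forall k, {linear 'rV[hgerm R n]_(r k.+1) -> 'rV[hgerm R n]_(r k)})
    (eps : 'rV[hgerm R n]_(r 0%N) -> {ideal_quot J})
    (E_res : free_resolution p phi eps)
    (rank_E0 : r 0%N = 1%N)
    (f : 'I_p -> hgerm R n)
    (I_codim : has_codim (ideal_gen f) p)
    (sub_IJ : {subset ideal_gen f <= J})
    (a : forall k, {linear koszul (hgerm R n) p k -> 'rV[hgerm R n]_(r k)})
    (a_morph : koszul_morphism f phi eps a)
    (X : 'I_p -> current R n)
    (X_bidegree : forall k : 'I_p, current_germ k (X k))
    (fX_one : forall k : 'I_p, k = 0%N :> nat ->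
       eq_current_germ (mul_current (f k) (X k)) one_current)
    (fX_zero : forall j k : 'I_p, (j < k)%N ->
       eq_current_germ (mul_current (f j) (X k)) zero_current)
    (fX_dbar : forall j k : 'I_p, k = j.+1 :> nat ->
       eq_current_germ (mul_current (f k) (X k)) (dbar (X j)))
    (last : 'I_p) (last_p : last.+1 = p) :
  ann (fun l : 'I_(r p) =>
         mul_current (a p (koszul_frame (hgerm R n) p) ord0 l) (dbar (X last)))
  = [set g | g \in J].
Proof.
destruct p as [|N]; first by case: last last_p.
have -> : last = ord_max by apply/val_inj; case: last_p.
have X_good (k : 'I_N.+1) : current_near k (X k) := current_germ_good (X_bidegree k).
have f0 : near_eq (mul_current (f ord0) (X ord0)) one_current by apply/eq_current_germP; exact: fX_one.
have fz (j k : 'I_N.+1) : (j < k)%N -> null_germ (mul_current (f j) (X k)).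
  by move=> jk; apply/near_eq_null/eq_current_germP; exact: fX_zero.
have fd (j k : 'I_N.+1) : k = j.+1 :> nat -> near_eq (mul_current (f k) (X k)) (dbar (X j)).
  by move=> jk; apply/eq_current_germP; exact: fX_dbar.
apply/seteqP; split=> g /= hg.
  apply: (ann_sub_ideal E_res a_morph X_good f0 fz fd) => l.
  by apply/near_eq_null/eq_current_germP; exact: hg.
by move=> l; apply/eq_current_germP/near_eq_null; exact: (ideal_sub_ann E_res a_morph X_good f0 fz fd).
Qed.
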